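(* Let $p$ be a prime, let $k$ be a field of characteristic $p$, and let $G$ be a finite $p$-group which does not have the elementary abelian $p$-group of order $p^2$ as a direct factor. If the essential ideal $\operatorname{Ess}(G)$ in $H^*(G,k)$ is nonzero, then $\operatorname{Ess}(G)$ is a Cohen--Macaulay $H^*(G,k)$-module with Krull dimension equal to the $p$-rank of the centre of $G$.
   Context: $H^*(G,k)$ denotes the (graded commutative, noetherian) cohomology ring of $G$ with coefficients in the trivial module $k$. The essential ideal $\operatorname{Ess}(G) \subseteq H^*(G,k)$ consists of those cohomology classes whose restriction to every proper subgroup of $G$ is zero. The Krull dimension of a finitely generated graded $H^*(G,k)$-module $M$ is the Krull dimension of $H^*(G,k)/\operatorname{Ann}(M)$; $M$ is Cohen--Macaulay if its depth (with respect to the ideal of positive-degree elements) equals its Krull dimension. The $p$-rank of a finite abelian group is the rank of its largest elementary abelian $p$-subgroup. *)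

(* Defs.v *)
From HB Require Import structures.
From mathcomp Require Import all_boot all_fingroup all_solvable all_algebra.
From mathcomp Require Import generic_quotient ring_quotient.
From mathcomp Require Import boolp functions ring.

Set Implicit Arguments.
Unset Strict Implicit.
Unset Printing Implicit Defensive.

Import GroupScope GRing.Theory.
Local Open Scope ring_scope.
Local Open Scope quotient_scope.

(* Ideals are boolean predicates; as boolp is classical, every subset of R is
   of this form via `[< _ >].  MathComp quotients rings only by ideals of
   commutative rings, hence the construction of quot2 below; it covers
   noncommutative R, and I = R (where the quotient is the zero ring). *)
HB.mixin Record isTwoSided (R : pzRingType) (S : R -> bool) := {
  ideal2_mull : forall a x : R, x \in S -> a * x \in S;
  ideal2_mulr : forall a x : R, x \in S -> x * a \in S
}.

#[short(type="ideal2")]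
HB.structure Definition TwoSidedIdeal (R : pzRingType) :=
  {S of isTwoSided R S & GRing.ZmodClosed R S}.

Section RingQuotient2.
Variables (R : pzRingType) (I : ideal2 R).

Definition quot2 : Type := Quotient.quot I.
HB.instance Definition _ := Choice.on quot2.
HB.instance Definition _ := GRing.Zmodule.on quot2.

Definition quot2_pi (x : R) : quot2 := \pi_(Quotient.quot I) x.
Definition quot2_repr (x : quot2) : R := repr (x : Quotient.quot I).
Definition quot2_one : quot2 := quot2_pi 1.
Definition quot2_mul (x y : quot2) : quot2 :=
  quot2_pi (quot2_repr x * quot2_repr y).

Lemma quot2_piP x y : reflect (quot2_pi x = quot2_pi y) (x - y \in I).
Proof. by rewrite Quotient.idealrBE; exact: eqP. Qed.

Lemma quot2_reprK : cancel quot2_repr quot2_pi.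
Proof. by move=> x; rewrite /quot2_pi /quot2_repr reprK. Qed.

Lemma quot2_piB : zmod_morphism quot2_pi.
Proof.
move=> x y; rewrite /quot2_pi.
exact: (raddfB (\pi_(Quotient.quot I) : {additive R -> Quotient.quot I})).
Qed.

HB.instance Definition _ := GRing.isZmodMorphism.Build R quot2 quot2_pi quot2_piB.

Lemma quot2_piM x y : quot2_pi (x * y) = quot2_mul (quot2_pi x) (quot2_pi y).
Proof.
have repr_mod z : z - quot2_repr (quot2_pi z) \in I.
  by apply/quot2_piP; rewrite quot2_reprK.
apply/quot2_piP.
set x' := quot2_repr _; set y' := quot2_repr _.
have -> : x * y - x' * y' = (x - x') * y + x' * (y - y').
  by rewrite mulrBl mulrBr addrA subrK.
by apply: rpredD; [apply: ideal2_mulr|apply: ideal2_mull]; apply: repr_mod.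
Qed.

Lemma quot2_mulA : associative quot2_mul.
Proof.
move=> x y z; rewrite -(quot2_reprK x) -(quot2_reprK y) -(quot2_reprK z).
by rewrite -!quot2_piM mulrA.
Qed.

Lemma quot2_mul1 : left_id quot2_one quot2_mul.
Proof. by move=> x; rewrite -(quot2_reprK x) -quot2_piM mul1r. Qed.

Lemma quot2_1mul : right_id quot2_one quot2_mul.
Proof. by move=> x; rewrite -(quot2_reprK x) -quot2_piM mulr1. Qed.

Lemma quot2_mulDl : left_distributive quot2_mul +%R.
Proof.
move=> x y z; rewrite -(quot2_reprK x) -(quot2_reprK y) -(quot2_reprK z).
by rewrite -raddfD -!quot2_piM -raddfD mulrDl.
Qed.

Lemma quot2_mulDr : right_distributive quot2_mul +%R.
Proof.
move=> x y z; rewrite -(quot2_reprK x) -(quot2_reprK y) -(quot2_reprK z).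
by rewrite -raddfD -!quot2_piM -raddfD mulrDr.
Qed.

HB.instance Definition _ := GRing.Zmodule_isPzRing.Build quot2
  quot2_mulA quot2_mul1 quot2_1mul quot2_mulDl quot2_mulDr.

HB.instance Definition _ := GRing.isMonoidMorphism.Build R quot2 quot2_pi
  (erefl, quot2_piM).

End RingQuotient2.

Arguments quot2 {R} I.
Arguments quot2_pi {R} I x.
Arguments quot2_repr {R} {I} x.

(* The invariants below are suprema of lengths, given as relations: a supremum
   which is infinite, or taken over the empty set, has no value in nat. *)
Definition is_greatest (P : nat -> Prop) (n : nat) : Prop :=
  P n /\ forall m, P m -> (m <= n)%N.

(* Elementwise primality.  In a graded-commutative ring it coincides with the
   noncommutative notion (I * J <= P implies I <= P or J <= P): for such a P the
   residue ring is commutative, because a homogeneous x of odd degree with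
   x ^+ 2 = 0 satisfies x * a * x = 0 for every a, hence lies in P. *)
Definition prime_ideal2 (R : pzRingType) (P : ideal2 R) : Prop :=
  1 \notin P /\ forall a b : R, a * b \in P -> a \in P \/ b \in P.

Definition prime_chain (R : pzRingType) (n : nat) : Prop :=
  exists c : nat -> ideal2 R,
    (forall i, (i <= n)%N -> prime_ideal2 (c i)) /\
    (forall i, (i < n)%N ->
       {subset c i <= c i.+1} /\ exists2 x, x \in c i.+1 & x \notin c i).

Definition krull_dim_ring (R : pzRingType) : nat -> Prop :=
  is_greatest (@prime_chain R).

Section ModuleInvariants.
Variables (R : pzRingType) (M : lmodType R).

Definition ann (a : R) : bool := `[< forall m : M, a *: m = 0 >].

Lemma annP a : reflect (forall m : M, a *: m = 0) (a \in ann).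
Proof. exact: asboolP. Qed.

Lemma ann_zmod_closed : zmod_closed ann.
Proof.
split=> [|a b /annP a0 /annP b0]; apply/annP => m; first exact: scale0r.
by rewrite scalerBl a0 b0 subr0.
Qed.

Lemma ann_mull a x : x \in ann -> a * x \in ann.
Proof. by move=> /annP x0; apply/annP => m; rewrite -scalerA x0 scaler0. Qed.

Lemma ann_mulr a x : x \in ann -> x * a \in ann.
Proof. by move=> /annP x0; apply/annP => m; rewrite -scalerA x0. Qed.

HB.instance Definition _ := GRing.isZmodClosed.Build R ann ann_zmod_closed.
HB.instance Definition _ := isTwoSided.Build R ann ann_mull ann_mulr.

(* The Krull dimension of R / Ann(M), meant for finitely generated M. *)
Definition krull_dim : nat -> Prop := krull_dim_ring (quot2 ann).

(* (x_1, ..., x_n) M.  For noncommutative R this need not be a submodule, but it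
   is one when R is graded-commutative and the x_i are homogeneous (then
   r * x_i = +/- x_i * r for homogeneous r), the only case in which the
   definitions below are meant to be used. *)
Definition seq_mul (xs : seq R) (m : M) : Prop :=
  exists ms : 'I_(size xs) -> M, m = \sum_(i < size xs) xs`_i *: ms i.

Definition regular_seq (xs : seq R) : Prop :=
  (forall i, (i < size xs)%N -> forall m : M,
     seq_mul (take i xs) (xs`_i *: m) -> seq_mul (take i xs) m) /\
  ~ (forall m : M, seq_mul xs m).

(* Greatest length of an M-regular sequence of elements of A.  The depth of a
   graded module with respect to the ideal of positive-degree elements is
   obtained by taking for A the homogeneous elements of positive degree. *)
Definition depth (A : R -> Prop) : nat -> Prop :=
  is_greatest (fun n => exists xs : seq R,
    [/\ size xs = n, forall x, x \in xs -> A x & regular_seq xs]).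

Definition cohen_macaulay (A : R -> Prop) : Prop :=
  exists2 n, depth A n & krull_dim n.

End ModuleInvariants.

Section BarComplex.
Variables (k : fieldType) (gT : finGroupType).
Implicit Types (f g h : seq gT -> k) (s t : seq gT) (x y : gT) (i n : nat).

(* A function on seq gT is a family (f_n) of functions on n-tuples, i.e. of
   inhomogeneous n-cochains with coefficients in k, f_n being the restriction of
   f to words of size n; it lies in the direct sum of the cochain groups when
   f_n = 0 for n large (finite_degree).

   face i [:: x_1; ...; x_n] drops x_1 if i = 0, drops x_n if i = n, and
   multiplies x_i by x_(i+1) otherwise; the values for i > n are junk. *)
Fixpoint face i s : seq gT :=
  match i, s with
  | 0, _ => behead s
  | 1, x :: y :: t => (x * y)%g :: t
  | 1, _ => [::]
  | i'.+1, x :: t => x :: face i' t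
  | _.+1, [::] => [::]
  end.

(* The coefficients are trivial, so the first face carries no action.  The
   value at [::] is 0 because there are no cochains in degree -1. *)
Definition bar_diff f s : k :=
  if s is [::] then 0
  else \sum_(i < (size s).+1) (-1) ^+ i * f (face i s).

Definition cup f g s : k :=
  \sum_(i < (size s).+1) f (take i s) * g (drop i s).

Definition cup1 s : k := (s == [::])%:R.

Definition finite_degree f : Prop :=
  exists n, forall s, (n <= size s)%N -> f s = 0.

Let shift f x : seq gT -> k := fun s => f (x :: s).
Let inner f s : k := \sum_(i < size s) (-1) ^+ i.+1 * f (face i.+1 s).
Definition bar_sign f s : k := (-1) ^+ size s * f s.

Let fctD f g s : (f + g) s = f s + g s. Proof. by []. Qed.

Lemma cup_nil f g : cup f g [::] = f [::] * g [::].
Proof. by rewrite /cup big_ord1. Qed.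

Lemma cup_cons f g x s :
  cup f g (x :: s) = f [::] * g (x :: s) + cup (shift f x) g s.
Proof. by rewrite /cup big_ord_recl. Qed.

Lemma cupDl f g h : cup (f + g) h = cup f h + cup g h.
Proof.
apply/funext => s; rewrite /cup -[RHS]big_split /=; apply: eq_bigr => i _.
by rewrite -mulrDl.
Qed.

Lemma cupDr f g h : cup h (f + g) = cup h f + cup h g.
Proof.
apply/funext => s; rewrite /cup -[RHS]big_split /=; apply: eq_bigr => i _.
by rewrite -mulrDr.
Qed.

Lemma cup0l g : cup (0 : seq gT -> k) g = 0.
Proof. by apply/funext => s; rewrite /cup big1 // => i _; rewrite mul0r. Qed.

Lemma cupZl c f g s : cup (fun t => c * f t) g s = c * cup f g s.
Proof. by rewrite /cup mulr_sumr; apply: eq_bigr => i _; rewrite mulrA. Qed.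

Lemma cup1f f : cup cup1 f = f.
Proof.
apply/funext => -[|x s]; first by rewrite cup_nil mul1r.
by rewrite cup_cons mul1r (_ : shift cup1 x = 0) ?cup0l ?addr0.
Qed.

Lemma cupf1 f : cup f cup1 = f.
Proof.
apply/funext => s; elim: s f => [|x s IHs] f; first by rewrite cup_nil mulr1.
by rewrite cup_cons IHs mulr0 add0r.
Qed.

Lemma cupA f g h : cup f (cup g h) = cup (cup f g) h.
Proof.
apply/funext => s; elim: s f g h => [|x s IHs] f g h.
  by rewrite !cup_nil mulrA.
rewrite !cup_cons IHs cup_nil.
rewrite (_ : shift (cup f g) x
  = (fun t => f [::] * shift g x t) + cup (shift f x) g).
  by rewrite cupDl fctD cupZl mulrDr mulrA addrA.
by apply/funext => t; rewrite /shift cup_cons.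
Qed.

Lemma findeg_cup f g : finite_degree f -> finite_degree g -> finite_degree (cup f g).
Proof.
move=> [m fm] [n gn]; exists (m + n)%N => s le_s; rewrite /cup big1 // => i _.
have [le_i|lt_i] := leqP m i.
  by rewrite fm ?mul0r // size_takel // -ltnS.
rewrite gn ?mulr0 // size_drop leq_subRL; last by rewrite -ltnS.
by apply: leq_trans le_s; rewrite leq_add2r ltnW.
Qed.

Lemma size_face i s : (size s <= (size (face i s)).+1)%N.
Proof.
elim: s i => [|x s IHs] [|i] //=.
by case: i => [|i] /=; [case: s {IHs}|rewrite ltnS; exact: (IHs i.+1)].
Qed.

Lemma findeg_diff f : finite_degree f -> finite_degree (bar_diff f).
Proof.
move=> [n fn]; exists n.+1 => -[|x s] // le_s; rewrite /bar_diff big1 // => i _.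
by rewrite fn ?mulr0 // -ltnS; apply: leq_trans le_s (size_face _ _).
Qed.

Lemma diffE f x s : bar_diff f (x :: s) = f s + inner f (x :: s).
Proof. by rewrite /bar_diff /inner big_ord_recl mul1r. Qed.

Lemma inner_cons f x s :
  inner f (x :: s) = - f (face 1 (x :: s)) - inner (shift f x) s.
Proof.
rewrite /inner big_ord_recl /= expr1 mulN1r; congr (_ + _).
rewrite -sumrN; apply: eq_bigr => -[i lt_i] _ /=.
by rewrite [in LHS]exprS -mulrA mulN1r.
Qed.

Lemma innerD f g s : inner (f + g) s = inner f s + inner g s.
Proof. by rewrite /inner -big_split /=; apply: eq_bigr => i _; rewrite -mulrDr. Qed.

Lemma innerZ c f s : inner (fun t => c * f t) s = c * inner f s.
Proof.
by rewrite /inner mulr_sumr; apply: eq_bigr => i _; rewrite mulrCA.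
Qed.

Lemma diffD f g : bar_diff (f + g) = bar_diff f + bar_diff g.
Proof.
apply/funext => -[|x s]; first by rewrite fctD addr0.
by rewrite diffE innerD !fctD !diffE addrACA.
Qed.

Lemma inner_cup f g s :
  inner (cup f g) s = cup (inner f) g s + cup (bar_sign f) (bar_diff g) s.
Proof.
elim: s f g => [|x t IHt] f g.
  by rewrite !cup_nil /inner !big_ord0 /bar_sign /= mulr0 mul0r addr0.
rewrite inner_cons.
rewrite (_ : shift (cup f g) x
  = (fun t => f [::] * shift g x t) + cup (shift f x) g); last first.
  by apply/funext => u; rewrite /shift cup_cons.
have inner0 h : inner h [::] = 0 by rewrite /inner big_ord0.
rewrite innerD innerZ IHt !cup_cons inner0 mul0r add0r.
rewrite {2}/bar_sign mul1r diffE inner_cons.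
have -> : shift (inner f) x
    = (fun u => (-1) * f (face 1 (x :: u))) + (fun u => (-1) * inner (shift f x) u).
  by apply/funext => u; rewrite /shift inner_cons fctD !mulN1r.
have -> : shift (bar_sign f) x = (fun u => (-1) * bar_sign (shift f x) u).
  by apply/funext => u; rewrite /shift /bar_sign /= exprS -mulrA.
rewrite cupDl fctD !cupZl !mulN1r.
suff -> : cup f g (face 1 (x :: t)) =
    cup (fun u => f (face 1 (x :: u))) g t - f [::] * g t
      + f [::] * g (face 1 (x :: t)).
  by ring.
case: t {IHt} => [|y u]; first by rewrite !cup_nil /= subrK.
by rewrite /= !cup_cons /=; ring.
Qed.

Lemma diff_cup f g :
  bar_diff (cup f g) = cup (bar_diff f) g + cup (bar_sign f) (bar_diff g).
Proof.
apply/funext => -[|x s]; first by rewrite fctD !cup_nil mul0r mulr0 addr0.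
rewrite diffE inner_cup fctD [in RHS]cup_cons mul0r add0r.
have -> : shift (bar_diff f) x = f + shift (inner f) x.
  by apply/funext => u; rewrite /shift diffE.
by rewrite cupDl fctD cup_cons {1}/inner big_ord0 mul0r add0r addrA.
Qed.

Lemma face_face i j s : (i <= j)%N -> face j (face i s) = face i (face j.+1 s).
Proof.
elim: s i j => [|x s IHs] i j; first by case: i j => [|[|i]] [|[|j]].
case: i j => [|i] [|j] //; first by case: s {IHs}.
rewrite ltnS; case: i j => [|i] [|j] // le_ij.
- case: s {IHs} => [|y [|z s]] //=; by rewrite mulgA.
- by case: s {IHs}.
- by rewrite -[RHS]/(x :: face i.+1 (face j.+2 s)) -IHs.
Qed.

Lemma size_face_eq i x s : (i <= (size s).+1)%N -> size (face i (x :: s)) = size s.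
Proof.
elim: s i x => [|y s IHs] [|[|i]] x //=.
by rewrite ltnS => le_i; congr _.+1; exact: (IHs i.+1 y).
Qed.

Lemma simplicial_sum0 (F : nat -> nat -> k) n :
    (forall i j, (i <= j)%N -> F i j = F j.+1 i) ->
  \sum_(i < n.+1) \sum_(j < n) (-1) ^+ i * ((-1) ^+ j * F i j) = 0.
Proof.
move=> FE; elim: n => [|n IHn]; first by rewrite big1 // => i _; rewrite big_ord0.
rewrite big_ord_recr /=; under eq_bigr do rewrite big_ord_recr /=.
rewrite big_split /= IHn add0r -big_split /= big1 // => i _.
have -> : F i n = F n.+1 i by apply: FE; rewrite -ltnS.
by rewrite [(-1) ^+ n.+1]exprS mulN1r mulNr mulrCA subrr.
Qed.

Lemma diff_diff f : bar_diff (bar_diff f) = 0.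
Proof.
apply/funext => -[|x [|y s]] //.
  rewrite /bar_diff big1 // => i _.
  by case: i => -[|[|i]] //= _; rewrite mulr0.
rewrite [LHS]/bar_diff -[RHS](@simplicial_sum0 (fun i j =>
  f (face j (face i [:: x, y & s]))) (size s).+2); last first.
  by move=> i j /face_face ->.
apply: eq_bigr => i _; rewrite -mulr_sumr; congr (_ * _).
have : size (face i [:: x, y & s]) = (size s).+1.
  by apply: size_face_eq; rewrite -ltnS.
by rewrite /bar_diff; case: (face i _) => // z t ->.
Qed.

Lemma diff_sign f : bar_diff (bar_sign f) = - bar_sign (bar_diff f).
Proof.
apply/funext => -[|x s].
  by rewrite -[RHS]/(- bar_sign (bar_diff f) [::]) /bar_sign mulr0 oppr0.
rewrite -[RHS]/(- bar_sign (bar_diff f) (x :: s)) /bar_sign /bar_diff mulr_sumr.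
rewrite -sumrN; apply: eq_bigr => i _.
by rewrite size_face_eq -1?ltnS //= exprS mulN1r mulNr opprK mulrCA.
Qed.

Lemma bar_signK f : bar_sign (bar_sign f) = f.
Proof. by apply/funext => s; rewrite /bar_sign mulrA -expr2 sqrr_sign mul1r. Qed.

Lemma findeg_sign f : finite_degree f -> finite_degree (bar_sign f).
Proof. by move=> [n fn]; exists n => s le_s; rewrite /bar_sign fn ?mulr0. Qed.

Lemma findeg0 : finite_degree 0.
Proof. by exists 0%N. Qed.

Lemma findeg1 : finite_degree cup1.
Proof. by exists 1%N => -[]. Qed.

Lemma findegB f g : finite_degree f -> finite_degree g -> finite_degree (f - g).
Proof.
move=> [m fm] [n gn]; exists (maxn m n) => s; rewrite geq_max => /andP[le_m le_n].
by rewrite -[LHS]/(f s - g s) fm ?gn ?subrr.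
Qed.

Lemma diff0 : bar_diff 0 = 0.
Proof. by apply: (addIr (bar_diff 0)); rewrite -diffD !add0r. Qed.

Lemma diffN f : bar_diff (- f) = - bar_diff f.
Proof. by apply: (addIr (bar_diff f)); rewrite -diffD !addNr diff0. Qed.

Lemma diff1 : bar_diff cup1 = 0.
Proof.
apply/funext => -[|x [|y s]] //.
  rewrite /bar_diff !big_ord_recl big_ord0 /= /cup1 /=.
  by rewrite expr0 expr1 mulr1 mulN1r addr0 subrr.
rewrite /bar_diff big1 // => i _; rewrite /cup1 -size_eq0.
by rewrite size_face_eq ?mulr0 // -ltnS.
Qed.

Record cochain : Type := Cochain {
  cochain_fun :> seq gT -> k;
  _ : `[< finite_degree cochain_fun >]
}.

HB.instance Definition _ := [isSub for cochain_fun].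
HB.instance Definition _ := [Choice of cochain by <:].

Definition mem_findeg f : bool := `[< finite_degree f >].

Lemma findeg_zmod_closed : zmod_closed mem_findeg.
Proof.
split=> [|f g /asboolP bf /asboolP bg]; apply/asboolP; first exact: findeg0.
exact: findegB.
Qed.

HB.instance Definition _ :=
  GRing.SubChoice_isSubZmodule.Build _ mem_findeg cochain findeg_zmod_closed.

Lemma cochainP (f : cochain) : finite_degree f.
Proof. by case: f => f /= /asboolP. Qed.

Definition mk_cochain f (bf : finite_degree f) : cochain :=
  Cochain (introT (asboolP _) bf).

Definition cochain_mul (f g : cochain) : cochain :=
  mk_cochain (findeg_cup (cochainP f) (cochainP g)).

Definition cochain_one : cochain := mk_cochain findeg1.

Definition cochain_diff (f : cochain) : cochain :=
  mk_cochain (findeg_diff (cochainP f)).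

Definition cochain_sign (f : cochain) : cochain :=
  mk_cochain (findeg_sign (cochainP f)).

Lemma cochain_mulA : associative cochain_mul.
Proof. by move=> f g h; apply: val_inj; exact: cupA. Qed.
Lemma cochain_mul1l : left_id cochain_one cochain_mul.
Proof. by move=> f; apply: val_inj; exact: cup1f. Qed.
Lemma cochain_mul1r : right_id cochain_one cochain_mul.
Proof. by move=> f; apply: val_inj; exact: cupf1. Qed.
Lemma cochain_mulDl : left_distributive cochain_mul +%R.
Proof. by move=> f g h; apply: val_inj; exact: cupDl. Qed.
Lemma cochain_mulDr : right_distributive cochain_mul +%R.
Proof. by move=> f g h; apply: val_inj; exact: cupDr. Qed.

HB.instance Definition _ := GRing.Zmodule_isPzRing.Build cochain
  cochain_mulA cochain_mul1l cochain_mul1r cochain_mulDl cochain_mulDr.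

Lemma cochain_diffB : zmod_morphism cochain_diff.
Proof. by move=> f g; apply: val_inj; rewrite /= diffD diffN. Qed.

HB.instance Definition _ :=
  GRing.isZmodMorphism.Build cochain cochain cochain_diff cochain_diffB.

Lemma cochain_diffM (f g : cochain) :
  cochain_diff (f * g) = cochain_diff f * g + cochain_sign f * cochain_diff g.
Proof. by apply: val_inj; exact: diff_cup. Qed.

Lemma cochain_diff_diff (f : cochain) : cochain_diff (cochain_diff f) = 0.
Proof. by apply: val_inj; exact: diff_diff. Qed.

Lemma cochain_diff_sign (f : cochain) :
  cochain_diff (cochain_sign f) = - cochain_sign (cochain_diff f).
Proof. by apply: val_inj; exact: diff_sign. Qed.

Lemma cochain_signK : involutive cochain_sign.
Proof. by move=> f; apply: val_inj; exact: bar_signK. Qed.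

Lemma cochain_sign0 : cochain_sign 0 = 0.
Proof. by apply: val_inj; apply/funext => s; rewrite /= /bar_sign mulr0. Qed.

Definition is_cocycle (f : cochain) : bool := cochain_diff f == 0.

Record cocycle : Type := Cocycle { cocycle_val :> cochain; _ : is_cocycle cocycle_val }.

HB.instance Definition _ := [isSub for cocycle_val].
HB.instance Definition _ := [Choice of cocycle by <:].

Lemma cocycle_subring_closed : subring_closed is_cocycle.
Proof.
split=> [|f g /eqP df /eqP dg|f g /eqP df /eqP dg]; apply/eqP.
- by apply: val_inj; exact: diff1.
- by rewrite raddfB /= df dg subrr.
- by rewrite cochain_diffM df dg mul0r mulr0 addr0.
Qed.

HB.instance Definition _ :=
  GRing.SubChoice_isSubPzRing.Build _ is_cocycle cocycle cocycle_subring_closed.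

Lemma cocycleP (z : cocycle) : cochain_diff z = 0.
Proof. by case: z => z /= /eqP. Qed.

Definition coboundary (z : cocycle) : bool :=
  `[< exists f : cochain, cocycle_val z = cochain_diff f >].

Lemma coboundary_zmod_closed : zmod_closed coboundary.
Proof.
split=> [|z w /asboolP[f zf] /asboolP[g wg]]; apply/asboolP.
  by exists 0; rewrite raddf0.
by exists (f - g); rewrite raddfB /= -zf -wg.
Qed.

Lemma coboundary_mull (a z : cocycle) : z \in coboundary -> a * z \in coboundary.
Proof.
move=> /asboolP[f zf]; apply/asboolP; exists (cochain_sign a * f).
by rewrite cochain_diffM cochain_diff_sign cochain_signK cocycleP cochain_sign0
  oppr0 mul0r add0r -zf.
Qed.

Lemma coboundary_mulr (a z : cocycle) : z \in coboundary -> z * a \in coboundary.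
Proof.
move=> /asboolP[f zf]; apply/asboolP; exists (f * cocycle_val a).
by rewrite cochain_diffM cocycleP mulr0 addr0 -zf.
Qed.

HB.instance Definition _ :=
  GRing.isZmodClosed.Build cocycle coboundary coboundary_zmod_closed.
HB.instance Definition _ :=
  isTwoSided.Build cocycle coboundary coboundary_mull coboundary_mulr.

(* H^*(gT, k), the direct sum of all H^n(gT, k), with the cup product. *)
Definition cohomology : Type := quot2 coboundary.
HB.instance Definition _ := GRing.PzRing.on cohomology.

Definition coclass (z : cocycle) : cohomology := quot2_pi coboundary z.
HB.instance Definition _ := GRing.RMorphism.copy coclass (quot2_pi coboundary).

Definition homogeneous n (x : cohomology) : Prop :=
  exists2 z : cocycle,
    (forall s, size s != n -> cocycle_val z s = 0) & coclass z = x.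

Definition homogeneous_pos (x : cohomology) : Prop :=
  exists2 n, (0 < n)%N & homogeneous n x.

End BarComplex.

Arguments cohomology k gT : clear implicits.

Section Pullback.
Variables (k : fieldType) (aT rT : finGroupType) (phi : aT -> rT).
Hypothesis phiM : {morph phi : x y / (x * y)%g}.
Implicit Types f g : seq rT -> k.

Definition pull f : seq aT -> k := fun s => f (map phi s).

Lemma findeg_pull f : finite_degree f -> finite_degree (pull f).
Proof. by move=> [n fn]; exists n => s le_s; rewrite /pull fn ?size_map. Qed.

Definition cochain_pull (f : cochain k rT) : cochain k aT :=
  mk_cochain (findeg_pull (cochainP f)).

Lemma cochain_pullB : zmod_morphism cochain_pull.
Proof. by move=> f g; apply: val_inj. Qed.

HB.instance Definition _ :=
  GRing.isZmodMorphism.Build _ _ cochain_pull cochain_pullB.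

Lemma cochain_pullM (f g : cochain k rT) :
  cochain_pull (f * g) = cochain_pull f * cochain_pull g.
Proof.
apply: val_inj; apply/funext => s; rewrite /= /pull /cup size_map.
by apply: eq_bigr => i _; rewrite map_take map_drop.
Qed.

Lemma cochain_pull1 : cochain_pull 1 = 1.
Proof. by apply: val_inj; apply/funext => -[]. Qed.

Lemma map_face i s : map phi (face i s) = face i (map phi s).
Proof.
elim: s i => [|x s IHs] [|[|i]] //=.
  by case: s {IHs} => //= y s; rewrite phiM.
by congr (_ :: _); exact: (IHs i.+1).
Qed.

Lemma cochain_pull_diff (f : cochain k rT) :
  cochain_pull (cochain_diff f) = cochain_diff (cochain_pull f).
Proof.
apply: val_inj; apply/funext => -[|x s] //; rewrite /= /pull /bar_diff size_map.
by apply: eq_bigr => i _; rewrite map_face.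
Qed.

Lemma cocycle_pull_subproof (z : cocycle k rT) : is_cocycle (cochain_pull z).
Proof. by apply/eqP; rewrite -cochain_pull_diff cocycleP raddf0. Qed.

Definition cocycle_pull (z : cocycle k rT) : cocycle k aT :=
  Cocycle (cocycle_pull_subproof z).

(* cohomology_pullE shows that the choice of representative is irrelevant. *)
Definition cohomology_pull (x : cohomology k rT) : cohomology k aT :=
  coclass (cocycle_pull (quot2_repr x)).

Lemma cohomology_pullE z : cohomology_pull (coclass z) = coclass (cocycle_pull z).
Proof.
apply/quot2_piP; set w := quot2_repr _.
have /asboolP[f wzf] : w - z \in @coboundary k rT.
  by apply/quot2_piP; rewrite quot2_reprK.
apply/asboolP; exists (cochain_pull f).
by rewrite -cochain_pull_diff -wzf /= raddfB.
Qed.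

Lemma cohomology_pullB : zmod_morphism cohomology_pull.
Proof.
move=> x y; rewrite -(quot2_reprK x) -(quot2_reprK y).
rewrite -raddfB !cohomology_pullE -raddfB; congr coclass.
by apply: val_inj; rewrite /= raddfB.
Qed.

Lemma cohomology_pull_monoid : monoid_morphism cohomology_pull.
Proof.
split=> [|x y].
  rewrite -[1 in LHS](rmorph1 (@coclass k rT)) cohomology_pullE.
  rewrite -[RHS](rmorph1 (@coclass k aT)); congr coclass.
  by apply: val_inj; exact: cochain_pull1.
rewrite -(quot2_reprK x) -(quot2_reprK y).
rewrite -rmorphM !cohomology_pullE -rmorphM; congr coclass.
by apply: val_inj; exact: cochain_pullM.
Qed.

HB.instance Definition _ :=
  GRing.isZmodMorphism.Build _ _ cohomology_pull cohomology_pullB.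
HB.instance Definition _ :=
  GRing.isMonoidMorphism.Build _ _ cohomology_pull cohomology_pull_monoid.

End Pullback.

Section Essential.
Variables (k : fieldType) (gT : finGroupType).

Definition incl (H G : {group gT}) (x : subg_of H) : subg_of G :=
  subg G (sgval x).

Lemma inclM (H G : {group gT}) :
  H \subset G -> {morph @incl H G : x y / (x * y)%g}.
Proof.
move=> /subsetP sHG x y; apply: val_inj.
by rewrite /incl /= !subgK ?groupM ?sHG ?subgP.
Qed.

Definition restriction (H G : {group gT}) (sHG : H \subset G) :
    {rmorphism cohomology k (subg_of G) -> cohomology k (subg_of H)} :=
  cohomology_pull (inclM sHG).

Variable G : {group gT}.

(* R^o is R as a left module over itself: a *: x = a * x. *)
Definition ess (x : (cohomology k (subg_of G))^o) : bool :=
  `[< forall (H : {group gT}) (pHG : H \proper G),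
        restriction (proper_sub pHG) x = 0 >].

Lemma ess_submod_closed : submod_closed ess.
Proof.
split=> [|a x y /asboolP x0 /asboolP y0]; apply/asboolP => H pHG.
  exact: raddf0.
by rewrite raddfD /= rmorphM x0 y0 mulr0 addr0.
Qed.

Record essential : Type := Essential {
  essential_val :> (cohomology k (subg_of G))^o;
  _ : ess essential_val
}.

HB.instance Definition _ := [isSub for essential_val].
HB.instance Definition _ := [Choice of essential by <:].
HB.instance Definition _ := GRing.SubChoice_isSubLmodule.Build
  _ _ ess essential (GRing.submod_closed_semi ess_submod_closed).

End Essential.

Arguments essential k {gT} G.

(* Main.v *)
Require Import Defs.
From HB Require Import structures.
From mathcomp Require Import all_boot all_fingroup all_solvable all_algebra
  all_character.
From mathcomp Require Import boolp functions ring zify.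

Set Implicit Arguments.
Unset Strict Implicit.
Unset Printing Implicit Defensive.

Import GroupScope GRing.Theory.
Local Open Scope ring_scope.

(** Let C be the largest central elementary abelian subgroup of G and r its rank.
A character lambda of C gives a class theta(lambda) of degree 2 |G : C|: the Euler
class of the product, over the cosets of C, of circles with p vertices rotated by
lambda.  Its restriction to C is a power of the Bockstein of lambda.  If c in C has
order p, then multiplication G x F_p -> G, (g, i) |-> g c^i, pulls theta(lambda)^p
back to a polynomial in the Bockstein of F_p which is monic when lambda(c) = 1 and
constant when lambda(c) = 0.  Comparing leading coefficients, the classes of a
triangular family of characters form a regular sequence on Ess(G), because every
c but the first one can be taken in the Frattini subgroup: this is where the
absence of a direct factor of order p^2 is used.

Ess(G) is annihilated by transfers from proper subgroups.  If E is elementary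
abelian and not central, a class of G which vanishes on the proper subgroups of E
has a power which agrees on E with a transfer from the centraliser of E; if K is
not elementary abelian, an even class of K which vanishes on its proper subgroups
is nilpotent.  By induction over the subgroups, an even class which vanishes on C
is nilpotent modulo Ann(Ess(G)).  Hence every even class has, modulo this
annihilator, a p-power which is a polynomial in the regular sequence, and the
annihilator contains no nonzero such polynomial.  This yields a chain of r + 1
primes, while r + 1 elements are always algebraically dependent, which bounds the
length of chains of primes and of regular sequences. *)

(** * Cochains of action groupoids *)

(** Everything comes from one resolution of k: the tensor power over the cosets of C of V -> E -> T,
    the cochains of a circle followed by T = k. Its last term is k, and its class as an iterated
    extension is theta(lambda). Hence naturality, vanishing at a fixed vertex, and a Gysin argument:
    a product of enough classes that vanish on the stabilisers of all cells but the top one is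
    divisible by theta(lambda). Odd classes are the recurring obstacle. Polynomial arguments take
    place in the commutative ring of even classes; any class differs from an even one by a class of
    square zero, which every prime contains. The pullback of theta(lambda) to G x F_p may contain
    terms y a with y of degree one; their p-th powers have the form x b with x the Bockstein class,
    which is why theta(lambda)^p is used. If c lies in the Frattini subgroup, J <c> is proper for
    every proper J, so multiplication carries Ess(G) to classes vanishing on all J x F_p, and
    descent yields relations with coefficients in Ess(G). At the first step the comparison is with 0
    alone, which leaves room for one direction of C outside the Frattini subgroup. *)

Section GroupoidCochains.
Variables (k : fieldType) (gT : finGroupType).
Implicit Types (f g : seq gT -> k) (s t : seq gT) (x y : gT).

Definition shift f x : seq gT -> k := fun s => f (x :: s).
(** The differential without its zeroth face, the only face that moves the base point of a groupoid
    cochain; [bar_diff] and [pdiff] share it. *)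
Definition inner f s : k := \sum_(i < size s) (-1) ^+ i.+1 * f (face i.+1 s).

Lemma bar_diff_cons f x s : bar_diff f (x :: s) = f s + inner f (x :: s).
Proof. exact: diffE. Qed.

Lemma inner_consE f x s :
  inner f (x :: s) = - f (face 1 (x :: s)) - inner (shift f x) s.
Proof. exact: inner_cons. Qed.

Lemma inner_nil f : inner f [::] = 0.
Proof. by rewrite /inner big_ord0. Qed.

Lemma inner_add f g s : inner (fun u => f u + g u) s = inner f s + inner g s.
Proof. exact: innerD. Qed.

Lemma inner_opp f s : inner (fun u => - f u) s = - inner f s.
Proof. by rewrite /inner -sumrN; apply: eq_bigr => i _; rewrite mulrN. Qed.

Lemma inner_sub f g s : inner (fun u => f u - g u) s = inner f s - inner g s.
Proof. by rewrite inner_add inner_opp. Qed.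

Lemma inner_scale c f s : inner (fun u => c * f u) s = c * inner f s.
Proof. exact: innerZ. Qed.

Lemma inner_sum (I : Type) (r : seq I) (P : pred I) (F : I -> seq gT -> k) s :
  inner (fun u => \sum_(i <- r | P i) F i u) s = \sum_(i <- r | P i) inner (F i) s.
Proof.
rewrite /inner exchange_big /=; apply: eq_bigr => i _.
by rewrite mulr_sumr.
Qed.

Lemma inner_cong f g s :
  (forall u, size u = (size s).-1 -> f u = g u) -> inner f s = inner g s.
Proof.
case: s => [|x s] fg; first by rewrite !inner_nil.
apply: eq_bigr => i _; rewrite fg // size_face_eq //.
Qed.

Section Action.
Variables (X : Type) (act : X -> gT -> X).
Hypothesis actM : forall c x y, act c (x * y)%g = act (act c x) y.
Implicit Types (F U : seq gT -> X -> k).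

(** Cochains with coefficients in the functions on [X]: the word [s] and the point [c] form a path
    of the action groupoid starting at [c], and dropping its first letter moves the start to
    [act c x]. *)
Definition pdiff F s c : k :=
  if s is x :: t then F t (act c x) + inner (F^~ c) s else 0.

Definition pcup F g s c : k := cup (F^~ c) g s.
Definition psign F s c : k := (-1) ^+ size s * F s c.

Lemma pdiffD F U : pdiff (F + U) = pdiff F + pdiff U.
Proof.
apply/funext => -[|x s]; apply/funext => c; first exact: esym (addr0 (0 : k)).
rewrite -[RHS]/(pdiff F (x :: s) c + pdiff U (x :: s) c) /=.
by rewrite [inner _ _](inner_add (F^~ c) (U^~ c)) addrACA.
Qed.

Lemma pdiffN F : pdiff (- F) = - pdiff F.
Proof.
apply/funext => -[|x s]; apply/funext => c; first exact: esym (oppr0 k).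
rewrite -[RHS]/(- pdiff F (x :: s) c) /=.
by rewrite [inner _ _](inner_opp (F^~ c)) -opprD.
Qed.

Lemma pdiffB F U : pdiff (F - U) = pdiff F - pdiff U.
Proof. by rewrite pdiffD pdiffN. Qed.

Lemma pdiff_mask (P : X -> bool) F : (forall c x, P (act c x) = P c) ->
  pdiff (fun s c => if P c then F s c else 0)
  = (fun s c => if P c then pdiff F s c else 0).
Proof.
move=> Pact; apply/funext => -[|x s]; apply/funext => c /=; first by case: (P c).
rewrite Pact; case: (P c) => //.
rewrite add0r /inner big1 // => i _; exact: mulr0.
Qed.

Lemma pdiff_cup F g :
  pdiff (pcup F g) = pcup (pdiff F) g + pcup (psign F) (bar_diff g).
Proof.
apply/funext => -[|x s]; apply/funext => c.
  rewrite -[RHS]/(pcup (pdiff F) g [::] c + pcup (psign F) (bar_diff g) [::] c).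
  by rewrite /pcup !cup_nil mul0r mulr0 addr0.
rewrite -[RHS]/(pcup (pdiff F) g (x :: s) c
  + pcup (psign F) (bar_diff g) (x :: s) c) /pdiff {1}/pcup.
have -> : inner ((pcup F g)^~ c) (x :: s)
  = cup (inner (F^~ c)) g (x :: s) + cup (bar_sign (F^~ c)) (bar_diff g) (x :: s).
  exact: inner_cup.
rewrite addrA; congr (_ + _).
rewrite /pcup [in RHS]cup_cons mul0r add0r.
have -> : Defs.cup (fun s0 => pdiff F (x :: s0) c) g s
  = cup ((F^~ (act c x)) + shift (inner (F^~ c)) x) g s by [].
by rewrite cupDl cup_cons inner_nil mul0r add0r.
Qed.

Definition pface i (cs : X * seq gT) : X * seq gT :=
  (if (i, cs.2) is (0%N, x :: _) then act cs.1 x else cs.1, face i cs.2).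

Lemma pdiffE F x s c : pdiff F (x :: s) c =
  \sum_(i < (size s).+2) (-1) ^+ i *
    F (pface i (c, x :: s)).2 (pface i (c, x :: s)).1.
Proof. by rewrite big_ord_recl /= mul1r; congr (_ + _). Qed.

Lemma pface_pface i j cs : (1 < size cs.2)%N -> (i <= j)%N -> pface j (pface i cs) = pface i (pface j.+1 cs).
Proof.
case: cs => c [|x [|y s]] //= _ le_ij; rewrite /pface /= face_face //; congr (_, _).
case: i le_ij => [|i] le_ij /=; last by case: j le_ij.
by case: j {le_ij} => [|j] //=; rewrite actM.
Qed.

Lemma pdiff_pdiff F : pdiff (pdiff F) = 0.
Proof.
apply/funext => -[|x [|y s]]; apply/funext => c //.
  by rewrite pdiffE big1 // => i _; case: i => -[|[|i]] //= _; rewrite mulr0.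
rewrite pdiffE -[RHS](@simplicial_sum0 k (fun i j =>
  F (pface j (pface i (c, [:: x, y & s]))).2
    (pface j (pface i (c, [:: x, y & s]))).1) (size s).+2); last first.
  by move=> i j le_ij; rewrite pface_pface.
apply: eq_bigr => i _; rewrite -mulr_sumr; congr (_ * _).
have : size (pface i (c, [:: x, y & s])).2 = (size s).+1.
  by apply: size_face_eq; rewrite -ltnS.
case: (pface i _) => c' [|z t] //= [szt].
by rewrite -[LHS]/(pdiff F (z :: t) c') pdiffE szt.
Qed.

End Action.
End GroupoidCochains.

(** * Homotopies from natural transformations *)

Section Prism.
Variables (k : fieldType) (gT hT : finGroupType).
Variables (X : Type) (act : X -> gT -> X) (Y : Type) (bct : Y -> hT -> Y).

Definition functor (f0 : Y -> X) (f1 : Y -> hT -> gT) : Prop :=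
  (forall y h, act (f0 y) (f1 y h) = f0 (bct y h)) /\
  (forall y h h', f1 y (h * h')%g = (f1 y h * f1 (bct y h) h')%g).

Fixpoint fword (f1 : Y -> hT -> gT) y (s : seq hT) : seq gT :=
  if s is h :: t then f1 y h :: fword f1 (bct y h) t else [::].

Definition fpull (f0 : Y -> X) f1 (F : seq gT -> X -> k) s y : k :=
  F (fword f1 y s) (f0 y).

Lemma size_fword f1 y s : size (fword f1 y s) = size s.
Proof. by elim: s y => //= h s IHs y; rewrite IHs. Qed.

Hypothesis bctM : forall y h h', bct y (h * h')%g = bct (bct y h) h'.

Lemma fword_face f1 y i s :
    (forall y h h', f1 y (h * h')%g = (f1 y h * f1 (bct y h) h')%g) ->
  fword f1 y (face i.+1 s) = face i.+1 (fword f1 y s).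
Proof.
move=> f1M; elim: s i y => [|h s IHs] i y; first by case: i.
case: i => [|i]; first by case: s {IHs} => //= h' s; rewrite f1M bctM.
by rewrite -[LHS]/(f1 y h :: fword f1 (bct y h) (face i.+1 s)) IHs.
Qed.

Lemma inner_fword f1 y (f : seq gT -> k) s :
    (forall y h h', f1 y (h * h')%g = (f1 y h * f1 (bct y h) h')%g) ->
  inner (fun u => f (fword f1 y u)) s = inner f (fword f1 y s).
Proof.
move=> f1M; rewrite /inner size_fword; apply: eq_bigr => i _.
by rewrite fword_face.
Qed.

Variables (f0 g0 : Y -> X) (f1 g1 : Y -> hT -> gT) (w : Y -> gT).
Hypotheses (ff : functor f0 f1) (gg : functor g0 g1).
Hypothesis w0 : forall y, act (f0 y) (w y) = g0 y.
Hypothesis w1 : forall y h, (f1 y h * w (bct y h) = w y * g1 y h)%g.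

(** The homotopy of a natural transformation [w]: the alternating sum over the places where [w] can
    be inserted, with [f1] applied before it and [g1] after it. *)
Fixpoint prism (f : seq gT -> k) (s : seq hT) y : k :=
  f (w y :: fword g1 y s) -
  (if s is h :: t then prism (shift f (f1 y h)) t (bct y h) else 0).

Lemma prismE f s y : prism f s y = f (w y :: fword g1 y s) -
  (if s is h :: t then prism (shift f (f1 y h)) t (bct y h) else 0).
Proof. by case: s. Qed.

Lemma prism_add f f' s y :
  prism (fun u => f u + f' u) s y = prism f s y + prism f' s y.
Proof.
elim: s f f' y => [|h s IHs] f f' y /=; first by rewrite !subr0.
by rewrite (IHs (shift f _) (shift f' _)); ring.
Qed.

Lemma prism_opp f s y : prism (fun u => - f u) s y = - prism f s y.
Proof.
elim: s f y => [|h s IHs] f y /=; first by rewrite !subr0.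
by rewrite (IHs (shift f _)); ring.
Qed.

Lemma prism_inner f s y :
  prism (inner f) s y + inner (fun u => prism f u y) s = - f (fword f1 y s).
Proof.
have [_ f1M] := ff; have [_ g1M] := gg.
elim: s f y => [|h s IHs] f y.
  by rewrite /= inner_nil inner_consE inner_nil; ring.
have E1 : prism (inner f) (h :: s) y = inner f (w y :: fword g1 y (h :: s))
    + prism (fun u => f (face 1 (f1 y h :: u))) s (bct y h)
    + prism (inner (shift f (f1 y h))) s (bct y h).
  rewrite prismE.
  have -> : shift (inner f) (f1 y h) = fun u =>
      - f (face 1 (f1 y h :: u)) + - inner (shift f (f1 y h)) u.
    by apply/funext => u; rewrite /shift inner_consE.
  by rewrite prism_add !prism_opp; ring.
have E2 : inner (fun u => prism f u y) (h :: s) = - prism f (face 1 (h :: s)) y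
    - inner (shift (shift f (w y)) (g1 y h)) (fword g1 (bct y h) s)
    + inner (fun u => prism (shift f (f1 y h)) u (bct y h)) s.
  rewrite inner_consE.
  have -> : shift (fun u => prism f u y) h = fun u =>
      shift (shift f (w y)) (g1 y h) (fword g1 (bct y h) u)
      - prism (shift f (f1 y h)) u (bct y h) by [].
  by rewrite inner_sub inner_fword //; ring.
have E3 : inner f (w y :: fword g1 y (h :: s)) =
    - f ((w y * g1 y h)%g :: fword g1 (bct y h) s)
    + f (w y :: face 1 (fword g1 y (h :: s)))
    + inner (shift (shift f (w y)) (g1 y h)) (fword g1 (bct y h) s).
  rewrite inner_consE /= inner_consE; rewrite /shift; ring.
(* The merged letters agree on both sides except where [w] takes part; there naturality [w1] turns
   [f1 y h * w (bct y h)] into [w y * g1 y h]. *)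
have E4 : prism (fun u => f (face 1 (f1 y h :: u))) s (bct y h)
    - prism f (face 1 (h :: s)) y
    = f ((w y * g1 y h)%g :: fword g1 (bct y h) s)
      - f (w y :: face 1 (fword g1 y (h :: s))).
  case: s {IHs E1 E2 E3} => [|h' s] /=; first by rewrite w1 !subr0.
  rewrite w1 g1M f1M bctM.
  have -> : shift (fun u => f (face 1 (f1 y h :: u))) (f1 (bct y h) h')
    = shift f (f1 y h * f1 (bct y h) h') by [].
  ring.
have {IHs} := IHs (shift f (f1 y h)) (bct y h).
rewrite E1 E2 E3 -[f (fword f1 y (h :: s))]/(shift f (f1 y h) (fword f1 (bct y h) s)).
by move=> <-; move/eqP: E4; rewrite subr_eq => /eqP ->; ring.
Qed.

Definition pprism (F : seq gT -> X -> k) s y : k := prism (F^~ (f0 y)) s y.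

Lemma pprism_diff F :
  pdiff bct (pprism F) + pprism (pdiff act F) = fpull g0 g1 F - fpull f0 f1 F.
Proof.
have [f0E _] := ff.
apply/funext => s; apply/funext => y.
rewrite -[LHS]/(pdiff bct (pprism F) s y + pprism (pdiff act F) s y).
rewrite -[RHS]/(F (fword g1 y s) (g0 y) - F (fword f1 y s) (f0 y)).
rewrite -(prism_inner (F^~ (f0 y)) s y) /pprism.
case: s => [|h s].
  by rewrite /= w0 inner_nil; ring.
rewrite [pdiff _ _ _ _]/= [prism (fun s0 => pdiff act F s0 _) _ _]prismE.
rewrite [pdiff act F _ _]/= w0.
have -> : shift ((pdiff act F)^~ (f0 y)) (f1 y h) = fun u =>
    F u (f0 (bct y h)) + shift (inner (F^~ (f0 y))) (f1 y h) u.
  by apply/funext => u; rewrite /shift /= f0E.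
rewrite prism_add [prism (inner _) (h :: s) y]prismE [fword _ _ (h :: s)]/=.
ring.
Qed.

End Prism.

(** * Shapiro's lemma for action groupoids *)

Section Shapiro.
Variables (k : fieldType) (gT : finGroupType) (X : Type) (act : X -> gT -> X).
Hypotheses (actM : forall c x y, act c (x * y)%g = act (act c x) y)
  (act1 : forall c, act c 1%g = c).
Variables (rep : X -> X) (wt : X -> gT).
Hypothesis wtP : forall c, act (rep c) (wt c) = c.
Hypothesis rep_act : forall c x, rep (act c x) = rep c.

(** Together with [rep], a retraction of the groupoid onto the stabilisers of the representatives: a
    step is closed up to a loop along the paths [wt], and these form a natural transformation to the
    identity. *)
Definition stab1 c x : gT := (wt c * x * (wt (act c x))^-1)%g.

Lemma stab_functor : functor act act rep stab1.
Proof.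
split=> [c x|c x y]; last by rewrite /stab1 actM !mulgA mulgKV.
rewrite /stab1 !actM wtP rep_act.
by rewrite -{1}(wtP (act c x)) rep_act -actM mulgV act1.
Qed.

Lemma stab_word_fix c s x : x \in fword act stab1 c s -> act (rep c) x = rep c.
Proof.
elim: s c => //= y s IHs c; rewrite inE => /predU1P[->|/IHs]; last by rewrite rep_act.
by have [-> _] := stab_functor; rewrite rep_act.
Qed.

(** Pulling [F] back along the retraction changes it by a coboundary, and the pullback only
    evaluates [F] on loops at representatives, where it has a primitive by hypothesis. *)
Lemma shapiro_rep (F : seq gT -> X -> k) : pdiff act F = 0 ->
    (forall c, exists a : seq gT -> k, forall s,
       (forall x, x \in s -> act (rep c) x = rep c) -> F s (rep c) = bar_diff a s) ->
  exists U, F = pdiff act U.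
Proof.
move=> dF stF.
have idf : functor act act id (fun _ x => x) by [].
have id0 c : act (rep c) (wt c) = id c by exact: wtP.
have id1 c x : (stab1 c x * wt (act c x) = wt c * x)%g by rewrite /stab1 mulgKV.
have := pprism_diff (k := k) actM stab_functor idf id0 id1 F.
have -> : fpull act id (fun _ x => x) F = F.
  apply/funext => s; apply/funext => c; rewrite /fpull; congr (F _ _).
  by elim: s c => //= x s IHs c; rewrite IHs.
rewrite dF; set U := pprism _ _ _ _ _.
have -> : U 0 = 0.
  apply/funext => s; apply/funext => c; rewrite /pprism.
  have p0 (f : seq gT -> k) u d : (forall v, f v = 0) ->
      prism act stab1 (fun _ x => x) wt f u d = 0.
    elim: u f d => [|x u IHu] f d f0 /=; first by rewrite f0 subr0.
    by rewrite f0 IHu ?subr0 // => v; apply: f0.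
  by rewrite [LHS](p0 _ s c).
rewrite addr0 => dU.
(* The primitive is made a function of the representative alone, so that it stays the same along a
   word. *)
have [a aP] : exists a : X -> seq gT -> k, forall c s,
    (forall x, x \in s -> act (rep c) x = rep c) -> F s (rep c) = bar_diff (a (rep c)) s.
  have rr c : rep (rep c) = rep c by rewrite -{2}(wtP c) rep_act.
  pose a c := projT1 (cid (stF c)); exists a => c s sc.
  rewrite -[in F _ _]rr; rewrite /a; case: cid => b /= -> //.
  by rewrite rr.
exists ((U F : seq gT -> X -> k) + fpull act rep stab1 (fun s c => a c s)).
rewrite pdiffD dU -[LHS](subrK (fpull act rep stab1 F)); congr (_ + _).
apply/funext => s; apply/funext => c; rewrite /fpull aP; last exact: stab_word_fix.
case: s => [|x s] //.
rewrite -[LHS]/(bar_diff _ (stab1 c x :: fword act stab1 (act c x) s)).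
rewrite bar_diff_cons [RHS]/= rep_act; congr (_ + _).
have [_ stM] := stab_functor.
exact: (esym (inner_fword actM c (a (rep c)) (x :: s) stM)).
Qed.

End Shapiro.

(** * Graded commutativity *)

Section Circle.
Variables (k : fieldType) (gT : finGroupType).
Implicit Types (f g : seq gT -> k) (s t u : seq gT) (x y a : gT).

(** [g] is evaluated on an initial block of [s], and [f] on the word in which this block is replaced
    by [a] times the product of its letters; the sum runs over the length of the block. *)
Fixpoint block f a g s : k :=
  if s is x :: t then f (a :: s) * g [::] + block f (a * x)%g (shift g x) t
  else f [:: a] * g [::].

Lemma block_add_r f a g h s :
  block f a (fun u => g u + h u) s = block f a g s + block f a h s.
Proof.
elim: s a g h => [|x s IHs] a g h /=; first by rewrite mulrDr.
by rewrite (IHs _ (shift g x) (shift h x)); ring.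
Qed.

Lemma block_opp_r f a g s : block f a (fun u => - g u) s = - block f a g s.
Proof.
elim: s a g => [|x s IHs] a g /=; first by rewrite mulrN.
by rewrite (IHs _ (shift g x)); ring.
Qed.

Lemma block_scale_r c f a g s : block f a (fun u => c * g u) s = c * block f a g s.
Proof.
elim: s a g => [|x s IHs] a g /=; first by rewrite mulrCA.
by rewrite (IHs _ (shift g x)); ring.
Qed.

Lemma block_add_l f h a g s :
  block (fun u => f u + h u) a g s = block f a g s + block h a g s.
Proof.
elim: s a g => [|x s IHs] a g /=; first by rewrite mulrDl.
by rewrite IHs; ring.
Qed.

Lemma block_opp_l f a g s : block (fun u => - f u) a g s = - block f a g s.
Proof.
elim: s a g => [|x s IHs] a g /=; first by rewrite mulNr.
by rewrite IHs; ring.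
Qed.

Lemma block_inner f a g s :
  block f a (inner g) s - inner (block f a g) s =
  block (inner f) a (bar_sign g) s + f [::] * bar_sign g s.
Proof.
elim: s a g => [|x s IHs] a g.
  by rewrite /= !inner_nil inner_consE inner_nil /bar_sign /=; ring.
have E1 : block f a (inner g) (x :: s) =
    - block f (a * x)%g (fun u => g (face 1 (x :: u))) s
    - block f (a * x)%g (inner (shift g x)) s.
  rewrite /= inner_nil mulr0 add0r.
  have -> : shift (inner g) x = fun u =>
      - g (face 1 (x :: u)) + - inner (shift g x) u.
    by apply/funext => u; rewrite /shift inner_consE.
  by rewrite block_add_r !block_opp_r.
have E2 : inner (block f a g) (x :: s) = - block f a g (face 1 (x :: s))
    - g [::] * inner (shift (shift f a) x) s
    - inner (block f (a * x)%g (shift g x)) s.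
  rewrite inner_consE.
  have -> : shift (block f a g) x = fun u =>
     g [::] * shift (shift f a) x u + block f (a * x)%g (shift g x) u.
    by apply/funext => u; rewrite /shift /= mulrC.
  by rewrite inner_add inner_scale; ring.
have E3 : block (inner f) a (bar_sign g) (x :: s) =
    (- f ((a * x)%g :: s) + f (a :: face 1 (x :: s))
      + inner (shift (shift f a) x) s) * g [::]
    - block (inner f) (a * x)%g (bar_sign (shift g x)) s.
  rewrite -[LHS]/(inner f (a :: x :: s) * bar_sign g [::]
    + block (inner f) (a * x)%g (shift (bar_sign g) x) s).
  have -> : shift (bar_sign g) x = fun u => - bar_sign (shift g x) u.
    by apply/funext => u; rewrite /shift /bar_sign /= exprS mulN1r mulNr.
  rewrite block_opp_r inner_consE inner_consE /bar_sign /= mul1r /shift; ring.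
have E4 : bar_sign g (x :: s) = - bar_sign (shift g x) s.
  by rewrite /bar_sign /= exprS mulN1r mulNr.
have E5 : block f (a * x)%g (fun u => g (face 1 (x :: u))) s + f (a :: face 1 (x :: s)) * g [::]
    = block f a g (face 1 (x :: s)) + f ((a * x)%g :: s) * g [::].
  case: s {IHs E1 E2 E3 E4} => [|y t] /=; first by rewrite addrC.
  rewrite mulgA.
  have -> : shift (fun u => g (face 1 (x :: u))) y = shift g (x * y)%g by [].
  ring.
have {IHs} := IHs (a * x)%g (shift g x).
rewrite E1 E2 E3 E4; move/eqP; rewrite subr_eq => /eqP ->.
move/eqP: E5; rewrite eq_sym -subr_eq => /eqP <-; ring.
Qed.

Variable e : k.

(** Gerstenhaber's circle product, or Steenrod's cup-1 product: the block may start anywhere. The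
    sign [e] stands for the parity of the degree of [g], which allows inhomogeneous [g]. *)
Fixpoint circ (e : k) f g s : k :=
  block f 1%g g s - (if s is x :: t then e * circ e (shift f x) g t else 0).

Lemma circE d f g s : circ d f g s =
  block f 1%g g s - (if s is x :: t then d * circ d (shift f x) g t else 0).
Proof. by case: s. Qed.

Lemma circ_add d f h g s :
  circ d (fun u => f u + h u) g s = circ d f g s + circ d h g s.
Proof.
elim: s f h => [|x s IHs] f h; first by rewrite !circE block_add_l; ring.
by rewrite !(circE _ _ _ (x :: s)) block_add_l (IHs (shift f x) (shift h x)); ring.
Qed.

Lemma circ_opp d f g s : circ d (fun u => - f u) g s = - circ d f g s.
Proof.
elim: s f => [|x s IHs] f /=; first by rewrite !subr0 mulNr.
rewrite (IHs (shift f x)) block_opp_l; ring.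
Qed.

Lemma block_face1 f a x g s :
  block (fun u => f (face 1 (x :: u))) a g s = block f (x * a)%g g s.
Proof. by elim: s a g => [|y s IHs] a g //=; rewrite IHs mulgA. Qed.

Definition parity_twist f s : k := e ^+ size s * f s.

Lemma block_bar_sign f a g s : bar_sign g = (fun u => e * g u) ->
  block f a (bar_sign g) s = e * block f a g s.
Proof. by move->; exact: block_scale_r. Qed.

Lemma circ_inner f g s : e * e = 1 -> bar_sign g = (fun u => e * g u) ->
  circ (- e) f (bar_diff g) s - inner (circ e f g) s - e * circ e (inner f) g s
  = e * cup (parity_twist f) g s.
Proof.
move=> ee ge; elim: s f => [|x s IHs] f.
  by rewrite /= inner_nil inner_consE inner_nil cup_nil /parity_twist /=; ring.
have E1 : circ (- e) f (bar_diff g) (x :: s) =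
    block f x g s + block f 1%g (inner g) (x :: s)
    + e * circ (- e) (shift f x) (bar_diff g) s.
  rewrite /= inner_nil mul1g !mulr0 !add0r.
  have -> : shift (bar_diff g) x = fun u => g u + shift (inner g) x u.
    by apply/funext => u; rewrite /shift bar_diff_cons.
  by rewrite block_add_r; ring.
have E2 : circ e (inner f) g (x :: s) = block (inner f) 1%g g (x :: s)
    + e * circ e (fun u => f (face 1 (x :: u))) g s
    + e * circ e (inner (shift f x)) g s.
  rewrite circE.
  have -> : shift (inner f) x = fun u =>
      - f (face 1 (x :: u)) + - inner (shift f x) u.
    by apply/funext => u; rewrite /shift inner_consE.
  by rewrite circ_add !circ_opp; ring.
have E3 : inner (circ e f g) (x :: s) = - circ e f g (face 1 (x :: s))
    - inner (shift (block f 1%g g) x) s + e * inner (circ e (shift f x) g) s.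
  rewrite inner_consE.
  have -> : shift (circ e f g) x = fun u =>
      shift (block f 1%g g) x u - e * circ e (shift f x) g u by [].
  by rewrite inner_sub inner_scale; ring.
have E4 : circ e f g (face 1 (x :: s)) - circ e (fun u => f (face 1 (x :: u))) g s
    = block f 1%g g (face 1 (x :: s)) - block f x g s.
  rewrite [circ e (fun u => f (face 1 (x :: u))) g s]circE block_face1 mulg1.
  case: s {IHs E1 E2 E3} => [|y t] /=; first by rewrite !subr0.
  have -> : shift (fun u => f (face 1 (x :: u))) y = shift f (x * y)%g by [].
  ring.
have E5 : block f 1%g (inner g) (x :: s) + block f 1%g g (face 1 (x :: s))
    + inner (shift (block f 1%g g) x) s
    = e * block (inner f) 1%g g (x :: s) + f [::] * (e * g (x :: s)).
  have := block_inner f 1%g g (x :: s); rewrite block_bar_sign // ge => <-.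
  by rewrite inner_consE; ring.
have E6 : cup (parity_twist f) g (x :: s)
    = f [::] * g (x :: s) + e * cup (parity_twist (shift f x)) g s.
  rewrite cup_cons /parity_twist /= mul1r; congr (_ + _).
  have -> : (fun s0 => e ^+ (size s0).+1 * f (x :: s0))
    = (fun s0 => e * parity_twist (shift f x) s0).
    by apply/funext => u; rewrite /parity_twist exprS mulrA.
  exact: cupZl.
rewrite E1 E2 E3 E6 mulrDr mulrA ee mul1r.
have := IHs (shift f x); move/(congr1 (fun z => e * z)); rewrite mulrA ee mul1r => <-.
move/eqP: E4; rewrite subr_eq => /eqP ->.
move/eqP: E5; rewrite -addrA addrC -subr_eq => /eqP E5.
set Z := circ (- e) _ _ s - _ - _.
rewrite (_ : e * (f [::] * g (x :: s) + e * (e * Z))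
  = f [::] * (e * g (x :: s)) + e * e * (e * Z)); last by ring.
rewrite ee mul1r {}/Z.
have -> : f [::] * (e * g (x :: s)) = block f 1%g (inner g) (x :: s) + block f 1%g g (face 1 (x :: s))
    + inner (shift (block f 1%g g) x) s - e * block (inner f) 1%g g (x :: s).
  move/eqP: E5; rewrite subr_eq => /eqP E5; rewrite [LHS](_ : _ = e * block (inner f) 1%g g (x :: s) + f [::] * (e * g (x :: s)) - e * block (inner f) 1%g g (x :: s)); last by ring.
  by rewrite -E5; ring.
by rewrite !mulrBr !mulrDr !(mulrA e e) ee !mul1r; ring.
Qed.

Lemma circ_diff f g : e * e = 1 -> bar_sign g = (fun u => e * g u) ->
  (fun s => circ (- e) f (bar_diff g) s - bar_diff (circ e f g) s
    - e * circ e (bar_diff f) g s)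
  = (fun s => e * (cup (parity_twist f) g s - cup g f s)).
Proof.
move=> ee ge; apply/funext => -[|x s].
  have h : bar_diff f [:: 1%g] = 0.
    by rewrite bar_diff_cons inner_consE inner_nil /=; ring.
  rewrite !cup_nil /parity_twist !circE.
  by rewrite -[block (bar_diff f) _ _ _]/(bar_diff f [:: 1%g] * g [::]) h /=; ring.
have E : circ e (bar_diff f) g (x :: s) =
    cup g f (x :: s) - e * circ e f g s + circ e (inner f) g (x :: s).
  rewrite circE.
  have -> : shift (bar_diff f) x = fun u => f u + shift (inner f) x u.
    by apply/funext => u; rewrite /shift bar_diff_cons.
  rewrite circ_add [circ e (inner f) g (x :: s)]circE.
  have bl a h t : block (bar_diff f) a h t = cup h f t + block (inner f) a h t.
    elim: t a h => [|y t IHt] a h.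
      by rewrite cup_nil -[LHS]/(bar_diff f [:: a] * h [::]) bar_diff_cons /=; ring.
    rewrite cup_cons -[LHS]/(bar_diff f (a :: y :: t) * h [::]
      + block (bar_diff f) (a * y)%g (shift h y) t) IHt bar_diff_cons /=.
    have -> : (fun s0 => h (y :: s0)) = shift h y by [].
    ring.
  by rewrite bl; ring.
rewrite bar_diff_cons E.
rewrite [RHS]mulrBr -(circ_inner _ _ ee ge).
transitivity (circ (- e) f (bar_diff g) (x :: s) - circ e f g s - inner (circ e f g) (x :: s) -
  e * cup g f (x :: s) + e * e * circ e f g s - e * circ e (inner f) g (x :: s)); first by ring.
by rewrite ee; ring.
Qed.

End Circle.

(** * Cohomology classes of cochains and their grading *)

Section Classes.
Variables (k : fieldType) (gT : finGroupType).
Implicit Types (f g h : seq gT -> k) (s : seq gT) (x : cohomology k gT) (n m : nat).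

Definition cocyc f : Prop := finite_degree f /\ bar_diff f = 0.

Lemma cocyc_is_cocycle f (fz : cocyc f) : is_cocycle (mk_cochain (proj1 fz)).
Proof. by apply/eqP; apply: val_inj; exact: (proj2 fz). Qed.

(** Total, with value 0 off the cocycles, so that classes can be rewritten without carrying proofs
    along. *)
Definition cl f : cohomology k gT :=
  if pselect (cocyc f) is left fz then coclass (Cocycle (cocyc_is_cocycle fz)) else 0.

Lemma cocycle_cocyc (z : cocycle k gT) : cocyc z.
Proof.
split; first exact: cochainP.
by have /(congr1 (@cochain_fun k gT)) := cocycleP z.
Qed.

Lemma cl_cocycle (z : cocycle k gT) : cl z = coclass z.
Proof.
rewrite /cl; case: pselect => [fz|[]]; last exact: cocycle_cocyc.
by congr coclass; do 2!apply: val_inj.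
Qed.

Definition repc x : seq gT -> k := cocycle_val (quot2_repr x).

Lemma repc_cocyc x : cocyc (repc x).
Proof. exact: cocycle_cocyc. Qed.

Lemma repcK x : cl (repc x) = x.
Proof. by rewrite cl_cocycle; exact: quot2_reprK. Qed.

Lemma clP x : exists2 f, cocyc f & x = cl f.
Proof. by exists (repc x); [exact: repc_cocyc | rewrite repcK]. Qed.

Lemma cl_lift f : cocyc f -> exists2 z : cocycle k gT, cochain_fun z = f & cl f = coclass z.
Proof. by move=> fz; exists (Cocycle (cocyc_is_cocycle fz)); rewrite // -cl_cocycle. Qed.

Definition dtrunc n f s : k := if (size s < n)%N then f s else 0.

Lemma size_face_ord (y : gT) s (i : 'I_(size s).+2) : size (face i (y :: s)) = size s.
Proof. by rewrite size_face_eq // -ltnS. Qed.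

Lemma dtrunc_diff n f : bar_diff (dtrunc n f) = dtrunc n.+1 (bar_diff f).
Proof.
apply/funext => -[|x s]; first by rewrite /dtrunc.
rewrite /dtrunc /= ltnS /bar_diff; case: ltnP => lt_s.
  by apply: eq_bigr => i _; rewrite size_face_ord lt_s.
by rewrite big1 // => i _; rewrite size_face_ord ltnNge lt_s mulr0.
Qed.

Lemma findeg_dtrunc n f : finite_degree (dtrunc n f).
Proof. by exists n => s le_ns; rewrite /dtrunc ltnNge le_ns. Qed.

(** The primitive [h] may have infinite degree: truncating it above the degrees of [f] and [g] keeps
    the identity. *)
Lemma cl_eqP f g : cocyc f -> cocyc g ->
  (cl f = cl g <-> exists h, forall s, f s - g s = bar_diff h s).
Proof.
move=> fz gz; have [z zf ->] := cl_lift fz; have [w wg ->] := cl_lift gz.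
split=> [/quot2_piP/asboolP[h /(congr1 (@cochain_fun k gT)) hE]|[h hE]].
  by exists h => s; rewrite -zf -wg -[RHS]/((cochain_diff h : seq gT -> k) s) -hE.
have [[a fa] _] := fz; have [[b gb] _] := gz.
apply/quot2_piP/asboolP; exists (mk_cochain (findeg_dtrunc (maxn a b) h)).
apply: val_inj; apply/funext => s /=; rewrite dtrunc_diff /dtrunc -hE -zf -wg ltnS.
case: leqP => [//|]; rewrite gtn_max => /andP[/ltnW la /ltnW lb].
by rewrite -[LHS]/((z : seq gT -> k) s - (w : seq gT -> k) s) zf wg fa // gb // subrr.
Qed.

Lemma cl_eq f g h : cocyc f -> cocyc g -> (forall s, f s - g s = bar_diff h s) ->
  cl f = cl g.
Proof. by move=> fz gz E; apply/cl_eqP => //; exists h. Qed.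

Lemma cocyc0 : cocyc 0.
Proof. by split; [exact: findeg0 | exact: diff0]. Qed.

Lemma cocyc1 : cocyc (@cup1 k gT).
Proof. by split; [exact: findeg1 | exact: diff1]. Qed.

Lemma cocycB f g : cocyc f -> cocyc g -> cocyc (f - g).
Proof.
move=> [ff df] [fg dg]; split; first exact: findegB.
by rewrite diffD diffN df dg subrr.
Qed.

Lemma cocycN f : cocyc f -> cocyc (- f).
Proof. by move=> fz; rewrite -sub0r; apply: cocycB => //; exact: cocyc0. Qed.

Lemma cocycD f g : cocyc f -> cocyc g -> cocyc (f + g).
Proof. by move=> fz gz; rewrite -[g]opprK; apply: cocycB => //; exact: cocycN. Qed.

Lemma sign0 : bar_sign (0 : seq gT -> k) = 0.
Proof. by apply/funext => s; exact: mulr0. Qed.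

Lemma cup0l g : cup (0 : seq gT -> k) g = 0.
Proof. by apply/funext => s; rewrite /cup big1 // => i _; exact: mul0r. Qed.

Lemma cup0r f : cup f (0 : seq gT -> k) = 0.
Proof. by apply/funext => s; rewrite /cup big1 // => i _; exact: mulr0. Qed.

Lemma cocycM f g : cocyc f -> cocyc g -> cocyc (cup f g).
Proof.
move=> [ff df] [fg dg]; split; first exact: findeg_cup.
by rewrite diff_cup df dg cup0l cup0r addr0.
Qed.

Lemma clB f g : cocyc f -> cocyc g -> cl (f - g) = cl f - cl g.
Proof.
move=> fz gz; have [z zf ->] := cl_lift fz; have [w wg ->] := cl_lift gz.
have <- : coclass (z - w) = coclass z - coclass w by rewrite rmorphB.
rewrite -cl_cocycle; congr cl.
by apply/funext => s; rewrite -zf -wg.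
Qed.

Lemma cl0 : cl 0 = 0.
Proof. by rewrite -(subrr 0) (clB cocyc0 cocyc0) subrr. Qed.

Lemma clN f : cocyc f -> cl (- f) = - cl f.
Proof. by move=> fz; rewrite -sub0r (clB cocyc0) // cl0 sub0r. Qed.

Lemma clD f g : cocyc f -> cocyc g -> cl (f + g) = cl f + cl g.
Proof. by move=> fz gz; rewrite -[g]opprK clB ?clN ?opprK //; exact: cocycN. Qed.

Lemma clM f g : cocyc f -> cocyc g -> cl (cup f g) = cl f * cl g.
Proof.
move=> fz gz; have [z zf ->] := cl_lift fz; have [w wg ->] := cl_lift gz.
have <- : coclass (z * w) = coclass z * coclass w by rewrite rmorphM.
rewrite -cl_cocycle; congr cl.
by apply/funext => s; rewrite -zf -wg.
Qed.

Lemma cl1 : cl (@cup1 k gT) = 1.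
Proof.
have <- : coclass 1 = 1 :> cohomology k gT by rewrite rmorph1.
by rewrite -cl_cocycle.
Qed.

Lemma cl_eq0P f : cocyc f -> (cl f = 0 <-> exists h, f = bar_diff h).
Proof.
move=> fz; rewrite -cl0 cl_eqP //; last exact: cocyc0.
split=> -[h hE]; exists h; first by apply/funext => s; rewrite -hE; exact/esym/subr0.
by move=> s; rewrite hE; exact: subr0.
Qed.

Definition scale_fun (c : k) f s : k := c * f s.

Lemma diff_scale c f : bar_diff (scale_fun c f) = scale_fun c (bar_diff f).
Proof.
apply/funext => -[|x s]; first by rewrite /scale_fun mulr0.
by rewrite /scale_fun /bar_diff mulr_sumr; apply: eq_bigr => i _; rewrite mulrCA.
Qed.

Lemma cocyc_scale c f : cocyc f -> cocyc (scale_fun c f).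
Proof.
move=> [[n fn] df]; split; first by exists n => s /fn; rewrite /scale_fun => ->; rewrite mulr0.
by rewrite diff_scale df; apply/funext => s; exact: mulr0.
Qed.

Definition scal c : cohomology k gT := cl (scale_fun c (@cup1 k gT)).

Lemma cup_scalel c f g : cup (scale_fun c f) g = scale_fun c (cup f g).
Proof. by apply/funext => s; exact: cupZl. Qed.

Lemma cup_scaler c f g : cup f (scale_fun c g) = scale_fun c (cup f g).
Proof.
apply/funext => s; rewrite /cup /scale_fun mulr_sumr.
by apply: eq_bigr => i _; rewrite mulrCA.
Qed.

Lemma scal_mull c f : cocyc f -> scal c * cl f = cl (scale_fun c f).
Proof. by move=> fz; rewrite -clM ?cup_scalel ?cup1f //; apply/cocyc_scale/cocyc1. Qed.

Lemma scal_mulr c f : cocyc f -> cl f * scal c = cl (scale_fun c f).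
Proof. by move=> fz; rewrite -clM ?cup_scaler ?cupf1 //; apply/cocyc_scale/cocyc1. Qed.

Lemma scal_comm c x : scal c * x = x * scal c.
Proof. by have [f fz ->] := clP x; rewrite scal_mull ?scal_mulr. Qed.

Lemma scal_zmod : zmod_morphism scal.
Proof.
move=> c d; rewrite -clB; try exact/cocyc_scale/cocyc1.
congr cl; apply/funext => s; exact: mulrBl.
Qed.

Lemma scal_monoid : monoid_morphism scal.
Proof.
split=> [|c d]; first by rewrite -cl1 /scal; congr cl; apply/funext => s; exact: mul1r.
rewrite scal_mull; last exact/cocyc_scale/cocyc1.
by congr cl; apply/funext => s; rewrite /scale_fun mulrA.
Qed.

HB.instance Definition _ := GRing.isZmodMorphism.Build k (cohomology k gT) scal scal_zmod.
HB.instance Definition _ := GRing.isMonoidMorphism.Build k (cohomology k gT) scal scal_monoid.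

Lemma scalM c d : scal (c * d) = scal c * scal d.
Proof. by have [_ ->] := scal_monoid. Qed.

Lemma scal0 : scal 0 = 0.
Proof. by rewrite -(subrr 0) scal_zmod subrr. Qed.

Lemma scal1 : scal 1 = 1.
Proof. by have [-> _] := scal_monoid. Qed.

Lemma scal_eq0 c : scal c = 0 -> c = 0.
Proof.
move/cl_eq0P => [|h /(congr1 (fun f : seq gT -> k => f [::]))].
  exact/cocyc_scale/cocyc1.
by rewrite /scale_fun /cup1 /= mulr1.
Qed.

Lemma cohomology_natr n : n%:R = scal n%:R.
Proof. by rewrite rmorph_nat. Qed.

Lemma scal_double x : x + x = scal 2%:R * x.
Proof. by rewrite -cohomology_natr mulr_natl mulr2n. Qed.

Lemma cohomology_neq0 : (1 : cohomology k gT) <> 0.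
Proof.
by rewrite -(rmorph1 scal) => /scal_eq0/eqP; rewrite oner_eq0.
Qed.

End Classes.

Section ChainOperators.
Variables (k : fieldType) (gT rT : finGroupType).
Implicit Types (h : (seq gT -> k) -> (seq rT -> k)).

(** The last clause is weaker than commutation with the differential, because [part] shifts its
    index across the differential and [bar_sign] anticommutes with it. *)
Definition chain_op h : Prop :=
  [/\ forall f g, h (f - g) = h f - h g,
      forall f, cocyc f -> cocyc (h f) &
      forall f, exists g, h (bar_diff f) = bar_diff g].

Definition hop h (x : cohomology k gT) : cohomology k rT := cl (h (repc x)).

Lemma hop_cl h f : chain_op h -> cocyc f -> hop h (cl f) = cl (h f).
Proof.
move=> [hB hz hd] fz; rewrite /hop.
have /cl_eqP[||u uE] := repcK (cl f); [exact: repc_cocyc | exact: fz |].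
have [v vE] := hd u; apply: (@cl_eq _ _ _ _ v); [by apply/hz/repc_cocyc | exact: hz |].
move=> s; rewrite -vE.
have -> : bar_diff u = repc (cl f) - f by apply/funext => t; rewrite -uE.
by rewrite hB.
Qed.

Lemma hopB h : chain_op h -> {morph hop h : x y / x - y}.
Proof.
move=> hh x y; have [hB hz _] := hh.
have [f fz ->] := clP x; have [g gz ->] := clP y.
by rewrite -clB // !hop_cl ?hB ?clB //; [exact: hz | exact: hz | exact: cocycB].
Qed.

Lemma hop0 h : chain_op h -> hop h 0 = 0.
Proof. by move=> hh; rewrite -(subrr 0) hopB // subrr. Qed.

Lemma hopN h : chain_op h -> {morph hop h : x / - x}.
Proof. by move=> hh x; rewrite -sub0r hopB // hop0 // sub0r. Qed.

Lemma hopD h : chain_op h -> {morph hop h : x y / x + y}.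
Proof. by move=> hh x y; rewrite -{1}[y]opprK hopB // hopN // opprK. Qed.

Lemma hop_sum h (I : Type) (r : seq I) (P : pred I) (F : I -> cohomology k gT) :
  chain_op h -> hop h (\sum_(i <- r | P i) F i) = \sum_(i <- r | P i) hop h (F i).
Proof. by move=> hh; apply: big_morph; [exact: hopD | exact: hop0]. Qed.

End ChainOperators.

Section Degrees.
Variables (k : fieldType) (gT : finGroupType).
Implicit Types (f g : seq gT -> k) (s : seq gT) (x y : cohomology k gT) (n m d : nat).

Definition part n f s : k := if size s == n then f s else 0.

Lemma part_diff n f : bar_diff (part n f) = part n.+1 (bar_diff f).
Proof.
apply/funext => -[|x s]; first by rewrite /part.
rewrite /part /= eqSS /bar_diff; case: eqP => [lt_s|/eqP/negPf lt_s].
  by apply: eq_bigr => i _; rewrite size_face_ord; case: eqP.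
by rewrite big1 // => i _; rewrite size_face_ord lt_s mulr0.
Qed.

Lemma part0_diff f : part 0 (bar_diff f) = 0.
Proof. by apply/funext => -[|x s]. Qed.

Lemma part_chain n : chain_op (part n).
Proof.
split=> [f g|f [_ df]|f].
- apply/funext => s; rewrite /part -[RHS]/(part n f s - part n g s) /part.
  by case: eqP => // _; exact/esym/subr0.
- split; last by rewrite part_diff df; apply/funext => s; rewrite /part; case: ifP.
  by exists n.+1 => s lt_s; rewrite /part gtn_eqF.
by case: n => [|n]; [exists 0; rewrite part0_diff diff0 | exists (part n f); rewrite part_diff].
Qed.

Lemma sign_chain : chain_op (@bar_sign k gT).
Proof.
split=> [f g|f [ff df]|f]; first by apply/funext => s; exact: mulrBr.
- by split; [exact: findeg_sign | rewrite diff_sign df sign0 oppr0].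
by exists (- bar_sign f); rewrite diffN diff_sign opprK.
Qed.

Definition hpart n := hop (part n).
Definition hsign := hop (@bar_sign k gT).

Lemma part_part n m f : part n (part m f) = if n == m then part n f else 0.
Proof.
apply/funext => s; rewrite /part; case: (eqVneq n m) => [->|nm]; case: eqP => // -> //.
by rewrite (negPf nm).
Qed.

Lemma hpart_hpart n m x : hpart n (hpart m x) = if n == m then hpart n x else 0.
Proof.
have [f fz ->] := clP x; have [_ mz _] := part_chain m; have [_ nz _] := part_chain n.
rewrite /hpart !hop_cl ?part_part; try exact: part_chain; try exact: mz; try done.
by case: eqP => //= _; rewrite cl0.
Qed.

Lemma hpart_large x : exists N, forall n, (N <= n)%N -> hpart n x = 0.
Proof.
have [f fz ->] := clP x; have [[N fN] _] := fz; exists N => n le_Nn.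
rewrite /hpart hop_cl //; last exact: part_chain.
rewrite -cl0; congr cl; apply/funext => s; rewrite /part.
by case: eqP => // sn; rewrite fN ?sn.
Qed.

Lemma hpart_sum x N : (forall n, (N <= n)%N -> hpart n x = 0) ->
  x = \sum_(n < N) hpart n x.
Proof.
have [f fz ->] := clP x; have [[M fM] _] := fz => xN.
have -> : \sum_(n < N) hpart n (cl f) = \sum_(n < N + M) hpart n (cl f).
  rewrite big_split_ord /= [X in _ = _ + X]big1 ?addr0 // => i _.
  by rewrite xN // leq_addr.
have H n : cocyc (\sum_(i < n) part i f) /\
    cl (\sum_(i < n) part i f) = \sum_(i < n) hpart i (cl f).
  elim: n => [|n [IH1 IH2]]; first by rewrite !big_ord0 cl0; split=> //; exact: cocyc0.
  have [_ pz' _] := part_chain n.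
  rewrite !big_ord_recr /= -IH2 /hpart hop_cl //; last exact: part_chain.
  by split; [apply: cocycD => //; exact: pz' | rewrite clD //; exact: pz'].
have [_ <-] := H (N + M)%N; congr cl; apply/funext => s.
have Hs n : (\sum_(i < n) part i f) s = if (size s < n)%N then f s else 0.
  elim: n => [|n IHn]; first by rewrite big_ord0.
  rewrite big_ord_recr /= -[LHS]/((\sum_(i < n) part i f) s + part n f s) IHn /part ltnS.
  by case: ltngtP => // _; rewrite ?addr0 ?add0r.
rewrite Hs; case: ltnP => // le_s; apply: fM.
by apply: leq_trans le_s; rewrite leq_addl.
Qed.

Lemma hpart_eq0 x : (forall n, hpart n x = 0) -> x = 0.
Proof. by move=> x0; rewrite (@hpart_sum x 0) ?big_ord0. Qed.

Definition homog n x : Prop := hpart n x = x.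

Lemma homog_hpart n x : homog n (hpart n x).
Proof. by rewrite /homog hpart_hpart eqxx. Qed.

Lemma homogP n x : homog n x -> exists f, [/\ cocyc f, x = cl f & part n f = f].
Proof.
have [f fz ->] := clP x; rewrite /homog /hpart hop_cl //; last exact: part_chain.
have [_ pz _] := part_chain n.
by move=> <-; exists (part n f); split; [exact: pz | | rewrite part_part eqxx].
Qed.

Lemma homog_cl n f : cocyc f -> part n f = f -> homog n (cl f).
Proof. by move=> fz fn; rewrite /homog /hpart hop_cl ?fn //; exact: part_chain. Qed.

Lemma homogeneousP n x : homogeneous n x <-> homog n x.
Proof.
split=> [[z zn <-]|/homogP[f [fz -> fn]]].
  rewrite -cl_cocycle; apply: homog_cl; first exact: cocycle_cocyc.
  by apply/funext => s; rewrite /part; case: eqP => // /eqP/zn ->.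
have [z zf ->] := cl_lift fz; exists z => // s /negPf sn.
by rewrite [LHS](congr1 (fun u => u s) zf) -fn /part sn.
Qed.

Lemma part_cupl d n f g : part d f = f -> part (d + n) (cup f g) = cup f (part n g).
Proof.
move=> fd; apply/funext => s; rewrite -fd /part /cup.
case: eqP => [sdn|sdn]; [apply: eq_bigr|rewrite big1 //] => i _.
  have le_i : (i <= size s)%N by rewrite -ltnS.
  rewrite size_takel //; case: eqP => [id|]; last by rewrite !mul0r.
  have -> : size (drop i s) = n by rewrite size_drop id sdn addKn.
  by rewrite eqxx.
have le_i : (i <= size s)%N by rewrite -ltnS.
rewrite size_takel //; case: eqP => [id|]; last by rewrite mul0r.
rewrite size_drop; case: eqP => [sn|]; last by rewrite mulr0.
by case: sdn; rewrite -id -sn subnKC.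
Qed.

Lemma part_cupl0 d n f g : part d f = f -> (n < d)%N -> part n (cup f g) = 0.
Proof.
move=> fd lt_nd; apply/funext => s; rewrite -fd /part /cup.
case: eqP => // sn; rewrite big1 // => i _.
have le_i : (i <= size s)%N by rewrite -ltnS.
rewrite size_takel //; case: eqP => [id|]; last by rewrite mul0r.
by move: lt_nd; rewrite -id ltnNge -sn le_i.
Qed.

Lemma hpart_mull d n x y : homog d x -> hpart (d + n) (x * y) = x * hpart n y.
Proof.
move=> /homogP[f [fz -> fd]]; have [g gz ->] := clP y.
have [_ pz _] := part_chain n.
rewrite -clM // /hpart !hop_cl; try exact: part_chain; try exact: cocycM; try done.
by rewrite (part_cupl n g fd) clM //; exact: pz.
Qed.

Lemma hpart_mull0 d n x y : homog d x -> (n < d)%N -> hpart n (x * y) = 0.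
Proof.
move=> /homogP[f [fz -> fd]] lt_nd; have [g gz ->] := clP y.
rewrite -clM // /hpart !hop_cl; try exact: part_chain; try exact: cocycM; try done.
by rewrite (part_cupl0 _ fd) // cl0.
Qed.

Lemma homogM m n x y : homog m x -> homog n y -> homog (m + n) (x * y).
Proof. by move=> xm yn; rewrite /homog hpart_mull // yn. Qed.

Lemma homog_scal c : homog 0 (scal gT c).
Proof.
apply: homog_cl; first exact/cocyc_scale/cocyc1.
by apply/funext => -[|x s]; rewrite /part //= /scale_fun /cup1 mulr0.
Qed.

Lemma homog1 : homog 0 1.
Proof. by rewrite -(rmorph1 (@scal k gT)); exact: homog_scal. Qed.

Lemma homogX n m x : homog n x -> homog (m * n) (x ^+ m).
Proof.
by move=> xn; elim: m => [|m IHm]; [exact: homog1 | rewrite exprS mulSn; exact: homogM].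
Qed.

Lemma homog0_scal x : homog 0 x -> exists c, x = scal gT c.
Proof.
move=> /homogP[f [fz -> f0]]; exists (f [::]); congr cl; apply/funext => -[|y s].
  by rewrite /scale_fun /cup1 mulr1.
by rewrite -f0 /part /scale_fun /cup1 mulr0.
Qed.

Lemma homog_sign n x : homog n x -> hsign x = scal gT ((-1) ^+ n) * x.
Proof.
move=> /homogP[f [fz -> fn]]; rewrite /hsign hop_cl //; last exact: sign_chain.
rewrite scal_mull //; congr cl; apply/funext => s; rewrite /bar_sign /scale_fun -fn /part.
by case: eqP => [->|_] //; rewrite !mulr0.
Qed.

Lemma hsignK : involutive hsign.
Proof.
move=> x; have [f fz ->] := clP x; have [_ sz _] := sign_chain.
rewrite /hsign !hop_cl ?bar_signK //; try exact: sign_chain; exact: sz.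
Qed.

Lemma bar_sign_cup f g : bar_sign (cup f g) = cup (bar_sign f) (bar_sign g).
Proof.
apply/funext => s; rewrite /bar_sign /cup mulr_sumr; apply: eq_bigr => i _.
have le_i : (i <= size s)%N by rewrite -ltnS.
rewrite size_takel // size_drop -{1}(subnKC le_i) exprD; ring.
Qed.

Lemma hsignM : {morph hsign : x y / x * y}.
Proof.
move=> x y; have [f fz ->] := clP x; have [g gz ->] := clP y.
have [_ sz _] := sign_chain.
rewrite -clM // /hsign !hop_cl ?bar_sign_cup ?clM //; try exact: sign_chain; try exact: sz.
exact: cocycM.
Qed.

Lemma hsign_scal c : hsign (scal gT c) = scal gT c.
Proof. by rewrite (homog_sign (homog_scal c)) rmorph1 mul1r. Qed.

Lemma block0r f a s : block f a (0 : seq gT -> k) s = 0.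
Proof.
have -> : (0 : seq gT -> k) = fun u => 0 * (0 : seq gT -> k) u.
  by apply/funext => u; rewrite mul0r.
by rewrite block_scale_r mul0r.
Qed.

Lemma circ0r e f s : circ e f (0 : seq gT -> k) s = 0.
Proof.
elim: s f => [|x s IHs] f; rewrite circE block0r; first by rewrite subr0.
by rewrite IHs mulr0 subr0.
Qed.

Lemma circ0l e g s : circ e (0 : seq gT -> k) g s = 0.
Proof.
have := circ_add e (0 : seq gT -> k) 0 g s.
have -> : (fun u => (0 : seq gT -> k) u + (0 : seq gT -> k) u) = 0.
  by apply/funext => u; exact: addr0.
by move/eqP; rewrite -subr_eq0 opprD addNKr oppr_eq0 => /eqP.
Qed.

Lemma homotopy_comm e f g : e * e = 1 -> bar_sign g = (fun u => e * g u) ->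
  cocyc f -> cocyc g -> cocyc (parity_twist e f) ->
  cl (parity_twist e f) * cl g = cl g * cl f.
Proof.
move=> ee ge fz gz tz; rewrite -!clM //.
apply: (@cl_eq _ _ _ _ (scale_fun (- e) (circ e f g))); try exact: cocycM.
move=> s; have /(congr1 (fun u => e * u s)) := circ_diff f ee ge.
have [_ df] := fz; have [_ dg] := gz.
rewrite df dg circ0r circ0l mulrA ee mul1r => <-.
by rewrite diff_scale /scale_fun; ring.
Qed.

(** Average a representative with its signed copy when 2 is invertible; in characteristic 2 the sign
    operator is the identity. *)
Lemma parity_rep e x : e = 1 \/ e = -1 -> hsign x = scal gT e * x ->
  exists g, [/\ cocyc g, x = cl g & bar_sign g = fun u => e * g u].
Proof.
move=> e1; have [f fz ->] := clP x; rewrite scal_mull // /hsign hop_cl //; last exact: sign_chain.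
have ee : e * e = 1 by case: e1 => ->; ring.
have [_ sz _] := sign_chain.
case: (eqVneq (2%:R : k) 0) => [k2|k2] fE.
  have m1 : (-1 : k) = 1 by apply/eqP; rewrite -subr_eq0 -opprD oppr_eq0 -k2.
  exists f; split=> //; apply/funext => s.
  by rewrite /bar_sign m1 expr1n; case: e1 => ->; rewrite ?m1.
exists (scale_fun (2%:R)^-1 (f + scale_fun e (bar_sign f))).
have cz : cocyc (scale_fun e (bar_sign f)) by apply/cocyc_scale/sz.
split; first exact/cocyc_scale/cocycD.
  rewrite -scal_mull; last exact: cocycD.
  rewrite clD // -[cl (scale_fun e _)]scal_mull; last exact: sz.
  rewrite fE -[cl (scale_fun e f)]scal_mull // mulrA -scalM ee scal1 mul1r.
  by rewrite scal_double mulrA -scalM mulVf // scal1 mul1r.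
apply/funext => s; rewrite /bar_sign /scale_fun.
rewrite -[(f + _) s]/(f s + e * ((-1) ^+ size s * f s)).
transitivity (2%:R^-1 * ((-1) ^+ size s * f s + e * ((-1) ^+ size s) ^+ 2 * f s)); first by ring.
rewrite sqrr_sign mulr1.
transitivity (2%:R^-1 * (e * e * ((-1) ^+ size s * f s) + e * f s)); last by ring.
by rewrite ee mul1r.
Qed.

Lemma even_comm x y : hsign x = x -> x * y = y * x.
Proof.
move=> xs; have [g [gz -> gs]] : exists g, [/\ cocyc g, x = cl g & bar_sign g = fun u => 1 * g u].
  by apply: parity_rep; [left | rewrite rmorph1 mul1r].
have [f fz ->] := clP y.
have tf : parity_twist 1 f = f by apply/funext => s; rewrite /parity_twist expr1n mul1r.
by rewrite -(homotopy_comm (mul1r 1) gs fz gz) tf.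
Qed.

Lemma odd_comm x y : hsign x = - x -> x * y = hsign y * x.
Proof.
move=> xs; have [g [gz -> gs]] : exists g, [/\ cocyc g, x = cl g & bar_sign g = fun u => -1 * g u].
  by apply: parity_rep; [right | rewrite rmorphN1 mulN1r].
have [f fz ->] := clP y; have [_ sz _] := sign_chain.
rewrite /hsign hop_cl //; last exact: sign_chain.
by apply/esym/homotopy_comm => //; [ring | exact: sz].
Qed.

Lemma odd_sqr x : (2%:R : k) != 0 -> hsign x = - x -> x * x = 0.
Proof.
move=> k2 xs; have := odd_comm x xs; rewrite xs mulNr => /eqP.
rewrite -addr_eq0 scal_double => /eqP.
move/(congr1 (fun z => scal gT (2%:R^-1) * z)).
by rewrite mulrA -scalM mulVf // scal1 mul1r mulr0.
Qed.

End Degrees.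

(** * Pullbacks *)

Section Pull.
Variables (k : fieldType) (aT rT : finGroupType) (phi : aT -> rT).
Implicit Types (x : cohomology k rT) (n : nat).
Hypothesis phiM : {morph phi : x y / (x * y)%g}.

Lemma pull_diff (f : seq rT -> k) : pull phi (bar_diff f) = bar_diff (pull phi f).
Proof.
apply/funext => -[|x s] //; rewrite /pull /bar_diff /= size_map.
by apply: eq_bigr => i _; rewrite -(map_face phiM i (x :: s)).
Qed.

Lemma cocyc_pull (f : seq rT -> k) : cocyc f -> cocyc (pull phi f).
Proof.
move=> [ff df]; split; first exact: findeg_pull.
by rewrite -pull_diff df.
Qed.

Lemma pull_cl (f : seq rT -> k) : cocyc f ->
  cohomology_pull phiM (cl f) = cl (pull phi f).
Proof.
move=> fz; have [z zf ->] := cl_lift fz.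
by rewrite cohomology_pullE -cl_cocycle -zf.
Qed.

Lemma pull_scal (c : k) : cohomology_pull phiM (scal rT c) = scal aT c.
Proof.
rewrite pull_cl; last exact/cocyc_scale/cocyc1.
by congr cl; apply/funext => -[].
Qed.

Lemma pull_hpart n x : cohomology_pull phiM (hpart n x) = hpart n (cohomology_pull phiM x).
Proof.
have [f fz ->] := clP x; have [_ pz _] := part_chain k rT n.
rewrite /hpart hop_cl //; last exact: part_chain.
rewrite !pull_cl //; last exact: pz.
rewrite hop_cl; [|exact: part_chain | exact: cocyc_pull].
by congr cl; apply/funext => s; rewrite /pull /part size_map.
Qed.

Lemma pull_homog n x : homog n x -> homog n (cohomology_pull phiM x).
Proof. by move=> xn; rewrite /homog -pull_hpart xn. Qed.

Lemma pull_hsign x : cohomology_pull phiM (hsign x) = hsign (cohomology_pull phiM x).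
Proof.
have [f fz ->] := clP x; have [_ pz _] := sign_chain k rT.
rewrite /hsign hop_cl //; last exact: sign_chain.
rewrite !pull_cl //; last exact: pz.
rewrite hop_cl; [|exact: sign_chain | exact: cocyc_pull].
by congr cl; apply/funext => s; rewrite /pull /bar_sign size_map.
Qed.

End Pull.

Lemma pull_comp (k : fieldType) (aT bT cT : finGroupType) (u : aT -> bT) (v : bT -> cT) (w : aT -> cT)
    (uM : {morph u : x y / (x * y)%g}) (vM : {morph v : x y / (x * y)%g})
    (wM : {morph w : x y / (x * y)%g}) (x : cohomology k cT) :
  (forall y, v (u y) = w y) ->
  cohomology_pull uM (cohomology_pull vM x) = cohomology_pull wM x.
Proof.
move=> uvw; have [f fz ->] := clP x.
rewrite !pull_cl //; last exact: cocyc_pull.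
by congr cl; apply/funext => s; rewrite /pull -map_comp (eq_map uvw).
Qed.

Lemma pull_id (k : fieldType) (aT : finGroupType) (u : aT -> aT)
    (uM : {morph u : x y / (x * y)%g}) (x : cohomology k aT) :
  (forall y, u y = y) -> cohomology_pull uM x = x.
Proof.
move=> u1; have [f fz ->] := clP x; rewrite pull_cl //.
by congr cl; apply/funext => s; rewrite /pull (eq_map u1) map_id.
Qed.

(** On the groupoid with one object, [g] is a natural transformation from conjugation by [g] to the
    identity, so the prism homotopy applies. *)
Lemma pull_conj (k : fieldType) (gT : finGroupType) (g : gT)
    (gM : {morph (fun x => (g * x * g^-1)%g) : x y / (x * y)%g}) (x : cohomology k gT) :
  cohomology_pull gM x = x.
Proof.
have [f fz ->] := clP x; rewrite pull_cl //.
pose act (c : unit) (y : gT) := c.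
pose f1 (c : unit) (y : gT) := (g * y * g^-1)%g.
have ff : functor act act id f1 by split=> // c y z; exact: gM.
have ii : functor act act id (fun _ y => y) by [].
have actM c y z : act c (y * z)%g = act (act c y) z by [].
have w0 c : act (id c) g = id c by [].
have w1 c y : (f1 c y * g = g * y)%g by rewrite /f1 mulgKV.
have E := pprism_diff (k := k) actM ff ii w0 w1 (fun s _ => f s).
have dU (U : seq gT -> unit -> k) s : pdiff act U s tt = bar_diff (U^~ tt) s.
  by case: s => // y s; rewrite bar_diff_cons.
have dF : pdiff act (fun s (_ : unit) => f s) = 0.
  by apply/funext => s; apply/funext => -[]; rewrite dU; have [_ ->] := fz.
move: E; rewrite dF; set U := pprism _ _ _ _ _ => E.
apply: (@cl_eq _ _ _ _ (- (U (fun s _ => f s))^~ tt)); [exact: cocyc_pull | exact: fz |].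
move=> s; have /(congr1 (fun u => u s tt)) := E.
have U0 : U 0 = 0.
  apply/funext => u; apply/funext => -[].
  have p0 (h : seq gT -> k) v d : (forall v, h v = 0) ->
      prism act f1 (fun _ x => x) (fun=> g) h v d = 0.
    elim: v h d => [|y v IHv] h d h0 /=; first by rewrite h0 subr0.
    by rewrite h0 IHv ?subr0 // => v'; apply: h0.
  by rewrite [LHS](p0 _ u tt).
rewrite U0 addr0 dU diffN => E'.
rewrite -[RHS]/(- bar_diff ((U (fun s _ => f s))^~ tt) s) E'.
transitivity (- (f (fword act (fun _ y => y) tt s) - f (fword act f1 tt s))); last by [].
rewrite opprB /pull; congr (f _ - f _); first by elim: s {E'} => //= y s ->.
by elim: s {E'} => //= y s {1}->.
Qed.

(** * Euler classes of products of circles *)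

(* The circle with p vertices and p edges has the cellular cochain complex
   V -> E; it is prolonged by a label T so that k -> V -> E -> T is exact. *)
Section Labels.
Variables (k : fieldType) (p : nat).

Definition lab : finType := option (bool * 'F_p).
Definition vl (i : 'F_p) : lab := Some (false, i).
Definition el (i : 'F_p) : lab := Some (true, i).
Definition isE (l : lab) := if l is Some (true, _) then true else false.
Definition isV (l : lab) := if l is Some (false, _) then true else false.
Definition ldeg (l : lab) : nat := if l is Some (b, _) then b else 2.
Definition sh (a : 'F_p) (l : lab) : lab := if l is Some (b, i) then Some (b, i + a) else None.

(** Matrix of the cochain differential: on an edge the difference of the values at its ends, on T
    the sum over all edges. *)
Definition Bm (x y : lab) : k :=
  match x, y with
  | Some (true, i), Some (false, j) => (j == i + 1)%:R - (j == i)%:R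
  | None, Some (true, _) => 1
  | _, _ => 0
  end.

(** A contraction onto the vertex 0: the vertex [i] receives the sum over the edges on the path from
    0 to [i], and the edge from -1 back to 0, which no such path uses, receives the value at T. *)
Definition Cm (x y : lab) : k :=
  match x, y with
  | Some (false, i), Some (true, j) => (j < i)%N%:R
  | Some (true, j), None => (j == -1)%:R
  | _, _ => 0
  end.

Definition Pm (x y : lab) : k := (isV x && (y == vl 0))%:R.

Lemma sum_lab (F : lab -> k) :
  \sum_l F l = F None + \sum_i F (vl i) + \sum_i F (el i).
Proof.
rewrite (bigD1 None) //= -addrA; congr (_ + _).
rewrite (reindex_omap Some id) /=; last by case.
rewrite (eq_bigl xpredT); last by move=> x; rewrite eqxx.
transitivity (\sum_(b : bool) \sum_(i : 'F_p) F (Some (b, i))).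
  by rewrite pair_bigA; apply: eq_bigr => -[b i] _.
by rewrite big_bool /= addrC.
Qed.

Lemma sum_pred1 (T : finType) (F : T -> k) (a : T) : \sum_i (i == a)%:R * F i = F a.
Proof.
rewrite (bigD1 a) //= eqxx mul1r big1 ?addr0 // => i /negPf ->.
by rewrite mul0r.
Qed.

Lemma Fp_succ (i : 'F_p) : (i + 1 : 'F_p) = (if i == -1 then 0 else i.+1) :> nat.
Proof.
case: eqP => [->|ni]; first by rewrite addNr.
have E : nat_of_ord (i + 1)%R = (i.+1 %% (Zp_trunc (pdiv p)).+2)%N.
  by rewrite /= ?modnDmr addn1.
rewrite E modn_small // ltn_neqAle ltn_ord andbT; apply/eqP => iE; apply: ni.
by apply/eqP; rewrite -addr_eq0; apply/eqP/val_inj; rewrite [LHS]E iE modnn.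
Qed.

Lemma Bm_sh a x y : Bm (sh a x) (sh a y) = Bm x y.
Proof.
case: x y => [[[] i]|] [[[] j]|] //=.
by rewrite [i + a + 1]addrAC !(inj_eq (addIr a)).
Qed.

Lemma Bm_odd x y : Bm x y != 0 -> isE y = ~~ isE x.
Proof. by case: x y => [[[] i]|] [[[] j]|] //=; rewrite eqxx. Qed.

Lemma Cm_odd x y : Cm x y != 0 -> isE y = ~~ isE x.
Proof. by case: x y => [[[] i]|] [[[] j]|] //=; rewrite eqxx. Qed.

Lemma Cm_ldeg x y : Cm x y != 0 -> ldeg y = (ldeg x).+1.
Proof. by case: x y => [[[] i]|] [[[] j]|] //=; rewrite eqxx. Qed.

Lemma Cm_nV x y : isV y -> Cm x y = 0.
Proof. by case: x y => [[[] i]|] [[[] j]|]. Qed.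

Lemma Bm_T x : Bm x None = 0.
Proof. by case: x => [[[] i]|]. Qed.

Lemma Bm_V x : \sum_l Bm x l * (isV l)%:R = 0.
Proof.
rewrite sum_lab /= mulr0 add0r [X in _ + X]big1 ?addr0; last by move=> i _; rewrite mulr0.
case: x => [[[] i]|] /=; try by rewrite big1 // => j _; rewrite mul0r.
under eq_bigr do rewrite mulr1.
rewrite sumrB.
have S a : \sum_(j : 'F_p) (j == a)%:R = 1 :> k.
  by rewrite -[RHS](sum_pred1 (fun=> 1) a); apply: eq_bigr => j _; rewrite mulr1.
by rewrite !S subrr.
Qed.

Hypotheses (p_prime : prime p) (char_k : p \in [pchar k]).

Lemma sum_Bm x (G : lab -> k) : \sum_l Bm x l * G l =
  match x with
  | Some (true, i) => G (vl (i + 1)) - G (vl i)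
  | Some (false, _) => 0
  | None => \sum_j G (el j)
  end.
Proof.
rewrite sum_lab Bm_T mul0r add0r.
case: x => [[[] i]|] /=.
- rewrite [X in _ + X]big1 ?addr0 => [|j _]; last by rewrite mul0r.
  under eq_bigr do rewrite mulrBl.
  by rewrite sumrB (sum_pred1 (fun l => G (vl l))) (sum_pred1 (fun l => G (vl l))).
- by rewrite !big1 ?addr0 // => j _; rewrite mul0r.
rewrite big1 ?add0r => [|j _]; last by rewrite mul0r.
by apply: eq_bigr => j _; rewrite mul1r.
Qed.

Lemma sum_Cm x (G : lab -> k) : \sum_l Cm x l * G l =
  match x with
  | Some (true, i) => (i == -1)%:R * G None
  | Some (false, i) => \sum_(j : 'F_p) (j < i)%N%:R * G (el j)
  | None => 0
  end.
Proof.
rewrite sum_lab [X in _ + X + _]big1 ?addr0 => [|j _]; last by rewrite Cm_nV ?mul0r.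
case: x => [[[] i]|] /=; rewrite ?mul0r ?add0r //.
  by rewrite big1 ?addr0 // => j _; rewrite mul0r.
by rewrite big1 // => j _; rewrite mul0r.
Qed.

Lemma BmBm x y : \sum_l Bm x l * Bm l y = 0.
Proof.
rewrite sum_Bm; case: x => [[[] i]|] //=; first exact: subrr.
case: y => [[[] j]|] /=; try by rewrite big1.
rewrite sumrB.
have S (a : 'F_p) (b : 'F_p) : \sum_(i : 'F_p) (a == i + b)%:R = 1 :> k.
  rewrite -[RHS](sum_pred1 (fun=> 1) (a - b)); apply: eq_bigr => i _.
  by rewrite mulr1 -subr_eq eq_sym.
have := S j 0; under eq_bigr do rewrite addr0.
by move=> ->; rewrite S subrr.
Qed.

Lemma Fp_max (j : 'F_p) : (j <= (-1 : 'F_p)%R)%N.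
Proof.
have -> : nat_of_ord (-1 : 'F_p)%R = (Zp_trunc (pdiv p)).+1.
  by rewrite /= [(1 %% _)%N]modn_small // subSS subn0 modn_small.
by rewrite -ltnS ltn_ord.
Qed.

Lemma BmCm x y :
  \sum_l Bm x l * Cm l y + \sum_l Cm x l * Bm l y = (x == y)%:R - Pm x y.
Proof.
rewrite sum_Bm sum_Cm /Pm; case: x => [[[] i]|].
- rewrite -[LHS]/(Cm (vl (i + 1)) y - Cm (vl i) y + (i == -1)%:R * Bm None y).
  move: (i + 1) (Fp_succ i) => i1 i1E; rewrite /= subr0; case: y => [[[] j]|] /=; rewrite ?mulr0 ?addr0 ?subrr //.
  rewrite mulr1 i1E; have -> : (Some (true, i) == Some (true, j) :> lab) = (i == j) by [].
  case: (eqVneq i (-1)) => [->|ni]; last rewrite mulr0n.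
    rewrite ltn0 sub0r addrC ltn_neqAle Fp_max andbT -[_ != _]/(j != -1) [-1 == j]eq_sym.
    by case: eqP => _ /=; rewrite ?subr0 ?subrr.
  rewrite addr0 ltnS leq_eqVlt -[(_ == _ :> nat)]/(j == i) [i == j]eq_sym.
  by case: (eqVneq j i) => [->|_]; rewrite ?ltnn ?subr0 ?subrr.
- rewrite [LHS]add0r /=; case: y => [[[] m]|] /=; last 1 first.
  - by rewrite big1 ?subrr // => l; rewrite mulr0.
  - by rewrite big1 ?subrr // => l; rewrite mulr0.
  under eq_bigr do rewrite mulrBr.
  rewrite sumrB.
  have -> : \sum_(l : 'F_p) (l < i)%N%:R * (m == l)%:R = (m < i)%N%:R :> k.
    rewrite -(sum_pred1 (fun l : 'F_p => (l < i)%N%:R) m).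
    by apply: eq_bigr => l _; rewrite mulrC eq_sym.
  have -> : \sum_(l : 'F_p) (l < i)%N%:R * (m == l + 1)%:R = ((m - 1)%R < i)%N%:R :> k.
    rewrite -(sum_pred1 (fun l : 'F_p => (l < i)%N%:R) (m - 1)).
    by apply: eq_bigr => l _; rewrite mulrC -subr_eq eq_sym.
  have -> : (Some (false, i) == Some (false, m) :> lab) = (i == m) by [].
  have -> : (Some (false, m) == vl 0 :> lab) = (m == 0) by [].
  have mE := Fp_succ (m - 1); rewrite subrK in mE.
  case: (eqVneq m 0) => [m0|nm].
    rewrite m0 sub0r.
    have -> : ((-1 : 'F_p)%R < i)%N = false by apply/negbTE; rewrite -leqNgt Fp_max.
    rewrite lt0n -[(_ != _ :> nat)]/(i != 0).
    by case: (i == 0); rewrite /= ?subrr ?subrr.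
  have m1 : (m - 1 == -1) = false by rewrite subr_eq addNr (negPf nm).
  rewrite m1 in mE; rewrite -mE subr0 leq_eqVlt -[(_ == _ :> nat)]/(m == i) [i == m]eq_sym.
  by case: (eqVneq m i) => [->|_]; rewrite ?ltnn ?subr0 ?subrr.
rewrite /= addr0 subr0; case: y => [[[] j]|] /=; try by rewrite big1.
rewrite -[RHS](sum_pred1 (fun=> 1) (-1 : 'F_p)); apply: eq_bigr => j _; exact/esym/mulr1.
Qed.

End Labels.

(** * Tensor products of circle complexes *)

Section Cells.
Variables (k : fieldType) (p : nat) (O : finType) (t : O -> O -> k).
Hypotheses (tsq : forall a b, t a b * t a b = 1)
  (tanti : forall a b, a != b -> t b a = - t a b).
Hypotheses (p_prime : prime p) (char_k : p \in [pchar k]).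

Local Notation lab := (lab p).
(** Basis of the tensor product over [O] of the complexes V -> E -> T. It resolves k and ends in a
    single top cell; without that cell it has the cohomology of a sphere of dimension 2 |O| - 1. *)
Definition cell := {ffun O -> lab}.
Implicit Types (c : cell) (o a b : O) (l x y : lab) (phi : cell -> k) (A : lab -> lab -> k).

Definition upd c o l : cell := [ffun a => if a == o then l else c a].

Lemma upd_upd c o l l' : upd (upd c o l) o l' = upd c o l'.
Proof. by apply/ffunP => a; rewrite !ffunE; case: eqP. Qed.

Lemma upd_swap c o o' l l' : o != o' ->
  upd (upd c o l) o' l' = upd (upd c o' l') o l.
Proof.
move=> oo; apply/ffunP => a; rewrite !ffunE.
by case: (eqVneq a o') => // ->; rewrite eq_sym (negPf oo).
Qed.

Lemma upd_id c o : upd c o (c o) = c.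
Proof. by apply/ffunP => a; rewrite ffunE; case: eqP => [->|]. Qed.

(* The sign of inserting o into the set of odd positions; t replaces the
   comparison with respect to an ordering of O, so that an action preserving t
   introduces no signs. *)
Definition sg o c : k := \prod_(a | (a != o) && isE (c a)) t a o.

Definition op A o phi c : k := sg o c * \sum_l A (c o) l * phi (upd c o l).

Lemma sg_upd_same o c l : sg o (upd c o l) = sg o c.
Proof.
apply: eq_bigl => a; rewrite ffunE.
by case: (eqVneq a o).
Qed.

Lemma sg_sqr o c : sg o c * sg o c = 1.
Proof. by rewrite -big_split /= big1. Qed.

Lemma sg_upd_odd o o' c l : o != o' -> isE l = ~~ isE (c o) ->
  sg o' (upd c o l) = sg o' c * t o o'.
Proof.
move=> oo lE.
have E c' : sg o' c' = (if isE (c' o) then t o o' else 1) *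
    \prod_(a | [&& a != o', isE (c' a) & a != o]) t a o'.
  rewrite /sg; case: ifP => coE.
    by rewrite (bigD1 o) /= ?coE ?oo //; congr (_ * _); apply: eq_bigl => a; rewrite andbA.
  rewrite mul1r; apply: eq_bigl => a; rewrite andbA.
  by case: (eqVneq a o) => [->|]; rewrite ?coE ?andbF ?andbT.
rewrite !E ffunE eqxx lE; set Q := \prod_(a | _) _; set Q' := \prod_(a | _) _.
have -> : Q' = Q.
  by apply: eq_bigl => a; rewrite ffunE; case: (eqVneq a o) => //=; rewrite !andbF.
by case: (isE (c o)) => /=; rewrite ?mul1r // ?[t _ _ * _]mulrC -?mulrA ?tsq ?mulr1 // mulrC.
Qed.

Lemma op_ext A o phi psi c : (forall c, phi c = psi c) -> op A o phi c = op A o psi c.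
Proof. by move=> E; congr (_ * _); apply: eq_bigr => l _; rewrite E. Qed.

Lemma opD A o phi psi c : op A o (fun c => phi c + psi c) c = op A o phi c + op A o psi c.
Proof.
rewrite /op -mulrDr -big_split /=; congr (_ * _); apply: eq_bigr => l _.
by rewrite mulrDr.
Qed.

Lemma opZ A o z phi c : op A o (fun c => z * phi c) c = z * op A o phi c.
Proof.
rewrite /op mulrCA; congr (_ * _); rewrite mulr_sumr; apply: eq_bigr => l _.
by rewrite mulrCA.
Qed.

Lemma op_sum A o (I : Type) (r : seq I) (P : pred I) (F : I -> cell -> k) c :
  op A o (fun c => \sum_(i <- r | P i) F i c) c = \sum_(i <- r | P i) op A o (F i) c.
Proof.
rewrite /op -mulr_sumr exchange_big /=; congr (_ * _); apply: eq_bigr => l _.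
by rewrite mulr_sumr.
Qed.

Lemma op_op_same A A' o phi c : op A o (op A' o phi) c =
  \sum_l' (\sum_l A (c o) l * A' l l') * phi (upd c o l').
Proof.
rewrite /op mulr_sumr.
transitivity (\sum_l \sum_l' A (c o) l * A' l l' * phi (upd c o l')).
  apply: eq_bigr => l _; rewrite sg_upd_same ffunE eqxx.
  rewrite (mulrCA (A (c o) l)) (mulrA (sg o c) (sg o c)) sg_sqr mul1r mulr_sumr.
  by apply: eq_bigr => l' _; rewrite upd_upd mulrA.
by rewrite exchange_big /=; apply: eq_bigr => l' _; rewrite mulr_suml.
Qed.

Lemma op_op A A' o o' phi c : o != o' -> (forall x y, A x y != 0 -> isE y = ~~ isE x) ->
  op A o (op A' o' phi) c = sg o c * sg o' c * t o o' *
  \sum_l \sum_l' A (c o) l * A' (c o') l' * phi (upd (upd c o l) o' l').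
Proof.
move=> oo oddA; rewrite /op -!mulrA; congr (_ * _); rewrite !mulr_sumr.
apply: eq_bigr => l _.
case: (eqVneq (A (c o) l) 0) => [->|Al].
  by rewrite mul0r big1 ?mulr0 // => l' _; rewrite !mul0r.
rewrite (sg_upd_odd oo (oddA _ _ Al)).
have -> : upd c o l o' = c o' by rewrite ffunE eq_sym (negPf oo).
rewrite mulrCA -mulrA; do 2!congr (_ * _); rewrite mulr_sumr.
by apply: eq_bigr => l' _; rewrite mulrA.
Qed.

Lemma op_anti A A' o o' phi c : o != o' ->
  (forall x y, A x y != 0 -> isE y = ~~ isE x) ->
  (forall x y, A' x y != 0 -> isE y = ~~ isE x) ->
  op A o (op A' o' phi) c = - op A' o' (op A o phi) c.
Proof.
move=> oo oA oA'; rewrite !op_op // 1?eq_sym // (tanti oo) mulrN mulNr opprK.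
rewrite [sg o' c * _]mulrC; congr (_ * _); rewrite exchange_big /=.
apply: eq_bigr => l' _; apply: eq_bigr => l _.
by rewrite [A _ _ * _]mulrC upd_swap.
Qed.

(** In characteristic 2 antisymmetry does not make the diagonal vanish, hence a separate hypothesis
    on it. *)
Lemma sum_antisym (F : O -> O -> k) : (forall a, F a a = 0) ->
  (forall a b, a != b -> F a b = - F b a) -> \sum_a \sum_b F a b = 0.
Proof.
move=> F0 Fa; rewrite pair_bigA /=.
pose lt (x : O * O) := (enum_rank x.1 < enum_rank x.2)%N.
rewrite (bigID lt) /= [X in _ + X](bigID (fun x : O * O => x.1 == x.2)) /=.
rewrite [X in _ + (X + _)]big1 ?add0r; last by move=> [a b] /= /andP[_ /eqP <-].
rewrite [X in _ + X](reindex_inj (h := fun x : O * O => (x.2, x.1))) /=; last first.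
  by move=> [a b] [a' b'] [-> ->].
rewrite [X in _ + X](eq_bigl lt) -?big_split /= ?big1 // => [[a b]|[a b]] /=.
  rewrite /lt /= => ab; rewrite [F b a]Fa ?subrr //.
  by apply/eqP => ba; rewrite ba ltnn in ab.
rewrite /lt /= -leqNgt; case: (eqVneq b a) => [->|ba]; first by rewrite ltnn andbF.
rewrite andbT leq_eqVlt; case: eqP => //= /val_inj/enum_rank_inj ab.
by rewrite ab eqxx in ba.
Qed.

Definition delta phi c : k := \sum_o op (@Bm k p) o phi c.

Lemma delta_sum (I : Type) (r : seq I) (P : pred I) (F : I -> cell -> k) c :
  delta (fun c => \sum_(i <- r | P i) F i c) c = \sum_(i <- r | P i) delta (F i) c.
Proof.
by rewrite /delta exchange_big /=; apply: eq_bigr => o _; rewrite op_sum.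
Qed.

Lemma deltaD phi psi c : delta (fun c => phi c + psi c) c = delta phi c + delta psi c.
Proof. by rewrite -big_split /=; apply: eq_bigr => o _; rewrite opD. Qed.

Lemma deltaZ z phi c : delta (fun c => z * phi c) c = z * delta phi c.
Proof. by rewrite mulr_sumr; apply: eq_bigr => o _; rewrite opZ. Qed.

Lemma deltaN phi c : delta (fun c => - phi c) c = - delta phi c.
Proof.
rewrite -[RHS]mulN1r -deltaZ; apply: eq_bigr => o _; apply: op_ext => d.
by rewrite mulN1r.
Qed.

Lemma delta_ext phi psi c : (forall c, phi c = psi c) -> delta phi c = delta psi c.
Proof. by move=> E; apply: eq_bigr => o _; exact: op_ext. Qed.

Lemma delta_delta phi c : delta (delta phi) c = 0.
Proof.
rewrite {1}/delta; transitivity (\sum_o \sum_o' op (@Bm k p) o (op (@Bm k p) o' phi) c).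
  by apply: eq_bigr => o _; rewrite /delta op_sum.
apply: sum_antisym => [o|o o' oo]; last by apply: op_anti => //; exact: Bm_odd.
by rewrite op_op_same big1 // => l _; rewrite BmBm ?mul0r.
Qed.

Definition proj o phi c : k := if isV (c o) then phi (upd c o (vl 0)) else 0.

Lemma homotopy_step o phi c :
  delta (op (@Cm k p) o phi) c + op (@Cm k p) o (delta phi) c = phi c - proj o phi c.
Proof.
rewrite /delta op_sum -big_split /= (bigD1 o) //= [X in _ + X]big1 ?addr0; last first.
  move=> a ao; rewrite (op_anti _ _ ao); try exact: Bm_odd; try exact: Cm_odd.
  by rewrite addNr.
rewrite !op_op_same -big_split /=.
transitivity (\sum_l ((c o == l)%:R - Pm k (c o) l) * phi (upd c o l)).
  by apply: eq_bigr => l _; rewrite -mulrDl BmCm.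
under eq_bigr do rewrite mulrBl.
rewrite sumrB; congr (_ - _).
  rewrite -[in RHS](upd_id c o) -(sum_pred1 (fun l => phi (upd c o l)) (c o)).
  by apply: eq_bigr => l _; rewrite eq_sym.
rewrite /proj /Pm; case: (isV (c o)) => /=; first exact: sum_pred1.
by rewrite big1 // => l _; rewrite mul0r.
Qed.

Lemma delta_proj o phi c : delta (proj o phi) c = proj o (delta phi) c.
Proof.
have E psi d : proj o psi d = psi d + - (delta (op (@Cm k p) o psi) d + op (@Cm k p) o (delta psi) d).
  by rewrite homotopy_step opprB addrCA subrr addr0.
rewrite (delta_ext _ (E phi)) deltaD deltaN deltaD delta_delta add0r [RHS]E.
congr (_ - _); rewrite [X in _ = _ + X](_ : _ = 0) ?addr0 //.
by rewrite /op big1 ?mulr0 // => l _; rewrite delta_delta mulr0.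
Qed.

(** The usual contraction of a tensor product: contract the factor [o], then the remaining factors
    after projecting [o] to its base vertex. *)
Fixpoint contr (s : seq O) phi c : k :=
  if s is o :: s' then op (@Cm k p) o phi c + proj o (contr s' phi) c else 0.

Fixpoint projs (s : seq O) phi c : k :=
  if s is o :: s' then proj o (projs s' phi) c else phi c.

Lemma contr_homotopy s phi c :
  delta (contr s phi) c + contr s (delta phi) c = phi c - projs s phi c.
Proof.
elim: s phi c => [|o s IHs] phi c /=.
  by rewrite subrr addr0 /delta big1 // => o _; rewrite /op big1 ?mulr0 // => l _; rewrite mulr0.
rewrite deltaD addrACA homotopy_step delta_proj.
have -> : proj o (delta (contr s phi)) c + proj o (contr s (delta phi)) c
    = proj o phi c - proj o (projs s phi) c.
  by rewrite /proj; case: ifP => _; rewrite ?IHs ?addr0 ?subr0.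
by rewrite addrA subrK.
Qed.

Definition base : cell := [ffun=> vl 0].
Definition topc : cell := [ffun=> None].
Definition allV c := [forall o, isV (c o)].
Definition aug (a : k) c : k := if allV c then a else 0.
Definition cdeg c : nat := \sum_o ldeg (c o).

Lemma projsE s phi c : projs s phi c =
  if all (fun o => isV (c o)) s then phi [ffun o => if o \in s then vl 0 else c o] else 0.
Proof.
elim: s phi c => [|o s IHs] phi c /=.
  by congr phi; apply/ffunP => o; rewrite ffunE.
rewrite /proj IHs; case: (boolP (isV (c o))) => //= co.
have -> : all (fun o0 => isV (upd c o (vl 0) o0)) s = all (fun o0 => isV (c o0)) s.
  by apply: eq_all => a; rewrite ffunE; case: eqP => [->|//]; rewrite co.
case: ifP => // _; congr phi; apply/ffunP => a; rewrite !ffunE inE.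
by case: (eqVneq a o) => //= ->; case: ifP.
Qed.

Definition contraction := contr (enum O).

Lemma contractionP phi c :
  delta (contraction phi) c + contraction (delta phi) c = phi c - aug (phi base) c.
Proof.
rewrite contr_homotopy projsE /aug; congr (_ - _).
have -> : all (fun o => isV (c o)) (enum O) = allV c.
  by apply/allP/forallP => H o; [apply: H; rewrite mem_enum | move=> _].
case: ifP => // _; congr phi; apply/ffunP => o; by rewrite !ffunE mem_enum.
Qed.

Lemma cdeg_upd c o l : (cdeg (upd c o l) + ldeg (c o) = cdeg c + ldeg l)%N.
Proof.
rewrite /cdeg (bigD1 o) //= [in RHS](bigD1 o) //= ffunE eqxx.
rewrite (eq_bigr (fun a => ldeg (c a))) => [|a /negPf ao]; last by rewrite ffunE ao.
by rewrite addnC addnA addnAC.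
Qed.

Lemma contraction_supp m phi c : (forall d, cdeg d = m.+1 -> phi d = 0) ->
  cdeg c = m -> contraction phi c = 0.
Proof.
move=> phi0; rewrite /contraction; elim: (enum O) c => //= o s IHs c cm.
rewrite /op big1 => [|l _]; last first.
  case: (eqVneq (Cm k (c o) l) 0) => [->|/Cm_ldeg lE]; first by rewrite mul0r.
  rewrite phi0 ?mulr0 //; have := cdeg_upd c o l; rewrite lE addnS -addSn cm.
  by move/addIn.
rewrite mulr0 add0r /proj; case: ifP => // co; apply: IHs.
have := cdeg_upd c o (vl 0); rewrite cm; case: (c o) co => [[[] i]|] //= _.
by rewrite !addn0.
Qed.

Lemma contractionD phi psi c :
  contraction (fun c => phi c + psi c) c = contraction phi c + contraction psi c.
Proof.
rewrite /contraction; elim: (enum O) c => [|o s IHs] c /=; first by rewrite addr0.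
by rewrite opD addrACA; congr (_ + _); rewrite /proj; case: ifP => _; rewrite ?IHs ?addr0.
Qed.

Lemma allV_upd c o l : allV (upd c o l) =
  isV l && [forall a, (a != o) ==> isV (c a)].
Proof.
apply/forallP/andP => [H|[lV /forallP H] a].
  split; first by have := H o; rewrite ffunE eqxx.
  by apply/forallP => a; apply/implyP => /negPf ao; have := H a; rewrite ffunE ao.
by rewrite ffunE; case: eqP => [//|/eqP ao]; have /implyP := H a; apply.
Qed.

Lemma contraction_aug (z : k) c : contraction (aug z) c = 0.
Proof.
rewrite /contraction; elim: (enum O) c => //= o s IHs c.
rewrite /op big1 => [|l _]; last first.
  by rewrite /aug allV_upd; case: (boolP (isV l)) => [/Cm_nV ->|_]; rewrite ?mul0r ?mulr0.
by rewrite mulr0 add0r /proj IHs; case: ifP.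
Qed.

Lemma delta_aug (z : k) c : delta (aug z) c = 0.
Proof.
rewrite /delta big1 // => o _; rewrite /op.
case: (boolP [forall a, (a != o) ==> isV (c a)]) => H.
  transitivity (sg o c * ((\sum_l Bm k (c o) l * (isV l)%:R) * z)).
    congr (_ * _); rewrite mulr_suml; apply: eq_bigr => l _.
    rewrite /aug allV_upd H andbT -mulrA.
    by case: (isV l); rewrite ?mul1r ?mul0r.
  by rewrite Bm_V mul0r mulr0.
by rewrite big1 ?mulr0 // => l _; rewrite /aug allV_upd (negPf H) andbF mulr0.
Qed.

Lemma delta_top (a : k) c : delta (fun d => if d == topc then a else 0) c = 0.
Proof.
rewrite /delta big1 // => o _; rewrite /op big1 ?mulr0 // => l _.
case: eqP => [E|]; last by rewrite mulr0.
have := congr1 (fun d : cell => d o) E; rewrite !ffunE eqxx => ->.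
by rewrite Bm_T mul0r.
Qed.

Lemma ldeg_le l : (ldeg l <= 2)%N. Proof. by case: l => [[[] i]|]. Qed.

Lemma cdeg_le c : (cdeg c <= #|O| * 2)%N.
Proof. by rewrite -sum_nat_const; apply: leq_sum => o _; exact: ldeg_le. Qed.

Lemma cdeg_top c : (cdeg c == #|O| * 2)%N = (c == topc).
Proof.
apply/eqP/eqP => [cE|->]; last first.
  by rewrite /cdeg -sum_nat_const; apply: eq_bigr => o _; rewrite ffunE.
apply/ffunP => o; rewrite ffunE; case co: (c o) => [[b i]|] //.
have : (cdeg c < #|O| * 2)%N; last by rewrite cE ltnn.
rewrite -sum_nat_const /cdeg (bigD1 o) //= [X in (_ < X)%N](bigD1 o) //=.
rewrite co -addSn leq_add //; first by case: (b).
by apply: leq_sum => a _; exact: ldeg_le.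
Qed.

Lemma cdeg_eq0 c : (cdeg c == 0%N) = allV c.
Proof.
rewrite /cdeg sum_nat_eq0; apply: eq_forallb => o /=.
by case: (c o) => [[[] i]|].
Qed.

Section Act.
Variables (gT : finGroupType) (lact : gT -> O -> O) (kap : gT -> O -> 'F_p).
Hypotheses (lactM : forall g h a, lact (g * h)%g a = lact g (lact h a))
  (lact1 : forall a, lact 1%g a = a)
  (kapM : forall g h a, kap (g * h)%g a = kap g (lact h a) + kap h a)
  (tinv : forall g a b, t (lact g a) (lact g b) = t a b).

(** A permutation of the factors combined with a rotation of each circle; [kapM] is the cocycle
    condition that makes this a right action. *)
Definition cact c g : cell := [ffun a => sh (kap g a) (c (lact g a))].

Lemma cactM c g h : cact c (g * h)%g = cact (cact c g) h.
Proof.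
apply/ffunP => a; rewrite !ffunE lactM kapM.
by case: (c _) => [[b i]|] //=; rewrite addrA.
Qed.

Lemma kap1 a : kap 1%g a = 0.
Proof.
have := kapM 1%g 1%g a; rewrite mulg1 lact1.
by move/(congr1 (fun z => z - kap 1%g a)); rewrite addrK subrr.
Qed.

Lemma cact1 c : cact c 1%g = c.
Proof.
apply/ffunP => a; rewrite !ffunE lact1 kap1.
by case: (c a) => [[b i]|] //=; rewrite addr0.
Qed.

Lemma lactK g : cancel (lact g) (lact g^-1%g).
Proof. by move=> a; rewrite -lactM mulVg lact1. Qed.

Lemma lactKV g : cancel (lact g^-1%g) (lact g).
Proof. by move=> a; rewrite -lactM mulgV lact1. Qed.

Lemma isE_sh (z : 'F_p) l : isE (sh z l) = isE l. Proof. by case: l => [[[] i]|]. Qed.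
Lemma isV_sh (z : 'F_p) l : isV (sh z l) = isV l. Proof. by case: l => [[[] i]|]. Qed.
Lemma ldeg_sh (z : 'F_p) l : ldeg (sh z l) = ldeg l. Proof. by case: l => [[[] i]|]. Qed.

Lemma sh_bij (z : 'F_p) : bijective (sh z).
Proof.
by exists (sh (- z)) => -[[c i]|] //=; rewrite ?addrK ?subrK.
Qed.

Lemma lact_bij g : bijective (lact g).
Proof. by exists (lact g^-1%g); [exact: lactK | exact: lactKV]. Qed.

Lemma sg_cact o c g : sg o (cact c g) = sg (lact g o) c.
Proof.
rewrite /sg [RHS](reindex (lact g)) /=; last by apply: onW_bij; exact: lact_bij.
apply: eq_big => [a|a _]; last by rewrite tinv.
by rewrite ffunE isE_sh (inj_eq (can_inj (lactK g))).
Qed.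

Lemma cact_upd c g o l : cact (upd c (lact g o) l) g = upd (cact c g) o (sh (kap g o) l).
Proof.
apply/ffunP => a; rewrite !ffunE (inj_eq (can_inj (lactK g))).
by case: eqP => [->|].
Qed.

Lemma delta_cact phi c g : delta phi (cact c g) = delta (fun d => phi (cact d g)) c.
Proof.
rewrite /delta [RHS](reindex (lact g)) /=; last by apply: onW_bij; exact: lact_bij.
apply: eq_bigr => o _; rewrite /op sg_cact; congr (_ * _).
rewrite (reindex (sh (kap g o))) /=; last by apply: onW_bij; exact: sh_bij.
by apply: eq_bigr => l _; rewrite cact_upd ffunE Bm_sh.
Qed.

Lemma allV_cact c g : allV (cact c g) = allV c.
Proof.
apply/forallP/forallP => H o; last by rewrite ffunE isV_sh.
by have := H (lact g^-1%g o); rewrite ffunE isV_sh lactKV.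
Qed.

Lemma cdeg_cact c g : cdeg (cact c g) = cdeg c.
Proof.
rewrite /cdeg [RHS](reindex (lact g)) /=; last by apply: onW_bij; exact: lact_bij.
by apply: eq_bigr => o _; rewrite ffunE ldeg_sh.
Qed.

Lemma cact_top c g : (cact c g == topc) = (c == topc).
Proof. by rewrite -!cdeg_top cdeg_cact. Qed.

End Act.
End Cells.

(** * Vanishing on the stabilisers of cells *)

Section OrbitShapiro.
Variables (k : fieldType) (gT : finGroupType) (X : finType) (act : X -> gT -> X).
Hypotheses (actM : forall c x y, act c (x * y)%g = act (act c x) y)
  (act1 : forall c, act c 1%g = c).

Definition stab_trivial (f : seq gT -> k) c : Prop :=
  exists a : seq gT -> k, forall s,
    (forall x, x \in s -> act c x = c) -> f s = bar_diff a s.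

Lemma orbit_section : exists rep : X -> X, exists wt : X -> gT,
  (forall c, act (rep c) (wt c) = c) /\ (forall c x, rep (act c x) = rep c).
Proof.
pose P c d := [exists g, act d g == c].
have Pc c : P c c by apply/existsP; exists 1%g; rewrite act1.
pose rep c := if [pick d | P c d] is Some d then d else c.
have repP c : P c (rep c).
  by rewrite /rep; case: pickP => [//|/(_ c)]; rewrite Pc.
have rep_act c x : rep (act c x) = rep c.
  rewrite /rep; have -> : [pick d | P (act c x) d] = [pick d | P c d].
    apply: eq_pick => d; apply/existsP/existsP => -[g /eqP gE].
      by exists (g * x^-1)%g; rewrite actM gE -actM mulgV act1.
    by exists (g * x)%g; rewrite actM gE.
  by case: pickP => [//|/(_ c)]; rewrite Pc.
exists rep; pose wt c := odflt 1%g [pick g | act (rep c) g == c].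
exists wt; split=> // c; rewrite /wt; case: pickP => [g /eqP //|/= no].
by have /existsP[g] := repP c; rewrite no.
Qed.

Lemma shapiro (F : seq gT -> X -> k) : pdiff act F = 0 ->
  (forall c, stab_trivial (F^~ c) c) -> exists U, F = pdiff act U.
Proof.
move=> dF stF; have [rep [wt [wtP rep_act]]] := orbit_section.
by apply: (shapiro_rep actM act1 wtP rep_act dF) => c; exact: stF.
Qed.

Lemma shapiro_supp (P : X -> bool) (F : seq gT -> X -> k) :
    (forall c x, P (act c x) = P c) -> pdiff act F = 0 ->
    (forall s c, ~~ P c -> F s c = 0) ->
    (forall c, P c -> stab_trivial (F^~ c) c) ->
  exists U, F = pdiff act U /\ forall s c, ~~ P c -> U s c = 0.
Proof.
move=> Pact dF FP stF.
have [|U UE] := shapiro dF.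
  move=> c; case: (boolP (P c)) => [/stF //|nP]; exists 0 => s _.
  by rewrite FP // diff0.
exists (fun s c => if P c then U s c else 0); split=> [|s c /negPf -> //].
rewrite pdiff_mask // -UE; apply/funext => s; apply/funext => c.
by case: ifP => // /negbT; exact: FP.
Qed.

(** On the words that fix [c] the cochain [F] is a cocycle, so its product with a primitive of [b]
    is, up to sign, a primitive of the product. *)
Lemma stab_cup_trivial (F : seq gT -> X -> k) (b : seq gT -> k) c :
  pdiff act F = 0 -> stab_trivial b c -> stab_trivial (fun s => pcup F b s c) c.
Proof.
move=> dF [a aE]; pose f := F^~ c; exists (cup (bar_sign f) a) => s sc.
rewrite diff_cup; rewrite -[RHS]/(cup (bar_diff (bar_sign f)) a s
  + cup (bar_sign (bar_sign f)) (bar_diff a) s) bar_signK diff_sign.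
have -> : cup (- bar_sign (bar_diff f)) a s = 0.
  rewrite /cup big1 // => i _.
  rewrite -[(- _) _]/(- ((-1) ^+ size (take i s) * bar_diff f (take i s))).
  suff -> : bar_diff f (take i s) = 0 by rewrite mulr0 oppr0 mul0r.
  have : forall x, x \in take i s -> act c x = c by move=> x /mem_take; exact: sc.
  case: (take i s) => [//|y t] tc; rewrite bar_diff_cons.
  have := congr1 (fun G => G (y :: t) c) dF; rewrite /= tc ?inE ?eqxx //.
rewrite add0r /pcup /cup; apply: eq_bigr => i _; rewrite aE // => x /mem_drop; exact: sc.
Qed.

End OrbitShapiro.

(** Data of a monomial representation: circles indexed by [pts], permuted by [lact] and rotated by
    the cocycle [kap]. The invariant tournament [tour] provides the signs that an ordering of [pts]
    would give. *)
Record sphere (k : fieldType) (p : nat) (gT : finGroupType) := Sphere {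
  pts : finType;
  tour : pts -> pts -> k;
  lact : gT -> pts -> pts;
  kap : gT -> pts -> 'F_p;
  tour_sq : forall a b, tour a b * tour a b = 1;
  tour_anti : forall a b, a != b -> tour b a = - tour a b;
  lactM : forall g h a, lact (g * h)%g a = lact g (lact h a);
  lact1 : forall a, lact 1%g a = a;
  kapM : forall g h a, kap (g * h)%g a = kap g (lact h a) + kap h a;
  tour_inv : forall g a b, tour (lact g a) (lact g b) = tour a b
}.

Lemma subrDK (V : zmodType) (x y z : V) : x - (y + z) + z = x - y.
Proof. by rewrite opprD addrA subrK. Qed.

(** * The double complex of a sphere and its Euler class *)

Section Total.
Variables (k : fieldType) (p : nat) (gT : finGroupType) (S : sphere k p gT).
Local Notation cell := (cell p (pts S)).
Local Notation act := (cact (@lact _ _ _ S) (@kap _ _ _ S)).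
Local Notation delta := (delta (@tour _ _ _ S)).
Local Notation contraction := (contraction (@tour _ _ _ S)).
Implicit Types (F v w : seq gT -> cell -> k) (a b : seq gT -> k) (c : cell) (s : seq gT).

Definition sact := act.

Lemma sactM c x y : act c (x * y)%g = act (act c x) y.
Proof. by apply: cactM; [exact: lactM | exact: kapM]. Qed.

Lemma sact1 c : act c 1%g = c.
Proof. by apply: cact1; [exact: lact1 | exact: kapM]. Qed.

Lemma cdeg_act c x : cdeg (act c x) = cdeg c.
Proof. by apply: cdeg_cact; [exact: lactM | exact: lact1]. Qed.

Lemma allV_act c x : allV (act c x) = allV c.
Proof. by apply: allV_cact; [exact: lactM | exact: lact1]. Qed.

Lemma top_act c x : (act c x == topc p (pts S)) = (c == topc p (pts S)).
Proof. by apply: cact_top; [exact: lactM | exact: lact1]. Qed.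

Lemma delta_act phi c x : delta phi (act c x) = delta (fun d => phi (act d x)) c.
Proof. by apply: delta_cact; [exact: lactM | exact: lact1 | exact: tour_inv]. Qed.

Lemma sdelta_delta phi c : delta (delta phi) c = 0.
Proof. by apply: delta_delta; [exact: tour_sq | exact: tour_anti]. Qed.

Lemma scontractionP phi c :
  delta (contraction phi) c + contraction (delta phi) c = phi c - aug (phi (base p (pts S))) c.
Proof. by apply: contractionP; [exact: tour_sq | exact: tour_anti]. Qed.

Lemma delta_supp m phi c : (forall d, cdeg d = m -> phi d = 0) -> cdeg c = m.+1 ->
  delta phi c = 0.
Proof.
move=> phi0 cm; rewrite /delta big1 // => o _; rewrite /op big1 ?mulr0 // => l _.
case: (eqVneq (Bm k (c o) l) 0) => [->|Bl]; first by rewrite mul0r.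
rewrite phi0 ?mulr0 //; have := cdeg_upd c o l; rewrite cm.
have -> : ldeg (c o) = (ldeg l).+1.
  by move: Bl; case: (c o) l => [[[] i]|] [[[] j]|] //=; rewrite eqxx.
by rewrite addnS addSn => -[/addIn].
Qed.

Lemma delta_supp0 phi c : cdeg c = 0%N -> delta phi c = 0.
Proof.
move/eqP; rewrite cdeg_eq0 => /forallP cV; rewrite /delta big1 // => o _.
rewrite /op big1 ?mulr0 // => l _; have := cV o.
by case: (c o) => [[[] i]|] //= _; rewrite mul0r.
Qed.

Lemma delta_weight phi c : delta (fun d => (-1) ^+ cdeg d * phi d) c
  = - ((-1) ^+ cdeg c * delta phi c).
Proof.
case cm : (cdeg c) => [|m]; first by rewrite !delta_supp0 // mulr0 oppr0.
rewrite exprS mulN1r mulNr opprK -deltaZ.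
apply/eqP; rewrite -subr_eq0 -deltaN -deltaD; apply/eqP; apply: (delta_supp (m := m)) => // d dm.
by rewrite dm subrr.
Qed.

(** The sign makes the group differential anticommute with the cellular differential [sd], so that
    [D] squares to zero. *)
Definition pd F s c : k := (-1) ^+ cdeg c * pdiff act F s c.
Definition sd F s c : k := delta (F s) c.
Definition D F s c : k := pd F s c + sd F s c.
Definition K F s c : k := contraction (F s) c.
Definition augc a s : cell -> k := aug (a s).

Lemma DE F s c : D F s c = (-1) ^+ cdeg c * pdiff act F s c + delta (F s) c.
Proof. by []. Qed.

Lemma D_add F v : D (F + v) = D F + D v.
Proof.
apply/funext => s; apply/funext => c.
rewrite -[RHS]/(D F s c + D v s c) !DE pdiffD.
rewrite -[(pdiff act F + _) s c]/(pdiff act F s c + pdiff act v s c).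
rewrite -[(F + v) s]/(fun d => F s d + v s d) deltaD; ring.
Qed.

Lemma D_opp F : D (- F) = - D F.
Proof.
apply/funext => s; apply/funext => c.
rewrite -[RHS]/(- D F s c) !DE pdiffN.
rewrite -[(- pdiff act F) s c]/(- pdiff act F s c).
rewrite -[(- F) s]/(fun d => - F s d) deltaN; ring.
Qed.

Lemma D_sub F v : D (F - v) = D F - D v.
Proof. by rewrite D_add D_opp. Qed.

Lemma D0 : D 0 = 0.
Proof. by apply: (addIr (D 0)); rewrite -D_add !add0r. Qed.

Lemma pd_sd F s c : pd (sd F) s c = - sd (pd F) s c.
Proof.
rewrite /pd /sd delta_weight opprK; congr (_ * _).
case: s => [|x s] /=; first by rewrite /delta big1 // => o _; rewrite /op big1 ?mulr0 // => l _; rewrite mulr0.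
rewrite deltaD delta_act; congr (_ + _).
rewrite /inner /sd; rewrite delta_sum; apply: eq_bigr => i _.
by rewrite deltaZ.
Qed.

Lemma pd_pd F s c : pd (pd F) s c = 0.
Proof.
rewrite /pd; have -> : pdiff act (fun s c => (-1) ^+ cdeg c * pdiff act F s c) s c
   = (-1) ^+ cdeg c * pdiff act (pdiff act F) s c.
  case: s => [|x s]; first by rewrite /= mulr0.
  rewrite [LHS]/= cdeg_act inner_scale -mulrDr; congr (_ * _).
by rewrite (pdiff_pdiff sactM) !mulr0.
Qed.

Lemma pdD F v s c : pd (fun s c => F s c + v s c) s c = pd F s c + pd v s c.
Proof.
have := congr1 (fun G => G s c) (pdiffD act F v); rewrite /pd => ->.
exact: mulrDr.
Qed.

Lemma DD F : D (D F) = 0.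
Proof.
apply/funext => s; apply/funext => c.
rewrite -[LHS]/(pd (fun s c => pd F s c + sd F s c) s c + sd (fun s c => pd F s c + sd F s c) s c).
rewrite pdD pd_pd add0r pd_sd /sd deltaD.
by rewrite sdelta_delta addr0 addNr.
Qed.

Lemma D_augc a : D (augc a) = augc (bar_diff a).
Proof.
apply/funext => s; apply/funext => c; rewrite DE delta_aug addr0.
case: (boolP (allV c)) => cV; last first.
  rewrite /augc /aug (negPf cV).
  case: s => [|x s] /=; first by rewrite mulr0.
  rewrite allV_act (negPf cV) /inner big1 ?addr0 ?mulr0 // => i _.
  by rewrite mulr0.
have := cV; rewrite -cdeg_eq0 => /eqP ->; rewrite mul1r /augc /aug cV.
case: s => [|x s] //; rewrite bar_diff_cons /= allV_act cV; congr (_ + _).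
Qed.

Lemma augc_inj a : augc a = 0 -> a = 0.
Proof.
move=> a0; apply/funext => s; have := congr1 (fun G => G s (base p (pts S))) a0.
rewrite /augc /aug; have -> : allV (base p (pts S)) by apply/forallP => o; rewrite ffunE.
by [].
Qed.

Lemma augcB a b : augc (a - b) = augc a - augc b.
Proof.
apply/funext => s; apply/funext => c; rewrite -[RHS]/(aug _ _ - aug _ _) /augc /aug.
by case: ifP; rewrite ?subrr.
Qed.

Lemma pcup_augc a b : pcup (augc a) b = augc (cup a b).
Proof.
apply/funext => s; apply/funext => c; rewrite /augc /pcup /aug /cup.
by case: (allV c) => //; rewrite big1 // => i _; rewrite mul0r.
Qed.

Lemma D_pcup F b : bar_diff b = 0 -> D (pcup F b) = pcup (D F) b.
Proof.
move=> db; apply/funext => s; apply/funext => c.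
rewrite DE pdiff_cup db.
have -> : pcup (psign F) 0 = 0.
  by apply/funext => u; apply/funext => d; rewrite /pcup cup0r.
rewrite addr0 /pcup /cup delta_sum mulr_sumr -big_split /=; apply: eq_bigr => i _.
rewrite DE mulrDl mulrA; congr (_ + _).
rewrite mulrC -deltaZ; apply: delta_ext => d; exact: mulrC.
Qed.

(* The contraction is not equivariant; the error N lowers the cell degree. *)
Lemma aug_exact F a : D F = augc a ->
  exists a' F', F = augc a' + D F'.
Proof.
have E G : exists m, forall s c, (m <= cdeg c)%N -> G s c = 0 :> k.
  exists (#|pts S| * 2).+1 => s c; rewrite ltnNge cdeg_le //.
have [m Fm] := E F; elim: m F a Fm => [|m IHm] F a Fm DF.
  exists 0, 0; rewrite D0 addr0; apply/funext => s; apply/funext => c.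
  by rewrite Fm // /augc /aug; case: ifP.
pose e s := F s (base p (pts S)).
pose N : seq gT -> cell -> k := fun s c => pd (K F) s c + K (pd F) s c.
have FE : F = augc e + D (K F) - N.
  apply/funext => s; apply/funext => c.
  rewrite -[RHS]/(aug (e s) c + (pd (K F) s c + sd (K F) s c) - (pd (K F) s c + K (pd F) s c)).
  have H : sd (K F) s c + contraction (delta (F s)) c = F s c - aug (e s) c by exact: scontractionP.
  have KD : K (pd F) s c + contraction (delta (F s)) c = 0.
    rewrite -contractionD -[RHS](contraction_aug (@tour _ _ _ S) (a s) c).
    by rewrite -[aug (a s)](congr1 (fun G => G s) DF).
  have -> : F s c = sd (K F) s c + contraction (delta (F s)) c + aug (e s) c by rewrite H subrK.
  by move/eqP: KD; rewrite addrC addr_eq0 => /eqP ->; ring.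
have NE : N = augc e + D (K F) - F.
  apply/funext => s; apply/funext => c; have H := congr1 (fun G => G s c) FE.
  rewrite -[RHS]/(augc e s c + D (K F) s c - F s c) H.
  rewrite -[(_ - N) s c]/(augc e s c + D (K F) s c - N s c); ring.
have [s c mc||a' [F' NF']] := IHm N (bar_diff e - a).
- have K0 G t d : (forall s c, (m < cdeg c)%N -> G s c = 0) -> (m <= cdeg d)%N -> K G t d = 0.
    move=> G0 md; rewrite /K; apply: (contraction_supp _ _ (erefl (cdeg d))) => d' d'E.
    by apply: G0; rewrite d'E.
  rewrite /N /pd K0 ?addr0 //; last first.
    move=> t d md; suff -> : pdiff act F t d = 0 by rewrite mulr0.
    case: t => [|x t] //=; rewrite Fm ?cdeg_act // add0r /inner big1 // => i _.
    by rewrite Fm ?mulr0.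
  suff -> : pdiff act (K F) s c = 0 by rewrite mulr0.
  case: s => [|x s] //=; rewrite K0 ?cdeg_act // add0r /inner big1 // => i _.
  by rewrite K0 ?mulr0.
- rewrite NE D_sub D_add DD addr0 D_augc DF.
  by apply/funext => s; apply/funext => c; rewrite /augc /aug -[LHS]/(_ - _) /augc /aug; case: ifP; rewrite ?subrr.
exists (e - a'), (K F - F'); rewrite D_sub {1}FE NF'.
have -> : augc (e - a') = augc e - augc a'.
  by apply/funext => s; apply/funext => c; rewrite -[RHS]/(aug _ _ - aug _ _) /augc /aug; case: ifP; rewrite ?subrr.
by rewrite opprD addrACA.
Qed.

Definition tpart n F s c : k := if (size s + cdeg c == n)%N then F s c else 0.

Lemma tpart_D n F : D (tpart n F) = tpart n.+1 (D F).
Proof.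
apply/funext => s; apply/funext => c; rewrite /tpart !DE.
have E1 : pdiff act (tpart n F) s c = if (size s + cdeg c == n.+1)%N then pdiff act F s c else 0.
  case: s => [|x s]; first by case: ifP.
  rewrite /= addSn eqSS /tpart cdeg_act; case: eqP => [E|nE].
    congr (_ + _); apply: inner_cong => u /= ->.
    by rewrite E eqxx.
  rewrite add0r /inner big1 // => i _; rewrite size_face_eq; last exact: ltn_ord.
  by move/eqP/negPf: nE => ->; rewrite mulr0.
have E2 : delta (tpart n F s) c = if (size s + cdeg c == n.+1)%N then delta (F s) c else 0.
  case cm : (cdeg c) => [|m]; first by rewrite !delta_supp0 //; case: ifP.
  rewrite addnS eqSS; case: eqP => [E|nE].
    apply/eqP; rewrite -subr_eq0 -deltaN -deltaD; apply/eqP; apply: (delta_supp (m := m)) => // d dm.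
    by rewrite /tpart dm E eqxx subrr.
  apply: (delta_supp (m := m)) => // d dm; rewrite /tpart dm.
  by case: eqP.
by rewrite -/(tpart n F) E1 E2; case: ifP; rewrite ?mulr0 ?addr0.
Qed.

Lemma tpart0_D F : tpart 0 (D F) = 0.
Proof.
apply/funext => s; apply/funext => c; rewrite /tpart addn_eq0.
case: s => [|x s] //=; case: eqP => // c0.
by rewrite DE /= mulr0 add0r delta_supp0.
Qed.

Definition onetop s c : k := if c == topc p (pts S) then @cup1 k gT s else 0.

Lemma D_onetop : D onetop = 0.
Proof.
apply/funext => s; apply/funext => c; rewrite DE.
have -> : delta (onetop s) c = 0 by exact: delta_top.
rewrite addr0; suff -> : pdiff act onetop s c = 0 by rewrite mulr0.
case: s => [|x s] //; rewrite /= /onetop top_act.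
case: eqP => _; last by rewrite add0r /inner big1 // => i _; rewrite mulr0.
by have := congr1 (fun f => f (x :: s)) (@diff1 k gT); rewrite bar_diff_cons.
Qed.

Local Notation top_degree := (#|pts S| * 2)%N.

(** [aug_exact] makes the augmentation a quasi-isomorphism; so the top cell, a cocycle of total
    degree [top_degree], is cohomologous to a class of the group, which is unique. *)
Definition is_euler (th : seq gT -> k) : Prop :=
  [/\ cocyc th, part top_degree th = th & exists w, onetop = augc th + D w].

Lemma euler_exists : exists th, is_euler th.
Proof.
have [|th [w E]] := @aug_exact onetop 0.
  by rewrite D_onetop; apply/funext => s; apply/funext => c; rewrite /augc /aug; case: ifP.
have dth : bar_diff th = 0.
  apply: augc_inj; rewrite -D_augc.
  have := congr1 D E; rewrite D_onetop D_add DD addr0 => <-.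
  by [].
have [_ pz pd'] := part_chain k gT top_degree.
exists (part top_degree th); split.
- split; last by rewrite part_diff dth; apply/funext => s; rewrite /part; case: ifP.
  by exists top_degree.+1 => s lt_s; rewrite /part gtn_eqF.
- by rewrite part_part eqxx.
have E1 : tpart top_degree onetop = onetop.
  apply/funext => s; apply/funext => c; rewrite /tpart /onetop -cdeg_top /cup1.
  case: (eqVneq (cdeg c) top_degree) => [->|]; last by case: ifP.
  by case: s => [|x s]; rewrite ?add0n ?eqxx //=; case: ifP.
have E2 : tpart top_degree (augc th) = augc (part top_degree th).
  apply/funext => s; apply/funext => c; rewrite /tpart /augc /aug /part.
  case: (boolP (allV c)) => [|_]; last by case: ifP.
  by rewrite -cdeg_eq0 => /eqP ->; rewrite addn0.
have tD F v n : tpart n (F + v) = tpart n F + tpart n v.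
  apply/funext => s; apply/funext => c; rewrite -[RHS]/(tpart n F s c + tpart n v s c) /tpart.
  by case: ifP => // _; rewrite addr0.
case nE : top_degree => [|n].
  by exists 0; rewrite D0 addr0 -nE -E2 -E1 {1}E tD nE tpart0_D addr0.
by exists (tpart n w); rewrite tpart_D -nE -E2 -E1 {1}E tD.
Qed.

Lemma euler_unique th th' : is_euler th -> is_euler th' -> cl th = cl th'.
Proof.
move=> [tz _ [w wE]] [tz' _ [w' wE']].
have : D (w' - w) = augc (th - th').
  rewrite D_sub; have : augc th + D w = augc th' + D w' by rewrite -wE.
  have -> : augc (th - th') = augc th - augc th'.
    by apply/funext => s; apply/funext => c; rewrite -[RHS]/(aug _ _ - aug _ _) /augc /aug; case: ifP; rewrite ?subrr.
  move/eqP; rewrite addrC -subr_eq => /eqP E.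
  move: (augc th) (augc th') (D w) (D w') E => A A' W W' <-.
  by rewrite opprB opprD addrCA [A + _]addrCA subrr addr0.
move=> E; have [a [F FE]] := aug_exact E.
apply: (@cl_eq _ _ _ _ a) => // s.
have : augc (th - th' - bar_diff a) = 0.
  have := congr1 (fun G => D G) FE; rewrite E [RHS]D_add DD addr0 D_augc => H.
  apply/funext => u; apply/funext => c; have := congr1 (fun G => G u c) H.
  rewrite /augc /aug; case: ifP => // _ H'.
  by rewrite -[LHS]/((th - th') u - bar_diff a u) H' subrr.
by move/augc_inj/(congr1 (fun f => f s)) => /eqP; rewrite subr_eq0 => /eqP.
Qed.

(** Evaluating the defining identity at the invariant vertex kills the top cell and the cellular
    differential, and displays [th] as a coboundary. The point [o] ensures that a vertex is not the
    top cell. *)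
Lemma euler_vertex th c (o : pts S) :
  allV c -> (forall x, act c x = c) -> is_euler th -> cl th = 0.
Proof.
move=> cV cfix [tz _ [w wE]]; apply/cl_eq0P => //.
exists (- w^~ c); apply/funext => s.
have E : onetop s c = aug (th s) c + D w s c := congr1 (fun G => G s c) wE.
have c0 : cdeg c = 0%N by apply/eqP; rewrite cdeg_eq0.
move: E; rewrite DE /aug cV delta_supp0 // c0 mul1r addr0.
have -> : onetop s c = 0.
  rewrite /onetop; case: eqP => // cT.
  by have /forallP/(_ o) := cV; rewrite cT ffunE.
move/eqP; rewrite eq_sym addr_eq0 => /eqP ->.
rewrite diffN -[RHS]/(- bar_diff (w^~ c) s); congr (- _).
by case: s => [|x s] //; rewrite bar_diff_cons /= cfix.
Qed.

(** A cochain supported on the top cell is [onetop] times its value [e] there, and [onetop] may be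
    replaced by [th]: this is the exactness of the Gysin sequence. *)
Lemma gysin th a v : is_euler th -> cocyc a ->
    (forall s c, c != topc p (pts S) -> (augc a - D v) s c = 0) ->
  exists2 e, cocyc e & cl a = cl th * cl e.
Proof.
move=> [tz thn [w wE]] az supp; pose e s := (augc a - D v) s (topc p (pts S)).
have [[M aM] da] := az.
have E : augc a - D v = pcup onetop e.
  apply/funext => s; apply/funext => c; rewrite /pcup.
  case: (eqVneq c (topc p (pts S))) => [->|nc]; last first.
    by rewrite supp // /cup big1 // => i _; rewrite /onetop (negPf nc) mul0r.
  rewrite -[LHS]/(e s) -{1}(cup1f e); congr (cup _ _ _).
  by apply/funext => u; rewrite /onetop eqxx.
have de : bar_diff e = 0.
  have : D (pcup onetop e) = 0 by rewrite -E D_sub DD subr0 D_augc da; apply/funext => s; apply/funext => c; rewrite /augc /aug; case: ifP.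
  move/(congr1 (fun G s => G s (topc p (pts S)))) => H; apply/funext => s.
  have := congr1 (fun f => f s) H; rewrite DE.
  have -> : delta (pcup onetop e s) (topc p (pts S)) = 0.
    rewrite -(delta_top (@tour _ _ _ S) (e s) (topc p (pts S))); apply: delta_ext => c.
    rewrite /pcup; case: (eqVneq c (topc p (pts S))) => [->|nc]; last first.
      by rewrite /cup big1 // => i _; rewrite /onetop (negPf nc) mul0r.
    rewrite -{2}(cup1f e); congr (cup _ _ _).
    by apply/funext => u'; rewrite /onetop eqxx.
  rewrite addr0 => /eqP; rewrite mulf_eq0 signr_eq0 /= => /eqP Hd.
  transitivity (pdiff act (pcup onetop e) s (topc p (pts S))); last exact: Hd.
  case: s {H Hd} => [|x s] //; rewrite bar_diff_cons /=.
  have /eqP -> : act (topc p (pts S)) x == topc p (pts S) by rewrite top_act.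
  have fE u : pcup onetop e u (topc p (pts S)) = e u.
    rewrite /pcup -{2}(cup1f e); congr (cup _ _ _).
    by apply/funext => u'; rewrite /onetop eqxx.
  by rewrite fE; congr (_ + _); apply: inner_cong => u _; rewrite fE.
have Eth : pcup onetop e = augc (cup th e) + D (pcup w e).
  by rewrite D_pcup // -pcup_augc wE; apply/funext => s; apply/funext => c; rewrite /pcup cupDl.
have [a' [F FE]] : exists a' F, v + pcup w e = augc a' + D F.
  apply: (@aug_exact _ (a - cup th e)); rewrite D_add.
  have -> : D v = augc a - pcup onetop e by rewrite -E opprB addrCA subrr addr0.
  by rewrite Eth subrDK augcB.
have ae s : a s - cup th e s = bar_diff a' s.
  have H : D (v + pcup w e) = augc (bar_diff a') by rewrite FE D_add DD addr0 D_augc.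
  have : augc (a - cup th e - bar_diff a') = 0.
    apply/funext => u; apply/funext => c.
    have := congr1 (fun G => G u c) H; rewrite D_add.
    have -> : D v = augc a - pcup onetop e by rewrite -E opprB addrCA subrr addr0.
    rewrite Eth subrDK -[(augc a - _) u c]/(aug _ _ - aug _ _) /augc /aug.
    case: ifP => // _ H'.
    by rewrite -[LHS]/(a u - cup th e u - bar_diff a' u) H' subrr.
  by move/augc_inj/(congr1 (fun f => f s)) => /eqP; rewrite subr_eq0 => /eqP.
have ez : cocyc (dtrunc M e).
  split; first exact: findeg_dtrunc.
  by rewrite dtrunc_diff de; apply/funext => s; rewrite /dtrunc; case: ifP.
exists (dtrunc M e) => //; rewrite -clM //.
(* [e] is cut off at the degree bound [M] of [a], so the identity is cut off at [M + top_degree];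
   the predecessor appears because the differential raises the degree by one. *)
apply: (@cl_eq _ _ _ _ (dtrunc (M + top_degree).-1 a')); [exact: az | exact: cocycM |] => s.
rewrite dtrunc_diff /dtrunc -ae.
have cE : cup th (dtrunc M e) s = if (size s < M + top_degree)%N then cup th e s else 0.
  rewrite -thn /part /cup; case: ifP => sM; [apply: eq_bigr|rewrite big1 //] => i _.
    have le_i : (i <= size s)%N by rewrite -ltnS.
    rewrite size_takel //; case: eqP => [iE|]; last by rewrite !mul0r.
    congr (_ * _); rewrite /dtrunc size_drop iE ltn_subLR ?sM //; last by rewrite -iE.
    by rewrite addnC sM.
  have le_i : (i <= size s)%N by rewrite -ltnS.
  rewrite size_takel //; case: eqP => [iE|]; last by rewrite !mul0r.
  rewrite /dtrunc size_drop iE ltn_subLR; last by rewrite -iE.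
  by rewrite addnC sM mulr0.
rewrite cE; case: (posnP (M + top_degree)%N) => [M0|M0].
  move: M0 => /eqP; rewrite addn_eq0 => /andP[/eqP M0 /eqP t0].
  rewrite M0 t0 addn0 /= aM ?M0 // sub0r oppr0.
  case: ltnP => // s1; rewrite -[X in X - _](aM s) ?M0 // ae; by case: (s) s1.
rewrite prednK //; case: ifP => // /negbT; rewrite -leqNgt => sM.
by rewrite aM ?subrr //; apply: leq_trans sM; rewrite leq_addr.
Qed.

(** Each factor raises by one the least cell degree in which the representative lives: it vanishes
    on the stabilisers of the cells of the current degree, so Shapiro's lemma removes that layer.
    After [top_degree] factors only the top cell is left, and [gysin] applies. *)
Lemma euler_prod th (bs : seq (seq gT -> k)) : is_euler th -> size bs = top_degree ->
    (forall i, (i < size bs)%N -> cocyc (nth 0 bs i)) ->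
    (forall i c, (i < size bs)%N -> c != topc p (pts S) -> stab_trivial act (nth 0 bs i) c) ->
  exists2 e, cocyc e & \prod_(b <- bs) cl b = cl th * cl e.
Proof.
move=> thE szb bz bst.
have H m : (m <= size bs)%N -> exists a v,
   [/\ cocyc a, cl a = \prod_(b <- take m bs) cl b &
       forall s c, (cdeg c < m)%N -> (augc a - D v) s c = 0].
  elim: m => [|m IHm] lt_m.
    by exists (@cup1 k gT), 0; split; [exact: cocyc1 | rewrite take0 big_nil cl1 |].
  have [a [v [az aE vE]]] := IHm (ltnW lt_m).
  pose b := nth 0 bs m; have bzm : cocyc b by exact: bz.
  have [_ db] := bzm; have [_ da] := az.
  pose f := augc a - D v.
  have Df : D f = 0 by rewrite D_sub DD subr0 D_augc da; apply/funext => s; apply/funext => c; rewrite /augc /aug; case: ifP.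
  pose fm s c := if cdeg c == m then f s c else 0.
  have dfm : pdiff act fm = 0.
    rewrite /fm pdiff_mask => [|c x]; last by rewrite cdeg_act.
    apply/funext => s; apply/funext => c; case: eqP => // cm.
    have := congr1 (fun G => G s c) Df; rewrite DE.
    have -> : delta (f s) c = 0.
      case cm' : (cdeg c) => [|m']; first exact: delta_supp0.
      by apply: (delta_supp (m := m')) => // d dm; apply: vE; rewrite dm -cm cm'.
    by rewrite addr0 => /eqP; rewrite mulf_eq0 signr_eq0 => /eqP.
  have [U [UE U0]] : exists U, pcup fm b = pdiff act U /\ forall s c, cdeg c != m -> U s c = 0.
    apply: (shapiro_supp sactM sact1 (P := fun c => cdeg c == m)) => [c x||s c nc|c /eqP cm].
    - by rewrite cdeg_act.
    - rewrite pdiff_cup dfm db; apply/funext => s; apply/funext => c.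
      by rewrite -[LHS]/(cup 0 b s + cup _ 0 s) cup0l cup0r addr0.
    - by rewrite /pcup /cup big1 // => i _; rewrite /fm (negPf nc) mul0r.
    by apply: stab_cup_trivial => //; apply: bst => //; rewrite -cdeg_top cm -szb ltn_eqF.
  exists (cup a b), (pcup v b + (fun s c => (-1) ^+ m * U s c)); split.
  - exact: cocycM.
  - by rewrite clM // aE (take_nth 0 lt_m) -cats1 big_cat big_seq1.
  move=> s c; rewrite ltnS leq_eqVlt => cm.
  rewrite D_add D_pcup // -pcup_augc.
  rewrite -[LHS]/(pcup (augc a) b s c - (pcup (D v) b s c + D (fun s c => (-1) ^+ m * U s c) s c)).
  have -> : pcup (augc a) b s c = pcup f b s c + pcup (D v) b s c.
    rewrite /pcup -[RHS]/((cup (f^~ c) b + cup ((D v)^~ c) b) s) -cupDl; congr (cup _ _ _).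
    by apply/funext => u; rewrite -[RHS]/(augc a u c - D v u c + D v u c) subrK.
  rewrite opprD addrA addrK DE.
  have -> : delta (fun c => (-1) ^+ m * U s c) c = 0.
    rewrite deltaZ; case cm' : (cdeg c) => [|m']; first by rewrite delta_supp0 ?mulr0.
    rewrite (delta_supp (m := m')) ?mulr0 // => d dm; apply: U0; rewrite dm.
    by apply/eqP => mE; move: cm; rewrite cm' mE ltnNge leqnSn orbF => /eqP/esym/n_Sn.
  have -> : pdiff act (fun s c => (-1) ^+ m * U s c) s c = (-1) ^+ m * pdiff act U s c.
    case: s => [|x s] /=; first by rewrite mulr0.
    by rewrite inner_scale mulrDr.
  rewrite addr0 -UE; case/orP: cm => [/eqP cm|cm].
    rewrite cm mulrA -exprMn mulrNN mulr1 expr1n mul1r.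
    have -> : pcup fm b s c = pcup f b s c; last by rewrite subrr.
    by rewrite /pcup; congr (cup _ _ _); apply/funext => u; rewrite /fm cm eqxx.
  have -> : pcup f b s c = 0.
    by rewrite /pcup /cup big1 // => i _; rewrite [f _ _]vE ?mul0r.
  have -> : pcup fm b s c = 0.
    by rewrite /pcup /cup big1 // => i _; rewrite /fm ltn_eqF ?mul0r.
  by rewrite !mulr0 subrr.
have [a [v [az aE vE]]] := H _ (leqnn _).
have [|e ez eE] := @gysin th a v thE az.
  move=> s c nc; apply: vE; rewrite szb ltn_neqAle cdeg_top nc; exact: cdeg_le.
by exists e => //; rewrite -eE aE take_size.
Qed.

End Total.

(** * Naturality of Euler classes *)

Section PullSphere.
Variables (k : fieldType) (p : nat) (aT gT : finGroupType) (phi : aT -> gT).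
Hypothesis phiM : {morph phi : x y / (x * y)%g}.
Variable S : sphere k p gT.

Lemma phi1 : phi 1%g = 1%g.
Proof. by apply: (mulgI (phi 1%g)); rewrite -phiM !mulg1. Qed.

Program Definition spull : sphere k p aT := @Sphere k p aT (pts S) (@tour _ _ _ S)
  (fun g => lact (phi g)) (fun g => kap (phi g)) _ _ _ _ _ _.
Next Obligation. exact: tour_sq. Qed.
Next Obligation. by move=> *; exact: tour_anti. Qed.
Next Obligation. by move=> *; rewrite phiM lactM. Qed.
Next Obligation. by move=> *; rewrite phi1 lact1. Qed.
Next Obligation. by move=> *; rewrite phiM kapM. Qed.
Next Obligation. by move=> *; exact: tour_inv. Qed.

Lemma euler_pull th : is_euler S th -> is_euler spull (pull phi th).
Proof.
move=> [tz tn [w wE]]; split; first exact: cocyc_pull.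
  by apply/funext => s; rewrite -{2}tn /part /pull size_map.
exists (fun s c => w (map phi s) c); apply/funext => s; apply/funext => c.
have E : onetop (S := S) (map phi s) c = aug (th (map phi s)) c + D w (map phi s) c.
  exact: (congr1 (fun G => G (map phi s) c) wE).
transitivity (onetop (S := S) (map phi s) c); first by rewrite /onetop /cup1; case: (s).
rewrite E; congr (_ + _); rewrite /D; congr (_ + _); rewrite /pd; congr (_ * _).
case: s {E} => [|x s] //=; congr (_ + _).
rewrite /inner -[size (phi x :: _)]/(size (map phi s)).+1 size_map; apply: eq_bigr => i _.
by rewrite -(map_face phiM i.+1 (x :: s)).
Qed.

End PullSphere.

Section EulerClass.
Variables (k : fieldType) (p : nat).

Definition eclass (gT : finGroupType) (S : sphere k p gT) : cohomology k gT :=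
  cl (projT1 (cid (euler_exists S))).

Lemma eclassP (gT : finGroupType) (S : sphere k p gT) : exists2 th, is_euler S th & eclass S = cl th.
Proof. by rewrite /eclass; case: cid => th /= thE; exists th. Qed.

Lemma eclassE (gT : finGroupType) (S : sphere k p gT) th : is_euler S th -> eclass S = cl th.
Proof. by move=> thE; have [th' thE' ->] := eclassP S; exact: euler_unique thE' thE. Qed.

Lemma eclass_homog (gT : finGroupType) (S : sphere k p gT) : homog (#|pts S| * 2) (eclass S).
Proof. by have [th [tz tn _] ->] := eclassP S; exact: homog_cl. Qed.

Lemma eclass_even (gT : finGroupType) (S : sphere k p gT) : hsign (eclass S) = eclass S.
Proof. by rewrite (homog_sign (eclass_homog S)) mulnC exprM sqrrN expr1n expr1n scal1 mul1r. Qed.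

Lemma eclass_pull (aT gT : finGroupType) (phi : aT -> gT) (phiM : {morph phi : x y / (x * y)%g})
  (S : sphere k p gT) : cohomology_pull phiM (eclass S) = eclass (spull phiM S).
Proof.
have [th thE ->] := eclassP S; have [tz _ _] := thE.
by rewrite pull_cl //; apply/esym/eclassE; exact: euler_pull.
Qed.

Lemma eclass_ext (gT : finGroupType) (O : finType) (t : O -> O -> k)
    (la la' : gT -> O -> O) (ka ka' : gT -> O -> 'F_p) sq sq' an an' lM lM' l1 l1' kM kM' ti ti' :
  (forall g a, la g a = la' g a) -> (forall g a, ka g a = ka' g a) ->
  eclass (@Sphere k p gT O t la ka sq an lM l1 kM ti)
    = eclass (@Sphere k p gT O t la' ka' sq' an' lM' l1' kM' ti').
Proof.
move=> lE kE; have lE' : la = la' by apply/funext => g; apply/funext => a.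
have kE' : ka = ka' by apply/funext => g; apply/funext => a.
subst la' ka'; have [th [tz tn [w wE]] ->] := eclassP (Sphere sq' an' lM' l1' kM' ti').
by apply: eclassE; split=> //; exists w.
Qed.

Lemma eclass_vertex (gT : finGroupType) (S : sphere k p gT) (c : cell p (pts S)) (o : pts S) :
  allV c -> (forall x, sact c x = c) -> eclass S = 0.
Proof.
by move=> cV cf; have [th thE ->] := eclassP S; exact: euler_vertex o cV cf thE.
Qed.

Definition res (gT : finGroupType) (J : {group gT}) :
    {rmorphism cohomology k gT -> cohomology k (subg_of J)} :=
  cohomology_pull (phi := @sgval gT J) (fun _ _ => erefl).

Lemma face_subg (gT : finGroupType) (J : {group gT}) i (s : seq gT) :
  (forall x, x \in s -> x \in J) -> face i (map (subg J) s) = map (subg J) (face i s).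
Proof.
elim: s i => [|y s IHs] [|[|i]] //= sJ.
  case: s {IHs} sJ => //= z s sJ; congr (_ :: _); apply: val_inj.
  by rewrite /= !subgK ?groupM //; apply: sJ; rewrite !inE eqxx ?orbT.
by congr (_ :: _); apply: (IHs i.+1) => z zs; apply: sJ; rewrite inE zs orbT.
Qed.

Lemma res_word_trivial gT (J : {group gT}) (b : seq gT -> k) :
    cocyc b -> res J (cl b) = 0 ->
  exists a, forall s, (forall x, x \in s -> x \in J) -> b s = bar_diff a s.
Proof.
move=> bz; rewrite [res J _]pull_cl // => /cl_eq0P[|h hE]; first exact: cocyc_pull.
exists (fun s => h (map (subg J) s)) => s sJ.
have mapK u : (forall x, x \in u -> x \in J) -> map sgval (map (subg J) u) = u.
  move=> uJ; rewrite -map_comp -[RHS]map_id; apply/eq_in_map => x /uJ xJ /=.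
  exact: subgK.
have := congr1 (fun f => f (map (subg J) s)) hE; rewrite /pull mapK // => ->.
case: s sJ => [|x s] sJ //; rewrite /bar_diff /= size_map.
apply: eq_bigr => i _; congr (_ * h _).
by rewrite -(face_subg i (s := x :: s)).
Qed.

Definition cstab (gT : finGroupType) (S : sphere k p gT) (c : cell p (pts S)) : {set gT} :=
  [set x | sact c x == c].

Lemma cstab_group (gT : finGroupType) (S : sphere k p gT) (c : cell p (pts S)) : group_set (cstab c).
Proof.
apply/group_setP; split=> [|x y]; first by rewrite inE /sact sact1.
by rewrite !inE /sact => /eqP cx /eqP cy; rewrite sactM cx cy.
Qed.

Definition cstabG (gT : finGroupType) (S : sphere k p gT) (c : cell p (pts S)) : {group gT} := Group (cstab_group c).

Lemma eclass_prod (gT : finGroupType) (S : sphere k p gT) (bs : seq (cohomology k gT)) :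
    size bs = (#|pts S| * 2)%N ->
    (forall b (c : cell p (pts S)), b \in bs -> c != topc p (pts S) -> res (cstabG c) b = 0) ->
  exists e, \prod_(b <- bs) b = eclass S * e.
Proof.
move=> szb bst; have [th thE ->] := eclassP S.
have [|i lt_i|i c lt_i cT|e ez eE] := @euler_prod k p gT S th (map (@repc k gT) bs) thE.
- by rewrite size_map.
- by rewrite size_map in lt_i; rewrite (nth_map 0) //; exact: repc_cocyc.
- rewrite size_map in lt_i; rewrite (nth_map 0) //.
  have [|a aE] := @res_word_trivial gT (cstabG c) (repc bs`_i) (repc_cocyc _).
    by rewrite repcK; apply: bst cT; exact: mem_nth.
  by exists a => s sc; apply: aE => x xs; rewrite inE; apply/eqP/sc.
exists (cl e); rewrite -eE big_map.
by apply: eq_bigr => b _; rewrite repcK.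
Qed.

End EulerClass.

Lemma pcupDl (k : fieldType) (gT : finGroupType) (T : Type) (F G : seq gT -> T -> k) b :
  pcup (F + G) b = pcup F b + pcup G b.
Proof. by apply/funext => s; apply/funext => c; rewrite /pcup -[RHS]/((_ + _) s) -cupDl. Qed.

(** * The circle of a character *)

Section CharP.
Variables (k : fieldType) (p : nat).
Hypotheses (p_prime : prime p) (char_k : p \in [pchar k]).

Lemma Fp_size : (Zp_trunc (pdiv p)).+2 = p.
Proof. by rewrite pdiv_id // Zp_cast // prime_gt1. Qed.

Lemma natr_modp n : (n %% p)%:R = n%:R :> k.
Proof. by rewrite {2}(divn_eq n p) natrD natrM (pcharf0 char_k) mulr0 add0r. Qed.

Lemma natr_modq n : (n %% (Zp_trunc (pdiv p)).+2)%:R = n%:R :> k.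
Proof. by rewrite Fp_size natr_modp. Qed.

Definition Fpk (i : 'F_p) : k := (nat_of_ord i)%:R.

Lemma FpkD i j : Fpk (i + j) = Fpk i + Fpk j.
Proof. by rewrite /Fpk /= natr_modq natrD. Qed.

Lemma Fpk1 : Fpk 1 = 1.
Proof. by rewrite /Fpk /= natr_modq. Qed.

Lemma sum_Fp (x : k) : \sum_(i : 'F_p) x = 0.
Proof. by rewrite sumr_const card_ord Fp_size -mulr_natl (pcharf0 char_k) mul0r. Qed.

Section Circle.
Variables (gT : finGroupType) (mu : gT -> 'F_p).
Hypothesis muM : forall g h, mu (g * h)%g = mu g + mu h.

Definition circle : sphere k p gT := @Sphere k p gT unit (fun _ _ => 1)
  (fun _ a => a) (fun g _ => mu g) (fun _ _ => mulr1 1)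
  (fun a b ab => False_ind _ (negP ab (introT eqP (match a, b with tt, tt => erefl end))))
  (fun _ _ _ => erefl) (fun _ => erefl) (fun g h _ => muM g h) (fun _ _ _ => erefl).

Definition cellof (l : lab p) : cell p (pts circle) := [ffun=> l].

Lemma cellofK (c : cell p (pts circle)) : cellof (c tt) = c.
Proof. by apply/ffunP => -[]; rewrite ffunE. Qed.

Lemma cellof_act l g : sact (cellof l) g = cellof (sh (mu g) l).
Proof. by apply/ffunP => -[]; rewrite !ffunE. Qed.

Lemma upd_cellof l l' : upd (cellof l) tt l' = cellof l'.
Proof. by apply/ffunP => -[]; rewrite !ffunE. Qed.

Lemma cdeg_cellof l : cdeg (cellof l) = ldeg l.
Proof. by rewrite /cdeg (big_pred1 tt) ?ffunE // => -[]. Qed.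

Lemma topc_cellof : topc p (pts circle) = cellof None.
Proof. by apply/ffunP => -[]; rewrite !ffunE. Qed.

Lemma allV_cellof l : allV (cellof l) = isV l.
Proof. by apply/forallP/idP => [/(_ tt)|lV []]; rewrite ffunE. Qed.

Lemma delta_cellof phi l : delta (@tour _ _ _ circle) phi (cellof l)
  = \sum_l' Bm k l l' * phi (cellof l').
Proof.
rewrite /delta (big_pred1 tt); last by case.
rewrite /op ffunE [sg _ _ _]big_pred0 ?mul1r; last by case.
by apply: eq_bigr => l' _; rewrite upd_cellof.
Qed.

Lemma delta_V phi i : delta (@tour _ _ _ circle) phi (cellof (vl i)) = 0.
Proof. by rewrite delta_cellof sum_Bm. Qed.

Lemma delta_E phi i : delta (@tour _ _ _ circle) phi (cellof (el i))
  = phi (cellof (vl (i + 1))) - phi (cellof (vl i)).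
Proof. by rewrite delta_cellof sum_Bm. Qed.

Lemma delta_T phi : delta (@tour _ _ _ circle) phi (cellof None)
  = \sum_i phi (cellof (el i)).
Proof. by rewrite delta_cellof sum_Bm. Qed.

Definition ycoch (s : seq gT) : k := if s is [:: g] then Fpk (mu g) else 0.

Lemma ycoch_cocyc : cocyc ycoch.
Proof.
split; first by exists 2 => -[|x [|y s]].
apply/funext => -[|x [|y [|z s]]] //.
- by rewrite bar_diff_cons inner_consE inner_nil subr0 /= subrr.
- by rewrite bar_diff_cons !inner_consE inner_nil /shift /= muM FpkD -[RHS]/(0 : k); ring.
rewrite /bar_diff big1 // => i _.
have : size (face i [:: x, y, z & s]) = (size s).+2 by exact: (@size_face_ord gT x [:: y, z & s] i).
by case: (face i _) => [|a [|b t]] //; rewrite mulr0.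
Qed.

Definition augE (b : seq gT -> k) (s : seq gT) (c : cell p (pts circle)) : k :=
  if isE (c tt) then b s else 0.

(** The coordinate of a vertex, read in k. It is not invariant under rotation: its group
    differential is the character itself, while its cellular differential is the constant 1 on the
    edges. *)
Definition ramp (s : seq gT) (c : cell p (pts circle)) : k :=
  if c tt is Some (false, i) then Fpk i * @cup1 k gT s else 0.

Lemma pdiff_augE b : pdiff (@sact _ _ _ circle) (augE b) = augE (bar_diff b).
Proof.
apply/funext => -[|x s]; apply/funext => c; first by rewrite /augE /=; case: ifP.
rewrite -(cellofK c) /= cellof_act /augE !ffunE isE_sh; case: ifP => _.
  by rewrite bar_diff_cons.
by rewrite add0r /inner big1 // => i _; rewrite mulr0.
Qed.

Lemma DV F s i : D F s (cellof (vl i)) = pdiff (@sact _ _ _ circle) F s (cellof (vl i)).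
Proof. by rewrite DE delta_V addr0 cdeg_cellof mul1r. Qed.

Lemma DEE F s i : D F s (cellof (el i)) = - pdiff (@sact _ _ _ circle) F s (cellof (el i))
  + (F s (cellof (vl (i + 1))) - F s (cellof (vl i))).
Proof. by rewrite DE delta_E cdeg_cellof expr1 mulN1r. Qed.

Lemma DT F s : D F s (cellof None) = pdiff (@sact _ _ _ circle) F s (cellof None)
  + \sum_i F s (cellof (el i)).
Proof. by rewrite DE delta_T cdeg_cellof sqrrN expr1n mul1r. Qed.

Lemma D_ramp : D ramp = augc (S := circle) ycoch + augE (@cup1 k gT).
Proof.
apply/funext => s; apply/funext => c; rewrite -(cellofK c); case: (c tt) => [[[] i]|].
- rewrite DEE /ramp !ffunE -[RHS]/(aug _ _ + augE _ _ _) /aug allV_cellof /augE ffunE /= add0r.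
  rewrite -mulrBl FpkD addrAC subrr add0r Fpk1 mul1r.
  suff -> : pdiff (@sact _ _ _ circle) ramp s (cellof (el i)) = 0 by rewrite oppr0 add0r.
  case: s => [|x s] //=; rewrite cellof_act /ramp !ffunE /= add0r.
  by rewrite /inner big1 // => j _; rewrite mulr0.
- rewrite DV -[RHS]/(aug _ _ + augE _ _ _) /aug allV_cellof /augE ffunE /= addr0.
  case: s => [|x s] //=; rewrite cellof_act /ramp !ffunE /=.
  case: s => [|y s] /=.
    by rewrite inner_consE inner_nil /cup1 /= FpkD; ring.
  rewrite /inner big1 ?addr0 ?mulr0 // => j _.
  have : size (face j.+1 [:: x, y & s]) = (size s).+1 by rewrite size_face_eq.
  by case: (face _ _) => // a t; rewrite /cup1 /= !mulr0.
rewrite DT -[RHS]/(aug _ _ + augE _ _ _) /aug allV_cellof /augE ffunE /= addr0.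
rewrite [X in _ + X]big1 => [|i _]; last by rewrite /ramp ffunE.
rewrite addr0; case: s => [|x s] //=; rewrite cellof_act /ramp !ffunE /= add0r.
by rewrite /inner big1 // => j _; rewrite mulr0.
Qed.

Lemma pcup_augE b b' : pcup (augE b) b' = augE (cup b b').
Proof.
apply/funext => s; apply/funext => c; rewrite /augE /pcup /cup.
by case: (isE _) => //; rewrite big1 // => i _; rewrite mul0r.
Qed.

Lemma augE_ramp b : bar_diff b = 0 ->
  augE b = D (pcup ramp b) - augc (S := circle) (cup ycoch b).
Proof.
move=> db; by rewrite D_pcup // D_ramp pcupDl -pcup_augc pcup_augE cup1f addrAC subrr add0r.
Qed.

(** On T the differential sums a constant over the [p] edges, which gives 0 in characteristic
    [p]. *)
Lemma D_augE b : D (augE b) = - augE (bar_diff b).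
Proof.
apply/funext => s; apply/funext => c; rewrite -[RHS]/(- augE (bar_diff b) s c).
rewrite -(cellofK c); case: (c tt) => [[[] i]|].
- rewrite DEE pdiff_augE /augE !ffunE /= subr0 addr0 //.
- by rewrite DV pdiff_augE /augE !ffunE /= oppr0.
rewrite DT pdiff_augE /augE !ffunE /= add0r oppr0.
under eq_bigr do rewrite ffunE.
exact: sum_Fp.
Qed.

Definition pfin (F : seq gT -> cell p (pts circle) -> k) : Prop :=
  exists n, forall s c, (n <= size s)%N -> F s c = 0.

End Circle.

Definition bet (gT : finGroupType) (mu : gT -> 'F_p) (muM : forall g h, mu (g * h)%g = mu g + mu h)
  : cohomology k gT := eclass (circle muM).

Definition ycl (gT : finGroupType) (mu : gT -> 'F_p) : cohomology k gT := cl (ycoch mu).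

End CharP.

(** * The product with a group of order p *)

Section Kunneth.
Variables (k : fieldType) (p : nat).
Hypotheses (p_prime : prime p) (char_k : p \in [pchar k]).
Variable (A : finGroupType).
Local Notation AZ := (A * 'F_p)%type.

Definition inA (a : A) : AZ := (a, 1%g).
Definition inZ (i : 'F_p) : AZ := (1%g, i).
Lemma inAM : {morph inA : x y / (x * y)%g}.
Proof. by move=> x y; rewrite /inA; congr (_, _); rewrite mulg1. Qed.
Lemma inZM : {morph inZ : x y / (x * y)%g}.
Proof. by move=> x y; rewrite /inZ; congr (_, _); rewrite mulg1. Qed.
Lemma fstM : {morph (@fst A 'F_p) : x y / (x * y)%g}. Proof. by []. Qed.
Lemma sndM (g h : AZ) : (g * h)%g.2 = g.2 + h.2 :> 'F_p. Proof. by []. Qed.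

Local Notation S := (circle k (gT := AZ) (mu := @snd A 'F_p) sndM).
Local Notation cellof := (cellof k (gT := AZ) (mu := @snd A 'F_p) sndM).
Local Notation act := (@sact _ _ _ S).
Implicit Types (F U : seq AZ -> cell p (pts S) -> k).
Local Notation pinf := (pull (@fst A 'F_p)).
Local Notation augEz := (augE (k := k) (gT := AZ) (mu := @snd A 'F_p) (muM := sndM)).

Lemma pull_inA_diff F l s : (forall a, sh (inA a).2 l = l) ->
  pdiff act F (map inA s) (cellof l) = bar_diff (fun u => F (map inA u) (cellof l)) s.
Proof.
move=> lf; case: s => [|a s] //; rewrite bar_diff_cons [LHS]/= cellof_act lf; congr (_ + _).
rewrite /inner (_ : size (inA a :: _) = size (a :: s)); last by rewrite /= size_map.
apply: eq_bigr => i _.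
by rewrite -(map_face inAM i.+1 (a :: s)).
Qed.

Lemma sh0 (l : lab p) : sh 0 l = l.
Proof. by case: l => [[b i]|] //=; rewrite addr0. Qed.

Definition masked (b : bool) F s (c : cell p (pts S)) : k :=
  if c tt is Some (b', _) then if b == b' then F s c else 0 else 0.

(** The vertices form a single orbit with stabilisers [A], and so do the edges; hence the
    restriction to [A] at one cell decides triviality. *)
Lemma circle_shapiro (b : bool) F : pdiff act F = 0 ->
    (forall s c, F s c != 0 -> exists i, c tt = Some (b, i)) ->
    (exists a, forall s, F (map inA s) (cellof (Some (b, 0))) = bar_diff a s) ->
  exists U, [/\ F = pdiff act U, forall s c, U s c != 0 -> exists i, c tt = Some (b, i)
    & forall n, (forall s c, (n <= size s)%N -> F s c = 0) ->
                forall s c, (n <= size s)%N -> U s c = 0].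
Proof.
move=> dF Fb [a aE].
pose rep (c : cell p (pts S)) := if c tt is Some (b', _) then cellof (Some (b', 0)) else c.
pose wt (c : cell p (pts S)) : AZ := if c tt is Some (_, i) then inZ i else 1%g.
have wtP c : act (rep c) (wt c) = c.
  rewrite /rep /wt; case ct : (c tt) => [[b' i]|]; last exact: sact1.
  by rewrite cellof_act /= add0r -ct cellofK.
have rep_act c x : rep (act c x) = rep c.
  rewrite -{1}(cellofK c) cellof_act /rep ffunE.
  case ct : (c tt) => [[b' i]|] //=.
  by rewrite -[RHS](cellofK c) ct.
have [|U UE] := shapiro_rep (@sactM _ _ _ S) (@sact1 _ _ _ S) wtP rep_act dF.
  move=> c; rewrite /rep; case ct : (c tt) => [[b' i]|]; last first.
    exists 0 => s _; rewrite diff0; case: (eqVneq (F s c) 0) => // /Fb[i].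
    by rewrite ct.
  case: (eqVneq b' b) => [->|b'b]; last first.
    exists 0 => s _; rewrite diff0; case: (eqVneq (F s (cellof (Some (b', 0)))) 0) => // /Fb[j].
    by rewrite ffunE => -[b'E]; rewrite b'E eqxx in b'b.
  exists (pinf a) => s sc.
  rewrite -pull_diff // /pull -aE; congr (F _ _).
  rewrite -map_comp -[LHS]map_id; apply/eq_in_map => x /sc.
  rewrite -[cact _ _ _ _]/(sact (cellof (Some (b, 0))) x) cellof_act /= => /(congr1 (fun c : cell p (pts S) => c tt)); rewrite !ffunE add0r => -[x2].
  by case: x x2 => a' i' /= ->.
pose P (c : cell p (pts S)) := if c tt is Some (b', _) then b == b' else false.
have Pact c x : P (act c x) = P c.
  by rewrite -{1}(cellofK c) cellof_act /P ffunE; case: (c tt) => [[b' i]|].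
have FP : F = pdiff act (fun s c => if P c then U s c else 0).
  rewrite pdiff_mask // -UE; apply/funext => s; apply/funext => c.
  case: ifP => // nP; apply/eqP; apply: contraFT nP => /Fb[i ct].
  by rewrite /P ct eqxx.
have Ub s c : (if P c then U s c else 0) != 0 -> exists i, c tt = Some (b, i).
  rewrite /P; case: (c tt) => [[b' i]|]; rewrite ?eqxx //.
  by case: (eqVneq b b') => [<- _|_]; rewrite ?eqxx //; exists i.
case: (pselect (exists n, forall s c, (n <= size s)%N -> F s c = 0)) => [fin|nfin]; last first.
  exists (fun s c => if P c then U s c else 0); split=> // n fn; by case: nfin; exists n.
have {fin} fin : exists n, `[< forall s c, (n <= size s)%N -> F s c = 0 >].
  by have [n fn] := fin; exists n; apply/asboolP.
(* Cutting off at the least bound [m] gives a single [U] that respects every bound [n]. *)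
case: (ex_minnP fin) => m /asboolP fm minm.
exists (fun s c => if (size s < m)%N then (if P c then U s c else 0) else 0); split.
- apply/funext => s; apply/funext => c; case: (leqP m.+1 (size s)) => sm.
    rewrite fm; last exact: ltnW.
    case: s sm => [|x s] //= sm; rewrite ltnNge -ltnS sm add0r /inner big1 // => i _.
    by rewrite size_face_eq ?ltn_ord // ltnNge -ltnS sm mulr0.
  rewrite {1}FP; case: s sm => [|x s] //=; rewrite ltnS => sm; rewrite sm; congr (_ + _).
  by apply: inner_cong => u /= ->; rewrite sm.
- by move=> s c; case: (size s < m)%N; [exact: Ub | rewrite eqxx].
move=> n fn s c ns; have mn : (m <= n)%N by apply: minm; apply/asboolP.
by rewrite ltnNge (leq_trans mn ns).
Qed.

Lemma pdiff_augc (b : seq AZ -> k) : pdiff act (augc (S := S) b) = augc (S := S) (bar_diff b).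
Proof.
apply/funext => -[|x s]; apply/funext => c; first by rewrite /augc /aug /=; case: ifP.
rewrite /= /augc /aug allV_act; case: ifP => _; first by rewrite bar_diff_cons.
by rewrite add0r /inner big1 // => i _; rewrite mulr0.
Qed.

Lemma normal_V F : (forall s i, D F s (cellof (vl i)) = 0) ->
  let a0 := fun s => F (map inA s) (cellof (vl 0)) in
  exists U, [/\ bar_diff a0 = 0,
    forall s i, (F - augc (S := S) (pinf a0) - D U) s (cellof (vl i)) = 0 &
    pfin F -> pfin U].
Proof.
move=> DF a0.
have da0 : bar_diff a0 = 0.
  apply/funext => s; rewrite /a0 -pull_inA_diff; last by move=> a; rewrite sh0.
  by rewrite -DV DF.
pose f0 := masked false F - augc (S := S) (pinf a0).
have mE s c : f0 s c = if c tt is Some (false, i) then F s c - a0 (map fst s) else 0.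
  rewrite -[f0 s c]/(masked false F s c - aug _ c) /masked /aug -(cellofK c) allV_cellof ffunE.
  by case: (c tt) => [[[] i]|] //=; rewrite subr0.
have d0 : pdiff act f0 = 0.
  rewrite /f0 pdiffB pdiff_augc -pull_diff // da0.
  apply/funext => s; apply/funext => c.
  rewrite -[LHS]/(pdiff act (masked false F) s c - aug 0 c).
  have -> : aug 0 c = 0 :> k by rewrite /aug; case: ifP.
  rewrite subr0; pose P (c : cell p (pts S)) := isV (c tt).
  have -> : masked false F = fun s c => if P c then F s c else 0.
    by apply/funext => u; apply/funext => d; rewrite /masked /P; case: (d tt) => [[[] i]|].
  rewrite pdiff_mask => [|d x]; last by rewrite -{1}(cellofK d) cellof_act /P ffunE isV_sh.
  rewrite /P; case: ifP => //; rewrite -(cellofK c) ffunE.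
  by case: (c tt) => [[[] i]|] // _; rewrite -DV DF.
have [||U [UE Ub Uf]] := circle_shapiro (b := false) d0.
- by move=> s c; rewrite mE; case: (c tt) => [[[] i]|]; rewrite ?eqxx //; exists i.
- exists 0 => s; rewrite diff0 mE ffunE.
  by rewrite -map_comp (eq_map (g := id)) ?map_id ?subrr.
exists U; split=> //.
  move=> s i.
  rewrite -[LHS]/(F s (cellof (vl i)) - aug (a0 (map fst s)) (cellof (vl i)) - D U s (cellof (vl i))).
  by rewrite DV -UE mE /aug allV_cellof ffunE subrr.
move=> [n fn]; exists n => s c ns; apply: Uf ns => u d nu.
rewrite mE; case: (d tt) => [[[] i]|] //; rewrite fn // /a0 fn ?subrr // !size_map //.
Qed.

Lemma normal_E F : (forall s i, F s (cellof (vl i)) = 0) ->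
    (forall s i, D F s (cellof (el i)) = 0) ->
  let a1 := fun s => F (map inA s) (cellof (el 0)) in
  exists U, [/\ bar_diff a1 = 0,
    forall s c, c <> topc p (pts S) -> (F - augEz (pinf a1) - D U) s c = 0 &
    pfin F -> pfin U].
Proof.
move=> FV DF a1.
have dE s i : pdiff act F s (cellof (el i)) = 0.
  by have := DF s i; rewrite DEE !FV subrr addr0 => /eqP; rewrite oppr_eq0 => /eqP.
have da1 : bar_diff a1 = 0.
  by apply/funext => s; rewrite /a1 -pull_inA_diff ?dE // => a; rewrite sh0.
pose f1 := masked true F - augEz (pinf a1).
have mE s c : f1 s c = if c tt is Some (true, i) then F s c - a1 (map fst s) else 0.
  rewrite -[f1 s c]/(masked true F s c - augEz _ s c) /masked /augE.
  by case: (c tt) => [[[] i]|] //=; rewrite subr0.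
have d1 : pdiff act f1 = 0.
  rewrite /f1 pdiffB pdiff_augE -pull_diff // da1.
  apply/funext => s; apply/funext => c.
  rewrite -[LHS]/(pdiff act (masked true F) s c - augEz 0 s c).
  have -> : augEz 0 s c = 0 :> k by rewrite /augE; case: ifP.
  rewrite subr0; pose P (c : cell p (pts S)) := isE (c tt).
  have -> : masked true F = fun s c => if P c then F s c else 0.
    by apply/funext => u; apply/funext => d; rewrite /masked /P; case: (d tt) => [[[] i]|].
  rewrite pdiff_mask => [|d x]; last by rewrite -{1}(cellofK d) cellof_act /P ffunE isE_sh.
  rewrite /P; case: ifP => //; rewrite -(cellofK c) ffunE.
  by case: (c tt) => [[[] i]|] // _; rewrite dE.
have [||U [UE Ub Uf]] := circle_shapiro (b := true) d1.
- by move=> s c; rewrite mE; case: (c tt) => [[[] i]|]; rewrite ?eqxx //; exists i.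
- exists 0 => s; rewrite diff0 mE ffunE.
  by rewrite -map_comp (eq_map (g := id)) ?map_id ?subrr.
have UV s i : U s (cellof (vl i)) = 0.
  by case: (eqVneq (U s (cellof (vl i))) 0) => // /Ub[j]; rewrite ffunE.
exists (- U); split=> //.
  move=> s c; rewrite topc_cellof -(cellofK c) D_opp.
  rewrite -[(_ - _) s _]/(F s (cellof (c tt)) - augEz (pinf a1) s (cellof (c tt)) - - D U s (cellof (c tt))).
  rewrite /augE ffunE; case: (c tt) => [[[] i]|] //= _.
    by rewrite DEE !UV subrr addr0 -UE mE ffunE /= opprK subrr.
  by rewrite DV -UE mE ffunE /= FV !oppr0 !addr0.
move=> [n fn]; exists n => s c ns; rewrite -[LHS]/(- U s c) (Uf n) ?oppr0 // => u d nu.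
rewrite mE; case: (d tt) => [[[] i]|] //; rewrite fn // /a1 fn ?subrr // !size_map //.
Qed.

Lemma pfinB F U : pfin F -> pfin U -> pfin (F - U).
Proof.
move=> [m fm] [n un]; exists (maxn m n) => s c; rewrite geq_max => /andP[ms ns].
by rewrite -[LHS]/(F s c - U s c) fm // un // subrr.
Qed.

Lemma pfinD F : pfin F -> pfin (D F).
Proof.
move=> [n fn]; exists n.+1 => -[|x s] c // ns; rewrite DE /= fn // add0r.
rewrite /inner big1 => [|i _]; last by rewrite fn ?mulr0 // size_face_eq ?ltn_ord.
rewrite mulr0 add0r /delta big1 // => o _; rewrite /op big1 ?mulr0 // => l _.
by rewrite fn ?mulr0 // ltnW.
Qed.

Lemma pfin_augc (b : seq AZ -> k) : finite_degree b -> pfin (augc (S := S) b).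
Proof. by move=> [n bn]; exists n => s c ns; rewrite /augc /aug bn //; case: ifP. Qed.

(** Normalise on the vertices, then on the edges: up to a coboundary both layers are inflated from
    [A], and what remains lives on T. *)
Lemma normal_form F : (forall s c, c <> topc p (pts S) -> D F s c = 0) ->
  exists a0 a1 U, [/\ bar_diff a0 = 0, bar_diff a1 = 0,
    forall s c, c <> topc p (pts S) -> (F - augc (S := S) (pinf a0) - augEz (pinf a1) - D U) s c = 0 &
    pfin F -> finite_degree a0 /\ finite_degree a1].
Proof.
move=> DF.
have nT l : isV l || isE l -> cellof l <> topc p (pts S).
  by rewrite topc_cellof => lT /(congr1 (fun c : cell p (pts S) => c tt)); rewrite !ffunE => lN; rewrite lN in lT.
have [|U0 [da0 F1V fin0]] := normal_V (F := F).
  by move=> s i; apply: DF; exact: nT.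
set a0 := fun s => F (map inA s) _ in da0 F1V.
pose F1 := F - augc (S := S) (pinf a0) - D U0.
have DF1 : D F1 = D F.
  rewrite /F1 !D_sub DD subr0 D_augc -pull_diff // da0.
  apply/funext => s; apply/funext => c; rewrite -[LHS]/(D F s c - aug 0 c) /aug.
  by case: ifP; rewrite subr0.
have [|U1 [da1 F2 fin1]] := normal_E (F := F1) F1V.
  by move=> s i; rewrite DF1; apply: DF; exact: nT.
set a1 := fun s => F1 (map inA s) _ in da1 F2.
exists a0, a1, (U0 + U1); split=> // [s c cT|fin].
  rewrite D_add -[RHS](F2 s c cT) /F1.
  rewrite -[LHS]/(F s c - augc (S := S) (pinf a0) s c - augEz (pinf a1) s c - (D U0 s c + D U1 s c)).
  rewrite -[RHS]/(F s c - augc (S := S) (pinf a0) s c - D U0 s c - augEz (pinf a1) s c - D U1 s c).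
  ring.
have fa0 : finite_degree a0.
  by have [n fn] := fin; exists n => s ns; apply: fn; rewrite size_map.
split=> //; have [n fn] : pfin F1.
  apply: pfinB; last exact/pfinD/fin0.
  by apply: pfinB => //; apply: pfin_augc; exact: findeg_pull.
by exists n => s ns; apply: fn; rewrite size_map.
Qed.

Lemma dinf (a : seq A -> k) : bar_diff a = 0 -> bar_diff (pinf a) = 0.
Proof. by move=> da; rewrite -pull_diff // da. Qed.

Definition infl : {rmorphism cohomology k A -> cohomology k AZ} :=
  cohomology_pull (phi := @fst A 'F_p) fstM.
Definition resA : {rmorphism cohomology k AZ -> cohomology k A} :=
  cohomology_pull (phi := inA) inAM.
Definition X : cohomology k AZ := bet k (gT := AZ) (mu := @snd A 'F_p) sndM.
Definition Y : cohomology k AZ := ycl k (@snd A 'F_p).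

Lemma Y_cocyc : cocyc (ycoch k (@snd A 'F_p)).
Proof. exact: ycoch_cocyc. Qed.

Lemma infl_cl a : cocyc a -> infl (cl a) = cl (pinf a).
Proof. exact: pull_cl. Qed.

(** Normalise the augmentation of [b]: the vertices give [a0], the edges become a multiple of [Y]
    through [augE_ramp], and the rest, supported on the top cell, is a multiple of [X] by
    [gysin]. *)
Lemma kunneth_exists b : exists a0 a1 b', b = infl a0 + Y * infl a1 + X * b'.
Proof.
have [f fz ->] := clP b; have [ff df] := fz.
have [s c cT|a0 [a1 [U [da0 da1 nf fin]]]] := normal_form (F := augc (S := S) f).
  by rewrite D_augc df /augc /aug; case: ifP.
have [fa0 fa1] := fin (pfin_augc ff).
have z0 : cocyc (pinf a0) by apply: cocyc_pull.
have z1 : cocyc (pinf a1) by apply: cocyc_pull.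
have [th thE thE'] := eclassP S.
have yz := Y_cocyc.
have [|s c /eqP cT|e ez eE] := @gysin _ _ _ S th (f - pinf a0 + cup (ycoch k (@snd A 'F_p)) (pinf a1))
    (U + pcup (ramp (k := k) (muM := sndM)) (pinf a1)) thE.
- by apply: cocycD; [exact: cocycB | exact: cocycM].
- rewrite -[RHS](nf s c cT) D_add augE_ramp //; last exact: dinf.
  rewrite -[RHS]/(augc (S := S) f s c - augc (S := S) (pinf a0) s c
     - (D (pcup (ramp (k := k) (muM := sndM)) (pinf a1)) s c
        - augc (S := S) (cup (ycoch k (@snd A 'F_p)) (pinf a1)) s c) - D U s c).
  rewrite -[LHS]/(augc (S := S) (f - pinf a0 + cup (ycoch k (@snd A 'F_p)) (pinf a1)) s c
     - (D U s c + D (pcup (ramp (k := k) (muM := sndM)) (pinf a1)) s c)).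
  have -> : augc (S := S) (f - pinf a0 + cup (ycoch k (@snd A 'F_p)) (pinf a1)) s c
    = augc (S := S) f s c - augc (S := S) (pinf a0) s c + augc (S := S) (cup (ycoch k (@snd A 'F_p)) (pinf a1)) s c.
    by rewrite /augc /aug; case: ifP; rewrite ?subr0 ?addr0.
  ring.
exists (cl a0), (- cl a1), (cl e); rewrite rmorphN !infl_cl //; try by split.
have := eE; rewrite clD ?clB ?clM //; try exact: cocycM; try exact: cocycB.
rewrite /X /bet thE' -/(ycl k (@snd A 'F_p)) -/Y => <-.
rewrite mulrN; move: (cl f) (cl (pinf a0)) (Y * _) => x y z.
by rewrite addrACA [y + _]addrCA subrr addr0 addNr addr0.
Qed.

Lemma resA_infl a : resA (infl a) = a.
Proof.
rewrite [LHS](@pull_comp k A AZ A inA fst id inAM fstM (fun _ _ => erefl)) //.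
exact: pull_id.
Qed.

Lemma resA_Y : resA Y = 0.
Proof.
rewrite [resA _]pull_cl; last exact: Y_cocyc.
rewrite -cl0; congr cl; apply/funext => -[|x [|y s]] //.
Qed.

Lemma resA_X : resA X = 0.
Proof.
rewrite [resA _]eclass_pull.
apply: (@eclass_vertex k p A (spull inAM S) [ffun=> vl 0] tt); first by apply/forallP => o; rewrite ffunE.
by move=> x; apply/ffunP => o; rewrite !ffunE /= addr0.
Qed.

Lemma X_even : hsign X = X. Proof. exact: eclass_even. Qed.

Lemma X_homog : homog 2 X.
Proof. by have := eclass_homog S; rewrite card_unit. Qed.

Lemma Y_homog : homog 1 Y.
Proof.
apply: homog_cl; first exact: Y_cocyc.
by apply/funext => -[|x [|y s]].
Qed.

(** If [X * b] bounds, then so does [b] placed on the top cell, in the double complex. Once the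
    primitive is normalised to vanish on the edges, its value on T is a primitive of [b]. *)
Lemma X_regular b : X * b = 0 -> b = 0.
Proof.
have [f fz ->] := clP b; have [ff df] := fz; have [th thE thE'] := eclassP S.
have [tz _ [w wE]] := thE.
rewrite /X /bet thE' -clM // => /cl_eq0P[|al alE]; first exact: cocycM.
pose v := augc (S := S) al + pcup w f.
have Dv : D v = pcup (onetop (S := S)) f.
  rewrite D_add D_pcup // D_augc -alE -pcup_augc wE.
  by apply/funext => s; apply/funext => c; rewrite /pcup cupDl.
have [s c cT|a0 [a1 [U [da0 da1 nf _]]]] := normal_form (F := v).
  by rewrite Dv /pcup /cup big1 // => i _; rewrite /onetop; case: eqP => // _; rewrite mul0r.
pose v2 := v - augc (S := S) (pinf a0) - augEz (pinf a1) - D U.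
have Dv2 : D v2 = pcup (onetop (S := S)) f.
  rewrite /v2 !D_sub DD subr0 D_augE // dinf // D_augc dinf // Dv.
  apply/funext => s; apply/funext => c.
  rewrite -[LHS]/(pcup (onetop (S := S)) f s c - aug 0 c - - augEz 0 s c).
  have -> : augEz 0 s c = 0 :> k by rewrite /augE; case: ifP.
  by rewrite /aug if_same !oppr0 !addr0.
apply/cl_eq0P => //; exists (v2^~ (topc p (pts S))); apply/funext => s.
have -> : f s = D v2 s (topc p (pts S)).
  rewrite Dv2 /pcup -{1}(cup1f f); congr (cup _ _ _).
  by apply/funext => u; rewrite /onetop eqxx.
rewrite topc_cellof DT big1 ?addr0; last first.
  move=> i _; apply: nf; rewrite topc_cellof => /(congr1 (fun c : cell p (pts S) => c tt)).
  by rewrite !ffunE.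
case: s => [|x s] //; rewrite bar_diff_cons /=; congr (_ + _).
by congr (v2 _ _); rewrite cellof_act.
Qed.

(** The hypothesis bounds, up to the top cell, the inflation of [a1] placed on the edges. Once the
    primitive vanishes on the vertices, its value on one edge is, up to sign, a primitive of
    [a1]. *)
Lemma Y_unique a1 b : Y * infl a1 + X * b = 0 -> a1 = 0.
Proof.
have [f fz ->] := clP b; have [g gz ->] := clP a1; have [th thE thE'] := eclassP S.
have [tz _ [w wE]] := thE; have [_ df] := fz; have [_ dg] := gz; have yz := Y_cocyc.
have gz' : cocyc (pinf g) by exact: cocyc_pull.
rewrite /X /bet thE' infl_cl // -!clM // -clD; try exact: cocycM.
move/cl_eq0P => [|al alE]; first by apply: cocycD; exact: cocycM.
pose v := pcup (ramp (k := k) (muM := sndM)) (pinf g) - pcup w f - augc (S := S) al.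
have Dv : D v = augEz (pinf g) - pcup (onetop (S := S)) f.
  rewrite !D_sub D_augc -alE [in RHS]augE_ramp //; last exact: dinf.
  rewrite wE [D (pcup w f)]D_pcup //.
  apply/funext => s; apply/funext => c.
  rewrite -[LHS]/(D (pcup (ramp (k := k) (muM := sndM)) (pinf g)) s c - pcup (D w) f s c
     - augc (S := S) (cup (ycoch k (@snd A 'F_p)) (pinf g) + cup th f) s c).
  rewrite -[RHS]/(D (pcup (ramp (k := k) (muM := sndM)) (pinf g)) s c
     - augc (S := S) (cup (ycoch k (@snd A 'F_p)) (pinf g)) s c - pcup (augc (S := S) th + D w) f s c).
  have -> : pcup (augc (S := S) th + D w) f s c = augc (S := S) (cup th f) s c + pcup (D w) f s c.
    by rewrite -pcup_augc /pcup cupDl.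
  have -> : augc (S := S) (cup (ycoch k (@snd A 'F_p)) (pinf g) + cup th f) s c
    = augc (S := S) (cup (ycoch k (@snd A 'F_p)) (pinf g)) s c + augc (S := S) (cup th f) s c.
    by rewrite /augc /aug; case: ifP; rewrite ?addr0.
  ring.
have oT s l : isV l || isE l -> pcup (onetop (S := S)) f s (cellof l) = 0.
  move=> lT; rewrite /pcup /cup big1 // => i _; rewrite /onetop topc_cellof.
  case: eqP => [/(congr1 (fun c : cell p (pts S) => c tt))|_]; last by rewrite mul0r.
  by rewrite !ffunE => lN; rewrite lN in lT.
have DvE s l : isV l || isE l -> D v s (cellof l) = augEz (pinf g) s (cellof l).
  by move=> lT; rewrite Dv -[LHS]/(augEz _ _ _ - pcup _ _ _ _) oT // subr0.
have [s i|U [da0 vV _]] := normal_V (F := v).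
  by rewrite DvE // /augE ffunE.
set a0 := fun s => v (map inA s) _ in da0 vV.
pose v1 := v - augc (S := S) (pinf a0) - D U.
have Dv1 s c : D v1 s c = D v s c.
  rewrite /v1 D_sub [D (v - _)]D_sub DD subr0 D_augc dinf // -[LHS]/(D v s c - aug 0 c) /aug.
  by case: ifP; rewrite subr0.
apply/cl_eq0P => //; exists (- (fun s => v1 (map inA s) (cellof (el 0)))).
apply/funext => s; rewrite diffN -[RHS]/(- bar_diff (fun s => v1 (map inA s) (cellof (el 0))) s).
have := Dv1 (map inA s) (cellof (el 0)); rewrite DvE //.
rewrite DEE [v1 _ (cellof (vl _))]vV [v1 _ (cellof (vl 0))]vV subrr addr0.
rewrite pull_inA_diff => [->|a]; last by rewrite sh0.
rewrite /augE ffunE /= /pull -map_comp (eq_map (g := id)) ?map_id //.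
Qed.

Lemma kunneth_unique a0 a1 b : infl a0 + Y * infl a1 + X * b = 0 ->
  [/\ a0 = 0, a1 = 0 & b = 0].
Proof.
move=> E; have a00 : a0 = 0.
  have := congr1 resA E; rewrite !rmorphD !rmorphM !resA_infl resA_X resA_Y.
  by rewrite !mul0r !addr0 rmorph0.
move: E; rewrite a00 rmorph0 add0r => E; have a10 := Y_unique E.
by split=> //; apply: X_regular; move: E; rewrite a10 rmorph0 mulr0 add0r.
Qed.

End Kunneth.

Arguments infl {k} p {A}.
Arguments resA {k p A}.

(** * The commutative ring of even classes *)

Section EvenRing.
Variables (k : fieldType) (gT : finGroupType).

(** Evenness is read off the sign operator, so that in characteristic 2 every class counts as
    even. *)
Definition mem_even (x : cohomology k gT) : bool := hsign x == x.

Lemma hsign1 : hsign (1 : cohomology k gT) = 1.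
Proof. by rewrite -(scal1 k gT) hsign_scal. Qed.

Lemma hsignB (x y : cohomology k gT) : hsign (x - y) = hsign x - hsign y.
Proof. exact: hopB (sign_chain k gT) x y. Qed.

Lemma hsignD (x y : cohomology k gT) : hsign (x + y) = hsign x + hsign y.
Proof. exact: hopD (sign_chain k gT) x y. Qed.

Lemma hsignN (x : cohomology k gT) : hsign (- x) = - hsign x.
Proof. exact: hopN (sign_chain k gT) x. Qed.

Lemma hpartD n (x y : cohomology k gT) : hpart n (x + y) = hpart n x + hpart n y.
Proof. exact: hopD (part_chain k gT n) x y. Qed.

Lemma mem_even_subring : subring_closed mem_even.
Proof.
split=> [|x y /eqP xe /eqP ye|x y /eqP xe /eqP ye]; apply/eqP.
- exact: hsign1.
- by rewrite hsignB xe ye.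
- by rewrite hsignM xe ye.
Qed.

Record evc : Type := Evc { ev_val :> cohomology k gT; _ : mem_even ev_val }.

HB.instance Definition _ := [isSub for ev_val].
HB.instance Definition _ := [Choice of evc by <:].
HB.instance Definition _ :=
  GRing.SubChoice_isSubPzRing.Build _ mem_even evc mem_even_subring.

Lemma evcP (x : evc) : hsign (ev_val x) = ev_val x.
Proof. by case: x => x /= /eqP. Qed.

Lemma evc_comm : @commutative evc evc *%R.
Proof. by move=> x y; apply: val_inj; exact: even_comm (evcP x). Qed.

HB.instance Definition _ := GRing.PzRing_hasCommutativeMul.Build evc evc_comm.

Lemma evc_neq0 : (1 : evc) != 0.
Proof. by apply/eqP => /(congr1 ev_val); exact: cohomology_neq0. Qed.

HB.instance Definition _ := GRing.PzSemiRing_isNonZero.Build evc evc_neq0.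

Lemma evD (x y : evc) : ev_val (x + y) = ev_val x + ev_val y. Proof. by []. Qed.
Lemma evB (x y : evc) : ev_val (x - y) = ev_val x - ev_val y. Proof. by []. Qed.
Lemma evN (x : evc) : ev_val (- x) = - ev_val x. Proof. by []. Qed.
Lemma evM (x y : evc) : ev_val (x * y) = ev_val x * ev_val y. Proof. by []. Qed.
Lemma ev0 : ev_val 0 = 0. Proof. by []. Qed.
Lemma ev1 : ev_val 1 = 1. Proof. by []. Qed.
Lemma evX (x : evc) n : ev_val (x ^+ n) = ev_val x ^+ n.
Proof. by elim: n => // n IHn; rewrite !exprS evM IHn. Qed.
Lemma ev_inj : injective ev_val. Proof. exact: val_inj. Qed.

Definition mkev (x : cohomology k gT) (xe : hsign x = x) : evc := Evc (introT eqP xe).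

Definition escal (c : k) : evc := mkev (hsign_scal gT c).

Lemma evc_char p : p \in [pchar k] -> p \in [pchar evc].
Proof.
move=> pk; rewrite inE (pcharf_prime pk) /=; apply/eqP/ev_inj.
have -> : ev_val p%:R = p%:R by elim: {pk}p => // n IHn; rewrite -!natr1 evD IHn.
by rewrite cohomology_natr (pcharf0 pk) rmorph0.
Qed.

End EvenRing.

Lemma frobD (R : comNzRingType) p (x y : R) : p \in [pchar R] ->
  (x + y) ^+ p = x ^+ p + y ^+ p.
Proof. by move=> pR; rewrite -!(pFrobenius_autE pR) rmorphD. Qed.

Section EvenPull.
Variables (k : fieldType) (aT gT : finGroupType) (phi : aT -> gT).
Hypothesis phiM : {morph phi : x y / (x * y)%g}.

Lemma epull_proof (x : evc k gT) :
  hsign (cohomology_pull phiM (ev_val x)) = cohomology_pull phiM (ev_val x).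
Proof. by rewrite -pull_hsign evcP. Qed.

Definition epull (x : evc k gT) : evc k aT := mkev (epull_proof x).

Lemma epull_zmod : zmod_morphism epull.
Proof. by move=> x y; apply: ev_inj; rewrite /= rmorphB. Qed.
Lemma epull_monoid : monoid_morphism epull.
Proof. by split=> [|x y]; apply: ev_inj; rewrite /= ?rmorph1 ?rmorphM. Qed.
HB.instance Definition _ := GRing.isZmodMorphism.Build _ _ epull epull_zmod.
HB.instance Definition _ := GRing.isMonoidMorphism.Build _ _ epull epull_monoid.
End EvenPull.

Section BetPull.
Variables (k : fieldType) (p : nat).

Lemma bet_ext (gT : finGroupType) (mu mu' : gT -> 'F_p) muM mu'M :
  (forall g, mu g = mu' g) -> bet k (mu := mu) muM = bet k (mu := mu') mu'M.
Proof. by move=> E; apply: eclass_ext. Qed.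

Lemma bet_pull (aT gT : finGroupType) (phi : aT -> gT) (phiM : {morph phi : x y / (x * y)%g})
    (mu : gT -> 'F_p) muM (mu' : aT -> 'F_p) mu'M : (forall g, mu (phi g) = mu' g) ->
  cohomology_pull phiM (bet k (mu := mu) muM) = bet k (mu := mu') mu'M.
Proof. by move=> E; rewrite [LHS]eclass_pull; apply: eclass_ext => // g a; exact: E. Qed.

Lemma bet_zero (gT : finGroupType) (mu : gT -> 'F_p) muM :
  (forall g, mu g = 0) -> bet k (mu := mu) muM = 0.
Proof.
move=> mu0; apply: (@eclass_vertex k p gT (circle k (mu := mu) muM) [ffun=> vl 0] tt).
  by apply/forallP => o; rewrite ffunE.
by move=> x; apply/ffunP => o; rewrite !ffunE /= mu0 addr0.
Qed.
End BetPull.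

Lemma subrACA (V : zmodType) (a a' b b' : V) : (a - a') + (b - b') = (a + b) - (a' + b').
Proof. by rewrite opprD addrACA. Qed.

Section TrivialGroup.
Variables (k : fieldType) (gT : finGroupType).
Hypothesis gT1 : forall x : gT, x = 1%g.

Lemma trivial_homog n (a : cohomology k gT) : homog n.+1 a -> a = 0.
Proof.
move=> /homogP[f [fz -> fn]]; have [_ df] := fz.
have wE (s : seq gT) : s = nseq (size s) 1%g.
  by elim: s => //= x s <-; rewrite (gT1 x).
have dE (h : seq gT -> k) m : bar_diff h (nseq m.+1 1%g) = (odd m)%:R * h (nseq m 1%g) :> k.
  have fE i : (i <= m.+1)%N -> h (face i (nseq m.+1 1%g)) = h (nseq m 1%g).
    by move=> le_i; rewrite (wE (face _ _)) size_face_eq ?size_nseq.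
  rewrite /bar_diff size_nseq -[nseq m.+1 _]/(1%g :: nseq m 1%g).
  under eq_bigr => i _ do rewrite fE -1?ltnS //.
  rewrite -mulr_suml; congr (_ * _).
  elim: {fE} m => [|m IHm]; first by rewrite !big_ord_recr big_ord0 /=; ring.
  by rewrite big_ord_recr /= {}IHm !exprS -(signr_odd _ m); case: (odd m); rewrite /= ?expr1 ?expr0; ring.
have f0 m : m != n.+1 -> f (nseq m 1%g) = 0.
  by move=> mn; rewrite -fn /part size_nseq (negPf mn).
case on : (odd n.+1); last first.
  apply/cl_eq0P => //; exists (fun s => if size s == n then f (nseq n.+1 1%g) else 0).
  apply/funext => s; rewrite (wE s); case: (size s) => [|m]; first exact: f0.
  rewrite dE size_nseq; case: (eqVneq m n) => [->|mn]; last by rewrite mulr0 f0.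
  by move: on; rewrite oddS => /negbFE ->; rewrite mul1r.
have fn0 : f (nseq n.+1 1%g) = 0.
  by have := dE f n.+1; rewrite on mul1r df.
rewrite -(cl0 k gT); congr cl; apply/funext => s; rewrite (wE s).
by case: (eqVneq (size s) n.+1) => [->|/f0].
Qed.

End TrivialGroup.

(** * Division by the Bockstein class of the factor of order p *)

Section KunnethOperators.
Variables (k : fieldType) (p : nat).
Hypotheses (p_prime : prime p) (char_k : p \in [pchar k]).

Section One.
Variable (A : finGroupType).
Local Notation AZ := (A * 'F_p)%type.
Local Notation H := (cohomology k AZ).
Implicit Types (a : cohomology k A) (b : H).
Local Notation X := (X k p A).
Local Notation Y := (Y k p A).
Local Notation infl := (@infl k p A).
Local Notation resA := (@resA k p A).

Lemma kunneth b : exists q : cohomology k A * cohomology k A * H,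
  b = infl q.1.1 + Y * infl q.1.2 + X * q.2.
Proof.
by have [a0 [a1 [b' E]]] := kunneth_exists p_prime char_k b; exists (a0, a1, b').
Qed.

Definition kY b := (projT1 (cid (kunneth b))).1.2.
(** The quotient in the division by [X]. It lowers the degree by 2 and is nilpotent on each class,
    which permits induction as on the degree of a polynomial. *)
Definition kX b := (projT1 (cid (kunneth b))).2.

Lemma kunnethE b : b = infl (resA b) + Y * infl (kY b) + X * kX b.
Proof.
rewrite /kY /kX; case: (cid _) => -[[a0 a1] b'] /= E.
rewrite {1}E; congr (infl _ + _ + _).
rewrite E !rmorphD !rmorphM /= resA_X resA_Y //.
by rewrite !mul0r !addr0; apply/esym/resA_infl.
Qed.

Lemma kunneth_eq a0 a1 b a0' a1' b' :
  infl a0 + Y * infl a1 + X * b = infl a0' + Y * infl a1' + X * b' ->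
  [/\ a0 = a0', a1 = a1' & b = b'].
Proof.
move=> E; have : infl (a0 - a0') + Y * infl (a1 - a1') + X * (b - b') = 0.
  by rewrite !rmorphB !mulrBr !subrACA E subrr.
by case/(kunneth_unique p_prime char_k) => /subr0_eq -> /subr0_eq -> /subr0_eq ->.
Qed.

Lemma kX_unique a0 a1 b b' : b = infl a0 + Y * infl a1 + X * b' -> kX b = b' /\ kY b = a1.
Proof. by rewrite {1}(kunnethE b) => /kunneth_eq[_ -> ->]. Qed.

Lemma kX_B b c : kX (b - c) = kX b - kX c.
Proof.
apply: proj1 (kX_unique (a0 := resA b - resA c) (a1 := kY b - kY c) _).
rewrite {1}(kunnethE b) {1}(kunnethE c) !rmorphB !mulrBr.
by rewrite !opprD addrACA; congr (_ + _); rewrite addrACA.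
Qed.

Lemma kX0 : kX 0 = 0.
Proof. by have := kX_B 0 0; rewrite !subrr. Qed.

Lemma kX_D b c : kX (b + c) = kX b + kX c.
Proof. by rewrite -{1}[c]opprK kX_B -[- c]sub0r kX_B kX0 sub0r opprK. Qed.

Lemma X_comm b : X * b = b * X.
Proof. exact/even_comm/X_even. Qed.

Lemma kX_X b : kX (X * b) = b.
Proof.
by apply: proj1 (kX_unique (a0 := 0) (a1 := 0) _); rewrite !rmorph0 mulr0 !add0r.
Qed.

Lemma kX_infl a : kX (infl a) = 0.
Proof.
by apply: proj1 (kX_unique (a0 := a) (a1 := 0) _); rewrite rmorph0 !mulr0 !addr0.
Qed.

Lemma Y_sign : hsign Y = - Y.
Proof. by rewrite (homog_sign (Y_homog p_prime char_k A)) expr1 rmorphN1 mulN1r. Qed.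

Lemma infl_sign a : hsign (infl a) = infl (hsign a).
Proof. exact/esym/pull_hsign. Qed.

Lemma Y_infl a : Y * infl a = infl (hsign a) * Y.
Proof. by rewrite (odd_comm _ Y_sign) infl_sign. Qed.

(** Moving an inflated class past [Y] twists it by the sign operator; this affects [kY] only, so
    [kX] is linear over the inflated classes. *)
Lemma kX_infl_mul a b : kX (infl a * b) = infl a * kX b.
Proof.
apply: proj1 (kX_unique (a0 := a * resA b) (a1 := hsign a * kY b) _).
rewrite {1}(kunnethE b) !mulrDr !rmorphM; congr (_ + _ + _).
  by rewrite !mulrA Y_infl hsignK.
by rewrite !mulrA X_comm.
Qed.

Lemma kX_scal c b : kX (scal _ c * b) = scal _ c * kX b.
Proof. by rewrite -(pull_scal (@fstM p A) c); exact: kX_infl_mul. Qed.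

Lemma kX_sign b : kX (hsign b) = hsign (kX b) /\ kY (hsign b) = - hsign (kY b).
Proof.
apply: (kX_unique (a0 := hsign (resA b))).
rewrite {1}(kunnethE b) !hsignD !hsignM infl_sign X_even Y_sign infl_sign.
by rewrite rmorphN mulrN mulNr.
Qed.

Lemma kX_hpart n b : hpart n (kX b) = kX (hpart n.+2 b) /\ hpart n.+1 (kY b) = kY (hpart n.+2 b).
Proof.
suff [-> ->] : kX (hpart n.+2 b) = hpart n (kX b) /\ kY (hpart n.+2 b) = hpart n.+1 (kY b) by [].
apply: (kX_unique (a0 := hpart n.+2 (resA b))).
rewrite {1}(kunnethE b) !hpartD.
rewrite (hpart_mull (d := 2) n _ (X_homog k p A)) (hpart_mull (d := 1) n.+1 _ (Y_homog p_prime char_k A)).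
have infl_hpart m a : hpart m (infl a) = infl (hpart m a) by exact/esym/pull_hpart.
by rewrite !infl_hpart.
Qed.

Lemma kX_homog n b : homog n.+2 b -> homog n (kX b) /\ homog n.+1 (kY b).
Proof. by move=> bn; have [E1 E2] := kX_hpart n b; rewrite /homog E1 E2 bn. Qed.

Lemma kX_nilp b : exists N, iter N kX b = 0.
Proof.
have [N bN] := hpart_large b; exists N.
suff H m n : (N <= n + m.*2)%N -> hpart n (iter m kX b) = 0.
  by apply: hpart_eq0 => n; apply: H; rewrite -addnn addnA leq_addl.
elim: m n => [|m IHm] n /=; first by rewrite addn0; exact: bN.
rewrite doubleS => le_N; have [-> _] := kX_hpart n (iter m kX b).
by rewrite IHm ?kX0 // !addSn -!addnS.
Qed.

Lemma iter_kX_D m b c : iter m kX (b + c) = iter m kX b + iter m kX c.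
Proof. by elim: m => //= m ->; exact: kX_D. Qed.

Lemma iter_kX0 m : iter m kX 0 = 0.
Proof. by elim: m => //= m ->; exact: kX0. Qed.

Lemma iter_kX_infl m a b : iter m kX (infl a * b) = infl a * iter m kX b.
Proof. by elim: m => //= m ->; exact: kX_infl_mul. Qed.

(** A polynomial of degree [d] in [X] with inflated coefficients and a scalar unit as leading one;
    the absence of [Y] makes leading coefficients of products computable. *)
Fixpoint xmonic d (Z : H) : Prop :=
  if d is d'.+1 then exists a Z', Z = infl a + X * Z' /\ xmonic d' Z'
  else exists2 u, u != 0 & Z = scal _ u.

Lemma monic_top d Z r : xmonic d Z -> kX r = 0 -> iter d.+1 kX (Z * r) = 0.
Proof.
elim: d Z => [|d IHd] Z /=; first by move=> [u _ ->] r0; rewrite kX_scal r0 mulr0.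
move=> [a [Z' [-> mZ']]] r0; rewrite -!iterS iterSr mulrDl kX_D kX_infl_mul r0 mulr0 add0r.
by rewrite -mulrA kX_X; exact: IHd.
Qed.

Section Descent.
Variable V : H -> Prop.
Hypotheses (V0 : V 0) (VB : forall b c, V b -> V c -> V (b - c))
  (VX : forall b, V b -> V (kX b)) (VA : forall a b, V b -> V (infl a * b)).

Lemma V_iter m b : V b -> V (iter m kX b).
Proof. by move=> Vb; elim: m => //= m; exact: VX. Qed.

(** The coefficient extracted from [Z * b] is the unit times [b] plus inflated multiples of iterates
    of [kX] on [kX b], which already lie in [V]. *)
Lemma monic_step d Z b : xmonic d Z -> V (kX b) -> V (iter d kX (Z * b)) -> V b.
Proof.
elim: d Z => [|d IHd] Z.
  move=> [u u0 ->] _ /= Vu; have := VA (scal _ u^-1) Vu.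
  by rewrite [infl _]pull_scal mulrA -scalM mulVf // scal1 mul1r.
move=> [a [Z' [-> mZ']]] Vb; rewrite iterSr mulrDl kX_D kX_infl_mul -mulrA kX_X.
rewrite iter_kX_D iter_kX_infl => VE; apply: (IHd _ mZ' Vb).
have := VB VE (VA a (V_iter d Vb)); by rewrite addrC addKr.
Qed.

(* Multiplication by a monic Z is injective modulo V: the leading
   coefficients of Z b and b agree up to a unit. *)
Lemma monic_descent d Z b : xmonic d Z -> V (iter d kX (Z * b)) -> V b.
Proof.
move=> mZ; have [N] := kX_nilp b; elim: N b => [|N IHN] b bN VE; first by rewrite [b]bN.
apply: (monic_step mZ _ VE); apply: IHN; first by rewrite -iterSr.
pose r := infl (resA b) + Y * infl (kY b).
have r0 : kX r = 0 by apply: proj1 (kX_unique (a0 := resA b) (a1 := kY b) _); rewrite mulr0 addr0.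
have bE : b = r + X * kX b by exact: kunnethE.
have := VX VE; rewrite -iterS {1}bE mulrDr iter_kX_D (monic_top mZ r0) add0r.
by rewrite mulrA -X_comm -mulrA iterSr kX_X.
Qed.

End Descent.

Lemma iter_kX_XX m b : iter m kX (X ^+ m * b) = b.
Proof.
by elim: m b => [|m IHm] b; rewrite ?mul1r // exprS -mulrA iterSr kX_X IHm.
Qed.

Lemma monicX j d Z : xmonic d Z -> xmonic (j + d) (X ^+ j * Z).
Proof.
move=> mZ; elim: j => [|j IHj]; first by rewrite mul1r.
by rewrite addSn; exists 0, (X ^+ j * Z); rewrite rmorph0 add0r exprS mulrA.
Qed.

End One.

Section Natural.
Variables (A B : finGroupType) (f : A -> B).
Hypothesis fM : {morph f : x y / (x * y)%g}.

Definition pmap (u : A * 'F_p) : B * 'F_p := (f u.1, u.2).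
Lemma pmapM : {morph pmap : x y / (x * y)%g}.
Proof. by move=> x y; rewrite /pmap fM. Qed.

Lemma pmap_infl (a : cohomology k B) :
  cohomology_pull pmapM (infl p a) = infl p (cohomology_pull fM a).
Proof.
have wM : {morph (fun u : A * 'F_p => f u.1) : x y / (x * y)%g} by move=> x y; rewrite -fM.
by rewrite /= (pull_comp _ _ wM) // (pull_comp _ _ wM).
Qed.

Lemma pmap_X : cohomology_pull pmapM (X k p B) = X k p A.
Proof. exact: bet_pull. Qed.

Lemma pmap_Y : cohomology_pull pmapM (Y k p B) = Y k p A.
Proof.
rewrite /Y /ycl pull_cl; last exact: Y_cocyc.
by congr cl; apply/funext => -[|x [|y s]].
Qed.

Lemma pmap_kX b : kX (cohomology_pull pmapM b) = cohomology_pull pmapM (kX b)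
  /\ kY (cohomology_pull pmapM b) = cohomology_pull fM (kY b).
Proof.
apply: (kX_unique (a0 := cohomology_pull fM (resA b))).
by rewrite {1}(kunnethE b) !rmorphD !rmorphM /= !pmap_infl pmap_X pmap_Y.
Qed.

Lemma pmap_iter m b : iter m (@kX A) (cohomology_pull pmapM b) = cohomology_pull pmapM (iter m (@kX B) b).
Proof. by elim: m => //= m ->; have [-> _] := pmap_kX (iter m (@kX B) b). Qed.

Lemma pmap_resA (b : cohomology k (B * 'F_p)%type) :
  resA (cohomology_pull pmapM b) = cohomology_pull fM (resA b).
Proof.
have wM : {morph (fun a : A => (f a, 1%g) : B * 'F_p) : x y / (x * y)%g}.
  by move=> x y; rewrite fM; congr (_, _); rewrite mulg1.
by rewrite /= (pull_comp _ _ wM) // (pull_comp _ _ wM).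
Qed.

End Natural.

Lemma pull_const_homog1 (A B : finGroupType) (f : A -> B) (fM : {morph f : x y / (x * y)%g})
    (a : cohomology k B) : (forall x, f x = 1%g) -> homog 1 a -> cohomology_pull fM a = 0.
Proof.
move=> f1 /homogP[g [gz -> g1]]; rewrite pull_cl // -cl0; congr cl; apply/funext => s.
have [_ dg] := gz; rewrite /pull.
case: s => [|x [|y s]]; [by rewrite -g1 | | by rewrite -g1 /part].
have E : bar_diff g [:: 1%g; 1%g] = g [:: 1%g].
  by rewrite bar_diff_cons !inner_consE inner_nil /shift /= mulg1; ring.
by rewrite /= f1 -E dg.
Qed.

(** By degree, the square is [Y] times a degree-one class of [A] plus a scalar multiple of [X]. It
    is natural in [A], and the constant endomorphism of [A], which fixes [Y], kills classes of
    degree one. *)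
Lemma Y_sqr (A : finGroupType) : exists c : k, Y k p A * Y k p A = X k p A * scal _ c.
Proof.
set y := Y k p A.
have yy : homog 2 (y * y) by exact: homogM (Y_homog _ _ _) (Y_homog _ _ _).
have [x0 y1] := kX_homog yy; have [c cE] := homog0_scal x0; exists c.
have oneM : {morph (fun _ : A => 1%g : A) : x y / (x * y)%g} by move=> *; rewrite mulg1.
have y1E : kY (y * y) = 0.
  have [_ E] := pmap_kX oneM (y * y).
  by move: E; rewrite rmorphM /= pmap_Y (pull_const_homog1 _ _ y1).
rewrite [LHS]kunnethE y1E rmorph0 mulr0 addr0 cE.
by rewrite rmorphM resA_Y // mul0r rmorph0 add0r.
Qed.

Section Frobenius.
Variable A : finGroupType.
Local Notation AZ := (A * 'F_p)%type.

Lemma odd_mul_sqr (a : cohomology k A) : hsign a = - a ->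
  exists c : k, (Y k p A * infl p a) ^+ 2 = X k p A * infl p (scal _ c * (a * a)).
Proof.
move=> ao; have [c cE] := Y_sqr A; exists (- c).
rewrite expr2 mulrA -[Y k p A * infl p a * Y k p A]mulrA.
have -> : infl p a * Y k p A = - (Y k p A * infl p a) by rewrite Y_infl ao rmorphN mulNr opprK.
rewrite mulrN mulNr !mulrA cE -!mulrA !rmorphM [infl p (scal _ _)]pull_scal.
by rewrite rmorphN mulNr mulrN.
Qed.

(** For [p = 2] this is the formula for the square; for odd [p] the square is already 0, because the
    odd class [a] has square 0. *)
Lemma odd_mul_frob (a : cohomology k A) : hsign a = - a ->
  exists2 b, hsign b = b & (Y k p A * infl p a) ^+ p = X k p A * infl p b.
Proof.
move=> ao; have [c cE] := odd_mul_sqr ao.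
case: (eqVneq p 2) => [p2|p2]; first exists (scal _ c * (a * a)).
- by rewrite hsignM hsign_scal hsignM ao mulrNN.
- by rewrite -cE; congr (_ ^+ _).
have k2 : (2%:R : k) != 0.
  apply/eqP => k2; have : 2 \in [pchar k] by rewrite inE k2 eqxx.
  by rewrite (pcharf_eq char_k) inE eq_sym (negPf p2).
exists 0; first by rewrite -(scal0 k A) hsign_scal.
rewrite -[in X in _ ^+ X](subnK (prime_gt1 p_prime)) exprD cE odd_sqr //.
by rewrite mulr0 !rmorph0 !mulr0.
Qed.

(** The [p]-th power is additive on even classes and turns each [Y] term into [X] times an inflated
    class. So an even class with a unit as its leading coefficient becomes monic in the sense of
    [xmonic]. *)
Lemma monic_frob n (T : evc k AZ) u : u != 0 ->
  iter n (@kX A) (ev_val T) = scal _ u -> xmonic (p * n) (ev_val T ^+ p).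
Proof.
move=> u0; elim: n T => [|n IHn] T.
  by rewrite muln0 /= => ->; exists (u ^+ p); rewrite ?expf_neq0 // rmorphXn.
rewrite iterSr => TE; set t := ev_val T.
have [kXs kYs] := kX_sign t; rewrite evcP in kXs kYs.
have X_ev := X_even k p A.
have rs : hsign (infl p (resA t)) = infl p (resA t).
  by rewrite infl_sign -[hsign (resA t)]pull_hsign evcP.
have ys : hsign (Y k p A * infl p (kY t)) = Y k p A * infl p (kY t).
  by rewrite hsignM Y_sign infl_sign mulNr -mulrN -rmorphN -kYs.
pose T0 := mkev rs; pose T1 := mkev ys; pose T2 := mkev (esym kXs); pose XX := mkev X_ev.
have TT : T = T0 + T1 + XX * T2 by apply: ev_inj; exact: kunnethE.
have pe := evc_char AZ char_k.
have E : t ^+ p = infl p (resA t ^+ p) + (Y k p A * infl p (kY t)) ^+ p + X k p A ^+ p * kX t ^+ p.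
  transitivity (ev_val (T0 ^+ p + T1 ^+ p + XX ^+ p * T2 ^+ p)).
    by rewrite /t -evX -exprMn -!(frobD _ _ pe) -TT.
  by rewrite evD evD evM (evX T0) (evX T1) (evX XX) (evX T2) rmorphXn.
have ko : hsign (kY t) = - kY t by rewrite {2}kYs opprK.
have [b _ bE] := odd_mul_frob ko.
have mT2 : xmonic (p * n) (kX t ^+ p) by apply: (IHn T2).
have [q pq] : exists q, p = q.+2.
  by have := prime_gt1 p_prime; case: (p) => [|[|q]] // _; exists q.
have -> : (p * n.+1)%N = (q + p * n).+2 by rewrite mulnS {1}pq !addSn.
have XE : X k p A ^+ p = X k p A * (X k p A * X k p A ^+ q).
  by rewrite -!exprS; congr (_ ^+ _).
exists (resA t ^+ p), (infl p b + X k p A * (X k p A ^+ q * kX t ^+ p)).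
split; first by rewrite E bE XE mulrDr addrA !mulrA.
by exists b, (X k p A ^+ q * kX t ^+ p); split=> //; exact: monicX.
Qed.

End Frobenius.
End KunnethOperators.

Lemma prod_nseq (R : pzSemiRingType) n (x : R) : \prod_(b <- nseq n x) b = x ^+ n.
Proof. by elim: n => [|n IHn]; rewrite ?big_nil // big_cons IHn exprS. Qed.

Lemma pullM (k : fieldType) (aT gT : finGroupType) (phi : aT -> gT)
    (phiM : {morph phi : x y / (x * y)%g}) (x y : cohomology k gT) :
  cohomology_pull phiM (x * y) = cohomology_pull phiM x * cohomology_pull phiM y.
Proof. exact: rmorphM. Qed.

Lemma pullX (k : fieldType) (aT gT : finGroupType) (phi : aT -> gT)
    (phiM : {morph phi : x y / (x * y)%g}) (x : cohomology k gT) n :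
  cohomology_pull phiM (x ^+ n) = cohomology_pull phiM x ^+ n.
Proof. exact: rmorphXn. Qed.

(** * Classes of central characters *)

Section FlatSphere.
Variables (k : fieldType) (p : nat).
Hypotheses (p_prime : prime p) (char_k : p \in [pchar k]).

Lemma idFM (g h : 'F_p) : id (g * h)%g = id g + id h :> 'F_p. Proof. by []. Qed.
Definition xF : cohomology k 'F_p := bet k (gT := 'F_p) (mu := id) idFM.

Local Notation T := 'I_1.
Lemma T1 (x : T) : x = 1%g. Proof. by apply: val_inj; case: x => -[]. Qed.
Local Notation TZ := (T * 'F_p)%type.

Lemma sndMor : {morph (@snd T 'F_p) : x y / (x * y)%g}. Proof. by []. Qed.

Lemma xF_snd : cohomology_pull sndMor xF = X k p T.
Proof. exact: bet_pull. Qed.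

Lemma X_inZ : cohomology_pull (@inZM p T) (X k p T) = xF.
Proof. exact: bet_pull. Qed.

(** The product decomposition over the trivial group ['I_1], whose classes of positive degree
    vanish, leaves only powers of [X] in even degree. *)
Lemma TZ_homog n (b : cohomology k TZ) : homog n.*2 b -> exists u, b = X k p T ^+ n * scal _ u.
Proof.
elim: n b => [|n IHn] b bn; first by have [u ->] := homog0_scal bn; exists u; rewrite mul1r.
have [Xn Yn] := kX_homog p_prime char_k bn; have [u uE] := IHn _ Xn.
exists u; rewrite {1}(kunnethE p_prime char_k b) uE.
rewrite (trivial_homog T1 (n := n.*2.+1) (a := resA b)); last exact: pull_homog.
rewrite (trivial_homog T1 Yn) !rmorph0 mulr0 !add0r exprS mulrA //.
Qed.

Lemma F_homog n (b : cohomology k 'F_p) : homog n.*2 b -> exists u, b = xF ^+ n * scal _ u.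
Proof.
move=> bn; have [u uE] := TZ_homog (pull_homog sndMor bn).
exists u; have := congr1 (cohomology_pull (@inZM p T)) uE.
have iM : {morph (id : 'F_p -> 'F_p) : x y / (x * y)%g} by [].
rewrite rmorphM rmorphXn /= X_inZ pull_scal (pull_comp _ _ iM) //.
by rewrite pull_id.
Qed.

Lemma xF_pow n : xF ^+ n <> 0.
Proof.
move/(congr1 (cohomology_pull sndMor)); rewrite rmorphXn rmorph0 /= xF_snd.
elim: n => [|n IHn]; first exact: cohomology_neq0.
by rewrite exprS => /(X_regular p_prime char_k).
Qed.

Lemma xF_res (J : {group 'F_p}) : (forall x, x \in J -> x = 1%g) -> res k J xF = 0.
Proof.
move=> J1; have zM (g h : subg_of J) : (0 : 'F_p) = 0 + 0 by rewrite addr0.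
rewrite [LHS](@bet_pull k p _ _ _ (fun _ _ => erefl) id idFM (fun _ => 0) zM).
  exact: bet_zero.
by move=> g; exact: J1 (subgP g).
Qed.

Variables (O : finType) (t : O -> O -> k).
Hypotheses (tsq : forall a b, t a b * t a b = 1) (tanti : forall a b, a != b -> t b a = - t a b).

Definition flat_sphere (gT : finGroupType) (mu : gT -> 'F_p)
    (muM : forall g h, mu (g * h)%g = mu g + mu h) : sphere k p gT :=
  @Sphere k p gT O t (fun _ a => a) (fun g _ => mu g) tsq tanti
  (fun _ _ _ => erefl) (fun _ => erefl) (fun g h _ => muM g h) (fun _ _ _ => erefl).

(** For the identity character of F_p the Euler class is, by degree, a multiple of a power of [xF].
    The multiple is not 0: cells other than the top one have trivial stabilisers, so a power of
    [xF], which does not vanish, is divisible by the Euler class. Other characters follow by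
    pullback. *)
Lemma flat_unit : exists2 u, u != 0 &
  forall (gT : finGroupType) (mu : gT -> 'F_p) muM,
    eclass (flat_sphere (mu := mu) muM) = bet k (mu := mu) muM ^+ #|O| * scal _ u.
Proof.
pose S := flat_sphere (gT := 'F_p) (mu := id) idFM.
have Sh : homog #|O|.*2 (eclass S) by rewrite -muln2; exact: (eclass_homog S).
have [u uE] := F_homog Sh; exists u.
  apply/eqP => u0; have [|b c|e] := @eclass_prod k p 'F_p S (nseq (#|O| * 2) xF).
  - by rewrite size_nseq.
  - rewrite mem_nseq => /andP[_ /eqP ->] cT; apply: xF_res => x.
    rewrite inE => /eqP xc; apply/eqP/negP => nx.
    case/negP: cT; apply/eqP/ffunP => o; rewrite ffunE.
    have := congr1 (fun c : cell p (pts S) => c o) xc; rewrite ffunE /=.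
    case: (c o) => [[b' i]|] //= [] /eqP.
    by rewrite -subr_eq0 addrAC subrr add0r.
  by rewrite prod_nseq uE u0 rmorph0 mulr0 mul0r; exact: xF_pow.
move=> gT mu muM.
have mM : {morph mu : x y / (x * y)%g} by exact: muM.
have E := congr1 (cohomology_pull mM) uE.
transitivity (cohomology_pull mM (eclass S)).
  by rewrite eclass_pull; apply: eclass_ext.
have xE : cohomology_pull mM xF = bet k muM by exact: bet_pull.
apply: etrans E _; move: xF xE => x xE.
by rewrite pullM pullX pull_scal xE.
Qed.

End FlatSphere.

Section Theta.
Variables (k : fieldType) (p : nat) (gT : finGroupType).
Hypotheses (p_prime : prime p) (char_k : p \in [pchar k]) (pG : p.-group [set: gT]).
Variables (C : {group gT}) (lam : gT -> 'F_p).
Hypotheses (CZ : forall c g : gT, c \in C -> (c * g)%g = (g * c)%g)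
  (lamM : forall c d, c \in C -> d \in C -> lam (c * d)%g = lam c + lam d).

Lemma CN g : g \in 'N(C)%g.
Proof.
apply/normP/setP => c; apply/imsetP/idP => [[d dC ->]|cC].
  by rewrite conjgE (CZ _ dC) mulKg.
by exists c; rewrite // conjgE (CZ _ cC) mulKg.
Qed.

Lemma cosM x y : coset C (x * y)%g = (coset C x * coset C y)%g.
Proof. by rewrite morphM ?CN. Qed.

Local Notation Q := (coset_of C).

Lemma coset_sqr (q : Q) : p != 2 -> q = q^-1%g -> q = 1%g.
Proof.
move=> p2 qq; apply/eqP; apply: contraNT p2 => nq.
have q2 : (q ^+ 2 = 1)%g by rewrite expgS expg1 {1}qq mulVg.
have := nt_prime_order (isT : prime 2) q2 nq.
have -> : q = coset C (repr q) by rewrite coset_reprK.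
move=> ord2; have : p.-nat #[coset C (repr q)]%g.
  apply: pnat_dvd (morph_order _ (CN _)) _; apply: pnat_dvd _ pG.
  by apply: order_dvdG; rewrite inE.
by rewrite ord2 pnatE // inE /= eq_sym.
Qed.

(** For odd [p] this chooses between [q] and its inverse, which differ unless [q] is 1; for [p = 2]
    signs are trivial in k. As [ttour] depends only on [a^-1 * b], translations preserve it. *)
Definition tau (q : Q) : k :=
  if (p == 2) || (enum_rank q < enum_rank q^-1%g)%N then 1 else -1.

Definition ttour (a b : Q) : k := tau (a^-1 * b)%g.

Lemma ttour_sq a b : ttour a b * ttour a b = 1.
Proof. by rewrite /ttour /tau; case: ifP; rewrite ?mulr1 // mulrNN mulr1. Qed.

Lemma ttour_anti a b : a != b -> ttour b a = - ttour a b.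
Proof.
move=> ab; rewrite /ttour; set q := (a^-1 * b)%g.
have -> : (b^-1 * a)%g = q^-1%g by rewrite invMg invgK.
have q1 : q != 1%g by rewrite -eq_mulVg1.
rewrite /tau invgK; case: eqP => [p2|/eqP p2] /=.
  have k2 : (2%:R : k) = 0 by move: char_k; rewrite p2 inE => /andP[_ /eqP].
  by apply/eqP; rewrite -subr_eq0 opprK -k2.
case: ltngtP => [_|_|/val_inj/enum_rank_inj qq]; rewrite ?opprK //.
by rewrite (coset_sqr p2 (esym qq)) eqxx in q1.
Qed.

Definition tlact g (a : Q) : Q := (coset C g * a)%g.

Lemma tlactM g h a : tlact (g * h)%g a = tlact g (tlact h a).
Proof. by rewrite /tlact cosM mulgA. Qed.

Lemma tlact1 a : tlact 1%g a = a.
Proof. by rewrite /tlact morph1 mul1g. Qed.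

(** The discrepancy in [C] between [g] times the representative of [a] and the representative of the
    translated coset. Applying [lam] gives the cocycle of the monomial representation induced from
    [lam]. *)
Definition tkel g (a : Q) : gT := ((repr (tlact g a))^-1 * g * repr a)%g.

Lemma tkelC g a : tkel g a \in C.
Proof.
apply: coset_idr; first exact: CN.
have iE x : coset C x^-1%g = (coset C x)^-1%g by rewrite morphV ?CN.
by rewrite !cosM iE !coset_reprK /tlact invMg mulgKV mulVg.
Qed.

Definition tkap g a : 'F_p := lam (tkel g a).

Lemma tkapM g h a : tkap (g * h)%g a = tkap g (tlact h a) + tkap h a.
Proof.
rewrite /tkap -lamM ?tkelC //; congr lam; rewrite /tkel tlactM !mulgA.
by rewrite mulgK.
Qed.

Lemma ttour_inv g a b : ttour (tlact g a) (tlact g b) = ttour a b.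
Proof. by rewrite /ttour /tlact invMg !mulgA mulgKV. Qed.

Definition tsphere : sphere k p gT :=
  Sphere ttour_sq ttour_anti tlactM tlact1 tkapM ttour_inv.

Definition theta : evc k gT := mkev (eclass_even tsphere).

Lemma theta_homog : homog #|{: Q}|.*2 (ev_val theta).
Proof. by rewrite -muln2; exact: (eclass_homog tsphere). Qed.

Lemma card_coset_pow : exists m, #|{: Q}| = (p ^ m)%N.
Proof.
have : p.-nat #|{: Q}|.
  have -> : #|{: Q}| = #|[set: gT] / C|%g.
    rewrite -cardsT; congr #|pred_of_set _|; apply/setP => q; rewrite inE.
    by rewrite -(coset_reprK q) mem_quotient ?inE.
  exact: quotient_pgroup.
by move/p_natP => [m ->]; exists m.
Qed.

Lemma tlactC c a : c \in C -> tlact c a = a.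
Proof. by move=> cC; rewrite /tlact coset_id // mul1g. Qed.

Lemma tkapC c a : c \in C -> tkap c a = lam c.
Proof.
move=> cC; by rewrite /tkap /tkel tlactC // -mulgA (CZ _ cC) mulKg.
Qed.

(** Elements of [C] fix every coset and rotate every circle by [lam], so the sphere becomes a flat
    one. *)
Lemma theta_unit : exists2 u, u != 0 & forall (aT : finGroupType) (phi : aT -> gT)
    (phiM : {morph phi : x y / (x * y)%g}) muM,
  (forall x, phi x \in C) ->
  cohomology_pull phiM (ev_val theta)
    = bet k (mu := fun x => lam (phi x)) muM ^+ #|{: Q}| * scal _ u.
Proof.
have [u u0 uE] := flat_unit p_prime char_k ttour_sq ttour_anti; exists u => // aT phi phiM muM phiC.
rewrite -uE [LHS]eclass_pull; apply: eclass_ext => x a; first exact: tlactC.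
exact: tkapC.
Qed.

Section Central.
Variable c : gT.
Hypotheses (cC : c \in C) (cp : (c ^+ p = 1)%g).

Definition mc (u : gT * 'F_p) : gT := (u.1 * c ^+ u.2)%g.

Lemma expF (i j : 'F_p) : (c ^+ (i * j)%g = c ^+ i * c ^+ j)%g.
Proof.
have X m : (c ^+ (m %% (Zp_trunc (pdiv p)).+2) = c ^+ m)%g.
  by rewrite (Fp_size p_prime) [in RHS](divn_eq m p) expgD mulnC expgM cp expg1n mul1g.
by rewrite -expgD -[RHS]X.
Qed.

Lemma mcM : {morph mc : x y / (x * y)%g}.
Proof.
move=> x y; rewrite /mc expF /= !mulgA; congr (_ * _)%g; rewrite -!mulgA; congr (_ * _)%g.
by apply/esym/CZ; rewrite groupX.
Qed.

Lemma lamX (i : nat) : lam (c ^+ i)%g = lam c *+ i.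
Proof.
elim: i => [|i IHi]; last by rewrite expgS lamM ?groupX // IHi mulrS.
by apply: (addIr (lam 1%g)); rewrite expg0 mulr0n add0r -lamM ?group1 // mulg1.
Qed.

Lemma theta_invariant : lam c = 0 ->
  cohomology_pull mcM (ev_val theta) = infl p (ev_val theta).
Proof.
move=> lc0; rewrite [LHS]eclass_pull [RHS]eclass_pull.
have ci (i : 'F_p) : (c ^+ i)%g \in C by rewrite groupX.
apply: eclass_ext => -[g i] a; first by rewrite /mc /= tlactM (tlactC _ (ci i)).
by rewrite /mc /= tkapM (tlactC _ (ci i)) (tkapC _ (ci i)) lamX lc0 mul0rn addr0.
Qed.

Lemma Fp_natr (i : 'F_p) : (1 : 'F_p) *+ i = i.
Proof. by rewrite -[RHS]natr_Zp. Qed.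

(** The coefficient of [X] to the power [#|{: Q}|] has degree 0, hence is a scalar; it can be read
    off after restriction to the factor of order [p], where [theta_unit] gives the unit [u]. *)
Lemma theta_monic (A : finGroupType) (phi : A * 'F_p -> gT)
    (phiM : {morph phi : x y / (x * y)%g}) :
  (forall i, phi (1%g, i) = (c ^+ i)%g) -> lam c = 1 ->
  xmonic (p * #|{: Q}|) (cohomology_pull phiM (ev_val theta) ^+ p).
Proof.
move=> phi1 lc1; have [u u0 uE] := theta_unit.
apply: (@monic_frob k p p_prime char_k A #|{: Q}| (epull phiM theta) u u0).
pose N := #|{: Q}|; have hN : homog N.*2 (cohomology_pull phiM (ev_val theta)).
  by apply: pull_homog; exact: theta_homog.
have : exists u', iter N (@kX k p p_prime char_k A) (cohomology_pull phiM (ev_val theta)) = scal _ u'.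
  apply: homog0_scal; elim: (N) (cohomology_pull _ _) hN => [|n IHn] b bn //.
  by rewrite iterSr; apply: IHn; have [] := kX_homog p_prime char_k bn.
move=> [u' u'E]; rewrite /= u'E; congr scal.
have oneM : {morph (fun _ : 'I_1 => 1%g : A) : x y / (x * y)%g} by move=> *; rewrite mulg1.
have := pmap_iter p_prime char_k oneM N (cohomology_pull phiM (ev_val theta)).
rewrite u'E pull_scal.
have wM : {morph (fun v : 'I_1 * 'F_p => (c ^+ v.2)%g) : x y / (x * y)%g}.
  by move=> x y; exact: expF.
have lM (g h : 'I_1 * 'F_p) : lam (c ^+ (g * h)%g.2)%g = lam (c ^+ g.2)%g + lam (c ^+ h.2)%g.
  by rewrite expF lamM ?groupX.
rewrite (pull_comp _ _ wM); last by move=> [x i]; rewrite /pmap /= phi1.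
rewrite (uE _ _ wM lM); last by move=> x; rewrite groupX.
rewrite (bet_ext k (mu' := @snd 'I_1 'F_p) lM (@sndM p 'I_1)); last first.
  by move=> g; rewrite lamX lc1 Fp_natr.
rewrite iter_kX_XX => /eqP; rewrite -subr_eq0 -rmorphB => /eqP/scal_eq0/eqP.
by rewrite subr_eq0 => /eqP.
Qed.

End Central.
End Theta.

(** * Elementary abelian groups *)

Section Bockstein.
Variables (k : fieldType) (p : nat).
Hypotheses (p_prime : prime p) (char_k : p \in [pchar k]).

Definition betE (gT : finGroupType) (mu : gT -> 'F_p) muM : evc k gT :=
  mkev (eclass_even (circle k (mu := mu) muM)).

Lemma epull_betE (aT gT : finGroupType) (phi : aT -> gT) (phiM : {morph phi : x y / (x * y)%g})
    (mu : gT -> 'F_p) muM (mu' : aT -> 'F_p) mu'M : (forall g, mu (phi g) = mu' g) ->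
  epull phiM (betE (mu := mu) muM) = betE (mu := mu') mu'M.
Proof. by move=> E; apply: ev_inj; exact: bet_pull. Qed.

Lemma frobDn (R : comNzRingType) (x y : R) j : p \in [pchar R] ->
  (x + y) ^+ (p ^ j) = x ^+ (p ^ j) + y ^+ (p ^ j).
Proof.
move=> pR; elim: j => [|j IHj]; first by rewrite expn0 !expr1.
by rewrite expnSr !exprM IHj frobD.
Qed.

(** An abstract closed set in place of the subring generated by the Bocksteins: later it is
    instantiated by conditions such as having a power that lifts to a larger group. *)
Record poly_closed (gT : finGroupType) (P : evc k gT -> Prop) : Prop := PolyClosed {
  pc_scal : forall c, P (escal gT c);
  pc_bet : forall mu muM, P (betE (mu := mu) muM);
  pc_add : forall x y, P x -> P y -> P (x + y);
  pc_mul : forall x y, P x -> P y -> P (x * y)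
}.

Lemma pc_exp (gT : finGroupType) (P : evc k gT -> Prop) : poly_closed P ->
  forall x n, P x -> P (x ^+ n).
Proof.
move=> cP x n Px; elim: n => [|n IHn]; last by rewrite exprS; exact: pc_mul.
have -> : x ^+ 0 = escal gT 1 by apply: ev_inj; rewrite /= scal1.
exact: pc_scal.
Qed.

Lemma even_hpart_sum (gT : finGroupType) (x : evc k gT) :
  (forall n, homog n.+1 (hpart n.+1 (ev_val x)) -> hpart n.+1 (ev_val x) = 0) ->
  exists c, x = escal gT c.
Proof.
move=> x0; have [c cE] := homog0_scal (homog_hpart 0 (ev_val x)); exists c; apply: ev_inj => /=.
rewrite -cE [LHS](@hpart_sum _ _ _ 1) ?big_ord1 // => -[|n] // _.
exact/x0/homog_hpart.
Qed.

Lemma abelem_factor (gT : finGroupType) : p.-abelem [set: gT] -> (1 < #|gT|)%N ->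
  exists (A : finGroupType) (phi : A * 'F_p -> gT) (psi : gT -> A * 'F_p),
    [/\ {morph phi : x y / (x * y)%g}, {morph psi : x y / (x * y)%g},
        cancel psi phi, p.-abelem [set: A] & (#|A| < #|gT|)%N].
Proof.
move=> abG G1; have cG : abelian [set: gT] := abelem_abelian abG.
have comm (x y : gT) : (x * y = y * x)%g by apply: (centsP cG); rewrite inE.
have [x x1] : exists x : gT, x != 1%g.
  apply/existsP; rewrite -[X in is_true X]negbK negb_exists; apply/negP => /forallP H.
  suff : (#|gT| <= 1)%N by rewrite leqNgt G1.
  rewrite -cardsT -(cards1 (1%g : gT)); apply: subset_leq_card.
  by apply/subsetP => y _; rewrite inE -[_ == _]negbK; exact: H.
have ox := abelem_order_p abG (in_setT x) x1.
have /splitsP[K /complP[tiK GE]] := abelem_splits abG (subsetT <[x]>%G).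
pose A := subg_of K; pose phi (u : A * 'F_p) := (sgval u.1 * x ^+ u.2)%g.
have xX (i j : 'F_p) : (x ^+ (i * j)%g = x ^+ i * x ^+ j)%g.
  have X m : (x ^+ (m %% (Zp_trunc (pdiv p)).+2) = x ^+ m)%g.
    rewrite (Fp_size p_prime) [in RHS](divn_eq m p) expgD mulnC expgM.
    by rewrite -ox expg_order expg1n mul1g.
  by rewrite -expgD -[RHS]X.
have phiM : {morph phi : u v / (u * v)%g}.
  move=> [a i] [b j]; rewrite /phi /= xX !mulgA; congr (_ * _)%g.
  by rewrite -!mulgA; congr (_ * _)%g; exact: comm.
have phi_inj : injective phi.
  suff H u : phi u = 1%g -> u = 1%g.
    move=> u v E; apply/eqP; rewrite eq_mulgV1; apply/eqP/H.
    rewrite phiM E -phiM mulgV; rewrite /phi /= mul1g; exact: expg0.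
  case: u => a i; rewrite /phi /= => E.
  have aE : sgval a = (x ^+ i)^-1%g by apply/eqP; rewrite eq_mulgV1 invgK E.
  have a1 : sgval a = 1%g.
    apply/set1gP; rewrite -tiK inE subgP andbT aE groupV mem_cycle //.
  have i0 : i = 0%g.
    apply: val_inj => /=; move: E; rewrite a1 mul1g => /eqP.
    rewrite -order_dvdn ox => /dvdnP[[|m] mE]; first by rewrite mE.
    by have := ltn_ord i; rewrite mE [X in (_ < X)%N](Fp_size p_prime) mulSn ltnNge leq_addr.
  by rewrite i0; congr (_, _); apply: val_inj.
have cardE : #|gT| = #|{: A * 'F_p}|.
  rewrite card_prod card_ord (Fp_size p_prime).
  have : #|(<[x]> * K)%g| = #|gT| by rewrite GE cardsT.
  rewrite TI_cardMg // => <-.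
  have -> : #|A| = #|K| by rewrite -cardsT -(card_isog (isog_subg K)).
  by rewrite mulnC -[#|<[x]>|]/#[x]%g ox.
have phi_bij : bijective phi by apply: inj_card_bij; rewrite ?cardE.
have [psi phiK psiK] := phi_bij.
exists A, phi, psi; split=> //.
- by move=> u v; apply: phi_inj; rewrite phiM !psiK.
- apply/abelemP => //; split.
    by apply/centsP => a _ b _; apply: val_inj; exact: comm.
  move=> a _; apply: val_inj => /=.
  have -> : sgval (a ^+ p)%g = (sgval a ^+ p)%g by elim: (p) => // n IHn; rewrite !expgS -IHn.
  by have /abelemP[//|_ ->] := abG; rewrite ?inE.
rewrite cardE card_prod card_ord (Fp_size p_prime) -{1}[#|A|]muln1 ltn_mul2l prime_gt1 // andbT.
by apply/card_gt0P; exists 1%g.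
Qed.

(** Split off a factor of order [p] and decompose [z] by [kunnethE]. The [p]-th power trades the [Y]
    term for [X] times a class of [A]; the induction runs over the order of the group for the
    classes of [A] and over the nilpotency of [kX] for the quotient by [X]. *)
Lemma bockstein_power (gT : finGroupType) (P : evc k gT -> Prop) :
  p.-abelem [set: gT] -> poly_closed P -> forall b, exists j, P (b ^+ (p ^ j)).
Proof.
have [m] := ubnP #|gT|; elim: m => // m IHm in gT P *; rewrite ltnS => le_m abG cP b.
case: (leqP #|gT| 1) => [G1|G1].
  have g1 (x : gT) : x = 1%g.
    apply/eqP; apply: contraTT G1 => nx; rewrite -ltnNge.
    by apply: leq_trans (max_card (mem [set 1%g; x])); rewrite cards2 eq_sym nx.
  have [n|c ->] := @even_hpart_sum gT b; first exact: (trivial_homog g1).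
  by exists 0%N; exact: pc_scal.
have [A [phi [psi [phiM psiM psiK abA ltA]]]] := abelem_factor abG G1.
have IHA : forall PA, poly_closed PA -> forall a : evc k A, exists j, PA (a ^+ (p ^ j)).
  by move=> PA cPA a; apply: IHm => //; exact: leq_trans ltA le_m.
pose Q (z : evc k (A * 'F_p)%type) := P (epull psiM z).
have cQ : poly_closed Q.
  split=> [c|mu muM|x y|x y]; rewrite /Q.
  - have -> : epull psiM (escal _ c) = escal _ c by apply: ev_inj; exact: pull_scal.
    exact: pc_scal.
  - have mM g h : mu (psi (g * h)%g) = mu (psi g) + mu (psi h) by rewrite psiM muM.
    by rewrite (epull_betE psiM muM mM) //; exact: pc_bet.
  - by rewrite rmorphD; exact: pc_add.
  - by rewrite rmorphM; exact: pc_mul.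
suff H : forall z, exists j, Q (z ^+ (p ^ j)).
  have [j b0] := H (epull phiM b); exists j; move: b0; rewrite /Q -rmorphXn.
  have idM : {morph (id : gT -> gT) : x y / (x * y)%g} by [].
  suff -> : epull psiM (epull phiM (b ^+ (p ^ j))) = b ^+ (p ^ j) by [].
  by apply: ev_inj; rewrite /= (pull_comp _ _ idM) // pull_id.
pose PA (a : evc k A) := Q (epull (@fstM p A) a).
have cPA : poly_closed PA.
  split=> [c|mu muM|x y|x y]; rewrite /PA.
  - have -> : epull (@fstM p A) (escal _ c) = escal _ c by apply: ev_inj; exact: pull_scal.
    exact: pc_scal.
  - have mM (g h : A * 'F_p) : mu (g * h)%g.1 = mu g.1 + mu h.1 by rewrite muM.
    by rewrite (epull_betE (@fstM p A) muM mM) //; exact: pc_bet.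
  - by rewrite rmorphD; exact: pc_add.
  - by rewrite rmorphM; exact: pc_mul.
move=> z; have [N] := kX_nilp p_prime char_k (ev_val z).
elim: N z => [|N IHN] z zN.
  exists 0%N; have -> : z = escal _ 0 by apply: ev_inj; rewrite /= scal0.
  exact: pc_scal.
set t := ev_val z in zN.
have [kXs kYs] := kX_sign p_prime char_k t; rewrite evcP in kXs kYs.
have rs : hsign (resA t) = resA t by rewrite -[hsign (resA t)]pull_hsign evcP.
have ko : hsign (kY p_prime char_k t) = - kY p_prime char_k t by rewrite {2}kYs opprK.
have [b1 b1e b1E] := odd_mul_frob p_prime char_k ko.
have ys : hsign (Y k p A * infl p (kY p_prime char_k t)) = Y k p A * infl p (kY p_prime char_k t).
  by rewrite hsignM Y_sign // infl_sign mulNr -mulrN -rmorphN -kYs.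
pose z2 := mkev (esym kXs); have [|j2 Q2] := IHN z2; first by rewrite -iterSr.
have [j0 Q0] := IHA PA cPA (mkev rs).
have [j1 Q1] := IHA PA cPA (mkev b1e).
pose XX := betE (mu := @snd A 'F_p) (@sndM p A).
pose E0 := epull (@fstM p A) (mkev rs); pose E1 := mkev ys.
pose B1 := epull (@fstM p A) (mkev b1e).
have zE : z = E0 + E1 + XX * z2 by apply: ev_inj; exact: kunnethE.
have E1p : E1 ^+ p = XX * B1 by apply: ev_inj; rewrite evX evM; exact: b1E.
have pe := evc_char (A * 'F_p)%type char_k.
(* A common exponent for the three parts; the extra factor [p] is the one spent on removing [Y]. *)
pose J := (j0 + j1 + j2)%N; exists J.+1.
have pw x j i : Q (x ^+ (p ^ j)) -> Q (x ^+ (p ^ (i + j))).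
  by move=> Qx; rewrite expnD mulnC exprM; exact: pc_exp.
rewrite expnS exprM {1}zE !(frobD _ _ pe) exprMn E1p !(frobDn _ _ _ pe) !exprMn.
have QX n : Q (XX ^+ n) by apply: pc_exp => //; exact: pc_bet.
rewrite -!exprM -!expnS.
apply: pc_add => //; first apply: pc_add => //.
- rewrite (_ : J.+1 = (j1 + j2).+1 + j0)%N; last by rewrite addSn /J -addnA addnC.
  by apply: pw; rewrite /E0 -rmorphXn.
- apply: pc_mul => //; rewrite (_ : J = (j0 + j2) + j1)%N; last by rewrite /J addnAC.
  by apply: pw; rewrite /B1 -rmorphXn.
apply: pc_mul => //.
by rewrite /J -addSn; exact: pw.
Qed.

Section Divide.
Variables (gT : finGroupType).

Lemma hsign_char2 (x : cohomology k gT) : (2%:R : k) = 0 -> hsign x = x.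
Proof.
move=> k2; have [f fz ->] := clP x; rewrite /hsign hop_cl //; last exact: sign_chain.
congr cl; apply/funext => s; rewrite /bar_sign.
have -> : (-1 : k) = 1 by apply/eqP; rewrite -subr_eq0 -opprD oppr_eq0 -k2.
by rewrite expr1n mul1r.
Qed.

(** As [y] and [b] are even, the even part of [e] serves as well; in characteristic 2 every class is
    even. *)
Lemma even_factor (b : evc k gT) (y : evc k gT) e :
  ev_val y = ev_val b * e -> exists e', y = b * e'.
Proof.
move=> yE; case: (eqVneq (2%:R : k) 0) => [k2|k2].
  by exists (mkev (hsign_char2 e k2)); apply: ev_inj.
have es : hsign (scal gT 2%:R^-1 * (e + hsign e)) = scal gT 2%:R^-1 * (e + hsign e).
  by rewrite hsignM hsign_scal hsignD hsignK addrC.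
exists (mkev es); apply: ev_inj; rewrite evM /= mulrA -scal_comm -mulrA mulrDr.
have -> : ev_val b * hsign e = ev_val b * e by rewrite -{1}(evcP b) -hsignM -yE evcP.
by rewrite -yE scal_double mulrA -scalM mulVf // scal1 mul1r.
Qed.

(** The stabilisers of the cells of the circle below the top lie in the kernel of [nu]; the exponent
    2 is the degree of the top cell. *)
Lemma bet_divides (nu : gT -> 'F_p) nuM (y : evc k gT) :
    (forall J : {group gT}, (forall x, x \in J -> nu x = 0) -> res k J (ev_val y) = 0) ->
  exists e, y ^+ 2 = betE (mu := nu) nuM * e.
Proof.
move=> y0; pose S := circle k (mu := nu) nuM.
have [|b c|e eE] := @eclass_prod k p gT S [:: ev_val y; ev_val y].
- by rewrite /= card_unit.
- rewrite !inE orbb => /eqP -> cT; apply: y0 => x.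
  rewrite inE => /eqP xc.
  have cN : c tt <> None.
    by move=> cN; case/negP: cT; rewrite -[c]cellofK cN -topc_cellof.
  have := congr1 (fun c : cell p (pts S) => c tt) xc; rewrite ffunE /=.
  case: (c tt) cN => [[b' i]|] // _ [/eqP].
  by rewrite -subr_eq0 addrAC subrr add0r => /eqP.
move: eE; rewrite !big_cons big_nil mulr1 => eE.
by apply: (even_factor (e := e)); rewrite evX expr2.
Qed.

End Divide.
End Bockstein.

(** * Classes vanishing on all proper subgroups *)

Section Essential.
Variables (k : fieldType).

Definition vanishing (gT : finGroupType) (x : cohomology k gT) : Prop :=
  forall J : {group gT}, J \proper [set: gT] -> res k J x = 0.

Lemma pull_factor (aT gT : finGroupType) (phi : aT -> gT) (phiM : {morph phi : x y / (x * y)%g})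
    (J : {group gT}) (x : cohomology k gT) :
  (forall a, phi a \in J) -> res k J x = 0 -> cohomology_pull phiM x = 0.
Proof.
move=> phiJ x0; pose psi a := subg J (phi a).
have psiM : {morph psi : a b / (a * b)%g}.
  by move=> a b; apply: val_inj; rewrite /psi /= !subgK ?groupM // phiM.
rewrite -(pull_comp psiM (v := @sgval _ J) (fun _ _ => erefl)).
  by rewrite [cohomology_pull _ x]x0 rmorph0.
by move=> a; rewrite /psi subgK.
Qed.

Lemma morph_img_group (aT gT : finGroupType) (phi : aT -> gT) :
  {morph phi : x y / (x * y)%g} -> forall D : {group aT}, group_set (phi @: D).
Proof.
move=> phiM D; apply/group_setP; split.
  apply/imsetP; exists 1%g; rewrite ?group1 //.
  by apply: (mulgI (phi 1%g)); rewrite -phiM !mulg1.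
move=> _ _ /imsetP[a aD ->] /imsetP[b bD ->]; rewrite -phiM; apply: imset_f.
exact: groupM.
Qed.

Lemma pull_vanishing (aT gT : finGroupType) (phi : aT -> gT)
    (phiM : {morph phi : x y / (x * y)%g}) (x : cohomology k gT) :
  vanishing x -> (exists g, forall a, phi a != g) -> cohomology_pull phiM x = 0.
Proof.
move=> vx [g gN]; pose J := Group (morph_img_group phiM [set: aT]).
apply: (@pull_factor _ _ _ _ J) => [a|]; first by rewrite imset_f ?inE.
apply: vx; apply/properP; split; first exact: subsetT.
by exists g; rewrite ?inE //; apply/imsetP => -[a _ gE]; have := gN a; rewrite gE eqxx.
Qed.

Lemma res_comp_vanish (gT : finGroupType) (J J' : {group gT}) (x : cohomology k gT) :
  J \subset J' -> res k J' x = 0 -> res k J x = 0.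
Proof.
by move=> /subsetP sJ; apply: pull_factor => a; apply: sJ; exact: subgP.
Qed.

End Essential.

Section Characters.
Variables (p : nat) (gT : finGroupType).
Hypothesis p_prime : prime p.

Lemma char_sep (E : {group gT}) z : p.-abelem E -> z \in E -> z != 1%g ->
  exists2 lam : gT -> 'F_p, {in E &, forall x y, lam (x * y)%g = lam x + lam y} & lam z = 1.
Proof.
move=> abE zE z1; have ntE : E :!=: 1%g by apply: contraNneq z1 => E1; rewrite -in_set1 -set1gE -E1.
pose v := abelem_rV abE ntE z.
have vM : {in E &, forall x y, abelem_rV abE ntE (x * y)%g
    = abelem_rV abE ntE x + abelem_rV abE ntE y}.
  by move=> x y xE yE; rewrite morphM.
have [j vj] : exists j, v 0 j != 0.
  apply/existsP; apply: contraNT z1 => /existsPn H; apply/eqP.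
  apply: (@abelem_rV_inj _ _ _ abE ntE) => //; rewrite morph1.
  by apply/rowP => j; rewrite [RHS]mxE; apply/eqP; have := H j; rewrite negbK.
exists (fun x => abelem_rV abE ntE x 0 j / v 0 j); last by rewrite divff.
by move=> x y xE yE; rewrite vM // mxE mulrDl.
Qed.

Lemma Phi_char0 (f : gT -> 'F_p) : p.-group [set: gT] ->
    (forall x y, f (x * y)%g = f x + f y) ->
  forall z, z \in 'Phi([set: gT]) -> f z = 0.
Proof.
move=> pG fM z zP.
pose fm := Morphism (D := [set: gT]) (in2W fM : {in setT &, {morph f : x y / (x * y)%g}}).
have : f z \in (fm @* 'Phi([set: gT]))%g.
  by apply/morphimP; exists z => //; rewrite inE.
have pF : p.-abelem [set: 'F_p].
  apply/abelemP => //; split=> [|x _].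
    by apply/centsP => x _ y _; exact: addrC.
  by rewrite FinRing.zmodXgE -mulr_natr pchar_Fp_0 // mulr0.
rewrite (morphim_Phi fm pG) ?subsetT //.
have -> : ('Phi(fm @* [set: gT]) = 1)%g.
  apply/eqP; rewrite (trivg_Phi (pgroupS (subsetT _) (abelem_pgroup pF))).
  exact: abelemS (subsetT _) pF.
by move/set1gP.
Qed.

Lemma central_Phi : p.-group [set: gT] -> ~~ p.-abelem [set: gT] ->
  exists z, [/\ z \in 'Phi([set: gT]), forall g, (z * g = g * z)%g, z != 1%g & #[z]%g = p].
Proof.
move=> pG nab; have ntP : 'Phi([set: gT]) != 1%g by rewrite (trivg_Phi pG).
have := meet_center_nil (pgroup_nil pG) (Phi_normal [set: gT]) ntP.
set M := ('Phi(_) :&: _)%g => ntM.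
have pM : p.-group M by apply: pgroupS pG; exact: subsetT.
have [_ pd _] := pgroup_pdiv pM ntM.
have [z /setIP[zP zZ] oz] := Cauchy p_prime pd; exists z; split=> //.
- by move=> g; have /centerP[_ ->] := zZ; rewrite ?inE.
- by rewrite -order_eq1 oz; apply: contraTneq p_prime => ->.
Qed.

End Characters.

Section Nilpotent.
Variables (k : fieldType) (p : nat) (gT : finGroupType).
Hypotheses (p_prime : prime p) (char_k : p \in [pchar k]) (pG : p.-group [set: gT]).

Lemma Fp_pgroup : p.-group [set: 'F_p].
Proof. by rewrite /pgroup cardsT card_Fp // pnat_id. Qed.

(** On the product with F_p take the character of [<z> x F_p] that is 1 on [z] and the identity on
    F_p. The inflation of [b] vanishes on the stabilisers of all cells but the top one, so a power
    of it is divisible by [theta]. Since [theta ^+ p] is monic in [X] and an inflated class has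
    degree 0 in [X], the [p]-th power of the cofactor vanishes. *)
Lemma vanishing_nilpotent (b : cohomology k gT) : ~~ p.-abelem [set: gT] -> hsign b = b ->
  vanishing b -> exists N, b ^+ N = 0.
Proof.
move=> nab be vb; have [z [zP zC z1 oz]] := central_Phi p_prime pG nab.
have zab : p.-abelem <[z]>.
  apply/abelemP => //; split=> [|x xz]; first exact: cycle_abelian.
  by apply/eqP; rewrite -order_dvdn -oz order_dvdG.
have [dl dlM dlz] := char_sep zab (cycle_id z) z1.
pose T := (gT * 'F_p)%type; pose C := setX_group <[z]>%G [set: 'F_p]%G.
have pT : p.-group [set: T].
  rewrite /pgroup cardsT card_prod -cardsT -[#|'F_p|]cardsT pnatM.
  by apply/andP; split; [exact: pG|exact: Fp_pgroup].
have CZ (c g : T) : c \in C -> (c * g)%g = (g * c)%g.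
  case: c g => [c i] [g j]; rewrite !inE /= andbT => /cycleP[m ->].
  congr (_, _); last exact: addrC.
  by apply/esym/commuteX/esym/zC.
pose lam (u : T) := dl u.1 + u.2.
have lamM : {in C &, forall x y, lam (x * y)%g = lam x + lam y}.
  move=> [c i] [d j]; rewrite !inE /= !andbT => cC dC.
  by rewrite /lam /= dlM // addrACA.
pose S := tsphere char_k pT CZ lamM.
pose n := (#|pts S| * 2)%N.
have [|b' c|e eE] := @eclass_prod k p T S (nseq n (infl p b)).
- by rewrite size_nseq.
- rewrite mem_nseq => /andP[_ /eqP ->] cT.
  have [o co] : exists o, c o != None.
    apply/existsP; apply: contraNT cT => /existsPn H; apply/eqP/ffunP => o.
    by rewrite ffunE; apply/eqP; have := H o; rewrite negbK.
  have Jlam x : x \in cstabG c -> x \in C -> lam x = 0.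
    rewrite inE => /eqP xc xC; have := congr1 (fun d : cell p (pts S) => d o) xc.
    rewrite ffunE /= tlactC // tkapC //; case: (c o) co => [[? i]|] // _ [/eqP].
    by rewrite -subr_eq0 addrAC subrr add0r => /eqP.
  have fM : {morph (fun u : subg_of (cstabG c) => (sgval u).1) : x y / (x * y)%g} by [].
  rewrite [res _ _ _](pull_comp _ _ fM) //; apply: pull_vanishing => //.
  apply: contrapT => nog.
  (* A stabiliser that projects onto the whole group meets F_p trivially, hence is the graph of a
     homomorphism [f] to F_p. As [z] lies in the Frattini subgroup, [f z = 0], and the element
     [(z, 0)] contradicts [Jlam]. *)
  have fex g : exists i : 'F_p, (g, i) \in cstabG c.
    apply: contrapT => noi; apply: nog; exists g => u; apply/eqP => ug.
    by apply: noi; exists (sgval u).2; rewrite -ug -surjective_pairing subgP.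
  have funi i : (1%g, i) \in cstabG c -> i = 0.
    move=> /Jlam; rewrite inE /= group1 inE => /(_ isT).
    have -> : lam (1%g, i) = i; last by [].
    rewrite /lam /=; have := dlM _ _ (group1 <[z]>) (group1 <[z]>).
    by rewrite mulg1 -[X in X = _]addr0 => /addrI <-; rewrite add0r.
  pose f g := projT1 (cid (fex g)); have fP g : (g, f g) \in cstabG c := projT2 (cid (fex g)).
  have fM' x y : f (x * y)%g = f x + f y.
    apply/eqP; rewrite -subr_eq0; apply/eqP/funi.
    have -> : (1%g, f (x * y)%g - (f x + f y)) = (((x * y)%g, f (x * y)%g) * ((x, f x) * (y, f y))^-1)%g :> T.
      by congr (_, _); rewrite /= mulgV.
    by rewrite groupM ?groupV ?groupM.
  have zf0 := Phi_char0 p_prime pG fM' zP.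
  have := Jlam (z, f z) (fP z); rewrite zf0 /lam /= dlz addr0 !inE /= cycle_id.
  by move=> /(_ isT)/eqP; rewrite oner_eq0.
rewrite prod_nseq in eE.
have ep : infl p b ^+ (n * p) = ev_val (theta char_k pT CZ lamM) ^+ p * e ^+ p.
  rewrite exprM eE exprMn_comm //; exact: even_comm (evcP (theta char_k pT CZ lamM)).
have cC : (1%g, 1) \in C by rewrite !inE group1.
have cX m : ((1%g, 1%R : 'F_p) ^+ m = (1%g, m%:R) :> T)%g.
  elim: m => [|m IHm]; first by [].
  by rewrite expgS IHm; congr (_, _); [exact: mulg1|exact: (esym (mulrS (1 : 'F_p) m))].
have cp : ((1%g, 1%R : 'F_p) ^+ p = 1 :> T)%g.
  by rewrite cX; congr (_, _); rewrite pchar_Fp_0.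
have lc : lam (1%g, 1) = 1.
  rewrite /lam /=; have := dlM _ _ (group1 <[z]>) (group1 <[z]>).
  by rewrite mulg1 -[X in X = _]addr0 => /addrI <-; rewrite add0r.
have idM : {morph (id : T -> T) : x y / (x * y)%g} by [].
have mon := theta_monic p_prime char_k pT CZ lamM cC cp (phi := id) idM.
have e0 : e ^+ p = 0.
  apply: (@monic_descent k p p_prime char_k gT (fun x => x = 0) _ _ _ _ _ _ _ (mon _ lc)).
  - by [].
  - by move=> ? ? -> ->; rewrite subr0.
  - by move=> ? ->; exact: kX0.
  - by move=> ? ? ->; rewrite mulr0.
  - by move=> i; rewrite cX natr_Zp.
  rewrite pull_id // -ep -rmorphXn.
  rewrite (_ : (p * _)%N = (p * #|{: coset_of C}|).-1.+1); last first.
    by rewrite prednK // muln_gt0 prime_gt0 //; apply/card_gt0P; exists 1%g.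
  by rewrite iterSr kX_infl iter_kX0.
exists (n * p)%N; apply: (can_inj (@resA_infl k p gT)).
by rewrite rmorph0 rmorphXn -[RHS](mulr0 (ev_val (theta char_k pT CZ lamM) ^+ p)) -e0 -ep.
Qed.

End Nilpotent.

(** * Additivity of the Bockstein class *)

Section Carry.
Variables (k : fieldType) (p : nat).
Hypotheses (p_prime : prime p) (char_k : p \in [pchar k]).
Local Notation q := (Zp_trunc (pdiv p)).+2.

Definition carry (a b : 'F_p) : nat := ((a + b)%N %/ q)%N.

Lemma carryE (a b : 'F_p) : (a + b = carry a b * q + (a + b)%R)%N.
Proof. exact: divn_eq. Qed.

Lemma carry_cocycle (a b c : 'F_p) : (carry (a + b)%R c + carry a b = carry b c + carry a (b + c)%R)%N.
Proof.
apply/eqP; rewrite -(eqn_pmul2r (isT : 0 < q)%N) !mulnDl; apply/eqP.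
have := carryE (a + b) c; have := carryE a b; have := carryE b c; have := carryE a (b + c).
rewrite addrA; move: (nat_of_ord (a + b + c)) (nat_of_ord (b + c)) (nat_of_ord (a + b)).
by move: (nat_of_ord a) (nat_of_ord b) (nat_of_ord c); lia.
Qed.

Lemma carry_add (a b c d : 'F_p) :
  (carry a b + carry c d + carry (a + b)%R (c + d)%R = carry a c + carry b d + carry (a + c)%R (b + d)%R)%N.
Proof.
apply/eqP; rewrite -(eqn_pmul2r (isT : 0 < q)%N) !mulnDl; apply/eqP.
have := carryE a b; have := carryE c d; have := carryE (a + b) (c + d).
have := carryE a c; have := carryE b d; have := carryE (a + c) (b + d).
rewrite addrACA; move: (nat_of_ord (a + b + (c + d))) (nat_of_ord (b + d)) (nat_of_ord (a + c)).
move: (nat_of_ord (a + b)) (nat_of_ord (c + d)).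
by move: (nat_of_ord a) (nat_of_ord b) (nat_of_ord c) (nat_of_ord d); lia.
Qed.

Lemma carry_succ (i m : 'F_p) :
  ((i == -1)%R + carry (i + 1)%R m = (i + m == -1)%R + carry i m)%N.
Proof.
have S (j : 'F_p) : ((j == -1)%R * q + (j + 1)%R = j.+1)%N.
  have := carryE j 1; rewrite [nat_of_ord 1]modn_small // addn1 => ->.
  rewrite -subr_eq0 opprK; congr (_ * q + _)%N.
  have := carryE j 1; rewrite [nat_of_ord 1]modn_small // addn1.
  case: eqP => [->|/eqP j1]; have := ltn_ord j.
    rewrite addn0 => lt_j jE; apply/eqP; rewrite -(eqn_pmul2r (isT : 0 < q)%N) -jE mul1n.
    by rewrite eqn_leq lt_j jE; case: (carry j 1) jE => // n _; rewrite mulSn leq_addr.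
  move=> lt_j jE; case: (carry j 1) jE => // n jE; case/negP: j1.
  rewrite -val_eqE /= -(eqn_add2l (n.+1 * q)) -jE addn0 eqn_leq.
  apply/andP; split; first by apply: leq_trans lt_j _; rewrite mulSn leq_addr.
  by rewrite jE leq_addr.
apply/eqP; rewrite -(eqn_pmul2r (isT : 0 < q)%N) !mulnDl; apply/eqP.
have := carryE (i + 1) m; have := carryE i m; have := S i; have := S (i + m).
rewrite addrAC; move: (nat_of_ord (i + 1 + m)) (nat_of_ord (i + m)) (nat_of_ord (i + 1)).
by move: (nat_of_ord i) (nat_of_ord m) (i == _) (i + m == _) => ? ? [] []; lia.
Qed.

Variables (gT : finGroupType).

(** Up to sign, the pullback along [mu] of the cocycle of the extension of F_p by F_p to Z / p^2. *)
Definition carry_coch (mu : gT -> 'F_p) (s : seq gT) : k :=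
  if s is [:: g; h] then - (carry (mu g) (mu h))%:R else 0.

Section Euler.
Variable mu : gT -> 'F_p.
Hypothesis muM : forall g h, mu (g * h)%g = mu g + mu h.
Local Notation S := (circle k muM).

(** Counts the passages over the edge from -1 to 0 when a vertex [i] is rotated by [mu g]; on edges
    it is the indicator of that edge. *)
Definition carry_chain (s : seq gT) (c : cell p (pts S)) : k :=
  match c tt, s with
  | Some (true, i), [::] => (i == -1)%:R
  | Some (false, i), [:: g] => (carry i (mu g))%:R
  | _, _ => 0
  end.

Lemma carry_chain_eq : onetop (S := S) = augc (S := S) (carry_coch mu) + D carry_chain.
Proof.
apply/funext => s; apply/funext => c.
rewrite -[RHS]/(aug (carry_coch mu s) c + D carry_chain s c) -(cellofK c).
have E i s' : carry_chain s' (cellof k muM (el i)) = if s' is [::] then (i == -1)%:R else 0.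
  by rewrite /carry_chain ffunE.
have V i s' : carry_chain s' (cellof k muM (vl i)) = if s' is [:: g] then (carry i (mu g))%:R else 0.
  by rewrite /carry_chain ffunE.
have T s' : carry_chain s' (cellof k muM None) = 0 by rewrite /carry_chain ffunE.
have in0 d (x y : gT) t : (forall s', size s' = (size t).+1 -> carry_chain s' d = 0) ->
    inner (carry_chain^~ d) [:: x, y & t] = 0.
  by move=> d0; rewrite (@inner_cong _ _ _ (fun _ => 0)) // /inner big1 // => i _; rewrite mulr0.
rewrite /onetop topc_cellof /aug; case: (c tt) => [[[] i]|].
- have -> : (cellof k muM (el i) == cellof k muM None) = false.
    by apply/eqP => /(congr1 (fun d : cell p (pts S) => d tt)); rewrite !ffunE.
  rewrite allV_cellof /= add0r DEE !V.
  case: s => [|g [|h t]] /=; first by rewrite oppr0 !addr0.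
    rewrite cellof_act inner_consE inner_nil !E /=.
    have := carry_succ i (mu g) => /(congr1 (fun n => n%:R : k)); rewrite !natrD => H.
    have -> : (carry (i + 1) (mu g))%:R = (i + mu g == -1)%:R + (carry i (mu g))%:R - (i == -1)%:R :> k.
      by apply: (addrI (i == -1)%:R); rewrite H; ring.
    by ring.
  rewrite cellof_act E in0 ?addr0 ?oppr0 ?add0r; last by move=> [].
  by case: t => //=; rewrite subrr.
- have -> : (cellof k muM (vl i) == cellof k muM None) = false.
    by apply/eqP => /(congr1 (fun d : cell p (pts S) => d tt)); rewrite !ffunE.
  rewrite allV_cellof /= DV.
  case: s => [|g [|h [|x t]]] /=; first by rewrite addr0.
  - by rewrite cellof_act inner_consE inner_nil !V /= subr0 oppr0 !addr0.
  - rewrite cellof_act !inner_consE inner_nil /shift /= !V /= muM.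
    have := carry_cocycle i (mu g) (mu h) => /(congr1 (fun n => n%:R : k)); rewrite !natrD => H.
    have -> : (carry (mu g) (mu h))%:R = (carry (i + mu g) (mu h))%:R + (carry i (mu g))%:R - (carry i (mu g + mu h))%:R :> k.
      by rewrite H addrK.
    by ring.
  by rewrite cellof_act V in0 ?addr0 // => -[|a [|b u]].
rewrite eqxx allV_cellof /= add0r DT; under eq_bigr do rewrite E.
have -> : pdiff (sact (S := S)) carry_chain s (cellof k muM None) = 0.
  case: s => [|g s] //=; rewrite cellof_act T add0r /inner big1 // => j _.
  by rewrite T mulr0.
rewrite add0r /cup1; case: s => [|g s] /=; last by rewrite big1.
by rewrite (bigD1 (-1)) //= eqxx big1 ?addr0 // => i /negPf ->.
Qed.

Lemma carry_euler : is_euler S (carry_coch mu).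
Proof.
split; [|by apply/funext => -[|a [|b [|d t]]]; rewrite /part card_unit|by exists carry_chain; exact: carry_chain_eq].
split; first by exists 3%N => -[|a [|b [|d t]]].
apply: (@augc_inj _ _ _ S); rewrite -D_augc.
by have := congr1 (fun F => D F) carry_chain_eq; rewrite D_onetop D_add DD addr0.
Qed.

Lemma bet_carry : bet k muM = cl (carry_coch mu).
Proof. exact/eclassE/carry_euler. Qed.

End Euler.

(** By [carry_add], the carry of [mu g] and [nu g] is a primitive of the difference between the two
    sides. *)
Lemma betD (mu nu lam : gT -> 'F_p) muM nuM lamM : (forall g, lam g = mu g + nu g) ->
  bet k (mu := lam) lamM = bet k (mu := mu) muM + bet k (mu := nu) nuM.
Proof.
move=> lamE; have [muz _ _] := carry_euler muM.
have [[nuz _ _] [lamz _ _]] := (carry_euler nuM, carry_euler lamM).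
rewrite !bet_carry -clD //; apply: (@cl_eq _ _ _ _ (fun s => if s is [:: g] then (carry (mu g) (nu g))%:R else 0)) => //.
  exact: cocycD.
move=> s; rewrite -[(_ + _) s]/(carry_coch mu s + carry_coch nu s).
case: s => [|g [|h [|x t]]].
- by rewrite /= addr0 subr0.
- by rewrite bar_diff_cons inner_consE inner_nil /= subr0 addr0 subrr.
- rewrite bar_diff_cons !inner_consE inner_nil /shift /= subr0 !lamE !muM !nuM.
  have := carry_add (mu g) (mu h) (nu g) (nu h) => /(congr1 (fun n => n%:R : k)); rewrite !natrD => H.
  have -> : (carry (mu g + nu g) (mu h + nu h))%:R = (carry (mu g) (mu h))%:R + (carry (nu g) (nu h))%:R
     + (carry (mu g + mu h) (nu g + nu h))%:R - (carry (mu g) (nu g))%:R - (carry (mu h) (nu h))%:R :> k.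
    by rewrite H; ring.
  by ring.
rewrite addr0 subr0 bar_diff_cons (@inner_cong _ _ _ (fun _ => 0)); last by move=> [|a [|b u]].
by rewrite /inner big1 ?addr0 // => j _; rewrite mulr0.
Qed.

Lemma betED (mu nu lam : gT -> 'F_p) muM nuM lamM : (forall g, lam g = mu g + nu g) ->
  betE k (mu := lam) lamM = betE k (mu := mu) muM + betE k (mu := nu) nuM.
Proof. by move=> lamE; apply: ev_inj; exact: betD. Qed.

End Carry.

Section StabilizerVertex.
Variables (k : fieldType) (p : nat) (gT : finGroupType) (S : sphere k p gT).

(* The labels of an invariant vertex trivialise kap over each orbit. *)
Lemma eclass_stab0 (o : pts S) :
  (forall (x : gT) (a : pts S), lact x a = a -> kap x a = 0) -> eclass S = 0.
Proof.
move=> k0; have lK x (a : pts S) : lact x^-1%g (lact x a) = a by rewrite -lactM mulVg lact1.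
pose orb (a : pts S) := [pred b | [exists x : gT, lact x b == a]].
pose rep a := odflt a [pick b in orb a].
have repP a : exists x : gT, lact x (rep a) = a.
  rewrite /rep; case: pickP => [b /existsP[x /eqP xb]|_] /=; first by exists x.
  by exists 1%g; rewrite lact1.
have rep_act x a : rep (lact x a) = rep a.
  have E : orb (lact x a) =1 orb a.
    move=> b; apply/existsP/existsP => -[y /eqP yE].
      by exists (x^-1 * y)%g; rewrite lactM yE lK.
    by exists (x * y)%g; rewrite lactM yE.
  rewrite /rep (eq_pick E); case: pickP => // /(_ a) /existsP[].
  by exists 1%g; rewrite lact1.
pose wt a := projT1 (cid (repP a)); have wtE a : lact (wt a) (rep a) = a := projT2 (cid (repP a)).
have vE x a : - kap (wt (lact x a)) (rep a) + kap x a = - kap (wt a) (rep a).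
  have yE : lact ((wt (lact x a))^-1 * (x * wt a))%g (rep a) = rep a.
    by rewrite !lactM wtE -{2}(wtE (lact x a)) rep_act lK.
  have := k0 _ _ yE; rewrite kapM lactM wtE (kapM x) wtE => E.
  have := k0 _ _ (lact1 (rep a)).
  rewrite -(mulVg (wt (lact x a))) kapM -{1}(rep_act x a) wtE => E'.
  move: E E'; move: (kap (wt (lact x a))^-1%g _) => z E E'.
  have <- : kap x a + kap (wt a) (rep a) = kap (wt (lact x a)) (rep a).
    by apply: (addrI z); rewrite E E'.
  by rewrite opprD addrC addrA subrr add0r.
apply: (@eclass_vertex _ _ _ S [ffun a => vl (- kap (wt a) (rep a))] o).
  by apply/forallP => a; rewrite ffunE.
by move=> x; apply/ffunP => a; rewrite !ffunE /= rep_act vE.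
Qed.

End StabilizerVertex.

(** * Transfers and noncentral subgroups *)

Section TracePower.
Variables (R : comNzRingType) (wT : finGroupType) (sg : wT -> R -> R).
Hypotheses (sg1 : forall x, sg 1%g x = x)
  (sgg : forall g h x, sg (g * h)%g x = sg h (sg g x))
  (sgD : forall g x y, sg g (x + y) = sg g x + sg g y)
  (sgM : forall g x y, sg g (x * y) = sg g x * sg g y)
  (sgU : forall g, sg g 1 = 1).

Definition trace z : R := \sum_g sg g z.

Lemma sg0 g : sg g 0 = 0.
Proof. by apply: (addIr (sg g 0)); rewrite -sgD !add0r. Qed.

Lemma sgN g x : sg g (- x) = - sg g x.
Proof. by apply: (addIr (sg g x)); rewrite -sgD !addNr sg0. Qed.

Lemma sg_sum g (I : finType) (P : pred I) (F : I -> R) :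
  sg g (\sum_(i | P i) F i) = \sum_(i | P i) sg g (F i).
Proof. exact: (big_morph _ (sgD g) (sg0 g)). Qed.

Lemma sg_prod g (I : finType) (P : pred I) (F : I -> R) :
  sg g (\prod_(i | P i) F i) = \prod_(i | P i) sg g (F i).
Proof. exact: (big_morph _ (sgM g) (sgU g)). Qed.

Lemma sg_trace g z : sg g (trace z) = trace z.
Proof.
rewrite /trace sg_sum [RHS](reindex_inj (mulIg g)).
by apply: eq_bigr => h _; rewrite sgg.
Qed.

Lemma trace_mull a z : (forall g, sg g a = a) -> a * trace z = trace (a * z).
Proof. by move=> ai; rewrite /trace mulr_sumr; apply: eq_bigr => g _; rewrite sgM ai. Qed.

(* For h <> 1 the factor at g = h of prod_g (x_g - h g^-1 x_g) vanishes, so only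
   h = 1 contributes to the sum of its multiples by h z; expand in the x_g. *)
Lemma different_trace (x : wT -> R) : exists a b : {set wT} -> R, forall z,
  (\prod_(g | g != 1%g) (x g - sg g^-1%g (x g))) * z = \sum_J a J * trace (b J * z).
Proof.
pose F (g : wT) := if g != 1%g then x g else 1.
pose G (g : wT) := if g != 1%g then - sg g^-1%g (x g) else 0.
exists (fun J : {set wT} => \prod_(g in J) F g), (fun J : {set wT} => \prod_(g | g \notin J) G g) => z.
have E h : \prod_g (F g + sg h (G g)) * sg h z = if h == 1%g then (\prod_g (F g + G g)) * z else 0.
  case: eqP => [->|/eqP h1]; first by rewrite sg1; congr (_ * _); apply: eq_bigr => g _; rewrite sg1.
  rewrite (bigD1 h) //= /F /G h1 sgN -sgg mulVg sg1 subrr mul0r mul0r //.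
transitivity (\sum_h \prod_g (F g + sg h (G g)) * sg h z).
  rewrite [RHS](bigD1 1%g) //= [X in _ = _ + X]big1 => [|h /negPf h1]; last by rewrite E h1.
  rewrite E eqxx addr0; congr (_ * z); rewrite [RHS](bigD1 1%g) //= /F /G eqxx addr0 mul1r.
  by apply: eq_bigr => g ->.
under eq_bigr do rewrite bigA_distr mulr_suml.
rewrite exchange_big /=; apply: eq_bigr => J _; rewrite /trace mulr_sumr; apply: eq_bigr => h _.
rewrite sgM sg_prod mulrA; congr (_ * _).
rewrite (bigID (mem J)) /=; congr (_ * _); first by apply: eq_bigr => g ->.
by apply: eq_bigr => g /negPf ->.
Qed.

(* y ^ |W| is the norm of y.  Expanding the product over W indexes its terms by the
   maps f : W -> I; those with the same fibre sizes have the same product of the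
   t_j, and their coefficients sum to an invariant. *)
Lemma norm_trace (I : finType) (a d : I -> R) (l y : R) :
    (forall g, sg g y = y) -> y = \sum_j a j * trace (l * d j) ->
  exists z, y ^+ #|{: wT}| = trace (l * z).
Proof.
move=> yi yE; pose t j := trace (l * d j).
have -> : y ^+ #|{: wT}| = \sum_(f : {ffun wT -> I}) (\prod_w sg w (a (f w))) * \prod_w t (f w).
  rewrite -prodr_const; transitivity (\prod_w \sum_j sg w (a j) * t j).
    apply: eq_bigr => w _; rewrite -[LHS](yi w) {1}yE sg_sum; apply: eq_bigr => j _.
    by rewrite sgM sg_trace.
  by rewrite bigA_distr_bigA; apply: eq_bigr => f _; rewrite big_split.
pose ty (f : {ffun wT -> I}) : {ffun I -> 'I_#|{: wT}|.+1} := [ffun j => inord #|[pred w | f w == j]|].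
rewrite (partition_big ty predT) //=.
have tyE f j : ty f j = #|[pred w | f w == j]| :> nat.
  by rewrite ffunE inordK // ltnS max_card.
have tE (f : {ffun wT -> I}) : \prod_w t (f w) = \prod_j t j ^+ ty f j.
  rewrite (partition_big f predT) //=; apply: eq_bigr => j _.
  by rewrite tyE -prodr_const; apply: eq_big => // w /eqP ->.
suff H u : exists z, \sum_(f | ty f == u) (\prod_w sg w (a (f w))) * \prod_w t (f w) = trace (l * z).
  pose z u := projT1 (cid (H u)); exists (\sum_u z u).
  have -> : trace (l * \sum_u z u) = \sum_u trace (l * z u).
    rewrite /trace exchange_big /=; apply: eq_bigr => g _.
    by rewrite mulr_sumr sg_sum.
  by apply: eq_bigr => u _; rewrite /z; case: cid.
have tr0 : trace (l * 0) = 0 by rewrite mulr0 /trace big1 // => g _; exact: sg0.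
case: (pickP (fun f => ty f == u)) => [f0 /eqP f0u|no]; last by exists 0; rewrite tr0 big_pred0.
have ti g : sg g (\prod_(w | w != 1%g) t (f0 w)) = \prod_(w | w != 1%g) t (f0 w).
  by rewrite sg_prod; apply: eq_bigr => w _; exact: sg_trace.
pose A := \sum_(f | ty f == u) \prod_w sg w (a (f w)).
have Ai g : sg g A = A.
  have bij : bijective (fun f : {ffun wT -> I} => [ffun w => f (w * g)%g]).
    exists (fun f : {ffun wT -> I} => [ffun w => f (w * g^-1)%g]) => f; apply/ffunP => w;
      by rewrite !ffunE ?mulgK ?mulgKV.
  rewrite /A sg_sum (reindex _ (onW_bij _ bij)) /=.
  apply: eq_big => [f|f _].
    congr (_ == u); apply/ffunP => j; apply: val_inj => /=; rewrite !tyE.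
    rewrite -(card_image (mulIg g) [pred w | [ffun w0 => f (w0 * g)%g] w == j]).
    apply: eq_card => w; rewrite -[w](mulgKV g) (mem_image (mulIg g)) !inE ffunE.
    by rewrite mulgKV.
  rewrite sg_prod [RHS](reindex_inj (mulIg g)).
  by apply: eq_bigr => w _; rewrite ffunE sgg.
exists (A * d (f0 1%g) * \prod_(w | w != 1%g) t (f0 w)).
rewrite (eq_bigr (fun f : {ffun wT -> I} => (\prod_w sg w (a (f w))) * \prod_w t (f0 w))); last first.
  by move=> f /eqP fu; rewrite !tE fu f0u.
rewrite -mulr_suml -/A; move: A Ai => A Ai; rewrite (bigD1 1%g) //= [A * (_ * _)]mulrA -[t (f0 1%g)]/(trace (l * d (f0 1%g))).
rewrite (trace_mull _ Ai) mulrC (trace_mull _ ti); move: (\prod_(w | _) _) => z.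
by congr trace; ring.
Qed.

End TracePower.

Lemma cl_sum (k : fieldType) (gT : finGroupType) (I : finType) (P : pred I) (F : I -> seq gT -> k) :
    (forall i, P i -> cocyc (F i)) ->
  cocyc (fun s => \sum_(i | P i) F i s) /\
  cl (fun s => \sum_(i | P i) F i s) = \sum_(i | P i) cl (F i).
Proof.
move=> Fz; have -> : (fun s => \sum_(i | P i) F i s) = \sum_(i | P i) F i.
  by apply/funext => s; rewrite fct_sumE.
have : cocyc (\sum_(i | P i) F i) /\ cl (\sum_(i | P i) F i) = \sum_(i | P i) cl (F i); last by [].
apply: (big_ind2 (fun f x => cocyc f /\ cl f = x)) => [|f x g y [fz <-] [gz <-]|i Pi].
- by split; [exact: cocyc0|exact: cl0].
- by rewrite clD //; split=> //; exact: cocycD.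
- by split=> //; exact: Fz.
Qed.

Lemma psum_diff (k : fieldType) (gT : finGroupType) (X : finType) (act : X -> gT -> X) (F : seq gT -> X -> k) :
    (forall x, injective (act^~ x)) ->
  (fun s => \sum_c pdiff act F s c) = bar_diff (fun s => \sum_c F s c).
Proof.
move=> act_inj; apply/funext => -[|x s]; first by rewrite big1.
rewrite bar_diff_cons big_split inner_sum; congr (_ + _).
by rewrite [RHS](reindex_inj (act_inj x)).
Qed.

Section Transfer.
Variables (k : fieldType) (gT : finGroupType) (N : {group gT}).

Definition rcos : finType := {c : {set gT} | c \in rcosets N [set: gT]}.

Lemma ract_proof (c : rcos) x : val c :* x \in rcosets N [set: gT].
Proof.
have /rcosetsP[y _ ->] := valP c.
by rewrite -rcosetM; apply/rcosetsP; exists (y * x)%g; rewrite ?inE.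
Qed.

Definition ract (c : rcos) x : rcos := Sub (val c :* x) (ract_proof c x).

Lemma ractM c x y : ract c (x * y)%g = ract (ract c x) y.
Proof. by apply: val_inj; rewrite /= rcosetM. Qed.

Lemma ract1 c : ract c 1%g = c.
Proof. by apply: val_inj; rewrite /= rcoset1. Qed.

Lemma ract_inj x : injective (ract^~ x).
Proof. by apply: (can_inj (g := ract^~ x^-1%g)) => c; rewrite -ractM mulgV ract1. Qed.

Definition rrep (c : rcos) : gT := repr (val c).

Lemma rrepE c : N :* rrep c = val c.
Proof. by have /rcosetsP[y _ E] := valP c; rewrite /rrep E rcoset_repr. Qed.

Lemma rstab_in c x : (rrep c * x * (rrep (ract c x))^-1)%g \in N.
Proof. by rewrite -mem_rcoset rrepE /= -rrepE -rcosetM rcoset_refl. Qed.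

Definition rstab (c : rcos) x : subg_of N := subg N (rrep c * x * (rrep (ract c x))^-1)%g.

Lemma rstabM c x y : rstab c (x * y)%g = (rstab c x * rstab (ract c x) y)%g.
Proof.
apply: val_inj; rewrite /= !subgK ?rstab_in //.
by rewrite ractM !mulgA mulgKV.
Qed.

Definition rword c s := fword ract rstab c s.
Definition cosum (f : seq (subg_of N) -> k) (s : seq gT) (c : rcos) : k := f (rword c s).
(** Pull back to the groupoid of right cosets, which is equivalent to [N], and sum over its
    objects. *)
Definition transfer_op (f : seq (subg_of N) -> k) (s : seq gT) : k := \sum_c cosum f s c.

Lemma cosum_diff f : pdiff ract (cosum f) = cosum (bar_diff f).
Proof.
apply/funext => -[|x s]; apply/funext => c //.
rewrite -[RHS]/(bar_diff f (rstab c x :: rword (ract c x) s)) bar_diff_cons [LHS]/=; congr (_ + _).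
exact: (inner_fword ractM c f (x :: s) rstabM).
Qed.

Lemma transfer_diff f : bar_diff (transfer_op f) = transfer_op (bar_diff f).
Proof. by rewrite /transfer_op -(psum_diff _ ract_inj) cosum_diff. Qed.

Lemma transfer_chain : chain_op transfer_op.
Proof.
have finT f : finite_degree f -> finite_degree (transfer_op f).
  move=> [n fn]; exists n => s le_s; rewrite /transfer_op big1 // => c _.
  by rewrite /cosum fn // /rword size_fword.
split=> [f g|f [/finT fin df]|f].
- apply/funext => s; rewrite -[RHS]/(transfer_op f s - transfer_op g s) -sumrB.
  by apply: eq_bigr.
- split=> //; rewrite transfer_diff df; apply/funext => s.
  by rewrite /transfer_op big1.
- by exists (transfer_op f); rewrite transfer_diff.
Qed.

Definition htransfer : cohomology k (subg_of N) -> cohomology k gT := hop transfer_op.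

Lemma transfer_hsign w : hsign (htransfer w) = htransfer (hsign w).
Proof.
have [f fz ->] := clP w; have [_ Tz _] := transfer_chain; have [_ Sz _] := @sign_chain k (subg_of N).
rewrite /htransfer (hop_cl transfer_chain fz) /hsign (hop_cl (@sign_chain k gT) (Tz _ fz)).
rewrite (hop_cl (@sign_chain k (subg_of N)) fz) (hop_cl transfer_chain (Sz _ fz)).
congr cl; apply/funext => s; rewrite /bar_sign /transfer_op mulr_sumr.
by apply: eq_bigr => c _; rewrite /cosum /rword size_fword.
Qed.

Lemma pcup_cosum f b s : \sum_c pcup (cosum f) b s c = cup (transfer_op f) b s.
Proof.
rewrite /pcup /cup exchange_big /=; apply: eq_bigr => i _.
by rewrite mulr_suml.
Qed.

(** The product is trivial before summation over the cosets, by Shapiro's lemma: the stabiliser of a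
    coset is a conjugate of [N], a proper subgroup, on which [x] vanishes. *)
Lemma transfer_vanishing w x : N \proper [set: gT] -> vanishing x -> htransfer w * x = 0.
Proof.
move=> pN vx; have [f [fin df] ->] := clP w; have [b bz xE] := clP x.
have fz : cocyc f by [].
have [_ Tz _] := transfer_chain.
have dF : pdiff ract (cosum f) = 0.
  by rewrite cosum_diff df; apply/funext => s; apply/funext => c.
rewrite xE /htransfer hop_cl //; last exact: transfer_chain.
rewrite -clM //; last exact: Tz.
apply/cl_eq0P; first by apply: cocycM => //; exact: Tz.
have [|c|U UE] := @shapiro k gT _ _ ractM ract1 (pcup (cosum f) b).
- rewrite pdiff_cup dF (proj2 bz); apply/funext => s; apply/funext => c.
  rewrite -[LHS]/(cup (0 : seq gT -> k) b s + cup (bar_sign (fun u => cosum f u c)) (0 : seq gT -> k) s).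
  by rewrite cup0l cup0r; exact: addr0.
- apply: stab_cup_trivial dF _.
  pose J := (N :^ rrep c)%G.
  have pJ : J \proper [set: gT].
    rewrite properEcard subsetT cardJg; exact: proper_card.
  have [|a aE] := @res_word_trivial k gT J b bz; first by rewrite -xE; exact: vx.
  exists a => s sc; apply: aE => z /sc zc.
  by rewrite mem_conjg conjgE invgK mulgA; have := rstab_in c z; rewrite zc.
exists (fun s => \sum_c U s c); rewrite -(psum_diff _ ract_inj) -UE.
by apply/funext => s; rewrite pcup_cosum.
Qed.

Section Restrict.
Variable E : {group gT}.

Definition coset_fixed (c : rcos) : bool := [forall e : subg_of E, ract c (@sgval gT E e) == c].

(** The value 1 off the fixed cosets makes this a homomorphism for every [c], as the pullback along
    it demands. *)
Definition coconj (c : rcos) (e : subg_of E) : subg_of N :=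
  subg N (if coset_fixed c then rrep c * (@sgval gT E e) * (rrep c)^-1 else 1)%g.

Lemma coset_fixed_in c (e : subg_of E) : coset_fixed c -> (rrep c * sgval e * (rrep c)^-1)%g \in N.
Proof. by move=> /forallP/(_ e)/eqP {2}<-; exact: rstab_in. Qed.

Lemma coconjM c : {morph coconj c : x y / (x * y)%g}.
Proof.
move=> x y; rewrite /coconj; case: (boolP (coset_fixed c)) => cf; apply: val_inj.
  by rewrite /= !subgK ?(coset_fixed_in (_ * _)%g) ?coset_fixed_in // !mulgA mulgKV.
by rewrite /= !subgK ?group1 // mulg1.
Qed.

(* The orbits of E without fixed point contribute multiples of restrictions of y to
   proper subgroups of E. *)
Lemma transfer_res w (y : cohomology k (subg_of E)) : vanishing y ->
  res k E (htransfer w) * y = (\sum_(c | coset_fixed c) cohomology_pull (coconjM c) w) * y.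
Proof.
move=> vy; have [f fz ->] := clP w; have [b bz yE] := clP y.
have [_ Tz _] := transfer_chain; have Tf := Tz f fz.
rewrite /htransfer hop_cl //; last exact: transfer_chain.
have -> : res k E (cl (transfer_op f)) = cl (pull (@sgval _ E) (transfer_op f)) by exact: pull_cl.
have Pz : cocyc (pull (@sgval _ E) (transfer_op f)) by apply: cocyc_pull.
pose G c := pull (coconj c) f.
have Gz c : cocyc (G c) by apply: cocyc_pull => //; exact: coconjM.
have [Sz SE] := cl_sum (fun c (_ : coset_fixed c) => Gz c).
rewrite (eq_bigr (fun c => cl (G c))); last by move=> c _; exact: pull_cl.
rewrite -SE yE -!clM //; apply/eqP; rewrite -subr_eq0 -clB; try exact: cocycM.
apply/eqP/cl_eq0P; first by apply: cocycB; apply: cocycM.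
pose act (c : rcos) (e : subg_of E) : rcos := ract c (sgval e).
have actM c x z : act c (x * z)%g = act (act c x) z by exact: ractM.
have act1 c : act c 1%g = c by exact: ract1.
have act_inj x : injective (act^~ x) by exact: ract_inj.
pose F (s : seq (subg_of E)) (c : rcos) : k := if ~~ coset_fixed c then cosum f (map sgval s) c else 0.
have fixact c x : ~~ coset_fixed (act c x) = ~~ coset_fixed c.
  congr (~~ _); apply/forallP/forallP => H e; apply/eqP.
    have /eqP := H (e ^ x)%g; rewrite -/(act _ _) -/(act _ _) -actM => H'.
    apply: (act_inj x); rewrite -/(act c e) -actM -[RHS]H'; congr (act _ _).
    by rewrite conjgE mulgA mulgA mulgV mul1g.
  have /eqP := H (x * e * x^-1)%g => H'.
  apply: (act_inj x^-1%g); rewrite -/(act _ e) -!actM mulgV act1 -[RHS]H'.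
  by rewrite mulgA.
have dF : pdiff act F = 0.
  rewrite (pdiff_mask (fun s c => cosum f (map sgval s) c) fixact).
  apply/funext => s; apply/funext => c; case: ifP => // _.
  transitivity (pdiff ract (cosum f) (map sgval s) c).
    case: s => [|x s] //=; congr (_ + _); rewrite /inner /= size_map; apply: eq_bigr => i _.
    congr (_ * cosum f _ c); exact: (@map_face _ _ (@sgval _ E) (fun _ _ => erefl) i.+1 (x :: s)).
  by rewrite cosum_diff (proj2 fz).
have [||c nc|U [UE _]] := @shapiro_supp k _ _ _ actM act1 (fun c => ~~ coset_fixed c) (pcup F b) fixact.
- rewrite pdiff_cup dF (proj2 bz); apply/funext => s; apply/funext => c.
  rewrite -[LHS]/(cup (0 : seq (subg_of E) -> k) b s + cup (bar_sign (fun u => F u c)) (0 : seq (subg_of E) -> k) s).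
  by rewrite cup0l cup0r; exact: addr0.
- move=> s c nc; rewrite /pcup /F (negPf nc) -/(0 : seq (subg_of E) -> k).
  by rewrite (cup0l b).
- apply: stab_cup_trivial dF _.
  have gJ : group_set [set e | act c e == c].
    apply/group_setP; split=> [|u v]; first by rewrite inE act1.
    by rewrite !inE => /eqP cu /eqP cv; rewrite actM cu cv.
  pose J := Group gJ.
  have pJ : J \proper [set: subg_of E].
    rewrite properT; apply: contraNneq nc => JT; apply/forallP => e.
    by have := in_setT e; rewrite -JT inE.
  have [|a aE] := @res_word_trivial k _ J b bz; first by rewrite -yE; exact: vy.
  by exists a => s sc; apply: aE => z /sc zc; rewrite inE zc.
exists (fun s => \sum_c U s c); rewrite -(psum_diff _ act_inj) -UE.
apply/funext => s; rewrite -[LHS]/(cup _ b s - cup _ b s) /pcup /cup -sumrB exchange_big /=.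
apply: eq_bigr => i _; rewrite -mulrBl -mulr_suml; congr (_ * _).
rewrite /pull /transfer_op (bigID coset_fixed) /= addrC big_mkcond /= -addrA [X in _ + X](_ : _ = 0) ?addr0 //.
apply/eqP; rewrite subr_eq0; apply/eqP/eq_bigr => c cf; rewrite /G /pull /cosum; congr f.
elim: (take i s) => //= e u IHu; rewrite /rword /=.
have ce : ract c (sgval e) = c by have /forallP/(_ e)/eqP := cf.
by rewrite /rstab ce -/(rword c _) IHu /coconj cf.
Qed.

End Restrict.
End Transfer.

Section ThetaKill.
Variables (k : fieldType) (p : nat) (gT : finGroupType).
Hypotheses (p_prime : prime p) (char_k : p \in [pchar k]) (pG : p.-group [set: gT]).
Variables (C : {group gT}) (lam : gT -> 'F_p).
Hypotheses (CZ : forall c g : gT, c \in C -> (c * g)%g = (g * c)%g)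
  (lamM : forall c d, c \in C -> d \in C -> lam (c * d)%g = lam c + lam d).

(** An element that fixes a coset is sent into [C], where the rotation is given by [lam]; so
    [eclass_stab0] applies. *)
Lemma theta_kill (aT : finGroupType) (phi : aT -> gT) (phiM : {morph phi : x y / (x * y)%g}) :
    (forall x, phi x \in C -> lam (phi x) = 0) ->
  cohomology_pull phiM (ev_val (theta char_k pG CZ lamM)) = 0.
Proof.
move=> lam0; rewrite [LHS]eclass_pull.
apply: (@eclass_stab0 k p aT (spull phiM (tsphere char_k pG CZ lamM)) 1%g) => x a.
rewrite /= => xa; have xC : phi x \in C.
  apply: coset_idr; first exact: (CN CZ).
  by apply: (mulIg a); rewrite mul1g.
by rewrite tkapC ?lam0.
Qed.

End ThetaKill.

Lemma power_divides (R : comNzRingType) (I : finType) (P : pred I) (b : I -> R) (y : R) :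
    (forall i, P i -> exists n e, y ^+ n = b i * e) ->
  exists n e, y ^+ n = (\prod_(i | P i) b i) * e.
Proof.
move=> H; apply: (big_ind (fun z => exists n e, y ^+ n = z * e)) => [|u v|//].
  by exists 0%N, 1; rewrite mulr1 expr0.
move=> [n [e nE]] [m [f mE]]; exists (n + m)%N, (e * f).
by rewrite exprD nE mE; ring.
Qed.

Lemma frob_sum (R : comNzRingType) p j (I : finType) (P : pred I) (F : I -> R) : p \in [pchar R] ->
  (\sum_(i | P i) F i) ^+ (p ^ j) = \sum_(i | P i) F i ^+ (p ^ j).
Proof.
move=> pR; apply: (big_morph (fun x : R => x ^+ (p ^ j))) => [x y|]; first exact: frobDn.
by rewrite expr0n expn_eq0 eqn0Ngt (prime_gt0 (pcharf_prime pR)).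
Qed.

Definition eres (k : fieldType) (gT : finGroupType) (J : {group gT}) :
    {rmorphism evc k gT -> evc k (subg_of J)} :=
  epull (phi := @sgval gT J) (fun _ _ => erefl).

Definition annih (k : fieldType) (gT : finGroupType) (u : cohomology k gT) : Prop :=
  forall x, vanishing x -> u * x = 0.

(** * Noncentral elementary abelian subgroups *)

Section Noncentral.
Variables (k : fieldType) (p : nat) (gT : finGroupType) (E : {group gT}).
Hypotheses (p_prime : prime p) (char_k : p \in [pchar k]) (pG : p.-group [set: gT]).
Hypotheses (abE : p.-abelem E) (ncE : ~~ (E \subset 'C([set: gT]))).

Local Notation N := 'C(E)%G.
Local Notation Nt := (subg_of N).
Local Notation Et := (subg_of E).

Lemma pNt : p.-group [set: Nt].
Proof. 
have := isog_subg N => /card_isog; rewrite /pgroup => <-.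
by move: (pgroupS (subsetT N) pG).
Qed.

Lemma sEN e : e \in E -> e \in N.
Proof. by apply/subsetP; exact: abelem_abelian abE. Qed.

Lemma N_proper : N \proper [set: gT].
Proof.
rewrite properT; apply: contra ncE => /eqP NT; rewrite centsC.
by rewrite -NT.
Qed.

Lemma centE n e : n \in N -> e \in E -> (n * e = e * n)%g.
Proof. by move=> /centP nE /nE. Qed.

Lemma EinN_group : group_set [set x : Nt | sgval x \in E].
Proof.
apply/group_setP; split=> [|x y]; first by rewrite inE group1.
by rewrite !inE; exact: groupM.
Qed.
Definition EinN := Group EinN_group.

Lemma EinN_central (c g : Nt) : c \in EinN -> (c * g)%g = (g * c)%g.
Proof. by rewrite inE => cE; apply: val_inj => /=; rewrite (centE (subgP g) cE). Qed.

Definition Echar (mu : gT -> 'F_p) := {in E &, forall x y, mu (x * y)%g = mu x + mu y}.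

Lemma EcharN mu : Echar mu -> forall c d : Nt, c \in EinN -> d \in EinN ->
  mu (sgval (c * d)%g) = mu (sgval c) + mu (sgval d).
Proof. by move=> muM c d; rewrite !inE; exact: muM. Qed.

Lemma EcharE mu : Echar mu -> forall c d : Et, mu (sgval (c * d)%g) = mu (sgval c) + mu (sgval d).
Proof. by move=> muM c d; apply: muM; exact: subgP. Qed.

Definition bE mu (muM : Echar mu) : evc k Et := betE k (EcharE muM).
Definition thN mu (muM : Echar mu) : evc k Nt := theta char_k pNt EinN_central (EcharN muM).

Definition inE_N (e : Et) : Nt := subg N (sgval e).
Lemma inE_NM : {morph inE_N : x y / (x * y)%g}.
Proof.
by move=> x y; apply: val_inj; rewrite /inE_N /= !subgK ?groupM //; apply: sEN; exact: subgP.
Qed.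

Lemma thN_bE mu (muM : Echar mu) : exists2 u, u != 0 &
  epull inE_NM (escal _ u * thN muM) = bE muM ^+ #|{: coset_of EinN}|.
Proof.
have [u u0 uE] := theta_unit p_prime char_k pNt EinN_central (EcharN muM).
have EN e : inE_N e \in EinN by rewrite inE subgK ?subgP // sEN ?subgP.
have sM (x y : Et) : mu (sgval (inE_N (x * y)%g)) = mu (sgval (inE_N x)) + mu (sgval (inE_N y)).
  by rewrite !subgK ?(sEN (subgP _)) //; exact: EcharE.
exists u^-1; first by rewrite invr_eq0.
apply: ev_inj; rewrite /= pullM pull_scal (uE _ _ inE_NM sM EN) scal_comm.
rewrite evX -mulrA -scalM mulfV // scal1 mulr1; congr (_ ^+ _).
by apply: bet_ext => e; rewrite subgK // sEN ?subgP.
Qed.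

Definition Wt := subg_of ('N(E) / 'C(E))%G.

Definition wrep (g : Wt) : gT := repr (sgval g).

Lemma NCN : 'N(E) \subset 'N('C(E)).
Proof. exact: cent_norm. Qed.

Lemma wrepN g : wrep g \in 'N(E).
Proof.
have /morphimP[x xN xE gE] := subgP g.
have : wrep g \in 'C(E) :* x.
  by rewrite /wrep gE /= val_coset ?mem_repr_rcoset.
case/rcosetP=> n nN ->; rewrite groupM //.
by rewrite (subsetP (cent_sub _)).
Qed.

Definition wmap (g : Wt) (e : Et) : Et := subg E (wrep g * sgval e * (wrep g)^-1)%g.

Lemma conj_in x e : x \in 'N(E) -> e \in E -> (x * e * x^-1)%g \in E.
Proof.
move=> xN eE; have -> : (x * e * x^-1 = e ^ x^-1)%g by rewrite conjgE invgK mulgA.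
by rewrite memJ_norm ?groupV.
Qed.

Lemma wmapE g e : sgval (wmap g e) = (wrep g * sgval e * (wrep g)^-1)%g.
Proof. by rewrite subgK // conj_in ?wrepN ?subgP. Qed.

Lemma wmapM g : {morph wmap g : x y / (x * y)%g}.
Proof. by move=> x y; apply: val_inj; rewrite [LHS]wmapE /= !wmapE !mulgA mulgKV. Qed.

Lemma wmap1 e : wmap 1%g e = e.
Proof.
apply: val_inj; rewrite [LHS]wmapE.
have wN : wrep 1%g \in N by rewrite [wrep _]repr_coset1 group1.
by rewrite (centE wN (subgP e)) mulgK.
Qed.

Lemma wmapg g h e : wmap (g * h)%g e = wmap g (wmap h e).
Proof.
apply: val_inj; rewrite [LHS]wmapE [RHS]wmapE wmapE.
have [n nN ->] : exists2 n, n \in N & wrep (g * h)%g = (n * (wrep g * wrep h))%g.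
  apply/rcosetP; have N' x : wrep x \in 'N('C(E)) by exact: repr_coset_norm.
  rewrite -(val_coset (groupM (N' g) (N' h))) morphM //= /wrep !coset_reprK.
  exact: mem_repr_coset.
have cE : (wrep g * (wrep h * sgval e * (wrep h)^-1) * (wrep g)^-1)%g \in E.
  by do 2!apply: conj_in (wrepN _) _; exact: subgP.
rewrite -[RHS](mulgK n) -(centE nN cE) !invMg !mulgA //.
Qed.

Definition sgm g : evc k Et -> evc k Et := epull (wmapM g).

Lemma sgm1 x : sgm 1%g x = x.
Proof. by apply: ev_inj; apply: pull_id; exact: wmap1. Qed.

Lemma sgmg g h x : sgm (g * h)%g x = sgm h (sgm g x).
Proof.
by apply: ev_inj; apply/esym/pull_comp => e; rewrite wmapg.
Qed.

Lemma sgmD g x y : sgm g (x + y) = sgm g x + sgm g y. Proof. exact: rmorphD. Qed.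
Lemma sgmM g x y : sgm g (x * y) = sgm g x * sgm g y. Proof. exact: rmorphM. Qed.
Lemma sgmU g : sgm g 1 = 1. Proof. exact: rmorph1. Qed.

Definition Enz (mu : gT -> 'F_p) := exists2 z, z \in E & mu z != 0.

Lemma char_vanish (A : {group gT}) : A \proper E ->
  exists2 mu, Echar mu & Enz mu /\ forall x, x \in A -> mu x = 0.
Proof.
move=> /properP[sA [z zE zA]]; have nA : E \subset 'N(A).
  by apply: cents_norm; apply: subset_trans (abelem_abelian abE) (centS sA).
have z1 : coset A z != 1%g.
  by apply: contra zA => /eqP/coset_idr; apply; exact: (subsetP nA).
have [lam lamM lamz] := char_sep (quotient_abelem A abE) (mem_quotient A zE) z1.
exists (fun x => lam (coset A x)).
  move=> x y xE yE; rewrite morphM ?(subsetP nA) // lamM ?mem_quotient //.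
split; first by exists z; rewrite // lamz oner_eq0.
move=> x xA; rewrite coset_id //; apply: (addrI (lam 1%g)).
by rewrite -lamM ?group1 // mulg1 addr0.
Qed.

Lemma bE_divides mu (muM : Echar mu) (y : evc k Et) : Enz mu -> vanishing (ev_val y) ->
  exists n e, y ^+ n = bE muM * e.
Proof.
move=> [z zE z0] vy; have [|e eE] := @bet_divides k p Et _ (EcharE muM) y.
  move=> J J0; apply: vy; rewrite properT; apply: contraNneq z0 => JT.
  have : subg E z \in [set: Et] by rewrite inE.
  by rewrite -JT => /J0; rewrite subgK // => ->.
by exists 2%N, e.
Qed.

Lemma sgm_bE g mu (muM : Echar mu) : exists muM' : Echar (fun x => mu (wrep g * x * (wrep g)^-1)%g),
  sgm g (bE muM) = bE muM'.
Proof.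
have muM' : Echar (fun x => mu (wrep g * x * (wrep g)^-1)%g).
  by move=> x y xE yE; rewrite -muM ?conj_in ?wrepN // !mulgA mulgKV.
by exists muM'; apply: epull_betE => e; rewrite wmapE.
Qed.

Lemma faithful (g : Wt) : g != 1%g -> exists2 e, e \in E & (wrep g * e * (wrep g)^-1)%g != e.
Proof.
move=> g1; apply: contrapT => no; case/negP: g1; apply/eqP/val_inj => /=.
rewrite -[sgval g](coset_reprK) coset_id //; apply/centP => e eE.
rewrite -/(wrep g); apply: (mulIg (wrep g)^-1%g); rewrite mulgK.
by apply: contrapT => H; apply: no; exists e => //; apply/eqP.
Qed.

(** The quotient of the normaliser by the centraliser acts faithfully on [E], so some character
    differs from its conjugate. By additivity the difference of the two Bocksteins is the Bockstein
    of a nonzero character, and it divides a power of [y]. *)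
Lemma different_char (g : Wt) : g != 1%g -> exists x, forall y : evc k Et, vanishing (ev_val y) ->
  exists n e, y ^+ n = (x - sgm g^-1%g x) * e.
Proof.
rewrite -eq_invg1 => /faithful[e eE]; set r := wrep _ => re.
have zE : ((r * e * r^-1)^-1 * e)%g \in E by rewrite groupM // groupV conj_in ?wrepN.
have [|mu muM muz] := char_sep abE zE; first by rewrite -eq_mulVg1.
have [muM' E'] := sgm_bE g^-1%g muM; exists (bE muM) => y vy.
pose nu x := mu x - mu (r * x * r^-1)%g.
have nuM : Echar nu by move=> a b aE bEE; rewrite /nu muM // muM' // opprD addrACA.
have -> : bE muM - sgm g^-1%g (bE muM) = bE nuM.
  apply/eqP; rewrite subr_eq E'; apply/eqP.
  by apply: betED => // x; rewrite /nu subrK.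
apply: bE_divides vy; exists e => //; rewrite /nu -/r.
have cE : (r * e * r^-1)%g \in E by rewrite conj_in ?wrepN.
have mu1 : mu 1%g = 0 by apply: (addrI (mu 1%g)); rewrite -muM // mulg1 addr0.
suff <- : mu ((r * e * r^-1)^-1 * e)%g = mu e - mu (r * e * r^-1)%g by rewrite muz oner_eq0.
rewrite (muM (r * e * r^-1)^-1%g e) ?groupV // addrC; congr (_ + _); apply/eqP; rewrite -addr_eq0 -muM ?groupV //.
by rewrite mulVg mu1.
Qed.

(** If [rrep c] does not normalise [E], the part of the conjugate of [E] inside [E] is a proper
    subgroup, and a nonzero character can be chosen to vanish on it. The class [thN] of this
    character then kills the term of [c] in [transfer_res]. *)
Lemma coset_char (c : rcos N) : exists2 mu, Echar mu & Enz mu /\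
  (coset_fixed E c -> rrep c \notin 'N(E) -> forall x : Et, coconj c x \in EinN -> mu (sgval (coconj c x)) = 0).
Proof.
case: (boolP (rrep c \in 'N(E))) => cN.
  have [|mu muM [muz _]] := @char_vanish 1%G; last by exists mu.
  rewrite properEneq sub1G andbT eq_sym; apply: contraNneq ncE => ->.
  exact: sub1G.
pose A := (E :&: E :^ (rrep c)^-1)%G.
have [|mu muM [muz mu0]] := @char_vanish A.
  rewrite properEneq subsetIl andbT; apply: contraNneq cN => AE.
  have sE : E \subset E :^ (rrep c)^-1 by apply/setIidPl.
  by rewrite -groupV; apply/normP/esym/eqP; rewrite eqEcard sE cardJg leqnn.
exists mu => //; split=> // cf _ x; rewrite inE => xE; apply: mu0; rewrite inE xE /=.
rewrite /coconj cf subgK; last exact: coset_fixed_in.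
by rewrite mem_conjg invgK conjgE -!mulgA mulVg mulg1 mulKg subgP.
Qed.

Lemma sgm_res g (y : evc k gT) :
  sgm g (epull (phi := @sgval _ E) (fun _ _ => erefl) y) = epull (phi := @sgval _ E) (fun _ _ => erefl) y.
Proof.
apply: ev_inj => /=; have cM : {morph (fun x => (wrep g * x * (wrep g)^-1)%g) : x y / (x * y)%g}.
  by move=> a b; rewrite !mulgA mulgKV.
have dM : {morph (fun x : Et => (wrep g * sgval x * (wrep g)^-1)%g) : x y / (x * y)%g}.
  by move=> a b; rewrite cM.
rewrite (pull_comp _ _ dM); last exact: wmapE.
by rewrite -(pull_comp (u := @sgval _ E) (fun _ _ => erefl) cM) // pull_conj.
Qed.

Definition wcos (g : Wt) : rcos N.
Proof.
exists (val (sgval g)).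
have /morphimP[x xN xE gE] := subgP g.
by apply/rcosetsP; exists x; rewrite ?inE // gE /= val_coset.
Defined.

Lemma wcos_rrep g : rrep (wcos g) = wrep g. Proof. by []. Qed.

Lemma wcos_fixed g : coset_fixed E (wcos g).
Proof.
apply/forallP => e'; apply/eqP/val_inj.
rewrite -[LHS]/(val (wcos g) :* sgval e') -[RHS]/(val (wcos g)) -rrepE wcos_rrep -rcosetM.
rewrite -[(wrep g * _)%g](mulgKV (wrep g)) rcosetM (@rcoset_id _ N (wrep g * sgval e' * (wrep g)^-1)%g) //.
by apply: sEN; rewrite conj_in ?wrepN ?subgP.
Qed.

Lemma wcos_coconj g e : coconj (wcos g) e = inE_N (wmap g e).
Proof.
by rewrite /coconj wcos_fixed /inE_N wmapE.
Qed.

Lemma sum_good (V : zmodType) (F : rcos N -> V) :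
  \sum_(c | coset_fixed E c && (rrep c \in 'N(E))) F c = \sum_g F (wcos g).
Proof.
have qN (c : rcos N) : rrep c \in 'N(E) -> coset N (rrep c) \in ('N(E) / 'C(E))%G.
  by move=> cN; apply: mem_quotient.
rewrite (reindex wcos) /=.
  by apply: eq_bigl => g; rewrite wcos_fixed wcos_rrep wrepN.
exists (fun c => subg _ (coset N (rrep c))) => [g _|c /andP[_ cN]]; apply: val_inj => /=.
  rewrite wcos_rrep /wrep coset_reprK subgK //; exact: subgP.
by rewrite subgK ?qN // val_coset ?rrepE //; exact: (subsetP NCN).
Qed.

Lemma Et_abelem : p.-abelem [set: Et].
Proof. by rewrite -(isog_abelem (isog_subg E)). Qed.

(** The classes whose power of exponent [#|{: coset_of EinN}|] lifts to the centraliser are closed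
    under sums, this exponent being a power of [p], and contain the Bocksteins by [thN_bE]; so
    [bockstein_power] applies. *)
Lemma bockstein_lift (z : evc k Et) : exists j w, epull inE_NM w = z ^+ (p ^ j * #|{: coset_of EinN}|).
Proof.
have [m mE] := card_coset_pow pNt EinN; rewrite mE.
have pe := evc_char Et char_k.
have [|j [w wE]] := @bockstein_power k p p_prime char_k Et
  (fun v => exists w, epull inE_NM w = v ^+ (p ^ m)) Et_abelem _ z; last first.
  by exists j, w; rewrite wE exprM.
split=> [c|mu muM|v1 v2 [w1 E1] [w2 E2]|v1 v2 [w1 E1] [w2 E2]].
- exists (escal _ (c ^+ (p ^ m))); apply: ev_inj; rewrite /= pull_scal evX.
  by rewrite /= rmorphXn.
- have muE : Echar (fun x => mu (subg E x)).
    by move=> x y xE yE; rewrite -muM; congr mu; apply: val_inj; rewrite /= !subgK ?groupM.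
  have [u _ uE] := thN_bE muE; exists (escal _ u * thN muE); rewrite uE mE; congr (_ ^+ _).
  by apply: ev_inj; apply: bet_ext => e; rewrite sgvalK.
- by exists (w1 + w2); rewrite rmorphD /= E1 E2 frobDn.
- by exists (w1 * w2); rewrite rmorphM /= E1 E2 exprMn.
Qed.

(** Restricted to [E], a transfer from the centraliser is a sum over fixed cosets. Those in the
    normaliser form a trace over [Wt]; the others are killed by including in the transferred class
    one factor [thN] per coset. As [Y] vanishes on the proper subgroups of [E], its powers are
    divisible by these factors and by the different, and [norm_trace] writes a power of [Y] as a
    trace of such a class. *)
Lemma noncentral_lift (y : evc k gT) : vanishing (res k E (ev_val y)) ->
  exists M (u : evc k gT), annih (ev_val u) /\ eres k E (y ^+ M) = eres k E u.
Proof.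
move=> vY; set Y := eres k E y; rewrite -[res _ _ _]/(ev_val Y) in vY.
pose mu c := s2val (cid2 (coset_char c)).
have muM c : Echar (mu c) := s2valP (cid2 (coset_char c)).
have muP c : Enz (mu c) /\ (coset_fixed E c -> rrep c \notin 'N(E) -> forall x : Et,
  coconj c x \in EinN -> mu c (sgval (coconj c x)) = 0) := s2valP' (cid2 (coset_char c)).
pose L := \prod_(c : rcos N) bE (muM c).
have /choice[x xP] : forall g : Wt, exists x, g != 1%g -> forall y : evc k Et, vanishing (ev_val y) ->
    exists n e, y ^+ n = (x - sgm g^-1%g x) * e.
  move=> g; case: (eqVneq g 1%g) => [_|g1]; first by exists 0.
  by have [x0 x0P] := different_char g1; exists x0.
have [n [e nE]] : exists n e, Y ^+ n = (\prod_(g | g != 1%g) (x g - sgm g^-1%g (x g))) * (L * e).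
  have [a [e1 aE]] := power_divides (P := predT) (fun c _ => bE_divides (muM c) (proj1 (muP c)) vY).
  have [b [e2 bE']] := power_divides (P := fun g => g != 1%g) (fun g g1 => xP g g1 _ vY).
  by exists (b + a)%N, (e1 * e2); rewrite exprD aE bE' -/L; ring.
have [a [b dE]] := different_trace sgm1 sgmg sgmD sgmM sgmU x.
have Yi g : sgm g (Y ^+ n) = Y ^+ n by rewrite /sgm rmorphXn /=; congr (_ ^+ n); exact: sgm_res.
have [z zE] : exists z, (Y ^+ n) ^+ #|{: Wt}| = trace sgm (L * z).
  apply: (@norm_trace _ _ _ sgmg sgmD sgmM sgmU _ a (fun J => b J * e)) => //.
  by rewrite nE dE; apply: eq_bigr => J _; congr (_ * trace _ _); rewrite mulrCA.
have [j [w2 w2E]] := bockstein_lift z.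
set Q := #|{: coset_of EinN}| in w2E.
have [m mE] : exists m, (p ^ j * Q = p ^ m)%N.
  by have [m0 m0E] := card_coset_pow pNt EinN; exists (j + m0)%N; rewrite expnD /Q m0E.
pose v c := s2val (cid2 (thN_bE (muM c))).
have vE c : epull inE_NM (escal _ (v c) * thN (muM c)) = bE (muM c) ^+ Q := s2valP' (cid2 (thN_bE (muM c))).
(* The exponents are matched: both factors restrict to powers of exponent [p ^ m], which is
   [p ^ j * Q]. *)
pose w := (\prod_(c : rcos N) (escal _ (v c) * thN (muM c))) ^+ (p ^ j) * w2.
have wE : epull inE_NM w = (L * z) ^+ (p ^ m).
  rewrite rmorphM rmorphXn rmorph_prod /= w2E (eq_bigr _ (fun c _ => vE c)).
  by rewrite prodrXl -exprM [(Q * _)%N]mulnC mE exprMn.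
have Te : hsign (htransfer (ev_val w)) = htransfer (ev_val w) by rewrite transfer_hsign evcP.
(* One more factor [y] supplies the class vanishing on proper subgroups of [E] that [transfer_res]
   calls for. *)
exists ((n * #|{: Wt}| * p ^ m).+1), (mkev Te * y); split.
  move=> t vt; rewrite mulrC evM -mulrA /= transfer_vanishing ?mulr0 //; exact: N_proper.
rewrite rmorphXn rmorphM -/Y exprSr !exprM zE; apply: ev_inj.
rewrite evM [in RHS]evM; rewrite [RHS](transfer_res _ vY); congr (_ * _).
have bad c : coset_fixed E c -> rrep c \notin 'N(E) -> cohomology_pull (coconjM (E := E) c) (ev_val w) = 0.
  move=> cf cN; suff E0 : epull (coconjM (E := E) c) w = 0 by exact: (congr1 (fun t : evc k Et => ev_val t) E0).
  rewrite rmorphM rmorphXn rmorph_prod /= (bigD1 c) //= [epull _ (escal _ _ * _)]rmorphM /=.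
  have -> : epull (coconjM (E := E) c) (thN (muM c)) = 0.
    by apply: ev_inj; apply: theta_kill; exact: (proj2 (muP c)).
  by rewrite mulr0 mul0r expr0n expn_eq0 eqn0Ngt prime_gt0 // mul0r.
rewrite (bigID (fun c => rrep c \in 'N(E))) /= [X in _ + X]big1 ?addr0; last first.
  by move=> c /andP[]; exact: bad.
rewrite sum_good /trace frob_sum ?(evc_char Et char_k) //.
rewrite (big_morph (@ev_val k Et) (@evD _ _) (@ev0 _ _)); apply: eq_bigr => g _.
rewrite /sgm -rmorphXn -wE [LHS]/=; apply: pull_comp => t.
by rewrite wcos_coconj.
Qed.

End Noncentral.

(** * The annihilator of the essential classes *)

Section Annihilator.
Variables (k : fieldType) (gT : finGroupType).
Implicit Types u v b : evc k gT.

Definition eann u : Prop := annih (ev_val u).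

Lemma eann0 : eann 0. Proof. by move=> x _; exact: mul0r. Qed.
Lemma eannB u v : eann u -> eann v -> eann (u - v).
Proof. by move=> au av x vx; rewrite evB mulrBl au // av // subrr. Qed.
Lemma eannN u : eann u -> eann (- u).
Proof. by move=> au x vx; rewrite evN mulNr au // oppr0. Qed.
Lemma eannD u v : eann u -> eann v -> eann (u + v).
Proof. by move=> au av; rewrite -[v]opprK; apply: eannB => //; exact: eannN. Qed.
Lemma eannM u v : eann u -> eann (v * u).
Proof. by move=> au x vx; rewrite evM -mulrA au // mulr0. Qed.

(** A multiplicative set, so that powers of [b] corrected to vanish on different subgroups can be
    multiplied together. *)
Definition pow_mod b (z : evc k gT) : Prop := exists M u, eann u /\ z = b ^+ M - u.

Lemma pow_mod1 b : pow_mod b 1.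
Proof. by exists 0%N, 0; split; [exact: eann0|rewrite expr0 subr0]. Qed.

Lemma pow_modM b y z : pow_mod b y -> pow_mod b z -> pow_mod b (y * z).
Proof.
move=> [M [u [au ->]]] [M' [u' [au' ->]]]; exists (M + M')%N, (b ^+ M * u' + (b ^+ M' - u') * u).
split; first by apply: eannD; exact: eannM.
by rewrite exprD; ring.
Qed.

Lemma pow_modX b y n : pow_mod b y -> pow_mod b (y ^+ n).
Proof.
move=> py; elim: n => [|n IHn]; first exact: pow_mod1.
by rewrite exprS; exact: pow_modM.
Qed.

End Annihilator.

Section Quillen.
Variables (k : fieldType) (p : nat) (gT : finGroupType).
Hypotheses (p_prime : prime p) (char_k : p \in [pchar k]) (pG : p.-group [set: gT]).

(* By induction on K, a power of b agrees on K with an annihilator of the essential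
   classes. *)
Lemma central_nilpotent (b : evc k gT) :
    (forall E : {group gT}, p.-abelem E -> E \subset 'C([set: gT]) -> eres k E b = 0) ->
  exists M, eann (b ^+ M).
Proof.
move=> bC.
have H n : forall K : {group gT}, (#|K| < n)%N -> exists2 z, pow_mod b z & eres k K z = 0.
  elim: n => // n IHn K; rewrite ltnS => leKn.
  have IH (J : {group gT}) : exists z, J \proper K -> pow_mod b z /\ eres k J z = 0.
    case: (boolP (J \proper K)) => [pJ|_]; last by exists 0.
    have [|z bz z0] := IHn J; first by apply: leq_trans leKn; exact: proper_card.
    by exists z.
  have /choice[f fP] := IH.
  (* One factor for each proper subgroup makes [z] vanish on all of them at once. *)
  pose z := \prod_(J : {group gT} | J \proper K) f J.
  have bz : pow_mod b z.
    by apply: big_ind => [|u v|J /fP[]//]; [exact: pow_mod1|exact: pow_modM].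
  have zJ (J : {group gT}) : J \proper K -> eres k J z = 0.
    by move=> pJ; rewrite rmorph_prod (bigD1 J) //= (proj2 (fP J pJ)) mul0r.
  have vz : vanishing (ev_val (eres k K z)).
    move=> J pJ; pose J1 := Group (morph_img_group (phi := @sgval _ K) (fun _ _ => erefl) J).
    have sM : {morph (fun a : subg_of J => sgval (sgval a)) : x y / (x * y)%g} by [].
    rewrite [LHS](pull_comp (u := @sgval _ J) _ _ sM) //.
    apply: (@pull_factor _ _ _ _ _ J1) => [a|]; first by rewrite imset_f // subgP.
    suff pJ1 : J1 \proper K by exact: (congr1 (fun t : evc k _ => ev_val t) (zJ _ pJ1)).
    rewrite properEcard; apply/andP; split.
      by apply/subsetP => _ /imsetP[a _ ->]; exact: subgP.
    rewrite card_imset; last exact: val_inj.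
    have := proper_card pJ; rewrite cardsT; rewrite -[#|{: subg_of K}|]cardsT.
    by rewrite -(card_isog (isog_subg K)).
  case: (boolP (p.-abelem K)) => abK.
    case: (boolP (K \subset 'C([set: gT]))) => cK.
      exists b; last exact: bC.
      by exists 1%N, 0; split; [exact: eann0|rewrite expr1 subr0].
    have [M [u [au uE]]] := noncentral_lift p_prime char_k pG abK cK vz.
    have [m [v [av vE]]] := pow_modX M bz.
    exists (z ^+ M - u); last by rewrite rmorphB /= uE subrr.
    by exists m, (v + u); split; [exact: eannD|rewrite vE opprD addrA].
  have pK : p.-group [set: subg_of K].
    have := isog_subg K => /card_isog; rewrite /pgroup => <-.
    by move: (pgroupS (subsetT K) pG).
  have nabK : ~~ p.-abelem [set: subg_of K] by rewrite -(isog_abelem (isog_subg K)).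
  have [N NE] := vanishing_nilpotent p_prime char_k pK nabK (evcP _) vz.
  exists (z ^+ N); first exact: pow_modX.
  by apply: ev_inj; rewrite rmorphXn evX NE.
have [z [M [u [au zE]]] z0] := H _ [set: gT]%G (leqnn _.+1).
exists M; suff -> : b ^+ M = u by [].
apply/eqP; rewrite -subr_eq0 -zE; apply/eqP/ev_inj.
pose phi (x : gT) : subg_of [set: gT] := subg _ x.
have phiM : {morph phi : x y / (x * y)%g}.
  by move=> x y; apply: val_inj; rewrite /= !subgK ?inE.
have iM : {morph (id : gT -> gT) : x y / (x * y)%g} by [].
transitivity (epull phiM (eres k [set: gT]%G z) : cohomology k gT); last by rewrite z0 rmorph0.
rewrite /= (pull_comp _ _ iM) ?pull_id // => x.
by rewrite /phi subgK ?inE.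
Qed.

End Quillen.

(** * The regular sequence *)

Section AdaptedBasis.
Variables (p : nat) (gT : finGroupType).
Hypothesis p_prime : prime p.

Definition achar (C : {group gT}) (mu : gT -> 'F_p) :=
  {in C &, forall x y, mu (x * y)%g = mu x + mu y}.

Lemma achar1 C mu : achar C mu -> mu 1%g = 0.
Proof. by move=> muM; apply: (addrI (mu 1%g)); rewrite -muM // mulg1 addr0. Qed.

Lemma acharX C mu x j : achar C mu -> x \in C -> mu (x ^+ j)%g = mu x *+ j.
Proof.
move=> muM xC; elim: j => [|j IHj]; first by rewrite (achar1 muM).
by rewrite expgS muM ?groupX // IHj mulrS.
Qed.

(** The pairing of [lam i] with [c j] is unitriangular, so multiplication by a later element
    preserves the classes of the earlier characters. Only [c 0] may lie outside [D]. *)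
Record adapted (C D : {group gT}) (n : nat) (c : nat -> gT) (lam : nat -> gT -> 'F_p) : Prop := Adapted {
  ad_card : #|C| = (p ^ n)%N;
  ad_in : forall i, (i < n)%N -> c i \in C;
  ad_char : forall i, achar C (lam i);
  ad_one : forall i, (i < n)%N -> lam i (c i) = 1;
  ad_tri : forall i j, (i < j < n)%N -> lam i (c j) = 0;
  ad_sub : forall i, (0 < i < n)%N -> c i \in D;
  ad_span : forall mu, achar C mu -> exists a : nat -> nat, {in C, forall x, mu x = \sum_(i < n) lam i x *+ a i}
}.

(** The index bound yields [H0] of index [p] in [C] and inside [D]. An element [z] outside [H0]
    comes first, and the induction goes on with both subgroups equal to [H0], so that all later
    elements lie in [D]. *)
Lemma adapted_basis (C D : {group gT}) : p.-abelem C -> D \subset C -> (#|C : D| %| p)%N ->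
  exists n c lam, adapted C D n c lam.
Proof.
have [m] := ubnP #|C|; elim: m => // m IHm in C D *; rewrite ltnS => le_m abC sDC iD.
case: (eqVneq #|C| 1%N) => [C1|ntC].
  exists 0%N, (fun _ => 1%g), (fun _ _ => 0); split=> //.
    by move=> i x y *; rewrite addr0.
  move=> mu muM; exists (fun _ => 0%N) => x; rewrite (card_le1_trivg (eq_leq C1)).
  by move/set1gP => ->; rewrite big_ord0 (achar1 muM).
have [H0 [sH0D sH0C cardC]] : exists H0 : {group gT}, [/\ H0 \subset D, H0 \subset C & #|C| = (p * #|H0|)%N].
  case: (eqVneq D C) => [->|nDC]; last first.
    exists D; split=> //; rewrite -(Lagrange sDC) mulnC; congr (_ * _)%N.
    have /primeP[_ /(_ _ iD)/orP[|/eqP//]] := p_prime.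
    by move=> /eqP/(index1g sDC) DC; case/eqP: nDC; apply: val_inj.
  have [E1|[M maxM _]] := maximal_exists (sub1G C); first by rewrite -E1 cards1 eqxx in ntC.
  exists M; have sM : M \subset C by apply: proper_sub; exact: maxgroupp maxM.
  by split=> //; rewrite -(Lagrange sM) (p_maximal_index (abelem_pgroup abC) maxM) mulnC.
have [z zC zH] : exists2 z, z \in C & z \notin H0.
  apply/subsetPn; apply/negP => /subset_leq_card; rewrite cardC leqNgt.
  by rewrite ltn_Pmull ?prime_gt1.
have cC := abelem_abelian abC.
have nH0 : C \subset 'N(H0) by exact: sub_abelian_norm.
have oz : #[z]%g = p by apply: (abelem_order_p abC zC); apply: contraNneq zH => ->.
have z1 : coset H0 z != 1%g.
  by apply: contra zH => /eqP/coset_idr; apply; exact: (subsetP nH0).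
have [l0 l0M l0z] := char_sep (quotient_abelem H0 abC) (mem_quotient H0 zC) z1.
pose lam0 x := l0 (coset H0 x).
have lam0M : achar C lam0.
  by move=> x y xC yC; rewrite /lam0 morphM ?(subsetP nH0) // l0M ?mem_quotient.
have lam00 x : x \in H0 -> lam0 x = 0.
  by move=> xH; rewrite /lam0 coset_id // -(coset_id (group1 H0)) [LHS](achar1 lam0M).
have abH0 : p.-abelem H0 := abelemS sH0C abC.
have [||n [c [lam [cardH inH charH oneH triH subH spanH]]]] := IHm H0 H0 _ abH0 (subxx _).
- by apply: leq_trans le_m; rewrite cardC ltn_Pmull ?prime_gt1.
- by rewrite indexgg.
pose K := <[z]>%G; have sK : K \subset C by rewrite cycle_subG.
have tiK : K :&: H0 = 1%g by apply: prime_TIg; rewrite ?cycle_subG //= -/(#[z]%g) oz.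
have KH : (K * H0 = C)%g.
  by apply/eqP; rewrite eqEcard mul_subG // TI_cardMg // cardC -[#|K|]/(#[z]%g) oz leqnn.
have cK : H0 \in [complements to K in C] by apply/complP.
have nK : K <| C by rewrite -sub_abelian_normal.
pose rm := remgr K H0.
have rmM : {in C &, {morph rm : x y / (x * y)%g}} := remgrM cK nK.
have rmH x : x \in C -> rm x \in H0 by move=> xC; apply: mem_remgr; rewrite KH.
have rm_id x : x \in H0 -> rm x = x by exact: remgr_id.
exists n.+1, (fun i => if i is j.+1 then c j else z), (fun i => if i is j.+1 then fun x => lam j (rm x) else lam0).
split.
- by rewrite cardC cardH expnS.
- by case=> // i lt_i; apply: (subsetP sH0C); exact: inH.
- case=> // i x y xC yC; rewrite rmM // charH // ?rmH //.
- by case=> // i lt_i; rewrite rm_id ?inH // oneH.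
- case=> [|i] [|j] //; rewrite !ltnS; first by move=> lt_j; rewrite lam00 // inH.
  by move=> /andP[lt_ij lt_j]; rewrite rm_id ?inH // triH // lt_ij.
- by case=> // i; rewrite ltnS /= => lt_i; apply: (subsetP sH0D); exact: inH.
move=> mu muM; have [|a aE] := spanH mu; first by move=> x y xH yH; apply: muM; exact: (subsetP sH0C).
exists (fun i => if i is j.+1 then a j else nat_of_ord (mu z)) => x xC.
rewrite big_ord_recl /= -aE ?rmH //.
have /mulsgP[k h kK hH xE] : x \in (K * H0)%g by rewrite KH.
have kC := subsetP sK _ kK; have hC := subsetP sH0C _ hH.
have -> : rm x = h by rewrite xE rmM // (rm_id h) // /rm (remgr1 _ kK) mul1g.
rewrite xE muM // lam0M // (lam00 h) // addr0; congr (_ + _).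
have /cycleP[j ->] := kK.
rewrite (acharX _ muM) // (acharX _ lam0M) // [lam0 z]l0z mulrnAC; congr (_ *+ j).
by rewrite Fp_natr.
Qed.

End AdaptedBasis.

Section RegularSequence.
Variables (k : fieldType) (p : nat) (gT : finGroupType).
Hypotheses (p_prime : prime p) (char_k : p \in [pchar k]) (pG : p.-group [set: gT]).
Variables (C D : {group gT}) (n : nat) (c : nat -> gT) (lam : nat -> gT -> 'F_p).
Hypotheses (CZ : forall x g : gT, x \in C -> (x * g)%g = (g * x)%g)
  (Cp : forall x, x \in C -> (x ^+ p)%g = 1%g) (CD : adapted C D n c lam)
  (DPhi : D \subset 'Phi([set: gT])).

Definition zeta i : evc k gT := theta char_k pG CZ (ad_char CD i) ^+ p.

Lemma zeta_homog i : homog (p * #|{: coset_of C}|.*2) (ev_val (zeta i)).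
Proof. by rewrite /zeta evX; apply: homogX; exact: theta_homog. Qed.

Lemma vanishing0 : vanishing (0 : cohomology k gT).
Proof. by move=> J pJ; exact: rmorph0. Qed.

Local Notation GZ := (gT * 'F_p)%type.

Definition incl_set (J : {group gT}) : subg_of J -> gT := @sgval gT J.
Definition incl_setM J : {morph @incl_set J : x y / (x * y)%g} := fun _ _ => erefl.

Definition zvanishing (b : cohomology k GZ) : Prop := forall J : {group gT}, J \proper [set: gT] ->
  cohomology_pull (pmapM (p := p) (@incl_setM J)) b = 0.

Lemma zvanishing0 : zvanishing 0.
Proof. by move=> J pJ; exact: rmorph0. Qed.

Lemma zvanishingB b b' : zvanishing b -> zvanishing b' -> zvanishing (b - b').
Proof. by move=> vb vb' J pJ; rewrite rmorphB /= vb // vb' // subrr. Qed.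

Lemma zvanishing_mull a b : zvanishing b -> zvanishing (a * b).
Proof. by move=> vb J pJ; rewrite pullM vb // mulr0. Qed.

Lemma zvanishing_kX b : zvanishing b -> zvanishing (kX p_prime char_k b).
Proof.
move=> vb J pJ; have [<- _] := pmap_kX p_prime char_k (@incl_setM J) b.
by rewrite vb // kX0.
Qed.

Lemma zvanishing_resA b : zvanishing b -> vanishing (resA b).
Proof.
by move=> vb J pJ; have := pmap_resA (@incl_setM J) b; rewrite vb // rmorph0 => /esym E; exact: E.
Qed.

Lemma Phi_join_proper x (J : {group gT}) : x \in 'Phi([set: gT]) -> J \proper [set: gT] ->
  J <*> <[x]> \proper [set: gT].
Proof.
move=> xP pJ; rewrite properT; apply: contraTneq pJ => JT; rewrite properT negbK.
rewrite -(genGid J); apply/eqP/Phi_nongen/eqP; rewrite -subTset.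
apply: (subset_trans (_ : _ \subset J <*> <[x]>)); first by rewrite JT.
by rewrite join_subG joing_subr; apply: subset_trans (joing_subl _ _); rewrite cycle_subG.
Qed.

(** The map sends [J x F_p] into [J <x>], which is still proper because [x] lies in the Frattini
    subgroup. *)
Lemma mc_vanishing x (xC : x \in C) (xp : (x ^+ p = 1)%g) m : x \in 'Phi([set: gT]) ->
  vanishing m -> zvanishing (cohomology_pull (mcM p_prime CZ xC xp) m).
Proof.
move=> xP vm J pJ.
have wM : {morph (fun u : subg_of J * 'F_p => mc x (sgval u.1, u.2)) : u v / (u * v)%g}.
  by move=> u v; rewrite -(mcM p_prime CZ xC xp).
rewrite (pull_comp _ _ wM) //; apply: (@pull_factor _ _ _ _ _ (J <*> <[x]>)%G) => [[h i]|].
  by rewrite /mc groupM //= ?(subsetP (joing_subl _ _) _ (subgP h)) // groupX // mem_gen // inE cycle_id orbT.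
by apply: vm; exact: Phi_join_proper.
Qed.

Definition in_span (P : cohomology k gT -> Prop) i (m : cohomology k gT) : Prop :=
  exists e : nat -> cohomology k gT, (forall j, P (e j)) /\ m = \sum_(j < i) ev_val (zeta j) * e j.

Lemma zeta_monic i (lti : (i < n)%N) : let cC := ad_in CD lti in
  xmonic (p * #|{: coset_of C}|) (cohomology_pull (mcM p_prime CZ cC (Cp cC)) (ev_val (zeta i))).
Proof.
move=> cC; rewrite /zeta evX pullX.
apply: (theta_monic p_prime char_k pG CZ _ cC (Cp cC)); last exact: (ad_one CD lti).
by move=> j; rewrite /mc mul1g.
Qed.

(** Multiplication by [c i] makes [zeta i] monic in [X] and leaves the earlier classes inflated, so
    [monic_descent] cancels it modulo their span; restriction to the first factor recovers [m]. For
    [i = 0] the span is 0; for later [i] the coefficients are kept vanishing by [mc_vanishing]. *)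
Lemma zeta_regular i m : (i < n)%N -> vanishing m ->
  in_span (@vanishing k gT) i (ev_val (zeta i) * m) -> in_span (@vanishing k gT) i m.
Proof.
move=> lti vm; pose cC := ad_in CD lti; pose mcp := cohomology_pull (k := k) (mcM p_prime CZ cC (Cp cC)).
have mcpM a b : mcp (a * b) = mcp a * mcp b by exact: pullM.
have mcK b : resA (mcp b) = b.
  have idM : {morph (id : gT -> gT) : x y / (x * y)%g} by [].
  rewrite /resA /= (pull_comp _ _ idM) ?pull_id // => x.
  by rewrite /mc /= mulg1.
case: i => [|i] in lti cC mcp mcpM mcK *.
  move=> [e [_ E]]; rewrite big_ord0 in E.
  suff -> : m = 0 by exists (fun _ => 0); split; [move=> _; exact: vanishing0|rewrite big_ord0].
  rewrite -(mcK m); suff -> : mcp m = 0 by rewrite rmorph0.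
  apply: (@monic_descent k p p_prime char_k gT (fun b => b = 0) _ _ _ _ _ _ _ (zeta_monic lti)) => //.
  - by move=> ? ? -> ->; rewrite subr0.
  - by move=> ? ->; exact: kX0.
  - by move=> ? ? ->; rewrite mulr0.
  by rewrite -mcpM E [mcp 0]rmorph0 iter_kX0.
move=> [e [ve E]]; have cP : c i.+1 \in 'Phi([set: gT]) by apply: (subsetP DPhi); exact: (ad_sub CD (i := i.+1)).
pose V (b : cohomology k GZ) := exists2 f : nat -> cohomology k GZ, (forall j, zvanishing (f j)) &
  b = \sum_(j < i.+1) infl p (ev_val (zeta j)) * f j.
have zE j : (j < i.+1)%N -> mcp (ev_val (zeta j)) = infl p (ev_val (zeta j)).
  move=> lt_j; rewrite /mcp /zeta evX pullX theta_invariant ?rmorphXn //.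
  by apply: (ad_tri CD); rewrite lt_j.
have VX b : V b -> V (kX p_prime char_k b).
  move=> [f vf ->]; exists (fun j => kX p_prime char_k (f j)) => [j|]; first exact: zvanishing_kX.
  rewrite (big_morph _ (@kX_D k p p_prime char_k gT) (kX0 p_prime char_k _)).
  by apply: eq_bigr => j _; rewrite kX_infl_mul.
have V0 : V 0.
  exists (fun _ => 0); first by move=> _; exact: zvanishing0.
  by rewrite big1 // => j _; rewrite mulr0.
have VB b b' : V b -> V b' -> V (b - b').
  move=> [f vf ->] [f' vf' ->]; exists (fun j => f j - f' j); first by move=> j; exact: zvanishingB.
  by rewrite -sumrB; apply: eq_bigr => j _; rewrite mulrBr.
have VA a b : V b -> V (infl p a * b).
  move=> [f vf ->]; exists (fun j => infl p a * f j); first by move=> j; exact: zvanishing_mull.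
  rewrite mulr_sumr; apply: eq_bigr => j _; rewrite !mulrA; congr (_ * _).
  by apply/esym/even_comm; rewrite infl_sign evcP.
have [f vf fE] : V (mcp m).
  apply: (monic_descent V0 VB VX VA (zeta_monic lti)).
  rewrite -mcpM E; elim: (p * _)%N => [|d IHd] /=; last exact: VX.
  exists (fun j => mcp (e j)); first by move=> j; apply: mc_vanishing.
  by rewrite /mcp rmorph_sum /=; apply: eq_bigr => j _; rewrite -zE // -mcpM.
exists (fun j => resA (f j)); split; first by move=> j; exact: zvanishing_resA.
rewrite -[LHS]mcK fE rmorph_sum; apply: eq_bigr => j _.
by rewrite rmorphM resA_infl.
Qed.

End RegularSequence.

(** * Algebraic dependence *)

Section IteratedPolynomials.
Variable k : fieldType.

(* k[X_0, ..., X_(n-1)], the last variable being the outermost. *)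
Fixpoint mp (n : nat) : idomainType := if n is m.+1 then {poly mp m} else k.

Fixpoint mpC n : {rmorphism k -> mp n} :=
  match n return {rmorphism k -> mp n} with
  | 0 => idfun
  | m.+1 => (polyC \o mpC m : {rmorphism k -> {poly mp m}})
  end.

Section Eval.
Variables (A : comNzRingType) (io : {rmorphism k -> A}) (x : nat -> A).

Fixpoint mpev n : {rmorphism mp n -> A} :=
  match n return {rmorphism mp n -> A} with
  | 0 => io
  | m.+1 => (horner_eval (x m) \o map_poly (mpev m) : {rmorphism {poly mp m} -> A})
  end.

Lemma mpevS n (q : {poly mp n}) : mpev n.+1 q = (map_poly (mpev n) q).[x n].
Proof. by []. Qed.

Lemma mpevP n (c : mp n) : mpev n.+1 c%:P = mpev n c.
Proof. by rewrite mpevS map_polyC hornerC. Qed.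

Lemma mpev_cons n (q : {poly mp n}) (c : mp n) :
  mpev n.+1 (q * 'X + c%:P) = mpev n.+1 q * x n + mpev n c.
Proof. by rewrite !mpevS rmorphD rmorphM /= map_polyX map_polyC hornerMXaddC. Qed.

Lemma mpevC n c : mpev n (mpC n c) = io c.
Proof. by elim: n => [//|n <-]; exact: (mpevP (mpC n c)). Qed.

End Eval.

Lemma mpev_comp (A B : comNzRingType) (ioA : {rmorphism k -> A}) (ioB : {rmorphism k -> B})
    (h : {rmorphism A -> B}) (x : nat -> A) n F :
  (forall c, h (ioA c) = ioB c) -> h (mpev ioA x n F) = mpev ioB (fun j => h (x j)) n F.
Proof.
move=> hio; elim: n F => [|n IHn] F; first exact: hio.
elim/poly_ind: F => [|q c IHq]; first by rewrite !rmorph0.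
by rewrite !mpev_cons rmorphD rmorphM IHq IHn.
Qed.

Lemma mpev_eq (A : comNzRingType) (io : {rmorphism k -> A}) (x y : nat -> A) n F :
  (forall j, (j < n)%N -> x j = y j) -> mpev io x n F = mpev io y n F.
Proof.
elim: n F => [|n IHn] F xy //.
have IH c : mpev io x n c = mpev io y n c by apply: IHn => j lt_j; apply: xy; exact: ltnW.
elim/poly_ind: F => [|q c IHq]; first by rewrite !rmorph0.
by rewrite !mpev_cons IHq IH xy.
Qed.

Lemma mpev_mod (A : comNzRingType) (io : {rmorphism k -> A}) (I : A -> Prop) (x y : nat -> A) n F :
    I 0 -> (forall a b, I a -> I b -> I (a + b)) -> (forall a b, I a -> I (b * a)) ->
  (forall j, (j < n)%N -> I (x j - y j)) -> I (mpev io x n F - mpev io y n F).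
Proof.
move=> I0 ID IM; elim: n F => [|n IHn] F xy; first by rewrite subrr.
have IH c : I (mpev io x n c - mpev io y n c) by apply: IHn => j lt_j; apply: xy; exact: ltnW.
elim/poly_ind: F => [|q c IHq]; first by rewrite !rmorph0 subrr.
rewrite !mpev_cons.
have -> (a b a' b' u u' : A) : a * b + u - (a' * b' + u') = b * (a - a') + a' * (b - b') + (u - u').
  by ring.
exact: (ID _ _ (ID _ _ (IM _ _ IHq) (IM _ _ (xy n (ltnSn n)))) (IH c)).
Qed.

Fixpoint mpX n (j : nat) : mp n :=
  match n return mp n with
  | 0 => 0
  | m.+1 => if j == m then 'X else (mpX m j)%:P
  end.

Lemma mpX_neq0 n j : (j < n)%N -> mpX n j != 0.
Proof.
elim: n => //= n IHn lt_j; case: (eqVneq j n) => [_|nj]; first exact: (negbT (polyX_eq0 (mp n))).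
by have := IHn; rewrite -(polyC_eq0 (mpX n j)); apply; rewrite ltn_neqAle nj.
Qed.

Lemma mpev_mpX (A : comNzRingType) (io : {rmorphism k -> A}) (x : nat -> A) n j : (j < n)%N ->
  mpev io x n (mpX n j) = x j.
Proof.
elim: n => [//|n IHn] lt_j; rewrite [mpX _ _]/=; case: (eqVneq j n) => [->|nj].
  by have := mpev_cons io x 1 (0 : mp n); rewrite polyC0 addr0 mul1r !rmorph0 rmorph1 mul1r addr0.
by rewrite -IHn; [exact: (mpevP io x (mpX n j))|rewrite ltn_neqAle nj].
Qed.

Section Chain.
Variables (A : comNzRingType) (io : {rmorphism k -> A}) (M : zmodType) (act : A -> M -> M).
Hypotheses (actD : forall a b m, act (a + b) m = act a m + act b m)
  (actM : forall a b m, act (a * b) m = act a (act b m)) (act1 : forall m, act 1 m = m).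
Variables (x : nat -> A) (T : nat -> M -> Prop).

(* The lowest power of the outermost variable can be cancelled, and then the terms
   divisible by this variable disappear modulo the next subset. *)
Lemma chain_descent n (F : mp n) m :
    (forall j u v, (j <= n)%N -> T j u -> T j v -> T j (u - v)) ->
    (forall j u, (j < n)%N -> T j.+1 (act (x j) u) -> T j.+1 u) ->
    (forall j u, (j < n)%N -> T j (act (x j) u)) ->
    (forall j u, (j < n)%N -> T j.+1 u -> T j u) ->
    (forall a u, T 0%N u -> T 0%N (act a u)) ->
  F != 0 -> T n (act (mpev io x n F) m) -> T 0%N m.
Proof.
move=> TB Treg Tx TS TA; elim: n F TB Treg Tx TS => [|n IHn] F TB Treg Tx TS F0.
  move/(TA (io F^-1)); rewrite -actM -rmorphM mulVf //= rmorph1 act1 //.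
elim/poly_ind: F F0 => [|q c IHq]; first by rewrite eqxx.
case: (eqVneq c 0) => [->|c0].
  rewrite addr0 mulf_eq0 polyX_eq0 orbF => q0.
  rewrite -[q * 'X]addr0 -polyC0 mpev_cons rmorph0 addr0 mulrC actM => /(Treg _ _ (leqnn _)).
  exact: IHq.
move=> _; rewrite mpev_cons mulrC actD => /(TS _ _ (leqnn _)) Tn.
apply: (IHn c) => //.
- by move=> j u v le_j; apply: TB; exact: leqW.
- by move=> j u lt_j; apply: Treg; exact: leqW.
- by move=> j u lt_j; apply: Tx; exact: leqW.
- by move=> j u lt_j; apply: TS; exact: leqW.
have -> : act (mpev io x n c) m = (act (x n * mpev io x n.+1 q) m + act (mpev io x n c) m)
    - act (x n * mpev io x n.+1 q) m by rewrite addrC addKr.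
by apply: TB => //; rewrite actM; exact: Tx.
Qed.

End Chain.

(** A bound on the size, that is the degree plus one, in each variable separately. *)
Fixpoint mpdeg n (D : nat) : mp n -> Prop :=
  match n return mp n -> Prop with
  | 0 => fun _ => True
  | m.+1 => fun q => (size (q : {poly mp m}) <= D)%N /\ forall i, @mpdeg m D (q : {poly mp m})`_i
  end.
Arguments mpdeg : clear implicits.

Lemma mpdeg0 n D : mpdeg n D 0.
Proof. by elim: n => //= n IHn; rewrite size_poly0; split=> // i; rewrite coef0. Qed.

Lemma mpdegD n D F G : mpdeg n D F -> mpdeg n D G -> mpdeg n D (F + G).
Proof.
elim: n F G => //= n IHn F G [sF dF] [sG dG]; split=> [|i]; last by rewrite coefD; exact: IHn.
by apply: leq_trans (size_polyD _ _) _; rewrite geq_max sF.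
Qed.

Lemma mpdegW n D D' F : (D <= D')%N -> mpdeg n D F -> mpdeg n D' F.
Proof.
move=> le_D; elim: n F => //= n IHn F [sF dF]; split=> [|i]; last exact: IHn.
exact: leq_trans le_D.
Qed.

Lemma mpdegM n D D' F G : mpdeg n D F -> mpdeg n D' G -> mpdeg n (D + D') (F * G).
Proof.
elim: n F G => //= n IHn F G [sF dF] [sG dG]; split=> [|i].
  by apply: leq_trans (size_polyMleq _ _) _; apply: leq_trans (leq_pred _) _; exact: leq_add.
rewrite coefM; apply: (big_ind (mpdeg n (D + D'))) => [|u v|j _]; [exact: mpdeg0|exact: mpdegD|].
exact: IHn.
Qed.

Lemma mpdegC n c : mpdeg n 1 (mpC n c).
Proof.
elim: n => //= n IHn; split=> [|i]; first exact: size_polyC_leq1.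
by rewrite coefC; case: ifP => // _; exact: mpdeg0.
Qed.

Lemma mpdegZ n D c F : mpdeg n D F -> mpdeg n D (mpC n c * F).
Proof.
elim: n F => //= n IHn F [sF dF]; split=> [|i]; last by rewrite coefCM; exact: IHn.
by rewrite mul_polyC (leq_trans (size_scale_leq _ _)).
Qed.

Lemma mpdegX n D F e : mpdeg n D F -> mpdeg n (e * D).+1 (F ^+ e).
Proof.
move=> dF; elim: e => [|e IHe]; first by rewrite expr0 -(rmorph1 (mpC n)); exact: mpdegC.
by rewrite exprS mulSn -addnS; exact: mpdegM.
Qed.

Lemma mpdeg_exists n F : exists D, mpdeg n D F.
Proof.
elim: n F => [|n IHn] F; first by exists 0%N.
elim/poly_ind: F => [|q c [D dq]]; first by exists 0%N; exact: mpdeg0.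
have [D' dc] := IHn c; exists (D.+1 + D')%N; case: dq => sq dq; split.
  apply: leq_trans (size_polyD _ _) _; rewrite geq_max; apply/andP; split.
    apply: leq_trans (size_polyMleq _ _) _; rewrite size_polyX addn2 /=.
    by rewrite addSn ltnS; apply: leq_trans sq (leq_addr _ _).
  by apply: leq_trans (size_polyC_leq1 _) _; rewrite addSn.
move=> i; rewrite coefD coefC coefMX; apply: mpdegD.
  case: ifP => _; first exact: mpdeg0.
  by apply: mpdegW (dq _); rewrite addSnnS leq_addr.
case: ifP => _; last exact: mpdeg0.
by apply: mpdegW dc; exact: leq_addl.
Qed.

Lemma mp_coefs n D : exists (J : finType) (phi : mp n -> J -> k),
  [/\ #|J| = (D ^ n)%N, forall F G j, phi (F + G) j = phi F j + phi G j,
      forall c F j, phi (mpC n c * F) j = c * phi F j &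
      forall F, mpdeg n D F -> (forall j, phi F j = 0) -> F = 0].
Proof.
elim: n => [|n [J [phi [cJ phiD phiZ phi0]]]].
  exists unit, (fun F _ => F); split=> //; first exact: card_unit.
  by move=> F _ /(_ tt).
exists ('I_D * J)%type, (fun F (u : 'I_D * J) => phi (F : {poly mp n})`_(u.1) u.2); split.
- by rewrite card_prod card_ord cJ expnS.
- by move=> F G j; rewrite coefD.
- by move=> c F j /=; rewrite coefCM.
move=> F [sF dF] F0; apply/polyP => i; rewrite coef0.
case: (ltnP i D) => [lt_i|le_i]; last by rewrite nth_default // (leq_trans sF).
by apply: phi0 => [|j]; [exact: dF|exact: (F0 (Ordinal lt_i, j))].
Qed.

Lemma mp_monomials n d : exists (I : finType) (mo : I -> mp n),
  [/\ #|I| = (d ^ n)%N,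
      forall v : I -> k, \sum_i mpC n (v i) * mo i = 0 -> forall i, v i = 0 &
      forall r D (g : nat -> mp r), (forall j, (j < n)%N -> mpdeg r D (g j)) ->
        forall i, mpdeg r (n * (d * D).+1).+1 (mpev (mpC r) g n (mo i))].
Proof.
elim: n => [|n [I [mo [cI indI degI]]]].
  exists unit, (fun _ => 1); split; first exact: card_unit.
    by move=> v; rewrite (big_pred1 tt) => [|[]//]; rewrite mulr1 => v0 [].
  by move=> r D g _ i; rewrite rmorph1 -(rmorph1 (mpC r)); exact: mpdegC.
exists ('I_d * I)%type, (fun u : 'I_d * I => (mo u.2)%:P * 'X^(u.1)); split.
- by rewrite card_prod card_ord cI expnS.
- move=> v v0 [e i]; apply: (indI (fun i => v (e, i))).
  have := congr1 (fun F : {poly mp n} => F`_e) v0; rewrite coef0 coef_sum => E; rewrite -[RHS]E {E}.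
  rewrite (eq_bigr (fun u : 'I_d * I => if u.1 == e then mpC n (v (u.1, u.2)) * mo u.2 else 0)); last first.
    case=> a b _ /=; rewrite mulrA -polyCM coefCM coefXn eq_sym.
    by rewrite val_eqE; case: eqP => _; rewrite ?mulr1 ?mulr0.
  rewrite -(pair_bigA _ (fun a b => if a == e then mpC n (v (a, b)) * mo b else 0)) /=.
  rewrite [RHS](bigD1 e) //= eqxx [X in _ = _ + X]big1 ?addr0 // => a /negPf ->.
  by rewrite big1.
move=> r D g dg [e i].
have -> : mpev (mpC r) g n.+1 ((mo i)%:P * 'X^e) = mpev (mpC r) g n (mo i) * g n ^+ e.
  by rewrite mpevS rmorphM /= map_polyC map_polyXn hornerM hornerC hornerXn.
have dgi := degI r D g (fun j lt_j => dg j (leqW lt_j)) i.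
apply: mpdegW (mpdegM dgi (mpdegX e (dg n (ltnSn n)))).
rewrite addSn ltnS addnC mulSn leq_add2r ltnS leq_mul2r.
by rewrite (ltnW (ltn_ord e)) orbT.
Qed.

(** Linear algebra: the [d ^ r.+1] monomials with exponents below [d], evaluated at [g], lie in a
    space with [B ^ r] coordinates, and [B] grows only linearly in [d]. *)
Lemma mp_dependent r (g : nat -> mp r) : exists2 F : mp r.+1, F != 0 & mpev (mpC r) g r.+1 F = 0.
Proof.
have [D dg] : exists D, forall j, (j < r.+1)%N -> mpdeg r D (g j).
  elim: (r.+1) => [|m [D dg]]; first by exists 0%N.
  have [D' dm] := mpdeg_exists (g m); exists (D + D')%N => j; rewrite ltnS leq_eqVlt => /predU1P[->|lt_j].
    by apply: mpdegW dm; exact: leq_addl.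
  by apply: mpdegW (dg _ lt_j); exact: leq_addr.
(* [B <= d * K], so [B ^ r <= d ^ r * K ^ r < d ^ r.+1] once [d] exceeds [K ^ r]. *)
pose K := (r.+1 * D.+1).+1; pose d := (K ^ r).+1; pose B := (r.+1 * (d * D).+1).+1.
have [I [mo [cI indI degI]]] := mp_monomials r.+1 d.
have [J [phi [cJ phiD phiZ phi0]]] := mp_coefs r B.
have ltJI : (#|J| < #|I|)%N.
  rewrite cI cJ; apply: (@leq_ltn_trans ((d * K) ^ r)).
    have le_exp a b e : (a <= b -> a ^ e <= b ^ e)%N by case: e => // e; rewrite leq_exp2r.
    apply: le_exp; rewrite /B /K; nia.
  by rewrite expnMn expnS mulnC ltn_pmul2r ?expn_gt0.
pose ev F := mpev (mpC r) g r.+1 F.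
pose A := \matrix_(i < #|I|, j < #|J|) phi (ev (mo (enum_val i))) (enum_val j).
have kA : kermx A != 0.
  rewrite -mxrank_eq0 mxrank_ker subn_eq0 -ltnNge.
  exact: leq_ltn_trans (rank_leq_col _) ltJI.
pose u := nz_row (kermx A); have u0 : u != 0 by rewrite nz_row_eq0.
have uA : u *m A = 0 by apply/sub_kermxP; exact: nz_row_sub.
pose v i := u 0 (enum_rank i).
exists (\sum_i mpC r.+1 (v i) * mo i).
  apply: contra u0 => /eqP/indI v0; apply/eqP/rowP => i.
  by rewrite mxE -(enum_valK i) [LHS]v0.
have evE : ev (\sum_i mpC r.+1 (v i) * mo i) = \sum_i mpC r (v i) * ev (mo i).
  by rewrite /ev rmorph_sum; apply: eq_bigr => i _; rewrite rmorphM mpevC.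
rewrite -/(ev _) evE; apply: phi0.
  apply: (big_ind (mpdeg r B)) => [|F G|i _]; [exact: mpdeg0|exact: mpdegD|].
  by apply: mpdegZ; apply: degI => j lt_j; exact: dg.
move=> j; have phi00 : phi 0 j = 0 by rewrite -(mul0r 0) -(rmorph0 (mpC r)) phiZ mul0r.
rewrite (big_morph (fun F => phi F j) (fun F G => phiD F G j) phi00).
have := congr1 (fun w : 'rV_ _ => w 0 (enum_rank j)) uA; rewrite !mxE => E; rewrite -[RHS]E {E}.
rewrite (reindex_onto enum_rank enum_val) => [|i _]; last exact: enum_valK.
apply: eq_big => [i|i _]; first by rewrite enum_rankK eqxx.
by rewrite phiZ mxE !enum_rankK.
Qed.

End IteratedPolynomials.

Section EscalMorphism.
Variables (k : fieldType) (gT : finGroupType).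

Lemma escal_zmod : zmod_morphism (@escal k gT).
Proof. by move=> c d; apply: ev_inj; exact: (rmorphB (scal gT)). Qed.
Lemma escal_monoid : monoid_morphism (@escal k gT).
Proof. by split=> [|c d]; apply: ev_inj; [exact: scal1|exact: scalM]. Qed.
HB.instance Definition _ := GRing.isZmodMorphism.Build k (evc k gT) (@escal k gT) escal_zmod.
HB.instance Definition _ := GRing.isMonoidMorphism.Build k (evc k gT) (@escal k gT) escal_monoid.

Lemma eres_escal (J : {group gT}) (c : k) : eres k J (escal gT c) = escal _ c.
Proof. by apply: ev_inj; exact: pull_scal. Qed.
End EscalMorphism.

(** * Integrality over the regular sequence *)

Section Integrality.
Variables (k : fieldType) (p : nat) (gT : finGroupType).
Hypotheses (p_prime : prime p) (char_k : p \in [pchar k]) (pG : p.-group [set: gT]).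
Variables (C D : {group gT}) (n : nat) (c : nat -> gT) (lam : nat -> gT -> 'F_p).
Hypotheses (CZ : forall x g : gT, x \in C -> (x * g)%g = (g * x)%g)
  (CD : adapted C D n c lam) (abC : p.-abelem C)
  (Cmax : forall E : {group gT}, p.-abelem E -> E \subset 'C([set: gT]) -> E \subset C).

Local Notation zeta := (zeta char_k pG CZ CD).
Local Notation Ct := (subg_of C).

(* The first class of the regular sequence is the value of the outermost variable. *)
Definition evz : {rmorphism mp k n -> evc k gT} := mpev (@escal k gT) (fun j => zeta (n - j.+1)) n.

Lemma acharC (mu : gT -> 'F_p) : achar (p := p) C mu -> forall x y : Ct, mu (sgval (x * y)%g) = mu (sgval x) + mu (sgval y).
Proof. by move=> muM x y; apply: muM; exact: subgP. Qed.

Lemma zeta_res i : exists2 u : k, u != 0 &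
  eres k C (zeta i) = betE k (acharC (ad_char CD i)) ^+ (#|{: coset_of C}| * p) * escal _ u.
Proof.
have [u u0 uE] := theta_unit p_prime char_k pG CZ (ad_char CD i).
exists (u ^+ p); first by rewrite expf_neq0.
rewrite rmorphXn rmorphXn exprM -exprMn; congr (_ ^+ p); apply: ev_inj.
rewrite evM evX; exact: (uE _ (@sgval _ C) (fun _ _ => erefl) (acharC (ad_char CD i)) (@subgP _ C)).
Qed.

(** The exponent is [#|{: coset_of C}| * p], the one with which [zeta i] restricts to a power of a
    Bockstein. Being a power of [p], it respects sums, and the [lam i] span all characters. *)
Lemma bet_zeta (m : nat) (mu : Ct -> 'F_p) muM : #|{: coset_of C}| = (p ^ m)%N ->
  exists g : mp k n, eres k C (evz g) = betE k (mu := mu) muM ^+ (p ^ m.+1).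
Proof.
move=> mE; have pe := evc_char Ct char_k.
pose P (v : evc k Ct) := exists g : mp k n, eres k C (evz g) = v ^+ (p ^ m.+1).
have PD v w : P v -> P w -> P (v + w).
  by move=> [g1 E1] [g2 E2]; exists (g1 + g2); rewrite !rmorphD /= E1 E2 frobDn.
have P0 : P 0.
  by exists 0; rewrite !rmorph0 expr0n expn_eq0 eqn0Ngt prime_gt0.
have Plam i : (i < n)%N -> P (betE k (acharC (ad_char CD i))).
  move=> lt_i; have [u u0 uE] := zeta_res i.
  exists (mpX k n (n - i.+1) * mpC k n u^-1).
  rewrite [evz _]rmorphM mpevC mpev_mpX; last by rewrite ltn_subrL; case: (n) lt_i.
  have -> : (n - (n - i.+1).+1 = i)%N by lia.
  rewrite rmorphM /= uE eres_escal -mulrA -rmorphM divff // rmorph1 mulr1 mE.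
  by rewrite -expnSr.
have muC : achar (p := p) C (fun x => mu (subg C x)).
  by move=> x y xC yC; rewrite -muM; congr mu; apply: val_inj; rewrite /= !subgK ?groupM.
have [a aE] := ad_span CD muC.
(* [nu] runs through the partial sums of the combination [aE], so that [betED] adds one character at
   a time. *)
pose nu j i x := \sum_(l < j) lam l x *+ a l + lam j x *+ i.
have nuM j i : achar (p := p) C (nu j i).
  move=> x y xC yC; rewrite /nu addrACA -big_split -mulrnDl (ad_char CD) //; congr (_ + _).
  by apply: eq_bigr => l _; rewrite (ad_char CD) // mulrnDl.
have Pnu j i : (j < n)%N -> P (betE k (acharC (nuM j i))).
  elim: j i => [|j IHj]; elim=> [|i IHi] lt_j.
  - suff -> : betE k (acharC (nuM 0%N 0%N)) = 0 by [].
    by apply: ev_inj; apply: bet_zero => x; rewrite /nu big_ord0 addr0.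
  - rewrite (betED p_prime char_k (acharC (nuM 0%N i)) (acharC (ad_char CD 0%N)) (acharC (nuM 0%N i.+1))).
      by apply: PD; [exact: IHi|exact: Plam].
    by move=> x; rewrite /nu mulrSr addrA.
  - suff -> : betE k (acharC (nuM j.+1 0%N)) = betE k (acharC (nuM j (a j))).
      by apply: IHj; exact: ltnW.
    by apply: ev_inj; apply: bet_ext => x; rewrite /nu big_ord_recr addr0.
  rewrite (betED p_prime char_k (acharC (nuM j.+1 i)) (acharC (ad_char CD j.+1)) (acharC (nuM j.+1 i.+1))).
    by apply: PD; [exact: IHi|exact: Plam].
  by move=> x; rewrite /nu mulrSr addrA.
rewrite -/(P _); case: (posnP n) => [n0|n_gt0].
  suff -> : betE k muM = 0 by [].
  apply: ev_inj; apply: bet_zero => x; have := aE _ (subgP x).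
  by rewrite sgvalK => ->; rewrite big1 // => -[i]; rewrite n0.
suff -> : betE k muM = betE k (acharC (nuM n.-1 (a n.-1))) by apply: Pnu; rewrite prednK.
apply: ev_inj; apply: bet_ext => x; have := aE _ (subgP x); rewrite sgvalK => ->.
rewrite /nu -(big_ord_recr n.-1 (fun l => lam l (sgval x) *+ a l)) prednK //.
Qed.

(** On [C] a power of [b] agrees with a polynomial by [bockstein_power]. The difference vanishes on
    every central elementary abelian subgroup, hence is nilpotent modulo the annihilator. *)
Lemma zeta_integral (b : evc k gT) : exists j g, eann (b ^+ (p ^ j) - evz g).
Proof.
have [m mE] := card_coset_pow pG C; have pe := evc_char Ct char_k.
have abCt : p.-abelem [set: Ct] by rewrite -(isog_abelem (isog_subg C)).
have [|j [g gE]] := @bockstein_power k p p_prime char_k Ct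
  (fun v => exists g : mp k n, eres k C (evz g) = v ^+ (p ^ m.+1)) abCt _ (eres k C b).
  split=> [a|mu muM|v w [g1 E1] [g2 E2]|v w [g1 E1] [g2 E2]].
  - by exists (mpC k n (a ^+ (p ^ m.+1))); rewrite [evz _]mpevC eres_escal rmorphXn.
  - exact: bet_zeta.
  - by exists (g1 + g2); rewrite !rmorphD /= E1 E2 frobDn.
  - by exists (g1 * g2); rewrite !rmorphM /= E1 E2 exprMn.
pose q := (p ^ (j + m.+1))%N.
have r0 : eres k C (b ^+ q - evz g) = 0.
  by rewrite rmorphB rmorphXn /= gE -exprM -expnD subrr.
have [|M aM] := central_nilpotent p_prime char_k pG (b := b ^+ q - evz g).
  move=> E abE cE; apply: ev_inj; apply: (@res_comp_vanish _ _ _ C); first exact: Cmax.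
  exact: (congr1 (fun t : evc k Ct => ev_val t) r0).
exists (j + m.+1 + M)%N, (g ^+ (p ^ M)).
have pG' := evc_char gT char_k.
(* As [M <= p ^ M], the nilpotent difference may be raised to a power of [p], which Frobenius
   distributes over its two terms. *)
suff -> : b ^+ (p ^ (j + m.+1 + M)) - evz (g ^+ (p ^ M)) = (b ^+ q - evz g) ^+ (p ^ M - M) * (b ^+ q - evz g) ^+ M.
  exact: eannM.
rewrite -exprD subnK; last exact: ltnW (ltn_expl _ (prime_gt1 p_prime)).
rewrite expnD exprM -/q rmorphXn /=; have := frobDn (b ^+ q - evz g) (evz g) M pG'.
by rewrite subrK => ->; rewrite addrK.
Qed.

End Integrality.

Lemma mul_split (R : pzRingType) (o e r f : R) :
  (o + e) * (r + f) = (e * f + o * r) - - (o * f + e * r).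
Proof.
by rewrite mulrDl !mulrDr opprK [X in _ + X = _]addrC addrACA [o * r + _]addrC.
Qed.

(** * Even parts and odd classes *)

Section EvenPart.
Variables (k : fieldType) (gT : finGroupType).
Implicit Types x y : cohomology k gT.

Definition even_part x : cohomology k gT :=
  if (2%:R : k) == 0 then x else scal gT 2%:R^-1 * (x + hsign x).

Lemma even_part_even x : hsign (even_part x) = even_part x.
Proof.
rewrite /even_part; case: eqP => [/hsign_char2 //|_].
by rewrite hsignM hsign_scal hsignD hsignK addrC.
Qed.

Definition evp x : evc k gT := mkev (even_part_even x).

Lemma evpB x y : evp (x - y) = evp x - evp y.
Proof.
apply: ev_inj; rewrite evB /= /even_part; case: eqP => // _.
by rewrite hsignB -mulrBr; congr (_ * _); rewrite opprD addrACA.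
Qed.

Lemma evpK (e : evc k gT) : evp (ev_val e) = e.
Proof.
apply: ev_inj; rewrite /= /even_part; case: eqP => // /eqP k2.
by rewrite evcP scal_double mulrA -scalM mulVf // scal1 mul1r.
Qed.

Lemma evp_odd x : hsign x = - x -> (2%:R : k) != 0 -> evp x = 0.
Proof. by move=> xo /negPf k2; apply: ev_inj; rewrite /= /even_part k2 xo subrr mulr0. Qed.

Lemma odd_part x : (2%:R : k) != 0 -> hsign (x - ev_val (evp x)) = - (x - ev_val (evp x)).
Proof.
move=> k2; rewrite hsignB evcP opprB; set e := ev_val (evp x).
have H : hsign x + x = e + e.
  rewrite scal_double /e /= /even_part (negPf k2) mulrA -scalM mulfV // scal1 mul1r.
  exact: addrC.
by rewrite (canRL (addrK x) H) addrAC addrK.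
Qed.

Lemma odd_part_sqr x : (x - ev_val (evp x)) * (x - ev_val (evp x)) = 0.
Proof.
case: (eqVneq (2%:R : k) 0) => [k2|k2]; last exact: odd_sqr (odd_part _ k2).
by rewrite /= /even_part k2 eqxx subrr mul0r.
Qed.

(** The defect of multiplicativity is the product of the odd parts, an even class of square zero. *)
Lemma evpM_nilp x y : exists2 w : evc k gT, evp (x * y) = evp x * evp y + w & w ^+ 2 = 0.
Proof.
case: (eqVneq (2%:R : k) 0) => [k2|k2].
  exists 0; last by rewrite expr0n.
  by apply: ev_inj; rewrite addr0 evM /= /even_part k2 eqxx.
set e := evp x; set f := evp y; pose o := x - ev_val e; pose r := y - ev_val f.
have oo : hsign o = - o := odd_part x k2; have ro : hsign r = - r := odd_part y k2.
have we : hsign (o * r) = o * r by rewrite hsignM oo ro mulrNN.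
exists (mkev we).
  have -> : x * y = ev_val (e * f + mkev we) - (- (o * ev_val f + ev_val e * r)).
    by rewrite -[LHS]/(x * y) -{1}[x](subrK (ev_val e)) -{1}[y](subrK (ev_val f)) mul_split.
  rewrite evpB evpK [evp (- _)]evp_odd ?subr0 //.
  by rewrite hsignN hsignD !hsignM oo ro !evcP mulNr mulrN -opprD.
apply: ev_inj; rewrite evX expr2 /= -mulrA [r * (o * r)]mulrA (odd_comm o ro) oo.
by rewrite -[X in _ * X]mulrA (odd_part_sqr y) !mulr0.
Qed.

Lemma vanishing_hsign x : vanishing x -> vanishing (hsign x).
Proof.
move=> vx J pJ; rewrite [LHS]pull_hsign [cohomology_pull _ x]vx //.
exact: (hop0 (@sign_chain k _)).
Qed.

(** The vanishing classes are stable under the sign operator, hence so is their annihilator. *)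
Lemma annih_evp x : annih x -> eann (evp x).
Proof.
move=> ax v vv; rewrite /= /even_part; case: eqP => _; first exact: ax.
rewrite -mulrA mulrDl ax // add0r -[v]hsignK -hsignM ax; last exact: vanishing_hsign.
by rewrite [hsign 0](hop0 (@sign_chain k _)) mulr0.
Qed.

End EvenPart.

Section Proper.
Variables (k : fieldType) (p : nat) (gT : finGroupType).
Hypotheses (p_prime : prime p) (char_k : p \in [pchar k]) (pG : p.-group [set: gT]).
Variables (C D : {group gT}) (n : nat) (c : nat -> gT) (lam : nat -> gT -> 'F_p).
Hypotheses (CZ : forall x g : gT, x \in C -> (x * g)%g = (g * x)%g)
  (CD : adapted C D n c lam).

Local Notation zeta := (zeta char_k pG CZ CD).

(* A nonzero component of minimal degree cannot lie in the ideal of positive degree. *)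
Lemma zeta_proper (x : cohomology k gT) : vanishing x -> x <> 0 ->
  exists2 m, vanishing m & ~ in_span char_k pG CZ CD (@vanishing k gT) n m.
Proof.
move=> vx x0; have [N] : exists N, `[< exists2 m : cohomology k gT, vanishing m & hpart N m <> 0 >].
  apply: contrapT => no; apply: x0; apply: hpart_eq0 => N; apply: contrapT => xN.
  by apply: no; exists N; apply/asboolP; exists x.
move=> exN0; case: (ex_minnP (ex_intro (fun N => `[< exists2 m : cohomology k gT, vanishing m & hpart N m <> 0 >]) N exN0)).
move=> {N exN0}N /asboolP[m vm mN] minN; exists m => // -[e [ve mE]]; apply: mN.
rewrite mE [LHS](hop_sum _ _ _ (@part_chain k gT N)) big1 // => j _; rewrite -/(hpart N _).
pose d := (p * #|{: coset_of C}|.*2)%N; have hd := zeta_homog char_k pG CZ CD j.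
have d_gt0 : (0 < d)%N.
  by rewrite muln_gt0 prime_gt0 // double_gt0; apply/card_gt0P; exists 1%g.
case: (ltnP N d) => [ltN|leN]; first exact: (hpart_mull0 _ hd).
rewrite -(subnKC leN) (hpart_mull _ _ hd); suff -> : hpart (N - d) (e j) = 0 by rewrite mulr0.
apply: contrapT => eN; have := minN (N - d)%N; rewrite leqNgt ltn_subrL d_gt0 (leq_trans d_gt0 leN).
by move=> H; have : false by apply: H; apply/asboolP; exists (e j).
Qed.

End Proper.

(** * Depth and Krull dimension *)

Section PowerRelation.
Variables (k : fieldType) (p : nat) (n : nat) (A : comNzRingType).
Hypotheses (pA : p \in [pchar A]) (pk : p \in [pchar k]).
Variables (I : A -> Prop) (ev : {rmorphism mp k n -> A}).
Hypotheses (I0 : I 0) (ID : forall a b, I a -> I b -> I (a + b)) (IM : forall a b, I a -> I (b * a))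
  (Iint : forall a, exists j g, I (a ^+ (p ^ j) - ev g)) (Iind : forall g, I (ev g) -> g = 0).
Implicit Types (e : A) (g : mp k n).

Lemma p_pr : prime p. Proof. exact: pcharf_prime pk. Qed.

Lemma IN a : I a -> I (- a).
Proof. by move=> Ia; rewrite -mulN1r; exact: IM. Qed.

Definition proot e j g : Prop := I (e ^+ (p ^ j) - ev g).

Lemma proot_pow e j g l : proot e j g -> proot e (j + l) (g ^+ (p ^ l)).
Proof.
move=> eg; rewrite /proot expnD exprM rmorphXn /=.
have -> : (e ^+ (p ^ j)) ^+ (p ^ l) - ev g ^+ (p ^ l) = (e ^+ (p ^ j) - ev g) ^+ (p ^ l).
  have := frobDn (e ^+ (p ^ j) - ev g) (ev g) l pA; rewrite subrK => ->; exact: addrK.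
rewrite -(prednK (_ : 0 < p ^ l)%N) ?expn_gt0 ?prime_gt0 ?p_pr // exprSr; exact: IM.
Qed.

Lemma prootD e e' j g g' : proot e j g -> proot e' j g' -> proot (e + e') j (g + g').
Proof.
move=> H H'; rewrite /proot (frobDn _ _ _ pA) rmorphD /= opprD addrACA; exact: ID.
Qed.

Lemma prootM e e' j g g' : proot e j g -> proot e' j g' -> proot (e * e') j (g * g').
Proof.
move=> H H'; rewrite /proot exprMn rmorphM /=.
have -> (a b a' b' : A) : a * b - a' * b' = b * (a - a') + a' * (b - b') by ring.
by apply: ID; exact: IM.
Qed.

Lemma proot_unique e j g g' : proot e j g -> proot e j g' -> g = g'.
Proof.
move=> H H'; apply/eqP; rewrite -subr_eq0; apply/eqP/Iind; rewrite rmorphB /=.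
have -> : ev g - ev g' = (e ^+ (p ^ j) - ev g') - (e ^+ (p ^ j) - ev g) by ring.
by apply: ID => //; exact: IN.
Qed.

Variable (s : {rmorphism mp k n -> mp k n}).

(** The prime of [A] over the kernel of [s]: modulo [I] each element has a [p]-power in the
    polynomial ring, so primes are determined by their traces there. *)
Definition pker e : Prop := exists j g, proot e j g /\ s g = 0.

(** Two polynomials attached to [e] agree after further [p]-powers, by independence modulo [I], and
    the target of [s] is a domain. *)
Lemma pker_all e j g : pker e -> proot e j g -> s g = 0.
Proof.
move=> [j' [g' [H' s0]]] H.
have E : g ^+ (p ^ j') = g' ^+ (p ^ j).
  by apply: proot_unique (proot_pow j' H) _; rewrite addnC; exact: proot_pow.
have : s g ^+ (p ^ j') == 0.
  by rewrite -rmorphXn E rmorphXn s0 expr0n expn_eq0 eqn0Ngt prime_gt0 ?p_pr.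
by rewrite expf_eq0 => /andP[_ /eqP].
Qed.

Lemma proot_common e e' : exists j g g', proot e j g /\ proot e' j g'.
Proof.
have [j [g H]] := Iint e; have [j' [g' H']] := Iint e'.
by exists (j + j')%N, (g ^+ (p ^ j')), (g' ^+ (p ^ j)); split; [|rewrite addnC]; exact: proot_pow.
Qed.

Lemma pkerD e e' : pker e -> pker e' -> pker (e + e').
Proof.
move=> ke ke'; have [j [g [g' [H H']]]] := proot_common e e'.
exists j, (g + g'); split; first exact: prootD.
by rewrite rmorphD /= (pker_all ke H) (pker_all ke' H') addr0.
Qed.

Lemma pkerM e e' : pker e -> pker (e' * e).
Proof.
move=> ke; have [j [g [g' [H H']]]] := proot_common e e'.
exists j, (g' * g); split; first exact: prootM.
by rewrite rmorphM /= (pker_all ke H) mulr0.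
Qed.

Lemma pkerB e e' : pker e -> pker e' -> pker (e - e').
Proof. by move=> ke ke'; apply: pkerD => //; rewrite -mulN1r; exact: pkerM. Qed.

Lemma pker_prime e e' : pker (e * e') -> pker e \/ pker e'.
Proof.
move=> ke; have [j [g [g' [H H']]]] := proot_common e e'.
have := pker_all ke (prootM H H'); rewrite rmorphM => /eqP.
by rewrite mulf_eq0 => /orP[] /eqP s0; [left; exists j, g|right; exists j, g'].
Qed.

Lemma pker1 : ~ pker 1.
Proof.
have H : proot 1 0 1 by rewrite /proot rmorph1 expr1n subrr.
by move=> /pker_all/(_ H)/eqP; rewrite rmorph1 oner_eq0.
Qed.

Lemma pker_ideal e : I e -> pker e.
Proof. by move=> Ie; exists 0%N, 0; rewrite /proot !rmorph0 subr0 expr1. Qed.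

Lemma pker_nil e : e ^+ 2 = 0 -> pker e.
Proof.
move=> e0; exists 1%N, 0; rewrite /proot !rmorph0 subr0 expn1; split=> //.
by rewrite -(subnK (prime_gt1 p_pr)) exprD e0 mulr0.
Qed.

End PowerRelation.

Lemma ideal2_exists (S : pzRingType) (P : S -> Prop) :
    P 0 -> (forall a b, P a -> P b -> P (a - b)) -> (forall a b, P b -> P (a * b)) ->
    (forall a b, P b -> P (b * a)) ->
  exists J : ideal2 S, forall a, a \in J <-> P a.
Proof.
move=> P0 PB Pl Pr; pose Pb (a : S) : bool := `[< P a >].
have zc : zmod_closed Pb.
  by split=> [|a b /asboolP Pa /asboolP Pc]; apply/asboolP => //; exact: PB.
have ml a x : x \in Pb -> a * x \in Pb by move=> /asboolP Px; apply/asboolP/Pl.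
have mr a x : x \in Pb -> x * a \in Pb by move=> /asboolP Px; apply/asboolP/Pr.
pose J : ideal2 S := HB.pack Pb (GRing.isZmodClosed.Build S Pb zc) (isTwoSided.Build S Pb ml mr).
by exists J => a; split=> [/asboolP|Pa]; last exact/asboolP.
Qed.

(** * Direct factors and the Frattini subgroup *)

Section DirectFactor.
Variables (p : nat) (gT : finGroupType) (G : {group gT}).
Hypotheses (p_prime : prime p) (pG : p.-group G).

Lemma Ohm_center_abelem : p.-abelem 'Ohm_1('Z(G)).
Proof. by apply: Ohm1_abelem (center_abelian G); apply: pgroupS pG; exact: center_sub. Qed.

(* A complement of the Frattini part of C has rank at most 1, as any subgroup of order
   p^2 meeting the Frattini subgroup trivially in the centre splits off. *)
Lemma no_factor_index : (~ exists E H : {group gT}, E \in 'E_p^2(G) /\ (E \x H = G)%g) ->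
  (#|'Ohm_1('Z(G)) : 'Ohm_1('Z(G)) :&: 'Phi(G)| %| p)%N.
Proof.
move=> noE; set C := 'Ohm_1('Z(G))%G; pose D := (C :&: 'Phi(G))%G.
have sCZ : C \subset 'Z(G) := Ohm_sub _ _.
have abC : p.-abelem C := Ohm_center_abelem.
have /splitsP[K /complP[tiK DK]] := abelem_splits abC (subsetIl C 'Phi(G) : D \subset C).
have sKC : K \subset C by rewrite -DK mulG_subr.
have abK := abelemS sKC abC.
have -> : #|C : C :&: 'Phi(G)| = #|K|.
  have := Lagrange (subsetIl C 'Phi(G)); rewrite -{1}[in RHS]DK (TI_cardMg tiK) => /eqP.
  by rewrite eqn_pmul2l // => /eqP.
have [m cK] := p_natP (abelem_pgroup abK); rewrite cK.
case: (leqP m 1) => [le_m|lt_m]; first by rewrite -{2}(expn1 p) dvdn_exp2l.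
case: noE; have /p_rank_geP[E EK] : (2 <= 'r_p(K))%N by rewrite (p_rank_abelem abK) cK pfactorK.
have sKG : K \subset G := subset_trans sKC (subset_trans sCZ (center_sub G)).
have EG : E \in 'E_p^2(G) := subsetP (pnElemS p 2 sKG) _ EK.
have [sEK abE _] := pnElemP EK.
have sEG := subset_trans sEK sKG.
have nP : G \subset 'N('Phi(G)) := normal_norm (Phi_normal G).
have abQ : p.-abelem (G / 'Phi(G)) := Phi_quotient_abelem pG.
have /splitsP[H /complP[tiH EH]] := abelem_splits abQ (quotientS 'Phi(G) sEG).
pose L := (G :&: coset 'Phi(G) @*^-1 H)%G.
exists E, L; split=> //; rewrite dprodE.
- apply/eqP; rewrite eqEsubset mul_subG ?subsetIl //=; apply/subsetP => x xG.
  have := mem_quotient 'Phi(G) xG; rewrite -EH => /mulsgP[_ h /morphimP[e eN eE ->] hH xE].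
  apply/mulsgP; exists e (e^-1 * x)%g => //; last by rewrite mulKVg.
  have eG := subsetP sEG _ eE; have exG : (e^-1 * x)%g \in G by rewrite groupM ?groupV.
  rewrite inE exG /=; apply/morphpreP; split; first exact: (subsetP nP).
  rewrite morphM ?morphV ?groupV ?(subsetP nP) //=.
  by rewrite /= xE mulKg.
- rewrite centsC; apply: subset_trans sEK (subset_trans sKC (subset_trans sCZ _)).
  by apply: subset_trans (subsetIr _ _) (centS (subsetIl _ _)).
apply/trivgP/subsetP => x /setIP[xE /setIP[xG /morphpreP[xN xH]]].
have : coset 'Phi(G) x \in (E / 'Phi(G) :&: H)%g by rewrite inE mem_quotient.
rewrite tiH => /set1gP/coset_idr xP; rewrite -tiK !inE xP //.
by rewrite (subsetP sEK) // (subsetP sKC) // (subsetP sEK).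
Qed.

End DirectFactor.

(** * The essential ideal as a module *)

Section Essential.
Variables (k : fieldType) (gT : finGroupType) (G : {group gT}).
Local Notation Gt := (subg_of G).

Lemma ess_vanishing (x : cohomology k Gt) : ess (G := G) x <-> vanishing x.
Proof.
split=> [/asboolP ex J pJ|vx]; last first.
  apply/asboolP => H pH; apply: pull_vanishing => //.
  have /properP[sHG [g gG gH]] := pH; exists (subg G g) => a; apply: contraNneq gH => E.
  have aG : sgval a \in G by apply: (subsetP sHG); exact: subgP.
  by have := congr1 (@sgval _ G) E; rewrite /Defs.incl !subgK // => <-; exact: subgP.
pose H := Group (morph_img_group (phi := @sgval gT G) (fun _ _ => erefl) J).
have pH : H \proper G.
  rewrite properEcard; apply/andP; split.
    by apply/subsetP => _ /imsetP[a _ ->]; exact: subgP.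
  rewrite card_imset; last exact: val_inj.
  have := proper_card pJ; rewrite cardsT; rewrite -[#|{: Gt}|]cardsT.
  by rewrite -(card_isog (isog_subg G)).
pose phi (a : subg_of J) : subg_of H := subg H (sgval (sgval a)).
have aH (a : subg_of J) : sgval (sgval a) \in H by rewrite imset_f // subgP.
have phiM : {morph phi : a b / (a * b)%g}.
  by move=> a b; apply: val_inj; rewrite /= !subgK ?groupM.
have := ex H pH; rewrite /restriction => x0.
rewrite -[LHS](pull_comp (u := phi) phiM (inclM (proper_sub pH)) _ x).
  by rewrite [cohomology_pull _ x]x0 rmorph0.
by move=> a; rewrite /Defs.incl [sgval (phi a)]subgK ?aH // sgvalK.
Qed.

Local Notation M := (essential k G).

Lemma ess_vanish (m : M) : vanishing (val m : cohomology k Gt).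
Proof. by case: m => m em; exact/ess_vanishing. Qed.

Definition mkess (x : cohomology k Gt) (vx : vanishing x) : M := Essential (proj2 (ess_vanishing x) vx).

Lemma ann_annih (a : cohomology k Gt) : a \in ann M <-> annih a.
Proof.
split=> [/annP am x vx|aa]; last by apply/annP => m; apply: val_inj; exact: aa (ess_vanish m).
exact: (congr1 val (am (mkess vx))).
Qed.

End Essential.

Section SeqMul.
Variables (R : pzRingType) (M : lmodType R).
Implicit Types (xs : seq R) (m : M).

Lemma seq_mulP xs m : seq_mul xs m <-> exists e : nat -> M, m = \sum_(j < size xs) xs`_j *: e j.
Proof.
split=> [[ms ->]|[e ->]]; last by exists (fun j => e j).
exists (fun j => if insub j is Some i then ms i else 0); apply: eq_bigr => j _.
by rewrite valK.
Qed.

Lemma seq_mul0 xs : seq_mul xs (0 : M).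
Proof. by apply/seq_mulP; exists (fun _ => 0); rewrite big1 // => j _; rewrite scaler0. Qed.

Lemma seq_mulB xs m m' : seq_mul xs m -> seq_mul xs m' -> seq_mul xs (m - m').
Proof.
move=> /seq_mulP[e ->] /seq_mulP[e' ->]; apply/seq_mulP; exists (fun j => e j - e' j).
by rewrite -sumrB; apply: eq_bigr => j _; rewrite scalerBr.
Qed.

Lemma seq_mul_nth xs i m : (i < size xs)%N -> seq_mul xs (xs`_i *: m).
Proof.
move=> lti; apply/seq_mulP; exists (fun j => if j == i then m else 0).
rewrite (bigD1 (Ordinal lti)) //= eqxx big1 ?addr0 // => j ji.
by rewrite ifN ?scaler0 //; apply: contra ji => /eqP E; apply/eqP/val_inj.
Qed.

Lemma seq_mul_cat xs ys m : seq_mul xs m -> seq_mul (xs ++ ys) m.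
Proof.
move=> /seq_mulP[e ->]; apply: (big_ind (seq_mul (xs ++ ys))) => [|u v su sv|j _]; first exact: seq_mul0.
  by rewrite -[v]opprK; apply: seq_mulB => //; rewrite -sub0r; apply: seq_mulB => //; exact: seq_mul0.
have -> : xs`_j = (xs ++ ys)`_j by rewrite nth_cat ltn_ord.
by apply: seq_mul_nth; rewrite size_cat ltn_addr.
Qed.

Lemma seq_mul_take xs i j m : (i <= j)%N -> seq_mul (take i xs) m -> seq_mul (take j xs) m.
Proof.
move=> le_ij; rewrite -(take_takel xs le_ij); move: (take j xs) => ys H.
by rewrite -(cat_take_drop i ys); exact: seq_mul_cat.
Qed.

Lemma seq_mulZ a xs m : (forall x, x \in xs -> a * x = x * a) -> seq_mul xs m -> seq_mul xs (a *: m).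
Proof.
move=> ac /seq_mulP[e ->]; apply/seq_mulP; exists (fun j => a *: e j).
rewrite scaler_sumr; apply: eq_bigr => j _.
by rewrite !scalerA ac // mem_nth.
Qed.

End SeqMul.

Section Assembly.
Variables (k : fieldType) (p : nat) (gT0 : finGroupType) (G : {group gT0}).
Local Notation gT := (subg_of G).
Local Notation M := (essential k G).
Local Notation R := (cohomology k gT).
Hypotheses (p_prime : prime p) (char_k : p \in [pchar k]) (pG : p.-group [set: gT]).
Variables (C D : {group gT}) (n : nat) (c : nat -> gT) (lam : nat -> gT -> 'F_p).
Hypotheses (CZ : forall x g : gT, x \in C -> (x * g)%g = (g * x)%g)
  (Cp : forall x, x \in C -> (x ^+ p)%g = 1%g) (CD : adapted C D n c lam)
  (DPhi : D \subset 'Phi([set: gT])) (abC : p.-abelem C)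
  (Cmax : forall E : {group gT}, p.-abelem E -> E \subset 'C([set: gT]) -> E \subset C).
Variables (m0 : M).
Hypothesis m00 : m0 != 0.

Local Notation zeta := (zeta char_k pG CZ CD).
Local Notation evz := (evz char_k pG CZ CD).
Definition zs : seq R := mkseq (fun j => ev_val (zeta j)) n.

Lemma zs_span i (m : M) : (i <= n)%N ->
  seq_mul (take i zs) m <-> in_span char_k pG CZ CD (@vanishing k gT) i (val m).
Proof.
move=> le_i; have sz : size (take i zs) = i by rewrite size_takel // size_mkseq.
have zE j : (j < i)%N -> (take i zs)`_j = ev_val (zeta j).
  by move=> lt_j; rewrite nth_take // nth_mkseq // (leq_trans lt_j).
split=> [/seq_mulP[e ->]|[e [ve mE]]].
  exists (fun j => val (e j)); split; first by move=> j; exact: ess_vanish.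
  by rewrite sz raddf_sum; apply: eq_bigr => j _; rewrite (zE j (ltn_ord j)).
apply/seq_mulP; exists (fun j => mkess (ve j)); apply: val_inj; rewrite sz raddf_sum [LHS]mE.
by apply: eq_bigr => j _; rewrite zE.
Qed.

Lemma zs_regular : regular_seq M zs.
Proof.
have sz : size zs = n by rewrite size_mkseq.
split=> [i|all].
  rewrite sz => lt_i m /(zs_span _ (ltnW lt_i)); rewrite nth_mkseq // => H.
  apply/(zs_span _ (ltnW lt_i)).
  exact: (zeta_regular p_prime Cp DPhi lt_i (ess_vanish m) H).
have m0n : (val m0 : R) <> 0 by move=> E; case/eqP: m00; exact: val_inj.
have [m vm] := zeta_proper p_prime char_k pG CZ CD (ess_vanish m0) m0n.
by apply; apply/(zs_span (mkess vm) (leqnn n)); rewrite take_oversize ?sz.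
Qed.

Lemma zs_pos x : x \in zs -> homogeneous_pos x.
Proof.
case/mapP=> j _ ->; exists (p * #|{: coset_of C}|.*2)%N.
  by rewrite muln_gt0 prime_gt0 // double_gt0; apply/card_gt0P; exists 1%g.
apply/homogeneousP; exact: zeta_homog.
Qed.

(** Modulo the annihilator, suitable [p]-powers of the [Y j] are polynomials in [n] classes, and
    [n.+1] polynomials in [n] variables are dependent. *)
Lemma eann_dependent (Y : nat -> evc k gT) : exists2 F : mp k n.+1, F != 0 &
  exists e : nat -> nat, eann (mpev (@escal k gT) (fun j => Y j ^+ (p ^ e j)) n.+1 F).
Proof.
have /choice[e eP] j : exists e, exists g, eann (Y j ^+ (p ^ e) - evz g).
  exact: zeta_integral.
have /choice[g gP] := eP; have [F F0 FE] := mp_dependent g.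
exists F => //; exists e.
have <- : mpev (@escal k gT) (fun j => Y j ^+ (p ^ e j)) n.+1 F - mpev (@escal k gT) (fun j => evz (g j)) n.+1 F
    = mpev (@escal k gT) (fun j => Y j ^+ (p ^ e j)) n.+1 F.
  rewrite -(mpev_comp (h := evz) (ioA := mpC k n)); last by move=> a; exact: mpevC.
  by rewrite FE rmorph0 subr0.
by apply: mpev_mod => // [|a b|a b]; [exact: eann0|exact: eannD|exact: eannM].
Qed.

(** If a nonzero polynomial annihilated the module, [chain_descent] would put every element into the
    submodule spanned by the regular sequence, which is proper. *)
Lemma evz_indep g : eann (evz g) -> g = 0.
Proof.
move=> ag; apply/eqP; apply: contrapT => /negP g0.
pose act (a : evc k gT) (m : M) : M := ev_val a *: m.
have [_] := zs_regular; apply=> m.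
rewrite -(take_oversize (_ : size zs <= n)%N); last by rewrite size_mkseq.
have := @chain_descent k _ (@escal k gT) M act _ _ _ (fun j => zeta (n - j.+1))
  (fun j u => seq_mul (take (n - j) zs) u) n g m.
rewrite subn0; apply=> //.
- by move=> a b u; exact: scalerDl.
- by move=> a b u; rewrite /act scalerA.
- by move=> u; exact: scale1r.
- by move=> j u v _; exact: seq_mulB.
- move=> j u lt_j H; have lt' : (n - j.+1 < n)%N by rewrite ltn_subrL; case: (n) lt_j.
  have [reg _] := zs_regular; apply: reg; first by rewrite size_mkseq.
  by rewrite nth_mkseq.
- move=> j u lt_j; have E : (zeta (n - j.+1) : R) = (take (n - j) zs)`_(n - j.+1).
    by rewrite nth_take ?nth_mkseq //; (clear -lt_j; lia).
  rewrite /act E; apply: seq_mul_nth; rewrite size_takel ?size_mkseq ?leq_subr //; (clear -lt_j; lia).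
- by move=> j u lt_j; apply: seq_mul_take; (clear -lt_j; lia).
- by move=> a u; apply: seq_mulZ => x _; exact: even_comm (evcP a).
rewrite subnn take0; apply/seq_mulP; exists (fun _ => 0); rewrite big_ord0.
by apply: val_inj; exact: ag (ess_vanish m).
Qed.

Lemma even_or_nil d (y : R) : homog d y -> hsign y = y \/ y * y = 0.
Proof.
move=> hy; have E := homog_sign hy; move: E; rewrite -signr_odd; case: (odd d).
  rewrite expr1 rmorphN1 mulN1r => yo.
  case: (eqVneq (2%:R : k) 0) => [/hsign_char2 ye|k2]; first by left.
  by right; exact: odd_sqr.
by rewrite expr0 rmorph1 mul1r; left.
Qed.

(** A longer regular sequence would satisfy a relation from [eann_dependent], and [chain_descent]
    would put the whole module into the span of its first [n.+1] members. *)
Lemma depth_ess : depth M (@homogeneous_pos k gT) n.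
Proof.
split.
  exists zs; split; [by rewrite size_mkseq|exact: zs_pos|exact: zs_regular].
move=> l [ys [szl hys [reg notall]]]; rewrite leqNgt; apply/negP => lt_nl.
have small i : (i <= l)%N -> ~ (forall m : M, seq_mul (take i ys) m).
  move=> le_i H; apply: notall => m; have := seq_mul_take le_i (H m).
  by rewrite -szl take_size.
(* Otherwise the member has square 0, and regularity applied twice puts every [m] into the span of
   the preceding ones. *)
have yev i : (i < l)%N -> hsign ys`_i = ys`_i.
  move=> lt_i; have memi : ys`_i \in ys by rewrite mem_nth ?szl.
  have [d _ /homogeneousP hy] := hys _ memi; have [//|y2] := even_or_nil hy.
  case: (small i (ltnW lt_i)) => m; apply: (reg i); rewrite ?szl //; apply: (reg i); rewrite ?szl //.
  by rewrite scalerA y2 scale0r; exact: seq_mul0.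
have yE i : (i < l)%N -> ev_val (evp ys`_i) = ys`_i.
  by move=> lt_i; exact: (congr1 (fun t : evc k gT => ev_val t) (evpK (mkev (yev i lt_i)))).
have regX i q u : (i < l)%N -> seq_mul (take i ys) (ys`_i ^+ q *: u : M) -> seq_mul (take i ys) u.
  move=> lt_i; elim: q => [|q IHq]; first by rewrite expr0 scale1r.
  by rewrite exprS -scalerA => H; apply: IHq; apply: (reg i); rewrite ?szl.
have [F F0 [e aF]] := eann_dependent (fun j => evp ys`_(n - j)).
pose act (a : evc k gT) (m : M) : M := ev_val a *: m.
apply: (small n.+1 lt_nl) => m.
have := @chain_descent k _ (@escal k gT) M act _ _ _ (fun j => evp ys`_(n - j) ^+ (p ^ e j))
  (fun j u => seq_mul (take (n.+1 - j) ys) u) n.+1 F m.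
rewrite subn0; apply=> //.
- by move=> a b u; exact: scalerDl.
- by move=> a b u; rewrite /act scalerA.
- by move=> u; exact: scale1r.
- by move=> j u v _; exact: seq_mulB.
- move=> j u lt_j; rewrite subSS /act evX yE; last (clear -lt_j lt_nl; lia).
  by apply: regX; (clear -lt_j lt_nl; lia).
- move=> j u lt_j; rewrite /act evX yE; last (clear -lt_j lt_nl; lia).
  rewrite -(prednK (_ : 0 < p ^ e j)%N) ?expn_gt0 ?prime_gt0 // exprS -scalerA.
  have -> : ys`_(n - j) = (take (n.+1 - j) ys)`_(n - j) by rewrite nth_take //; (clear -lt_j lt_nl; lia).
  by apply: seq_mul_nth; rewrite size_takel ?szl; (clear -lt_j lt_nl; lia).
- by move=> j u lt_j; apply: seq_mul_take; (clear -lt_j lt_nl; lia).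
- by move=> a u; apply: seq_mulZ => x _; exact: even_comm (evcP a).
rewrite subnn take0; apply/seq_mulP; exists (fun _ => 0); rewrite big_ord0.
by apply: val_inj; exact: aF (ess_vanish m).
Qed.

Local Notation Q := (quot2 (ann M)).
Local Notation pi := (@quot2_pi R (ann M)).

Lemma pi0 x : annih x -> pi x = 0.
Proof. by move=> ax; rewrite -(raddf0 pi); apply/quot2_piP; rewrite subr0; apply/ann_annih. Qed.

Lemma piM x y : pi (x * y) = pi x * pi y.
Proof. exact: (rmorphM pi). Qed.

Lemma pi_even (P : ideal2 Q) (x : R) : prime_ideal2 P -> (pi (ev_val (evp x)) \in P) = (pi x \in P).
Proof.
move=> [_ primeP].
have oP : pi (x - ev_val (evp x)) \in P.
  have : pi (x - ev_val (evp x)) * pi (x - ev_val (evp x)) \in P.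
    by rewrite -piM odd_part_sqr raddf0 rpred0.
  by case/primeP.
by rewrite -[in RHS](subrK (ev_val (evp x)) x) raddfD /= rpredDl.
Qed.

(** A chain of primes can replace the regular sequence in [chain_descent]: [a i] lies in [ch i.+1]
    and is regular modulo [ch i]. A relation among the even parts would put 1 into [ch n.+1]. *)
Lemma krull_upper l : prime_chain Q l -> (l <= n)%N.
Proof.
move=> [ch [prch sch]]; rewrite leqNgt; apply/negP => lt_nl.
have mono i j : (i <= j <= l)%N -> {subset ch i <= ch j}.
  move=> /andP[le_ij le_jl]; rewrite -(subnKC le_ij); move: (j - i)%N (subnKC le_ij) => d dE.
  elim: d i le_ij dE => [|d IHd] i le_ij dE x xi; first by rewrite addn0.
  rewrite addnS -addSn; apply: IHd; rewrite ?addSnnS //; first by rewrite -dE -addSnnS leq_addr.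
  by have [] := sch i (leq_trans _ le_jl); [rewrite -dE -addSnnS leq_addr|move=> + _; apply].
have /choice[a aP] i : exists x : Q, (i < l)%N -> x \in ch i.+1 /\ x \notin ch i.
  by case: (ltnP i l) => [/sch[_ [x x1 x0]]|_]; [exists x|exists 0].
pose Y i := evp (quot2_repr (a i)).
have YE i j : (j <= l)%N -> (pi (ev_val (Y i)) \in ch j) = (a i \in ch j).
  by move=> le_j; rewrite /Y pi_even ?quot2_reprK //; exact: prch.
have [F F0 [e aF]] := eann_dependent (fun j => Y (n - j)%N).
pose act (b : evc k gT) (m : Q) : Q := pi (ev_val b) * m.
have [one _] := prch n.+1 lt_nl; case/negP: one.
have XP i q u j : (j <= l)%N -> pi (ev_val (Y i ^+ q)) * u \in ch j -> a i \notin ch j -> u \in ch j.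
  move=> le_j; elim: q => [|q IHq]; first by rewrite expr0 (rmorph1 pi) mul1r.
  rewrite exprS evM piM -mulrA => H nY; have [_ prj] := prch j le_j.
  by case/prj: H => [|/IHq]; [rewrite YE // (negPf nY)|apply].
have := @chain_descent k _ (@escal k gT) Q act _ _ _ (fun j => Y (n - j)%N ^+ (p ^ e j))
  (fun j u => u \in ch (n.+1 - j)%N) n.+1 F 1.
rewrite subn0; apply=> //.
- by move=> b b' u; rewrite /act evD raddfD mulrDl.
- by move=> b b' u; rewrite /act evM piM mulrA.
- by move=> u; rewrite /act (rmorph1 pi) mul1r.
- by move=> j u v _; exact: rpredB.
- move=> j u lt_j; rewrite subSS /act => H; apply: XP H _; first (clear -lt_j lt_nl; lia).
  by have [|_ ->//] := aP (n - j)%N; (clear -lt_j lt_nl; lia).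
- move=> j u lt_j; rewrite /act -(prednK (_ : 0 < p ^ e j)%N) ?expn_gt0 ?prime_gt0 // exprS evM piM.
  rewrite -mulrA; apply: ideal2_mulr; rewrite YE; last (clear -lt_j lt_nl; lia).
  rewrite subSn //; have [|-> //] := aP (n - j)%N; (clear -lt_j lt_nl; lia).
- by move=> j u lt_j; apply: mono; (clear -lt_j lt_nl; lia).
- by move=> b u; exact: ideal2_mull.
by rewrite subnn /act pi0 ?mul0r ?rpred0.
Qed.

(** Sets to 0 the variables of the first [i] classes of the sequence; [evz] numbers the variables in
    reverse. *)
Definition subst i : {rmorphism mp k n -> mp k n} :=
  mpev (mpC k n) (fun j => if (n - j.+1 < i)%N then 0 else mpX k n j) n.

Lemma subst_subst i g : subst i.+1 (subst i g) = subst i.+1 g.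
Proof.
rewrite /subst (mpev_comp _ _ (ioB := mpC k n)) => [|a]; last exact: mpevC.
apply: mpev_eq => j lt_j; case: ifP => [lt_i|]; first by rewrite rmorph0 leqW.
by move=> _; rewrite mpev_mpX.
Qed.

Definition ker_subst i (e : evc k gT) : Prop := pker p (@eann k gT) evz (subst i) e.

(** A prime of the even ring that contains the annihilator extends to the quotient of the full ring
    through even parts, which are multiplicative up to elements of square zero. *)
Lemma prime_chain_even (K : nat -> evc k gT -> Prop) :
    (forall i x y, K i x -> K i y -> K i (x - y)) -> (forall i x y, K i y -> K i (x * y)) ->
    (forall i x, eann x -> K i x) -> (forall i x, x ^+ 2 = 0 -> K i x) ->
    (forall i, ~ K i 1) -> (forall i x y, K i (x * y) -> K i x \/ K i y) ->
    (forall i x, K i x -> K i.+1 x) ->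
    (forall i, (i < n)%N -> exists2 x, K i.+1 x & ~ K i x) ->
  prime_chain Q n.
Proof.
move=> KB KM Kann Knil K1 Kprime Ksucc Knew.
pose P i (a : Q) := K i (evp (quot2_repr a)).
have KN i x : K i x -> K i (- x) by move=> Kx; rewrite -mulN1r; apply: KM Kx.
have KD i x y : K i x -> K i y -> K i (x + y).
  by move=> Kx Ky; rewrite -[y]opprK; apply: KB Kx (KN _ _ Ky).
have Kmod i x y : eann (x - y) -> K i x -> K i y.
  by move=> axy Kx; rewrite -[y](subKr x); exact: KB Kx (Kann _ _ axy).
have Ppi i x : P i (pi x) <-> K i (evp x).
  have ax : eann (evp (quot2_repr (pi x)) - evp x).
    rewrite -evpB; apply: annih_evp; apply/ann_annih/quot2_piP; exact: quot2_reprK.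
  split=> H; first exact: Kmod ax H.
  by apply: Kmod H; rewrite -opprB; exact: eannN ax.
have evM i x y : K i (evp (x * y)) <-> K i (evp x * evp y).
  have [w -> w2] := evpM_nilp x y; split=> H; last exact: KD H (Knil _ _ w2).
  by have := KB _ _ _ H (Knil i _ w2); rewrite addrK.
have PQ i (a b : Q) : P i (a * b) <-> K i (evp (quot2_repr a) * evp (quot2_repr b)).
  have E : a * b = pi (quot2_repr a * quot2_repr b) by rewrite piM !quot2_reprK.
  by rewrite E; split=> H; [apply/evM/Ppi|apply/Ppi/evM].
have /choice[ch chP] i : exists J : ideal2 Q, forall a, a \in J <-> P i a.
  apply: ideal2_exists => [|a b Pa Pb|a b Pb|a b Pb].
  - rewrite -(raddf0 pi); apply/Ppi/Kann; apply: annih_evp => v _; exact: mul0r.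
  - have E : a - b = pi (quot2_repr a - quot2_repr b) by rewrite raddfB /= !quot2_reprK.
    by rewrite E; apply/Ppi; rewrite evpB; exact: KB Pa Pb.
  - by apply/PQ; exact: KM Pb.
  - by apply/PQ; rewrite mulrC; exact: KM Pb.
exists ch; split=> i le_i.
  split; first by apply/negP => /chP; rewrite -(rmorph1 pi) => /Ppi; rewrite -ev1 evpK; exact: K1.
  move=> a b /chP/PQ/Kprime[Ha|Hb]; [left|right]; exact/chP.
split; first by move=> a /chP Pa; apply/chP; exact: Ksucc Pa.
have [x Kx nKx] := Knew i le_i; exists (pi (ev_val x)); first by apply/chP/Ppi; rewrite evpK.
by apply/negP => /chP/Ppi; rewrite evpK.
Qed.

(** [zeta i] separates the prime of index [i] from the next one, since [subst i] keeps its variable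
    and [subst i.+1] kills it. *)
Lemma krull_lower : prime_chain Q n.
Proof.
have pA := evc_char gT char_k.
have I0 := @eann0 k gT; have ID := @eannD k gT; have IM := @eannM k gT.
have Iint : forall a, exists j g, eann (a ^+ (p ^ j) - evz g) by exact: zeta_integral.
have Iind := evz_indep.
apply: (@prime_chain_even ker_subst).
- move=> i x y; exact: (pkerB pA char_k ID IM Iint Iind).
- move=> i x y; exact: (pkerM pA char_k ID IM Iint Iind).
- move=> i x; exact: pker_ideal.
- move=> i x; exact: (pker_nil char_k evz I0).
- move=> i; exact: (pker1 pA char_k I0 ID IM Iind).
- move=> i x y; exact: (pker_prime pA char_k ID IM Iint Iind).
- move=> i x [j [g [H g0]]]; exists j, g; split; first exact: H.
  by rewrite -subst_subst g0 rmorph0.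
move=> i lt_i; have lt' : (n - i.+1 < n)%N by rewrite ltn_subrL; case: (n) lt_i.
have nE : (n - (n - i.+1).+1 = i)%N by clear -lt_i; lia.
have zX : proot p (@eann k gT) evz (zeta i) 0 (mpX k n (n - i.+1)).
  by rewrite /proot [evz _]mpev_mpX // expr1 nE subrr.
exists (zeta i).
  exists 0%N, (mpX k n (n - i.+1)); split; first exact: zX.
  by rewrite /subst mpev_mpX // nE ltnSn.
move=> H; have := pker_all pA char_k ID IM Iind H zX.
by rewrite /subst mpev_mpX // nE ltnn => /eqP; apply/negP; exact: mpX_neq0.
Qed.

Lemma krull_ess : krull_dim M n.
Proof. split; [exact: krull_lower|exact: krull_upper]. Qed.

End Assembly.

Theorem theorem1 (p : nat) (k : fieldType) (gT : finGroupType)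
    (G : {group gT}) (p_prime : prime p) (char_k : p \in [pchar k])
    (pG : p.-group G)
    (no_factor : ~ exists E H : {group gT},
                     E \in 'E_p^2(G) /\ (E \x H = G)%g)
    (ess_neq0 : exists x : essential k G, x != 0) :
  cohen_macaulay (essential k G) (@homogeneous_pos k (subg_of G)) /\
  krull_dim (essential k G) 'r_p('Z(G)).
Proof.
pose Gt := subg_of G.
have pGt : p.-group [set: Gt] by rewrite /pgroup -(card_isog (isog_subg G)).
have injG := injm_sgval G.
have noE : ~ exists E H : {group Gt}, E \in 'E_p^2([set: Gt]) /\ (E \x H = [set: Gt])%g.
  move=> [E [H [/pnElemP[_ abE cE] EH]]]; apply: no_factor.
  exists (sgval @* E)%G, (sgval @* H)%G; split.
    apply/pnElemP; split; last by rewrite card_injm ?subsetT.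
      by apply/subsetP => _ /morphimP[x _ _ ->]; exact: subgP.
    by rewrite injm_abelem ?subsetT.
  by rewrite (injm_dprod (subxx _) injG EH) im_sgval.
pose C := 'Ohm_1('Z([set: Gt]))%G; pose D := (C :&: 'Phi([set: Gt]))%G.
have abC : p.-abelem C := Ohm_center_abelem pGt.
have sCZ : C \subset 'Z([set: Gt]) := Ohm_sub _ _.
have CZ (x g : Gt) : x \in C -> (x * g)%g = (g * x)%g.
  by move=> /(subsetP sCZ)/centerP[_ ->]; rewrite ?inE.
have Cp (x : Gt) : x \in C -> (x ^+ p)%g = 1%g by case/abelemP: abC => // _; apply.
have Cmax (E : {group Gt}) : p.-abelem E -> E \subset 'C([set: Gt]) -> E \subset C.
  move=> abE cE; rewrite -(Ohm1_id abE); apply: OhmS.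
  by rewrite subsetI subsetT.
have sDC : D \subset C := subsetIl _ _.
have [n [c [lam CD]]] := adapted_basis p_prime abC sDC (no_factor_index p_prime pGt noE).
have DPhi : D \subset 'Phi([set: Gt]) := subsetIr _ _.
have [m m0] := ess_neq0.
have rE : 'r_p('Z(G)) = n.
  rewrite -{1}(im_sgval G) -(injm_center injG (subxx _)) injm_p_rank ?subsetT //.
  by rewrite -p_rank_Ohm1 (p_rank_abelem abC) (ad_card CD) pfactorK.
rewrite rE; split; last exact: (krull_ess p_prime char_k pGt CZ Cp CD DPhi abC Cmax m0).
exists n; first exact: (depth_ess p_prime char_k pGt CZ Cp CD DPhi abC Cmax m0).
exact: (krull_ess p_prime char_k pGt CZ Cp CD DPhi abC Cmax m0).
Qed.
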